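(* Let $N>2$ be an integer with $3\mid N$. Then the multiplicities $d(\cdot)$ of the irreducible representations of $G=\mathrm{PSL}_2(\mathbb{Z})/\Phi(N)\simeq(\mathbb{Z}/N\mathbb{Z})^2\rtimes S_3$ inside the canonical representation $\rho_{\Phi(N)}$ on $S_2(\Phi(N))$ are given by $$d(\rho_1)=d(\rho_2)=d(\rho_3)=0,\qquad d(\rho_\alpha^+)=0,\quad \alpha=1,\dots,N-1,\ \alpha\neq N/3,2N/3,$$ $$d(\rho_\alpha^-)=\begin{cases}1&\text{if }\alpha=1,\dots,\left\lfloor\frac{N-1}{2}\right\rfloor,\\ 0&\text{if }\alpha=\left\lfloor\frac{N-1}{2}\right\rfloor+1,\dots,N-1,\end{cases}\qquad \alpha\neq N/3,2N/3,$$ $$d(\rho_{\alpha_i,\beta_i})=\begin{cases}1&\text{if }\alpha_i+\beta_i<N,\\0&\text{if }\alpha_i+\beta_i\ge N,\end{cases}\qquad \alpha_i,\beta_i\neq0,$$ $$d(\rho^1_{N/3})=d(\rho^1_{2N/3})=d(\rho^2_{2N/3})=0,\qquad d(\rho^2_{N/3})=1,\qquad d(\rho^3_{N/3})=d(\rho^3_{2N/3})=0.$$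
   Context: In $\mathrm{PSL}_2(\mathbb{Z})$ let $S=\begin{pmatrix}0&-1\\1&0\end{pmatrix}$, $T=\begin{pmatrix}1&1\\0&1\end{pmatrix}$, $A=\begin{pmatrix}1&2\\0&1\end{pmatrix}$, $B=\begin{pmatrix}1&0\\-2&1\end{pmatrix}$, $U=\begin{pmatrix}2&1\\1&1\end{pmatrix}$. The image of $\Gamma(2)$ in $\mathrm{PSL}_2(\mathbb{Z})$ is free on $A,B$, and $\Phi(N)$ is the kernel of the homomorphism from it to $\mathbb{Z}/N\mathbb{Z}\times\mathbb{Z}/N\mathbb{Z}$ with $A\mapsto(1,0)$, $B\mapsto(0,1)$. $\Phi(N)$ is normal in $\mathrm{PSL}_2(\mathbb{Z})$, and $G=\mathrm{PSL}_2(\mathbb{Z})/\Phi(N)$ is the semidirect product of $(\mathbb{Z}/N\mathbb{Z})^2=\langle A,B\rangle$ by $S_3=\langle S,U\rangle$, with $SAS=B$, $UAU^2=B$, $UBU^2=A^{-1}B^{-1}$ in $G$. The curve $X(\Phi(N))$ is a model of the Fermat curve $X^N+Y^N=Z^N$. $\rho_{\Phi(N)}$ is the action of $G$ on the space $S_2(\Phi(N))$ of weight two cusp forms, $\rho_{\Phi(N)}(\gamma)f=f|_2\gamma=f\left(\frac{a\tau+b}{c\tau+d}\right)(c\tau+d)^{-2}$ for $\gamma=\begin{pmatrix}a&b\\c&d\end{pmatrix}$. (It is a right action; multiplicities are those of characters in the class function $g\mapsto\operatorname{Tr}\rho_{\Phi(N)}(g)$ on $G$.) Irreducible representations of $G$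 when $3\mid N$. Let $\zeta_N=e^{2\pi i/N}$ and let $\chi_{\alpha,\beta}$ be the character of $(\mathbb{Z}/N\mathbb{Z})^2$ with $\chi_{\alpha,\beta}(A)=\zeta_N^\alpha$, $\chi_{\alpha,\beta}(B)=\zeta_N^\beta$; $S_3$ acts on these characters by $(g\chi)(x)=\chi(g^{-1}xg)$. The characters $\chi_{0,0}$, $\chi_{N/3,N/3}$, $\chi_{2N/3,2N/3}$ are fixed by $S_3$; each extends to a character of $G$ that is trivial on $S_3$. The irreducible representations are: - $\rho_1,\rho_2,\rho_3$: the inflations to $G$ of the trivial, sign and two-dimensional irreducible representations of $S_3$; - for $\alpha\in\{N/3,2N/3\}$, $\rho^1_\alpha,\rho^2_\alpha,\rho^3_\alpha$: the tensor products of $\rho_1,\rho_2,\rho_3$ respectively with the extension of $\chi_{\alpha,\alpha}$ to $G$ trivial on $S_3$; - $\rho_\alpha^{\pm}$, $\alpha\in\{1,\dots,N-1\}\setminus\{N/3,2N/3\}$ (dimension 3): the representation induced to $G$ from $(\mathbb{Z}/N\mathbb{Z})^2\rtimes\langle S\rangle$ of the character equal to $\chi_{\alpha,\alpha}$ on $(\mathbb{Z}/N\mathbb{Z})^2$ and sending $S\mapsto\pm1$; - $\rho_{\alpha_i,\beta_i}$ (dimension 6): the representation induced to $G$ from $(\mathbb{Z}/N\mathbb{Z})^2$ of $\chi_{\alpha_i,\beta_i}$, where $\chi_{\alpha_i,\beta_i}$ are representatives of the $S_3$-orbits of size 6, chosen with $\alpha_i,\beta_i\in\{1,\dots,N-1\}$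 (always possible). *)

(* Defs.v *)
From mathcomp Require Import all_boot all_order all_algebra all_fingroup.
From mathcomp Require Import complex.
From mathcomp Require Import all_classical all_reals all_analysis.

Set Implicit Arguments.
Unset Strict Implicit.
Unset Printing Implicit Defensive.

Import Order.TTheory GRing.Theory Num.Theory numFieldNormedType.Exports.
Local Open Scope classical_set_scope.
Local Open Scope ring_scope.
Local Open Scope complex_scope.

(* ** The groups.
   Subgroups of PSL_2(Z) are represented by their preimages in SL_2(Z); these
   contain -1, and quotients of PSL_2(Z) are the corresponding quotients of
   SL_2(Z).  Products and inverses are those of the ring 'M[int]_2. *)

Notation M2Z := 'M[int]_2.

Definition mx22 (a b c d : int) : M2Z :=
  \matrix_(i < 2, j < 2)
    if i == 0 then (if j == 0 then a else b) else (if j == 0 then c else d).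

Definition SL2Z : set M2Z := [set g | \det g = 1].

Definition matS : M2Z := mx22 0 (-1) 1 0.
Definition matA : M2Z := mx22 1 2 0 1.
Definition matB : M2Z := mx22 1 0 (-2) 1.
Definition matU : M2Z := mx22 2 1 1 1.

Definition Gamma2 : set M2Z :=
  [set g | SL2Z g /\ forall i j, (g i j = (1 : M2Z) i j %[mod 2])%Z].

Definition mult_on (T : pzRingType) (K : set M2Z) (l : M2Z -> T) : Prop :=
  forall g h, K g -> K h -> l (g * h) = l g * l h.

(* "The" homomorphism from the image of Gamma(2) in PSL_2(Z), which is free on
   A and B, to (Z/N)^2: it is determined on Gamma2 because Gamma2 is generated
   by -1, A and B.  Its values off Gamma2 are irrelevant. *)
Definition is_expAB (N : nat) (phi : M2Z -> 'Z_N * 'Z_N) : Prop :=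
  [/\ forall g h, Gamma2 g -> Gamma2 h -> phi (g * h) = phi g + phi h,
      phi (-1) = 0, phi matA = (1, 0) & phi matB = (0, 1)].

Definition expAB (N : nat) : M2Z -> 'Z_N * 'Z_N := xget (fun=> 0) (@is_expAB N).

Definition Phi (N : nat) : set M2Z := [set g | Gamma2 g /\ expAB N g = 0].

(* K / Phi(N) for a subgroup K containing Phi(N), as a set of cosets; in
   particular [quot N SL2Z] is G and [quot N Gamma2] is (Z/N)^2. *)
Definition quot (N : nat) (K : set M2Z) : set (set M2Z) :=
  [set [set g * h | h in Phi N] | g in K].

Section Main.
Variable R : realType.
Local Notation C := R[i].

(* ** Functions on K / Phi(N).
   They are represented by functions of a matrix which, on K, depend only on
   the coset modulo Phi(N). *)

Definition qsum (N : nat) (K : set M2Z) (F : M2Z -> C) : C :=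
  \sum_(X \in quot N K) F (xget 1 X).

Definition qcard (N : nat) (K : set M2Z) : C := qsum N K (fun=> 1).

Definition cdot (N : nat) (F1 F2 : M2Z -> C) : C :=
  (qcard N SL2Z)^-1 * qsum N SL2Z (fun g => F1 g * (F2 g)^*).

(* The character of the representation induced from K / Phi(N) to G of a
   one-dimensional representation [l]. *)
Definition ind (N : nat) (K : set M2Z) (l : M2Z -> C) (g : M2Z) : C :=
  (qcard N K)^-1 *
  qsum N SL2Z
    (fun x => let y := x^-1 * g * x in if y \in K then l y else 0).

(* ** Weight two cusp forms.
   A function on the upper half plane is represented by its extension by 0 to
   the whole of C. As z / 0 = 0, [slash] preserves such extensions. *)

Definition upper (z : C) : bool := 0 < complex.Im z.

Definition slash (g : M2Z) (f : C -> C) (z : C) : C :=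
  let a := (g 0 0)%:~R in let b := (g 0 1)%:~R in
  let c := (g 1 0)%:~R in let d := (g 1 1)%:~R in
  f ((a * z + b) / (c * z + d)) / (c * z + d) ^+ 2.

Definition holo_upper (f : C -> C) : Prop :=
  forall z, upper z -> derivable (f : C^o -> C^o) z 1.

Definition vanish_at_ioo (f : C -> C) : Prop :=
  forall eps : R, 0 < eps -> exists B : R,
    forall z : C, B < complex.Im z -> `|f z| < eps%:C.

Definition S2 (N : nat) : set (C -> C) :=
  [set f | [/\ forall z, ~~ upper z -> f z = 0,
               holo_upper f,
               forall g, Phi N g -> slash g f = f &
               forall g, SL2Z g -> vanish_at_ioo (slash g f)]].

Definition lincomb (n : nat) (e : 'I_n -> C -> C) (c : 'I_n -> C) : C -> C :=
  fun z => \sum_i c i * e i z.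

Definition is_basis (V : set (C -> C)) (n : nat) (e : 'I_n -> C -> C) : Prop :=
  (forall i, V (e i)) /\
  (forall f, V f -> exists! c : {ffun 'I_n -> C}, f = lincomb e c).

Definition is_trace (V : set (C -> C)) (T : (C -> C) -> (C -> C)) (t : C) :
    Prop :=
  exists (n : nat) (e : 'I_n -> C -> C) (M : 'M[C]_n),
    [/\ is_basis V e, forall i, T (e i) = lincomb e (M i) & t = \tr M].

Definition trace_on (V : set (C -> C)) (T : (C -> C) -> (C -> C)) : C :=
  xget 0 (is_trace V T).

Definition canonical_char (N : nat) (g : M2Z) : C := trace_on (S2 N) (slash g).

Definition multiplicity (N : nat) (chi : M2Z -> C) : C :=
  cdot N (canonical_char N) chi.

(* ** Characters of the irreducible representations of G. *)

Definition zeta (N : nat) : C :=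
  cos (2 * pi / N%:R) +i* sin (2 * pi / N%:R).

(* A one-dimensional representation of K / Phi(N) described by [P]. In each
   use below it is unique on K, since [P] prescribes it on generators. *)
Definition the_lin_char (N : nat) (K : set M2Z) (P : (M2Z -> C) -> Prop) :
    M2Z -> C :=
  xget (fun=> 0)
    [set l | [/\ mult_on K l, forall g, Phi N g -> l g = 1 & P l]].

Definition chi (N a b : nat) : M2Z -> C :=
  the_lin_char N Gamma2
    (fun l => l matA = zeta N ^+ a /\ l matB = zeta N ^+ b).

(* Representatives in SL_2(Z) of the subgroup <S, U> of G. *)
Definition S3set : set M2Z :=
  [set 1] `|` [set matU] `|` [set matU ^+ 2] `|`
  [set matS] `|` [set matS * matU] `|` [set matS * matU ^+ 2].

Definition orbit_chi (N a b : nat) : set (M2Z -> C) :=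
  [set (fun x => if x \in Gamma2 then chi N a b (g^-1 * x * g) else 0)
  | g in S3set].

(* An identification of SL_2(Z) / Gamma(2) with the symmetric group; it is
   unique up to inner automorphisms of the latter. *)
Definition is_toS3 (p : M2Z -> 'S_3) : Prop :=
  [/\ forall g h, SL2Z g -> SL2Z h -> p (g * h) = (p g * p h)%g,
      forall g, SL2Z g -> (p g = 1%g <-> Gamma2 g) &
      forall s, exists2 g, SL2Z g & p g = s].

Definition toS3 : M2Z -> 'S_3 := xget (fun=> 1%g) is_toS3.

Definition rho1 (g : M2Z) : C := 1.
Definition rho2 (g : M2Z) : C := (-1) ^+ odd_perm (toS3 g).
(* The two-dimensional irreducible representation of the symmetric group is
   the complement of the trivial one in the permutation representation. *)
Definition rho3 (g : M2Z) : C := \tr (perm_mx (toS3 g) : 'M[C]_3) - 1.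

Definition chi_ext (N a : nat) : M2Z -> C :=
  the_lin_char N SL2Z
    (fun l => [/\ forall g, Gamma2 g -> l g = chi N a a g,
                  l matS = 1 & l matU = 1]).

Definition rho1_ (N a : nat) (g : M2Z) : C := rho1 g * chi_ext N a g.
Definition rho2_ (N a : nat) (g : M2Z) : C := rho2 g * chi_ext N a g.
Definition rho3_ (N a : nat) (g : M2Z) : C := rho3 g * chi_ext N a g.

(* The preimage of the subgroup (Z/N)^2 ><| <S> of G. *)
Definition Gamma2S : set M2Z :=
  Gamma2 `|` [set g * matS | g in Gamma2].

Definition rho_sgn (N : nat) (eps : C) (a : nat) : M2Z -> C :=
  ind N Gamma2S
    (the_lin_char N Gamma2S
      (fun l => (forall g, Gamma2 g -> l g = chi N a a g) /\ l matS = eps)).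

Definition rho_plus (N a : nat) : M2Z -> C := rho_sgn N 1 a.
Definition rho_minus (N a : nat) : M2Z -> C := rho_sgn N (-1) a.

Definition rho6 (N a b : nat) : M2Z -> C := ind N Gamma2 (chi N a b).

End Main.

Arguments orbit_chi : clear implicits.

(* Main.v *)
(* Let theta_2, theta_3, theta_4 be the theta constants. The forms
     e_{l,m,n} = theta_2^(4l/N) theta_4^(4m/N) theta_3^(4n/N),  l + m + n = N,  l, m, n >= 1,
   are cusp forms of weight two on Phi(N); A and B multiply e_{l,m,n} by zeta^l
   and zeta^m, while S and T permute these forms up to roots of unity, with
   e_{l,m,n}|S = - e_{m,l,n}. The law of the theta constants under S holds because
   theta(z/tau, -1/tau) exp(-pi i z^2/tau) / theta(z, tau) is elliptic and entire.

   These forms are a basis of S_2(Phi(N)). Indeed decompose a cusp form under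
   <A, B> and divide an eigenform, together with its images under the six cosets
   of Gamma(2), by products of powers of theta constants with the same eigenvalues.
   S and T permute the absolute values of the quotients, which are bounded and, after
   subtracting a multiple of e_{l,m,n} if the eigenvalues are those of such a form,
   tend to 0 at the cusps; the maximum principle makes them vanish.

   By Frobenius reciprocity a multiplicity is then an average, over at most six
   cosets of Gamma(2), of the diagonal coefficient of the action at the unique
   e_{l,m,n} with the prescribed eigenvalues. *)

Require Import Defs.
From mathcomp Require Import all_boot all_order all_algebra all_fingroup.
From mathcomp Require Import complex zify ring lra.
From mathcomp Require Import all_classical all_reals all_analysis.

Set Implicit Arguments.
Unset Strict Implicit.
Unset Printing Implicit Defensive.

Import Order.TTheory GRing.Theory Num.Theory numFieldNormedType.Exports.
Local Open Scope classical_set_scope.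
Local Open Scope ring_scope.
Local Open Scope complex_scope.

(** * Complex differentiation *)

Section ComplexAbs.
Variable R : realType.
Local Notation C := R[i].
Implicit Types z w : C.

Definition cabs z : R := Num.sqrt (complex.Re z ^+ 2 + complex.Im z ^+ 2).

Lemma normC_cabs z : `|z| = (cabs z)%:C.
Proof. by rewrite normc_def. Qed.

Lemma cabs_ge0 z : 0 <= cabs z.
Proof. exact: sqrtr_ge0. Qed.

Lemma cabsM z w : cabs (z * w) = cabs z * cabs w.
Proof. by apply: complexI; rewrite rmorphM /= -!normC_cabs normrM. Qed.

Lemma cabsD z w : cabs (z + w) <= cabs z + cabs w.
Proof. by rewrite -lecR rmorphD /= -!normC_cabs ler_normD. Qed.

Lemma cabsN z : cabs (- z) = cabs z.
Proof. by apply: complexI; rewrite -!normC_cabs normrN. Qed.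

Lemma cabsB z w : cabs (z - w) <= cabs z + cabs w.
Proof. by rewrite (le_trans (cabsD _ _)) // cabsN. Qed.

Lemma cabs_sym z w : cabs (z - w) = cabs (w - z).
Proof. by rewrite -cabsN opprB. Qed.

Lemma cabs0 : cabs 0 = 0.
Proof. by apply: complexI; rewrite -normC_cabs normr0. Qed.

Lemma cabs1 : cabs 1 = 1.
Proof. by apply: complexI; rewrite -normC_cabs normr1. Qed.

Lemma cabsV z : cabs z^-1 = (cabs z)^-1.
Proof. by apply: complexI; rewrite fmorphV /= -!normC_cabs normfV. Qed.

Lemma cabsX z n : cabs (z ^+ n) = cabs z ^+ n.
Proof. by apply: complexI; rewrite rmorphXn /= -!normC_cabs normrX. Qed.

Lemma cabs_eq0 z : (cabs z == 0) = (z == 0).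
Proof.
rewrite -(normr_eq0 z) normC_cabs.
by apply/eqP/eqP => [->//|/complexI].
Qed.

Lemma cabs_gt0 z : (0 < cabs z) = (z != 0).
Proof. by rewrite lt_neqAle cabs_ge0 andbT eq_sym cabs_eq0. Qed.

Lemma cabs_real (x : R) : cabs x%:C = `|x|.
Proof. by rewrite /cabs /= expr0n /= addr0 sqrtr_sqr. Qed.

Lemma cabs_sqr z : cabs z ^+ 2 = complex.Re z ^+ 2 + complex.Im z ^+ 2.
Proof. by rewrite sqr_sqrtr // addr_ge0 // sqr_ge0. Qed.

Lemma cabs_Re z : `|complex.Re z| <= cabs z.
Proof. by rewrite -sqrtr_sqr ler_wsqrtr // lerDl sqr_ge0. Qed.

Lemma cabs_Im z : `|complex.Im z| <= cabs z.
Proof. by rewrite -sqrtr_sqr ler_wsqrtr // lerDr sqr_ge0. Qed.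

Lemma cabs_i : cabs 'i = 1.
Proof. by rewrite /cabs /= expr0n /= add0r expr1n sqrtr1. Qed.

Lemma cabs_ReIm z : cabs z <= `|complex.Re z| + `|complex.Im z|.
Proof.
case: z => a b /=.
have -> : a +i* b = a%:C + 'i * b%:C by simpc.
by rewrite (le_trans (cabsD _ _)) // cabsM cabs_i mul1r !cabs_real.
Qed.

Lemma cabs_sub_ge z w : cabs z - cabs w <= cabs (z - w).
Proof. by rewrite lerBlDr -{1}(subrK w z) cabsD. Qed.

Lemma cabs_dist z w : `|cabs z - cabs w| <= cabs (z - w).
Proof. by rewrite ler_norml cabs_sub_ge lerNl opprB cabs_sym cabs_sub_ge. Qed.

Lemma cabs_nat n : cabs n%:R = n%:R.
Proof. by rewrite -[n%:R](rmorph_nat (real_complex R)) cabs_real normr_nat. Qed.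

Lemma cabs_conj z : cabs z^* = cabs z.
Proof. by case: z => a b; rewrite /cabs /= sqrrN. Qed.

Lemma realCM (x y : R) : (x * y)%:C = x%:C * y%:C.
Proof. exact: rmorphM. Qed.

Lemma realCD (x y : R) : (x + y)%:C = x%:C + y%:C.
Proof. exact: rmorphD. Qed.

Lemma realCN (x : R) : (- x)%:C = - x%:C.
Proof. exact: rmorphN. Qed.

Lemma realCV (x : R) : (x^-1)%:C = x%:C^-1.
Proof. exact: fmorphV. Qed.

Lemma realCn n : n%:R%:C = n%:R :> C.
Proof. exact: rmorph_nat. Qed.

Lemma conjM_cabs z : z^* * z = (cabs z ^+ 2)%:C.
Proof. by rewrite cabs_sqr; case: z => a b; simpc; congr Complex; ring. Qed.

Lemma cReM z w : complex.Re (z * w) =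
  complex.Re z * complex.Re w - complex.Im z * complex.Im w.
Proof. by case: z; case: w. Qed.

Lemma cImM z w : complex.Im (z * w) =
  complex.Re z * complex.Im w + complex.Im z * complex.Re w.
Proof. by case: z; case: w. Qed.

Lemma cReD z w : complex.Re (z + w) = complex.Re z + complex.Re w.
Proof. by case: z; case: w. Qed.

Lemma cImD z w : complex.Im (z + w) = complex.Im z + complex.Im w.
Proof. by case: z; case: w. Qed.

Lemma cReN z : complex.Re (- z) = - complex.Re z.
Proof. by case: z. Qed.

Lemma cImN z : complex.Im (- z) = - complex.Im z.
Proof. by case: z. Qed.

Lemma cReV z : complex.Re z^-1 = complex.Re z / cabs z ^+ 2.
Proof. by rewrite cabs_sqr; case: z. Qed.

Lemma cImV z : complex.Im z^-1 = - complex.Im z / cabs z ^+ 2.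
Proof. by rewrite cabs_sqr; case: z => a b /=; rewrite mulNr. Qed.

Lemma cReR (x : R) : complex.Re x%:C = x. Proof. by []. Qed.
Lemma cImR (x : R) : complex.Im x%:C = 0. Proof. by []. Qed.

Lemma cRe1 : complex.Re (1 : C) = 1. Proof. by []. Qed.
Lemma cIm1 : complex.Im (1 : C) = 0. Proof. by []. Qed.

Lemma cRei : complex.Re ('i : C) = 0. Proof. by []. Qed.
Lemma cImi : complex.Im ('i : C) = 1. Proof. by []. Qed.

Lemma cImn n : complex.Im (n%:R : C) = 0.
Proof. by rewrite -[n%:R](rmorph_nat (real_complex R)). Qed.

Lemma cReZ (x : R) z : complex.Re (x%:C * z) = x * complex.Re z.
Proof. by rewrite cReM cReR cImR mul0r subr0. Qed.

Lemma cImZ (x : R) z : complex.Im (x%:C * z) = x * complex.Im z.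
Proof. by rewrite cImM cReR cImR mul0r addr0. Qed.

Lemma complex_eq z w :
  complex.Re z = complex.Re w -> complex.Im z = complex.Im w -> z = w.
Proof. by case: z; case: w => a b c d /= -> ->. Qed.

End ComplexAbs.

Section Calculus.
Variable R : realType.
Local Notation C := R[i].
Implicit Types (f g : C -> C) (z w l : C).

Definition ccont f z := forall e : R, 0 < e ->
  exists2 d : R, 0 < d & forall w, cabs (w - z) < d -> cabs (f w - f z) < e.

Definition cderiv f z l := forall e : R, 0 < e ->
  exists2 d : R, 0 < d & forall w, cabs (w - z) < d ->
    cabs (f w - f z - l * (w - z)) <= e * cabs (w - z).

Definition cdiff f z := exists l, cderiv f z l.

Lemma ccont_near f g z (d : R) : 0 < d ->
  (forall w, cabs (w - z) < d -> f w = g w) -> ccont f z -> ccont g z.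
Proof.
move=> d0 fg cf e e0; have [d' d'0 H] := cf e e0.
exists (Num.min d d'); first by rewrite lt_min d0.
move=> w; rewrite lt_min => /andP[h1 h2].
by rewrite -!fg ?H // subrr cabs0.
Qed.

Lemma cderiv_near f g z l (d : R) : 0 < d ->
  (forall w, cabs (w - z) < d -> f w = g w) -> cderiv f z l -> cderiv g z l.
Proof.
move=> d0 fg cf e e0; have [d' d'0 H] := cf e e0.
exists (Num.min d d'); first by rewrite lt_min d0.
move=> w; rewrite lt_min => /andP[h1 h2].
by rewrite -!fg ?H // subrr cabs0.
Qed.

Lemma cdiff_near f g z (d : R) : 0 < d ->
  (forall w, cabs (w - z) < d -> f w = g w) -> cdiff f z -> cdiff g z.
Proof. by move=> d0 fg [l /(cderiv_near d0 fg)]; exists l. Qed.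

Lemma eq_ccont f g z : f =1 g -> ccont f z -> ccont g z.
Proof. by move=> fg; apply: (@ccont_near _ _ _ 1) => // w _; exact: fg. Qed.

Lemma eq_cderiv f g z l : f =1 g -> cderiv f z l -> cderiv g z l.
Proof. by move=> fg; apply: (@cderiv_near _ _ _ _ 1) => // w _; exact: fg. Qed.

Lemma eq_cdiff f g z : f =1 g -> cdiff f z -> cdiff g z.
Proof. by move=> fg [l /(eq_cderiv fg)]; exists l. Qed.

Lemma ccont_cst (c : C) z : ccont (fun=> c) z.
Proof. by move=> e e0; exists 1 => // w _; rewrite subrr cabs0. Qed.

Lemma ccont_id z : ccont id z.
Proof. by move=> e e0; exists e. Qed.

Lemma ccontD f g z : ccont f z -> ccont g z -> ccont (fun w => f w + g w) z.
Proof.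
move=> cf cg e e0; have e20 : 0 < e / 2 by lra.
have [d1 d10 H1] := cf _ e20; have [d2 d20 H2] := cg _ e20.
exists (Num.min d1 d2); first by rewrite lt_min d10.
move=> w; rewrite lt_min => /andP[/H1 h1 /H2 h2].
have -> : f w + g w - (f z + g z) = (f w - f z) + (g w - g z) by ring.
by rewrite (le_lt_trans (cabsD _ _)) //; lra.
Qed.

Lemma ccont_loc_bound f z : ccont f z ->
  exists2 d : R, 0 < d & forall w, cabs (w - z) < d -> cabs (f w) < cabs (f z) + 1.
Proof.
move=> /(_ 1 ltr01)[d d0 H]; exists d => // w /H h.
by have := cabs_sub_ge (f w) (f z); lra.
Qed.

Lemma ccontM f g z : ccont f z -> ccont g z -> ccont (fun w => f w * g w) z.
Proof.
move=> cf cg e e0.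
pose A := cabs (f z) + 1; pose B := cabs (g z) + 1.
have A0 : 0 < A by rewrite ltr_wpDl ?cabs_ge0.
have B0 : 0 < B by rewrite ltr_wpDl ?cabs_ge0.
have eA : 0 < e / 2 / A by rewrite !divr_gt0.
have eB : 0 < e / 2 / B by rewrite !divr_gt0.
have [d1 d10 H1] := cf _ eB; have [d2 d20 H2] := cg _ eA.
have [d3 d30 H3] := ccont_loc_bound cg.
exists (Num.min d1 (Num.min d2 d3)); first by rewrite !lt_min d10 d20.
move=> w; rewrite !lt_min => /and3P[/H1 h1 /H2 h2 /H3 h3].
have -> : f w * g w - f z * g z = (f w - f z) * g w + f z * (g w - g z) by ring.
rewrite (le_lt_trans (cabsD _ _)) // !cabsM.
have k1 : cabs (f w - f z) * cabs (g w) <= e / 2 / B * B.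
  by rewrite ler_pM ?cabs_ge0 // ltW.
have k2 : cabs (f z) * cabs (g w - g z) <= cabs (f z) * (e / 2 / A).
  by rewrite ler_wpM2l ?cabs_ge0 // ltW.
have k3 : cabs (f z) * (e / 2 / A) < A * (e / 2 / A).
  by rewrite ltr_pM2r // ltrDl.
have k4 : e / 2 / B * B = e / 2 by rewrite divfK // gt_eqF.
have k5 : A * (e / 2 / A) = e / 2 by rewrite mulrC divfK // gt_eqF.
lra.
Qed.

Lemma ccontN f z : ccont f z -> ccont (fun w => - f w) z.
Proof.
by move=> cf e /cf[d d0 H]; exists d => // w /H; rewrite -opprD cabsN.
Qed.

Lemma ccontB f g z : ccont f z -> ccont g z -> ccont (fun w => f w - g w) z.
Proof. by move=> cf cg; apply: ccontD => //; exact: ccontN. Qed.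

Lemma ccont_comp f g z : ccont f z -> ccont g (f z) -> ccont (fun w => g (f w)) z.
Proof.
by move=> cf cg e /cg[d /cf[d' d'0 H'] H]; exists d' => // w /H' /H.
Qed.

Lemma ccont_inv z : z != 0 -> ccont (fun w => w^-1) z.
Proof.
move=> z0 e e0; have az : 0 < cabs z by rewrite cabs_gt0.
pose d := Num.min (cabs z / 2) (e / 2 * cabs z ^+ 2).
have d0 : 0 < d by rewrite lt_min !divr_gt0 // mulr_gt0 ?exprn_gt0 ?divr_gt0.
exists d => // w; rewrite lt_min => /andP[h1 h2].
have aw : cabs z / 2 < cabs w.
  by have := cabs_sub_ge z w; rewrite cabs_sym; lra.
have aw0 : 0 < cabs w by lra.
have w0 : w != 0 by rewrite -cabs_gt0.
have -> : w^-1 - z^-1 = (z - w) / (w * z) by field; rewrite z0 w0.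
rewrite cabsM cabsV cabsM cabs_sym ltr_pdivrMr ?mulr_gt0 //.
apply: (lt_le_trans h2); rewrite expr2 mulrA -mulrA -mulrA.
rewrite ler_pM2l //; rewrite mulrA ler_pM2r //; lra.
Qed.

Lemma ccontV f z : f z != 0 -> ccont f z -> ccont (fun w => (f w)^-1) z.
Proof. by move=> fz0 cf; apply: (ccont_comp cf); exact: ccont_inv. Qed.

Lemma cderivP f z l : cderiv f z l <->
  exists phi, [/\ forall w, f w = f z + phi w * (w - z), ccont phi z & phi z = l].
Proof.
split=> [df|[phi [fE cphi <-]] e e0].
  exists (fun w => if w == z then l else (f w - f z) / (w - z)).
  rewrite eqxx; split=> // [w|e e0].
    case: eqP => [->|/eqP wz]; first by rewrite subrr mulr0 addr0.
    by rewrite divfK ?subr_eq0 // addrC subrK.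
  have e20 : 0 < e / 2 by lra.
  have [d d0 H] := df _ e20; exists d => // w /H.
  rewrite eqxx; case: eqP => [->|/eqP wz]; first by move=> _; rewrite subrr cabs0.
  have wz0 : w - z != 0 by rewrite subr_eq0.
  have az : 0 < cabs (w - z) by rewrite cabs_gt0.
  have -> : (f w - f z) / (w - z) - l = (f w - f z - l * (w - z)) / (w - z).
    by field.
  rewrite cabsM cabsV => h; rewrite ltr_pdivrMr // (le_lt_trans h) //.
  by rewrite ltr_pM2r //; lra.
have [d d0 H] := cphi _ e0; exists d => // w /H h.
have -> : f w - f z - phi z * (w - z) = (phi w - phi z) * (w - z).
  by rewrite fE; ring.
by rewrite cabsM ler_wpM2r ?cabs_ge0 // ltW.
Qed.

Lemma cderiv_cont f z l : cderiv f z l -> ccont f z.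
Proof.
case/cderivP=> phi [fE cphi _].
apply: (@eq_ccont (fun w => f z + phi w * (w - z))); first by move=> w; rewrite [RHS]fE.
apply: ccontD; first exact: ccont_cst.
apply: ccontM => //; apply: ccontB; [exact: ccont_id|exact: ccont_cst].
Qed.

Lemma cdiff_cont f z : cdiff f z -> ccont f z.
Proof. by case=> l /cderiv_cont. Qed.

Lemma cderiv_cst (c : C) z : cderiv (fun=> c) z 0.
Proof.
move=> e e0; exists 1 => // w _; rewrite subrr sub0r mul0r oppr0 cabs0.
by rewrite mulr_ge0 ?cabs_ge0 // ltW.
Qed.

Lemma cderiv_id z : cderiv id z 1.
Proof.
move=> e e0; exists 1 => // w _; rewrite mul1r subrr cabs0.
by rewrite mulr_ge0 ?cabs_ge0 // ltW.
Qed.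

Lemma cderivD f g z l m : cderiv f z l -> cderiv g z m ->
  cderiv (fun w => f w + g w) z (l + m).
Proof.
move=> /cderivP[p [fE cp pz]] /cderivP[q [gE cq qz]].
apply/cderivP; exists (fun w => p w + q w); split.
- by move=> w; rewrite fE gE; ring.
- exact: ccontD.
- by rewrite pz qz.
Qed.

Lemma cderivM f g z l m : cderiv f z l -> cderiv g z m ->
  cderiv (fun w => f w * g w) z (l * g z + f z * m).
Proof.
move=> df dg; have cg := cderiv_cont dg.
case/cderivP: df => p [fE cp pz]; case/cderivP: dg => q [gE cq qz].
apply/cderivP; exists (fun w => p w * g w + f z * q w); split.
- by move=> w; rewrite fE gE; ring.
- by apply: ccontD; apply: ccontM => //; exact: ccont_cst.
- by rewrite pz qz.
Qed.

Lemma cderivN f z l : cderiv f z l -> cderiv (fun w => - f w) z (- l).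
Proof.
move=> /cderivP[p [fE cp pz]]; apply/cderivP; exists (fun w => - p w); split.
- by move=> w; rewrite fE; ring.
- exact: ccontN.
- by rewrite pz.
Qed.

Lemma cderivB f g z l m : cderiv f z l -> cderiv g z m ->
  cderiv (fun w => f w - g w) z (l - m).
Proof. by move=> df dg; apply: cderivD => //; exact: cderivN. Qed.

Lemma cderivZ (c : C) f z l : cderiv f z l -> cderiv (fun w => c * f w) z (c * l).
Proof.
move=> df; have := cderivM (cderiv_cst c z) df.
by rewrite mul0r add0r.
Qed.

Lemma cderiv_comp f g z l m : cderiv f z l -> cderiv g (f z) m ->
  cderiv (fun w => g (f w)) z (m * l).
Proof.
move=> df dg; have cf := cderiv_cont df.
case/cderivP: df => p [fE cp pz]; case/cderivP: dg => q [gE cq qz].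
apply/cderivP; exists (fun w => q (f w) * p w); split.
- by move=> w; rewrite [LHS]gE [in X in _ * X]fE; ring.
- by apply: ccontM => //; apply: (ccont_comp cf).
- by rewrite pz qz.
Qed.

Lemma cderiv_inv z : z != 0 -> cderiv (fun w => w^-1) z (- (z ^+ 2)^-1).
Proof.
move=> z0; have az : 0 < cabs z by rewrite cabs_gt0.
apply/cderivP; exists (fun w => if w == 0 then (z ^+ 2)^-1 else - (w^-1 * z^-1)).
split.
- move=> w; case: eqP => [->|/eqP w0]; first by rewrite invr0; field.
  by field; rewrite w0 z0.
- apply: (@ccont_near (fun w => - (w^-1 * z^-1)) _ _ (cabs z)) => //.
    move=> w; case: eqP => // ->; rewrite sub0r cabsN ltxx //.
  apply: ccontN; apply: ccontM; [exact: ccont_inv|exact: ccont_cst].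
- by rewrite (negPf z0) -invfM expr2.
Qed.

Lemma cderivV f z l : f z != 0 -> cderiv f z l ->
  cderiv (fun w => (f w)^-1) z (- l / f z ^+ 2).
Proof.
move=> fz0 df; have := cderiv_comp df (cderiv_inv fz0).
by rewrite mulNr mulrC mulNr.
Qed.

Lemma cderivX n z : cderiv (fun w => w ^+ n) z (n%:R * z ^+ n.-1).
Proof.
elim: n => [|n IH].
  by rewrite mul0r; apply: (eq_cderiv _ (cderiv_cst 1 z)) => w; rewrite expr0.
have := cderivM (cderiv_id z) IH.
have -> : 1 * z ^+ n + id z * (n%:R * z ^+ n.-1) = n.+1%:R * z ^+ n.+1.-1.
  case: n {IH} => [|n] /=; first by rewrite expr0; ring.
  by rewrite exprS -(natr1 n.+1); ring.
by apply: eq_cderiv => w; rewrite exprS.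
Qed.

Lemma cdiff_cst (c : C) z : cdiff (fun=> c) z.
Proof. by exists 0; exact: cderiv_cst. Qed.
Lemma cdiff_id z : cdiff id z.
Proof. by exists 1; exact: cderiv_id. Qed.
Lemma cdiffD f g z : cdiff f z -> cdiff g z -> cdiff (fun w => f w + g w) z.
Proof. by case=> l df [m dg]; eexists; exact: cderivD df dg. Qed.
Lemma cdiffB f g z : cdiff f z -> cdiff g z -> cdiff (fun w => f w - g w) z.
Proof. by case=> l df [m dg]; eexists; exact: cderivB df dg. Qed.
Lemma cdiffN f z : cdiff f z -> cdiff (fun w => - f w) z.
Proof. by case=> l df; eexists; exact: cderivN df. Qed.
Lemma cdiffM f g z : cdiff f z -> cdiff g z -> cdiff (fun w => f w * g w) z.
Proof. by case=> l df [m dg]; eexists; exact: cderivM df dg. Qed.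
Lemma cdiffZ (c : C) f z : cdiff f z -> cdiff (fun w => c * f w) z.
Proof. by case=> l df; eexists; exact: cderivZ df. Qed.
Lemma cdiffV f z : f z != 0 -> cdiff f z -> cdiff (fun w => (f w)^-1) z.
Proof. by move=> f0 [l df]; eexists; exact: cderivV f0 df. Qed.
Lemma cdiff_comp f g z : cdiff f z -> cdiff g (f z) -> cdiff (fun w => g (f w)) z.
Proof. by case=> l df [m dg]; eexists; exact: cderiv_comp df dg. Qed.
Lemma cdiffX n z : cdiff (fun w => w ^+ n) z.
Proof. by eexists; exact: cderivX. Qed.

Lemma derivable_cdiff f z : derivable (f : C^o -> C^o) z 1 <-> cdiff f z.
Proof.
split.
- move=> /cvg_ex[/= l /cvgrPdist_le H]; exists l => e e0.
  have /H : 0 < e%:C by rewrite ltcR.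
  rewrite /dnbhs /within /= => /nbhs_ballP[[dr di]].
  rewrite /= ltcE /= => /andP[/eqP di0 dr0]; rewrite di0 {di di0} => Hb.
  exists dr => // w wd; have [->|wz] := eqVneq w z.
    by rewrite !subrr mulr0 subrr cabs0 mulr0.
  have wz0 : w - z != 0 by rewrite subr_eq0.
  have az : 0 < cabs (w - z) by rewrite cabs_gt0.
  have := Hb (w - z); rewrite /ball /= sub0r normrN normC_cabs ltcR.
  move=> /(_ wd wz0); rewrite normC_cabs lecR /= /GRing.scale /= mulr1 subrK.
  have -> : l - (w - z)^-1 * (f w - f z) = - ((f w - f z - l * (w - z)) / (w - z)).
    by field.
  by rewrite cabsN cabsM cabsV ler_pdivrMr.
- case=> l df; apply/cvg_ex; exists l; apply/cvgrPdist_le => /= -[er ei].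
  rewrite ltcE /= => /andP[/eqP -> e0].
  have [d d0 H] := df _ e0.
  rewrite /dnbhs /within /=; apply/nbhs_ballP; exists d%:C; first by rewrite /= ltcR.
  move=> h; rewrite /ball /= sub0r normrN normC_cabs ltcR => hd h0.
  have ah : 0 < cabs h by rewrite cabs_gt0.
  rewrite normC_cabs lecR /= /GRing.scale /= mulr1.
  have -> : l - h^-1 * (f (h + z) - f z) = - ((f (h + z) - f z - l * h) / h).
    by field.
  rewrite cabsN cabsM cabsV ler_pdivrMr //.
  by have := H (h + z); rewrite addrK; exact.
Qed.

End Calculus.

(** * Integrals and the Cauchy-Goursat theorem *)

Section RealIntegral.
Variable R : realType.
Implicit Types (u v U V : R -> R) (a b c x : R).

Definition prim u U := forall x, is_derive x 1 U (u x).

Lemma rcontP u : (forall x e, 0 < e -> exists2 d, 0 < d &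
  forall y, `|y - x| < d -> `|u y - u x| < e) -> continuous u.
Proof.
move=> H x; apply/cvgrPdist_lt => e e0; have [d d0 Hd] := H x e e0.
apply/nbhs_ballP; exists d => // y; rewrite /ball /= distrC => /Hd.
by rewrite distrC.
Qed.

Lemma prim_cst U V u : prim u U -> prim u V -> forall a b, U b - U a = V b - V a.
Proof.
move=> pU pV a b.
have d0 x : is_derive x 1 (fun x => U x - V x) 0.
  by have := is_deriveB (pU x) (pV x); rewrite subrr; exact.
have h : U b - V b = U a - V a by apply: (@is_derive_0_is_cst _ (fun x => U x - V x)).
lra.
Qed.

Lemma half_prim u c : continuous u ->
  exists U, forall x, c < x -> is_derive x 1 U (u x).
Proof.
move=> cu; exists (fun y => (\int[lebesgue_measure]_(t in `[c, y]) u t)%R) => x cx.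
have x1 : x < x + 1 by rewrite ltrDl.
have int : lebesgue_measure.-integrable `[c, x + 1] (EFin \o u).
  apply: continuous_compact_integrable; first exact: segment_compact.
  exact: continuous_subspaceT.
have [d1] := continuous_FTC1_closed x1 int cx (cu x).
by rewrite derive1E => <-; exact: DeriveDef.
Qed.

Lemma continuous_prim u : continuous u -> exists U, prim u U.
Proof.
move=> cu; have [F dF] := half_prim (-1) cu.
have cuN : continuous (fun x => u (- x)).
  by move=> x; apply: continuous_comp; [exact: opp_continuous|exact: cu].
have [G0 dG0] := half_prim (-1) cuN.
pose G x := - G0 (- x).
have dG x : x < 1 -> is_derive x 1 G (u x).
  move=> x1; have nx : -1 < - x by lra.
  have h := dG0 _ nx.
  have h1 : is_derive x 1 (fun x => G0 (- x)) (- u x).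
    have := @is_derive1_comp R G0 (@GRing.opp R) x _ _ h (is_deriveNid x 1).
    by rewrite opprK mulrN1; exact.
  by have := is_deriveN h1; rewrite opprK; exact.
exists (fun x => if x < 0 then G x - G 0 else F x - F 0).
have FG x : -1 < x < 1 -> F x - F 0 = G x - G 0.
  move=> /andP[x1 x2].
  have key a b : -1 < a -> b < 1 -> a < b -> F b - G b = F a - G a.
    move=> a1 b1 ab.
    have [||c _] := @MVT R (fun x => F x - G x) (fun=> 0) a b ab; last first.
      by rewrite mul0r => /eqP; rewrite subr_eq0 => /eqP.
    - apply: derivable_within_continuous => c; rewrite in_itv /= => /andP[c1 c2].
      have h1 : -1 < c by lra.
      have h2 : c < 1 by lra.
      by have [h _] := is_deriveB (dF _ h1) (dG _ h2); exact: h.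
    - move=> c; rewrite in_itv /= => /andP[c1 c2].
      have h1 : -1 < c by lra.
      have h2 : c < 1 by lra.
      by have := is_deriveB (dF _ h1) (dG _ h2); rewrite subrr; exact.
  have [x0|x0|->] := ltgtP x 0; last by rewrite !subrr.
  - have := key x 0 x1 ltr01 x0; lra.
  - have m1 : (-1 : R) < 0 by lra.
    have := key 0 x m1 x2 x0; lra.
move=> x; have [x0|x0] := ltP x 0.
- apply: (@near_eq_is_derive _ _ _ (fun x => G x - G 0)).
  + have : \forall y \near x, y < 0 by apply: lt_nbhsl.
    by apply: filterS => y ->.
  + have x1 : x < 1 by lra.
    by have := is_deriveB (dG _ x1) (is_derive_cst (G 0) x 1); rewrite subr0; exact.
- apply: (@near_eq_is_derive _ _ _ (fun x => F x - F 0)).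
  + have : \forall y \near x, -1 < y by apply: lt_nbhsr; lra.
    apply: filterS => y y1; case: ifP => // y0.
    by rewrite FG //; rewrite y1 /=; lra.
  + have x1 : -1 < x by lra.
    by have := is_deriveB (dF _ x1) (is_derive_cst (F 0) x 1); rewrite subr0; exact.
Qed.

(* The integral is defined through a primitive; it is a junk value when there is
   none, which for continuous [u] does not happen. *)
Definition RI u a b : R := let U := xget u [set U | prim u U] in U b - U a.

Lemma RI_prim u U a b : prim u U -> RI u a b = U b - U a.
Proof.
move=> pU; rewrite /RI; set V := xget _ _.
have pV : prim u V by exact: xgetI pU.
exact: prim_cst pV pU a b.
Qed.

Lemma RI_cat u a b c : RI u a b + RI u b c = RI u a c.
Proof. by rewrite /RI; ring. Qed.

Lemma eq_RI u v a b : u =1 v -> RI u a b = RI v a b.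
Proof. by move=> /funext ->. Qed.

Lemma RID u v a b : continuous u -> continuous v ->
  RI (fun x => u x + v x) a b = RI u a b + RI v a b.
Proof.
move=> /continuous_prim[U pU] /continuous_prim[V pV].
rewrite (RI_prim _ _ pU) (RI_prim _ _ pV) (@RI_prim _ (fun x => U x + V x)); first ring.
by move=> x; have := is_deriveD (pU x) (pV x); exact.
Qed.

Lemma RIZ c u a b : continuous u -> RI (fun x => c * u x) a b = c * RI u a b.
Proof.
move=> /continuous_prim[U pU].
rewrite (RI_prim _ _ pU) (@RI_prim _ (fun x => c * U x)); first ring.
by move=> x; have := is_deriveZ c (pU x); exact.
Qed.

Lemma RI_cst c a b : RI (fun=> c) a b = c * (b - a).
Proof.
rewrite (@RI_prim _ (fun x => c * x)); first ring.
by move=> x; have := is_deriveZ c (is_derive_id x 1); rewrite /GRing.scale /= mulr1; exact.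
Qed.

Lemma RI_id a b : RI id a b = (b ^+ 2 - a ^+ 2) / 2.
Proof.
rewrite (@RI_prim _ (fun x => 2^-1 * (x * x))); first by field.
move=> x; have := is_deriveZ 2^-1 (is_deriveM (is_derive_id x 1) (is_derive_id x 1)).
by rewrite /GRing.scale /= !mulr1 (_ : 2^-1 * (x + x) = id x); [exact|rewrite /=; field].
Qed.

Lemma RI_ge0 u a b : continuous u -> a <= b ->
  (forall x, a <= x <= b -> 0 <= u x) -> 0 <= RI u a b.
Proof.
move=> /continuous_prim[U pU]; rewrite le_eqVlt => /orP[/eqP->|ab] u0.
  by rewrite /RI subrr.
rewrite (RI_prim _ _ pU).
have [||c] := @MVT R U u a b ab.
- by move=> x _; exact: pU.
- apply: derivable_within_continuous => x _; have [h _] := pU x; exact: h.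
- rewrite in_itv /= => /andP[c1 c2] ->.
  apply: mulr_ge0; last by rewrite subr_ge0 ltW.
  by apply: u0; rewrite !ltW.
Qed.

Lemma RIN u a b : continuous u -> RI (fun x => - u x) a b = - RI u a b.
Proof.
by move=> cu; rewrite -mulN1r -RIZ //; apply: eq_RI => x; rewrite mulN1r.
Qed.

Lemma RI_le u v a b : continuous u -> continuous v -> a <= b ->
  (forall x, a <= x <= b -> u x <= v x) -> RI u a b <= RI v a b.
Proof.
move=> cu cv ab uv; rewrite -subr_ge0 -RIN // -RID //; last first.
  by move=> x; apply: continuousN; exact: cu.
apply: RI_ge0 => // [x|x /uv]; last by rewrite subr_ge0.
by apply: cvgB; [exact: cv|exact: cu].
Qed.

Lemma RI_shift u h a b : continuous u ->
  RI (fun x => u (x + h)) a b = RI u (a + h) (b + h).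
Proof.
move=> /continuous_prim[U pU]; rewrite (RI_prim _ _ pU).
rewrite (@RI_prim _ (fun x => U (x + h))) // => x.
have := @is_derive1_comp R U (fun x => x + h) x _ _ (pU (x + h))
  (is_deriveD (is_derive_id x 1) (is_derive_cst h x 1)).
by rewrite addr0 mulr1; exact.
Qed.

Lemma RI_period u a b : continuous u -> (forall x, u (x + 1) = u x) ->
  RI u a (a + 1) = RI u b (b + 1).
Proof.
move=> cu per; rewrite -(RI_cat u a b (a + 1)) -(RI_cat u b (a + 1) (b + 1)).
by rewrite -(RI_shift 1 a b cu) (eq_RI _ _ per) addrC.
Qed.

Lemma RI_eq0 u a b : continuous u -> a < b ->
  (forall x, 0 <= u x) -> RI u a b = 0 -> forall x, a <= x <= b -> u x = 0.
Proof.
move=> cu ab u0 I0 x /andP[ax xb].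
have sub c d : a <= c -> c <= d -> d <= b -> RI u c d = 0.
  move=> ac cd db.
  have h1 : 0 <= RI u a c by apply: RI_ge0.
  have h2 : 0 <= RI u c d by apply: RI_ge0.
  have h3 : 0 <= RI u d b by apply: RI_ge0.
  move: I0; rewrite -(RI_cat u a c b) -(RI_cat u c d b); lra.
have [U pU] := continuous_prim cu.
apply/eqP; rewrite eq_le u0 andbT; apply/ler_addgt0Pr => e e0; rewrite add0r.
have /cvgrPdist_lt /(_ _ e0) /nbhs_ballP [d /= d0 H] := cu x.
pose c := Num.max a (x - d / 2); pose f := Num.min b (x + d / 2).
have hc1 : a <= c by rewrite le_max lexx.
have hc2 : x - d / 2 <= c by rewrite le_max lexx orbT.
have hf1 : f <= b by rewrite ge_min lexx.
have hf2 : f <= x + d / 2 by rewrite ge_min lexx orbT.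
have d20 : 0 < d / 2 by lra.
have cf : c < f by rewrite /c /f gt_max !lt_min; apply/andP; split; apply/andP; split; lra.
have [||y] := @MVT R U u c f cf.
- by move=> y _; exact: pU.
- apply: derivable_within_continuous => y _; have [h _] := pU y; exact: h.
rewrite in_itv /= => /andP[y1 y2]; rewrite -(RI_prim _ _ pU).
rewrite (sub _ _ hc1 (ltW cf) hf1).
move=> /esym/eqP; rewrite mulf_eq0 subr_eq0 (gt_eqF cf) orbF => /eqP uy.
have yd : ball x d y by rewrite /ball /= ltr_norml; apply/andP; split; lra.
by have := H y yd; rewrite /= uy subr0 ger0_norm //; exact: ltW.
Qed.

End RealIntegral.

Section ComplexIntegral.
Variable R : realType.
Local Notation C := R[i].
Implicit Types (u v : R -> C) (f g : C -> C) (a b c : R).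

Definition rcont u := forall x e, 0 < e -> exists2 d, 0 < d &
  forall y, `|y - x| < d -> cabs (u y - u x) < e.

Lemma rcont_Re u : rcont u -> continuous (fun x => complex.Re (u x)).
Proof.
move=> cu; apply: rcontP => x e /(cu x)[d d0 H]; exists d => // y /H.
by apply: le_lt_trans; rewrite -cReN -cReD cabs_Re.
Qed.

Lemma rcont_Im u : rcont u -> continuous (fun x => complex.Im (u x)).
Proof.
move=> cu; apply: rcontP => x e /(cu x)[d d0 H]; exists d => // y /H.
by apply: le_lt_trans; rewrite -cImN -cImD cabs_Im.
Qed.

Lemma rcont_ccont f u : rcont u -> (forall x, ccont f (u x)) -> rcont (fun x => f (u x)).
Proof.
move=> cu cf x e /(cf x)[d /(cu x)[d' d'0 H'] H]; exists d' => // y /H'.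
exact: H.
Qed.

Lemma rcont_hline y : rcont (fun x => x +i* y).
Proof.
move=> x e e0; exists e => // x'; apply: le_lt_trans.
by apply: le_trans (cabs_ReIm _) _; rewrite /= subrr normr0 addr0.
Qed.

Lemma rcont_vline x : rcont (fun y => x +i* y).
Proof.
move=> y e e0; exists e => // y'; apply: le_lt_trans.
by apply: le_trans (cabs_ReIm _) _; rewrite /= subrr normr0 add0r.
Qed.

Lemma rcontD u v : rcont u -> rcont v -> rcont (fun x => u x + v x).
Proof.
move=> cu cv x e e0; have e20 : 0 < e / 2 by lra.
have [d1 d10 H1] := cu x _ e20; have [d2 d20 H2] := cv x _ e20.
exists (Num.min d1 d2); first by rewrite lt_min d10.
move=> y; rewrite lt_min => /andP[/H1 h1 /H2 h2].
have -> : u y + v y - (u x + v x) = (u y - u x) + (v y - v x) by ring.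
by rewrite (le_lt_trans (cabsD _ _)) //; lra.
Qed.

Lemma rcontZ (k : C) u : rcont u -> rcont (fun x => k * u x).
Proof.
move=> cu; apply: (@rcont_ccont (fun z => k * z) u cu) => x.
by apply: ccontM; [exact: ccont_cst|exact: ccont_id].
Qed.

Lemma rcont_cst (k : C) : rcont (fun=> k).
Proof. by move=> x e e0; exists 1 => // y _; rewrite subrr cabs0. Qed.

Definition CI u a b : C :=
  RI (fun x => complex.Re (u x)) a b +i* RI (fun x => complex.Im (u x)) a b.

Lemma CI_cat u a b c : CI u a b + CI u b c = CI u a c.
Proof. by rewrite /CI; simpc; rewrite !RI_cat. Qed.

Lemma eq_CI u v a b : u =1 v -> CI u a b = CI v a b.
Proof. by move=> /funext ->. Qed.

Lemma CID u v a b : rcont u -> rcont v ->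
  CI (fun x => u x + v x) a b = CI u a b + CI v a b.
Proof.
move=> cu cv; apply: complex_eq; rewrite ?cReD ?cImD /=.
- by rewrite -RID; [apply: eq_RI => x; rewrite cReD|exact: rcont_Re..].
- by rewrite -RID; [apply: eq_RI => x; rewrite cImD|exact: rcont_Im..].
Qed.

Lemma CIZ (k : C) u a b : rcont u -> CI (fun x => k * u x) a b = k * CI u a b.
Proof.
move=> cu; have cr := rcont_Re cu; have ci := rcont_Im cu.
have cZ (k' : R) (w : R -> R) : continuous w -> continuous (fun x => k' * w x).
  by move=> cw x; apply: cvgMr; exact: cw.
apply: complex_eq.
- rewrite [RHS]cReM /= -!RIZ // -RIN -?RID; first by apply: eq_RI => x; rewrite cReM.
  + exact: cZ.
  + by move=> x; apply: cvgN; exact: cZ.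
  + exact: cZ.
- rewrite [RHS]cImM /= -!RIZ // -RID; first by apply: eq_RI => x; rewrite cImM.
  + exact: cZ.
  + exact: cZ.
Qed.

Lemma CIN u a b : rcont u -> CI (fun x => - u x) a b = - CI u a b.
Proof. by move=> cu; rewrite -mulN1r -CIZ //; apply: eq_CI => x; rewrite mulN1r. Qed.

Lemma CIB u v a b : rcont u -> rcont v ->
  CI (fun x => u x - v x) a b = CI u a b - CI v a b.
Proof.
move=> cu cv; rewrite CID //; first by rewrite CIN.
by apply: (@rcont_ccont (fun z => - z) v cv) => x; apply: ccontN; exact: ccont_id.
Qed.

Lemma CI_cst (k : C) a b : CI (fun=> k) a b = k * (b - a)%:C.
Proof. by rewrite /CI !RI_cst; case: k => k1 k2; simpc. Qed.

Lemma CI_id a b : CI (fun x => x%:C) a b = ((b ^+ 2 - a ^+ 2) / 2)%:C.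
Proof.
rewrite /CI; congr Complex; first exact: RI_id.
by rewrite RI_cst mul0r.
Qed.

Lemma CI_bound u a b (M : R) : rcont u -> a <= b ->
  (forall x, a <= x <= b -> cabs (u x) <= M) -> cabs (CI u a b) <= M * (b - a).
Proof.
move=> cu ab uM; have [->|I0] := eqVneq (CI u a b) 0.
  rewrite cabs0 mulr_ge0 ?subr_ge0 // (le_trans (cabs_ge0 (u a))) // uM //.
  by rewrite lexx.
have aI : 0 < cabs (CI u a b) by rewrite cabs_gt0.
pose k := (CI u a b)^* / (cabs (CI u a b))%:C.
have k1 : cabs k = 1.
  by rewrite cabsM cabsV cabs_conj cabs_real (gtr0_norm aI) divff // gt_eqF.
have -> : cabs (CI u a b) = complex.Re (CI (fun x => k * u x) a b).
  rewrite CIZ // /k.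
  have -> : (CI u a b)^* / (cabs (CI u a b))%:C * CI u a b
    = (cabs (CI u a b) ^+ 2 / cabs (CI u a b))%:C.
    by rewrite mulrAC conjM_cabs [in RHS]realCM realCV.
  by rewrite /= expr2 mulfK // gt_eqF.
rewrite /= -RI_cst; apply: RI_le => //.
- by apply: rcont_Re; exact: rcontZ.
- by move=> x; exact: cvg_cst.
move=> x /uM; rewrite -[cabs (u x)]mul1r -k1 -cabsM; apply: le_trans.
by rewrite (le_trans (ler_norm _)) // cabs_Re.
Qed.

Lemma CI_period u a b : rcont u -> (forall x, u (x + 1) = u x) ->
  CI u a (a + 1) = CI u b (b + 1).
Proof.
move=> cu per; congr Complex; apply: RI_period.
- exact: rcont_Re.
- by move=> x; rewrite per.
- exact: rcont_Im.
- by move=> x; rewrite per.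
Qed.

Lemma CI_extremal u a (M : R) : rcont u -> (forall x, cabs (u x) <= M) ->
  cabs (CI u a (a + 1)) = M -> forall x, a <= x <= a + 1 -> cabs (u x) = M.
Proof.
move=> cu uM IM x xab; have [M0|M0] := eqVneq M 0.
  by apply/eqP; rewrite eq_le uM M0 cabs_ge0.
have Mp : 0 < M by rewrite lt_neqAle eq_sym M0 -IM cabs_ge0.
pose k := (CI u a (a + 1))^* / M%:C.
have k1 : cabs k = 1.
  by rewrite cabsM cabsV cabs_conj cabs_real (gtr0_norm Mp) IM divff.
pose v x := M - complex.Re (k * u x).
have ck : continuous (fun x => complex.Re (k * u x)).
  by apply: rcont_Re; exact: rcontZ.
have reM x' : complex.Re (k * u x') <= cabs (u x').
  by rewrite -[cabs (u x')]mul1r -k1 -cabsM (le_trans (ler_norm _)) // cabs_Re.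
have v0 x' : 0 <= v x' by rewrite subr_ge0 (le_trans (reM _)).
have cv : continuous v by move=> y; apply: cvgB; [exact: cvg_cst|exact: ck].
have aa : a < a + 1 by rewrite ltrDl.
have Iv : RI v a (a + 1) = 0.
  rewrite RID // ?RIN // ?RI_cst; last 2 first.
  - by move=> y; exact: cvg_cst.
  - by move=> y; apply: cvgN; exact: ck.
  have -> : RI (fun x => complex.Re (k * u x)) a (a + 1) =
    complex.Re (CI (fun x => k * u x) a (a + 1)) by [].
  rewrite CIZ // /k.
  have -> : (CI u a (a + 1))^* / M%:C * CI u a (a + 1)
    = (cabs (CI u a (a + 1)) ^+ 2 / M)%:C.
    by rewrite mulrAC conjM_cabs [in RHS]realCM realCV.
  by rewrite IM /= expr2 mulfK //; ring.
have := RI_eq0 cv aa v0 Iv xab; rewrite /v => /eqP; rewrite subr_eq0 => /eqP h.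
by apply/eqP; rewrite eq_le uM {1}h reM.
Qed.

Definition gcont f := forall z, ccont f z.

Lemma gcont_h f y : gcont f -> rcont (fun x => f (x +i* y)).
Proof. by move=> cf; apply: rcont_ccont (rcont_hline y) _ => x; exact: cf. Qed.

Lemma gcont_v f x : gcont f -> rcont (fun y => f (x +i* y)).
Proof. by move=> cf; apply: rcont_ccont (rcont_vline x) _ => y; exact: cf. Qed.

(* Integral over the boundary of the rectangle, counterclockwise. *)
Definition J f (x1 x2 y1 y2 : R) : C :=
  CI (fun t => f (t +i* y1)) x1 x2 - CI (fun t => f (t +i* y2)) x1 x2 +
  'i * (CI (fun t => f (x2 +i* t)) y1 y2 - CI (fun t => f (x1 +i* t)) y1 y2).

Lemma J_hcat f x1 x2 x3 y1 y2 : J f x1 x2 y1 y2 + J f x2 x3 y1 y2 = J f x1 x3 y1 y2.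
Proof. by rewrite /J -!(CI_cat _ x1 x2 x3); ring. Qed.

Lemma J_vcat f x1 x2 y1 y2 y3 : J f x1 x2 y1 y2 + J f x1 x2 y2 y3 = J f x1 x2 y1 y3.
Proof. by rewrite /J -!(CI_cat _ y1 y2 y3); ring. Qed.

Lemma J_affine (k l : C) x1 x2 y1 y2 : J (fun z => k + l * z) x1 x2 y1 y2 = 0.
Proof.
have h y p q : CI (fun t => k + l * (t +i* y)) p q =
    (k + l * (0 +i* y)) * (q - p)%:C + l * ((q ^+ 2 - p ^+ 2) / 2)%:C.
  rewrite -CI_id -CI_cst -CIZ; last exact: rcont_hline.
  rewrite -CID; [|exact: rcont_cst|by apply: rcontZ; exact: rcont_hline].
  apply: eq_CI => t; rewrite -addrA -mulrDr; congr (_ + _ * _).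
  by simpc.
have v x p q : CI (fun t => k + l * (x +i* t)) p q =
    (k + l * x%:C) * (q - p)%:C + l * 'i * ((q ^+ 2 - p ^+ 2) / 2)%:C.
  rewrite -CI_id -CI_cst -CIZ; last exact: rcont_hline.
  rewrite -CID; [|exact: rcont_cst|by apply: rcontZ; exact: rcont_hline].
  apply: eq_CI => t; rewrite -addrA -mulrA -mulrDr; congr (_ + _ * _).
  by simpc.
rewrite /J !h !v {h v}; case: k => k1 k2; case: l => l1 l2; simpc.
by congr Complex; field.
Qed.

Lemma JB f g x1 x2 y1 y2 : gcont f -> gcont g ->
  J (fun z => f z - g z) x1 x2 y1 y2 = J f x1 x2 y1 y2 - J g x1 x2 y1 y2.
Proof.
move=> cf cg; rewrite /J.
rewrite (CIB _ _ (gcont_h y1 cf) (gcont_h y1 cg)).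
rewrite (CIB _ _ (gcont_h y2 cf) (gcont_h y2 cg)).
rewrite (CIB _ _ (gcont_v x1 cf) (gcont_v x1 cg)).
by rewrite (CIB _ _ (gcont_v x2 cf) (gcont_v x2 cg)); ring.
Qed.

Lemma J_bound f x1 x2 y1 y2 (M : R) : gcont f -> x1 <= x2 -> y1 <= y2 ->
  (forall x y, x1 <= x <= x2 -> y1 <= y <= y2 -> cabs (f (x +i* y)) <= M) ->
  cabs (J f x1 x2 y1 y2) <= 2 * M * (x2 - x1 + (y2 - y1)).
Proof.
move=> cf x12 y12 fM.
have h y : y1 <= y <= y2 -> cabs (CI (fun t => f (t +i* y)) x1 x2) <= M * (x2 - x1).
  by move=> yy; apply: CI_bound => // [|x xx]; [exact: gcont_h|exact: fM].
have v x : x1 <= x <= x2 -> cabs (CI (fun t => f (x +i* t)) y1 y2) <= M * (y2 - y1).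
  by move=> xx; apply: CI_bound => // [|y yy]; [exact: gcont_v|exact: fM].
have h1 := h y1; have h2 := h y2; have v1 := v x1; have v2 := v x2.
have {}h1 : cabs (CI (fun t => f (t +i* y1)) x1 x2) <= M * (x2 - x1).
  by apply: h1; rewrite lexx.
have {}h2 : cabs (CI (fun t => f (t +i* y2)) x1 x2) <= M * (x2 - x1).
  by apply: h2; rewrite lexx andbT.
have {}v1 : cabs (CI (fun t => f (x1 +i* t)) y1 y2) <= M * (y2 - y1).
  by apply: v1; rewrite lexx.
have {}v2 : cabs (CI (fun t => f (x2 +i* t)) y1 y2) <= M * (y2 - y1).
  by apply: v2; rewrite lexx andbT.
rewrite /J (le_trans (cabsD _ _)) // cabsM cabs_i mul1r.
have := cabsB (CI (fun t => f (t +i* y1)) x1 x2) (CI (fun t => f (t +i* y2)) x1 x2).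
have := cabsB (CI (fun t => f (x2 +i* t)) y1 y2) (CI (fun t => f (x1 +i* t)) y1 y2).
lra.
Qed.

End ComplexIntegral.

Section ComplexExp.
Variable R : realType.
Local Notation C := R[i].
Implicit Types (z w : C).

Definition cexp z : C :=
  (expR (complex.Re z) * cos (complex.Im z)) +i*
  (expR (complex.Re z) * sin (complex.Im z)).

Lemma Re_cexp z : complex.Re (cexp z) = expR (complex.Re z) * cos (complex.Im z).
Proof. by []. Qed.

Lemma Im_cexp z : complex.Im (cexp z) = expR (complex.Re z) * sin (complex.Im z).
Proof. by []. Qed.

Lemma cexpD z w : cexp (z + w) = cexp z * cexp w.
Proof.
apply: complex_eq.
  by rewrite cReM !Re_cexp !Im_cexp cReD cImD expRD cosD; ring.
by rewrite cImM !Re_cexp !Im_cexp cReD cImD expRD sinD; ring.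
Qed.

Lemma cexp0 : cexp 0 = 1.
Proof. by rewrite /cexp /= expR0 cos0 sin0 mulr1 mulr0. Qed.

Lemma cabs_cexp z : cabs (cexp z) = expR (complex.Re z).
Proof.
rewrite /cabs /= !exprMn -mulrDr cos2Dsin2 mulr1 sqrtr_sqr.
by rewrite gtr0_norm // expR_gt0.
Qed.

Lemma cexp_neq0 z : cexp z != 0.
Proof. by rewrite -cabs_gt0 cabs_cexp expR_gt0. Qed.

Lemma cexpN z : cexp (- z) = (cexp z)^-1.
Proof.
apply: (mulfI (cexp_neq0 z)); rewrite -cexpD subrr cexp0 divff //.
exact: cexp_neq0.
Qed.

Lemma cexpB z w : cexp (z - w) = cexp z / cexp w.
Proof. by rewrite cexpD cexpN. Qed.

Lemma cexp_natM n z : cexp (n%:R * z) = cexp z ^+ n.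
Proof.
elim: n => [|n IH]; first by rewrite mul0r cexp0 expr0.
by rewrite -natr1 mulrDl mul1r cexpD IH exprSr.
Qed.

Lemma cexp_real (x : R) : cexp x%:C = (expR x)%:C.
Proof. by rewrite /cexp /= cos0 sin0 mulr1 mulr0. Qed.

Lemma cexp_ipi : cexp ('i * pi%:C) = -1.
Proof.
rewrite /cexp (_ : 'i * pi%:C = 0 +i* pi); last by simpc.
by rewrite /= expR0 cospi sinpi mul1r mulr0; apply: complex_eq; rewrite /= ?oppr0.
Qed.

Lemma cexp_2ipi : cexp (2 * ('i * pi%:C)) = 1.
Proof. by rewrite (cexp_natM 2) cexp_ipi sqrrN expr1n. Qed.

Lemma is_derive_eps (f : R -> R) (x l : R) : is_derive x 1 f l -> forall e, 0 < e ->
  exists2 d, 0 < d & forall h, `|h| < d -> `|f (x + h) - f x - l * h| <= e * `|h|.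
Proof.
move=> [df fl] e e0.
have : (fun h => h^-1 *: ((f \o shift x) (h *: 1) - f x)) @ 0^' --> l.
  by rewrite -fl; exact: df.
move=> /cvgrPdist_le /(_ _ e0); rewrite /dnbhs /within /= => /nbhs_ballP[d d0 H].
exists d => // h hd; have [->|h0] := eqVneq h 0.
  by rewrite addr0 subrr mulr0 subr0 normr0 mulr0.
have := H h; rewrite /ball /= sub0r normrN => /(_ hd h0).
have h1 : 0 < `|h| by rewrite normr_gt0.
rewrite /GRing.scale /= mulr1.
have -> : l - h^-1 * (f (h + x) - f x) = - ((f (x + h) - f x - l * h) / h).
  by rewrite (addrC h); field.
by rewrite normrN normrM normfV ler_pdivrMr.
Qed.

Lemma cderiv_cexp0 : cderiv cexp 0 1.
Proof.
move=> e e0; have [t [t0 t6 t1]] : exists t, [/\ 0 < t, t <= e / 7 & t <= 1 / 2].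
  exists (Num.min (e / 7) (1 / 2)); rewrite !ge_min !lexx orbT lt_min.
  by split=> //; apply/andP; split; lra.
have [d1 d10 H1] := is_derive_eps (is_derive_expR 0) t0.
have [d2 d20 H2] := is_derive_eps (is_derive_cos 0) t0.
have [d3 d30 H3] := is_derive_eps (is_derive_sin 0) t0.
exists (Num.min (Num.min d1 t) (Num.min d2 d3)).
  by rewrite !lt_min d10 d20 d30 t0.
move=> w; rewrite subr0 !lt_min -andbA => /and4P[w1 wt w2 w3].
have ax := cabs_Re w; have ay := cabs_Im w.
have := H1 (complex.Re w) (le_lt_trans ax w1).
have := H2 (complex.Im w) (le_lt_trans ay w2).
have := H3 (complex.Im w) (le_lt_trans ay w3).
rewrite !add0r cos0 sin0 expR0 oppr0 mul0r !mul1r !subr0 addr0 cexp0.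
set x := complex.Re w; set y := complex.Im w => s c E.
have -> : cexp w - 1 - w =
   (expR x - 1 - x + expR x * (cos y - 1)) +i*
   (expR x * (sin y - y) + (expR x - 1) * y).
  apply: complex_eq.
    by rewrite !(cReD, cReN) cRe1 Re_cexp /= -/x -/y; ring.
  by rewrite !(cImD, cImN) cIm1 Im_cexp /= -/x -/y; ring.
apply: le_trans (cabs_ReIm _) _ => /=.
have nx : `|x| <= cabs w by exact: ax.
have ny : `|y| <= cabs w by exact: ay.
have tx : t * `|x| <= 1 / 2 * `|x| by rewrite ler_wpM2r.
have ex : `|expR x - 1| <= 2 * `|x|.
  have -> : expR x - 1 = (expR x - 1 - x) + x by ring.
  by apply: le_trans (ler_normD _ _) _; have := normr_ge0 x; lra.
have ex2 : `|expR x| <= 2.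
  have -> : expR x = (expR x - 1) + 1 by ring.
  by apply: le_trans (ler_normD _ _) _; rewrite normr1; lra.
have b1 : `|expR x * (cos y - 1)| <= 2 * (t * `|y|) by rewrite normrM ler_pM.
have b2 : `|expR x * (sin y - y)| <= 2 * (t * `|y|) by rewrite normrM ler_pM.
have b3 : `|(expR x - 1) * y| <= 2 * t * cabs w.
  by rewrite normrM ler_pM //; lra.
have k1 : t * `|x| <= t * cabs w by rewrite ler_pM2l.
have k2 : t * `|y| <= t * cabs w by rewrite ler_pM2l.
have k3 : 7 * t * cabs w <= e * cabs w by rewrite ler_wpM2r ?cabs_ge0 //; lra.
apply: le_trans (lerD (ler_normD _ _) (ler_normD _ _)) _.
lra.
Qed.

Lemma cderiv_cexp z : cderiv cexp z (cexp z).
Proof.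
have dsub : cderiv (fun w => w - z) z 1.
  by have := cderivB (cderiv_id z) (cderiv_cst z z); rewrite subr0.
have d0 := cderiv_cexp0; rewrite -(subrr z) in d0.
have := cderivZ (cexp z) (cderiv_comp dsub d0); rewrite !mulr1.
by apply: eq_cderiv => w; rewrite -cexpD addrC subrK.
Qed.

Lemma cdiff_cexp z : cdiff cexp z.
Proof. by exists (cexp z); exact: cderiv_cexp. Qed.

Definition e2 z : C := cexp (2 * ('i * pi%:C) * z).

Lemma e2D z w : e2 (z + w) = e2 z * e2 w.
Proof. by rewrite /e2 mulrDr cexpD. Qed.

Lemma e2N z : e2 (- z) = (e2 z)^-1.
Proof. by rewrite /e2 mulrN cexpN. Qed.

Lemma e2_neq0 z : e2 z != 0.
Proof. exact: cexp_neq0. Qed.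

Lemma e2_0 : e2 0 = 1.
Proof. by rewrite /e2 mulr0 cexp0. Qed.

Lemma e2_1 : e2 1 = 1.
Proof. by rewrite /e2 mulr1 cexp_2ipi. Qed.

Lemma e2D1 z : e2 (z + 1) = e2 z.
Proof. by rewrite e2D e2_1 mulr1. Qed.

Lemma e2_natM n z : e2 (n%:R * z) = e2 z ^+ n.
Proof. by rewrite /e2 -cexp_natM; congr cexp; ring. Qed.

Lemma cabs_e2 z : cabs (e2 z) = expR (- (2 * pi * complex.Im z)).
Proof.
rewrite /e2 cabs_cexp (_ : 2 * ('i * pi%:C) = 0 +i* (2 * pi)).
  by congr expR; rewrite cReM /= mul0r sub0r.
by rewrite -realCn; simpc.
Qed.

Lemma cderiv_e2 z : cderiv e2 z (2 * ('i * pi%:C) * e2 z).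
Proof.
have dl : cderiv (fun w => 2 * ('i * pi%:C) * w) z (2 * ('i * pi%:C)).
  by have := cderivZ (2 * ('i * pi%:C)) (cderiv_id z); rewrite mulr1.
by rewrite mulrC; exact: cderiv_comp dl (cderiv_cexp _).
Qed.

Lemma cdiff_e2 z : cdiff e2 z.
Proof. by eexists; exact: cderiv_e2. Qed.

End ComplexExp.

Section Goursat.
Variable R : realType.
Local Notation C := R[i].
Implicit Types (f g : C -> C).

Lemma nested_dyadic (a : nat -> R) (w : R) : 0 <= w ->
  (forall n, a n <= a n.+1 <= a n + w / 2 ^+ n.+1) ->
  exists X, forall n, a n <= X <= a n + w / 2 ^+ n.
Proof.
move=> w0 H.
have mono m n : (m <= n)%N -> a m <= a n.
  move=> /subnK <-; elim: (n - m)%N => [|k IH]; first by rewrite add0n.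
  by rewrite addSn (le_trans IH) //; case/andP: (H (k + m)%N).
have anti m n : (m <= n)%N -> a n + w / 2 ^+ n <= a m + w / 2 ^+ m.
  move=> /subnK <-; elim: (n - m)%N => [|k IH]; first by rewrite add0n.
  rewrite addSn (le_trans _ IH) //; case/andP: (H (k + m)%N) => _ h.
  have E : w / 2 ^+ (k + m) = 2 * (w / 2 ^+ (k + m).+1).
    by rewrite exprS; field; rewrite expf_neq0 // pnatr_eq0.
  by rewrite E; lra.
have wn n : 0 <= w / 2 ^+ n by rewrite divr_ge0 // exprn_ge0.
have ub n : ubound (range a) (a n + w / 2 ^+ n).
  move=> _ [m _ <-]; have [mn|nm] := leqP m n.
    by rewrite (le_trans (mono _ _ mn)) // lerDl.
  have := anti _ _ (ltnW nm); apply: le_trans.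
  by rewrite lerDl.
have hs : has_sup (range a).
  by split; [exists (a 0%N); exists 0%N|exists (a 0%N + w / 2 ^+ 0)].
exists (sup (range a)) => n; apply/andP; split.
  by apply: ub_le_sup; [case: hs|exists n].
by apply: ge_sup; [case: hs|exact: ub].
Qed.

Lemma goursat f x1 x2 y1 y2 : gcont f -> x1 <= x2 -> y1 <= y2 ->
  (forall x y, x1 <= x <= x2 -> y1 <= y <= y2 -> cdiff f (x +i* y)) ->
  J f x1 x2 y1 y2 = 0.
Proof.
move=> cf x12 y12 df.
pose w := x2 - x1; pose h := y2 - y1.
have w0 : 0 <= w by rewrite subr_ge0.
have h0 : 0 <= h by rewrite subr_ge0.
pose Q n (p : R * R) := cabs (J f p.1 (p.1 + w / 2 ^+ n) p.2 (p.2 + h / 2 ^+ n)).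
pose step n (p : R * R) := [set q : R * R |
  [/\ q.1 = p.1 \/ q.1 = p.1 + w / 2 ^+ n.+1,
      q.2 = p.2 \/ q.2 = p.2 + h / 2 ^+ n.+1 & Q n p <= 4 * Q n.+1 q]].
have half (x : R) n : x / 2 ^+ n = x / 2 ^+ n.+1 + x / 2 ^+ n.+1.
  by rewrite exprS; field; rewrite expf_neq0 // pnatr_eq0.
have stepP n p : exists q, step n p q.
  apply: contrapT => /forallNP N.
  have F q : (q.1 = p.1 \/ q.1 = p.1 + w / 2 ^+ n.+1) ->
      (q.2 = p.2 \/ q.2 = p.2 + h / 2 ^+ n.+1) -> 4 * Q n.+1 q < Q n p.
    by move=> a b; rewrite ltNge; apply/negP => c; apply: (N q).
  have F1 := F (p.1, p.2) (or_introl erefl) (or_introl erefl).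
  have F2 := F (p.1 + w / 2 ^+ n.+1, p.2) (or_intror erefl) (or_introl erefl).
  have F3 := F (p.1, p.2 + h / 2 ^+ n.+1) (or_introl erefl) (or_intror erefl).
  have F4 := F (p.1 + w / 2 ^+ n.+1, p.2 + h / 2 ^+ n.+1) (or_intror erefl) (or_intror erefl).
  move: F1 F2 F3 F4; rewrite /Q /=.
  rewrite (half w n) (half h n) !addrA.
  set a := p.1; set b := p.2; set u := w / _; set v := h / _.
  rewrite -(J_vcat f a (a + u + u) b (b + v) (b + v + v)).
  rewrite -(J_hcat _ a (a + u) (a + u + u) b) -(J_hcat _ a (a + u) (a + u + u) (b + v)).
  set A := J _ _ _ _ _; set B := J _ _ _ _ _; set D := J _ _ _ _ _; set E := J _ _ _ _ _.
  have := cabsD (A + B) (D + E); have := cabsD A B; have := cabsD D E.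
  lra.
pose fix corner n := if n is m.+1 then xget (0, 0) (step m (corner m)) else (x1, y1).
have cornerP n : step n (corner n) (corner n.+1).
  by have [q /xgetI] := stepP n (corner n); exact.
have Qn n : Q 0%N (x1, y1) <= 4 ^+ n * Q n (corner n).
  elim: n => [|n IH]; first by rewrite mul1r.
  have [_ _ s] := cornerP n.
  apply: (le_trans IH); rewrite exprSr -mulrA ler_wpM2l ?exprn_ge0 //.
have wn n : 0 <= w / 2 ^+ n by rewrite divr_ge0 // exprn_ge0.
have hn n : 0 <= h / 2 ^+ n by rewrite divr_ge0 // exprn_ge0.
have [X HX] : exists X, forall n, (corner n).1 <= X <= (corner n).1 + w / 2 ^+ n.
  apply: nested_dyadic => // n; have [[->|->] _ _] := cornerP n.
    by rewrite lexx lerDl wn.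
  by rewrite lexx lerDl wn.
have [Y HY] : exists Y, forall n, (corner n).2 <= Y <= (corner n).2 + h / 2 ^+ n.
  apply: nested_dyadic => // n; have [_ [->|->] _] := cornerP n.
    by rewrite lexx lerDl hn.
  by rewrite lexx lerDl hn.
have QE : Q 0%N (x1, y1) = cabs (J f x1 x2 y1 y2).
  by rewrite /Q /= expr0 !divr1 /w /h ![_ + (_ - _)]addrC !subrK.
have [l dl] : cdiff f (X +i* Y).
  apply: df; [have := HX 0%N|have := HY 0%N].
    by rewrite /= expr0 divr1 /w [_ + (_ - _)]addrC subrK.
  by rewrite /= expr0 divr1 /h [_ + (_ - _)]addrC subrK.
apply/eqP; rewrite -cabs_eq0 eq_le cabs_ge0 andbT -QE.
apply/ler_addgt0Pr => e e0; rewrite add0r.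
pose K := 2 * (w + h) ^+ 2 + 1.
have K0 : 0 < K by rewrite ltr_wpDl // mulr_ge0 ?sqr_ge0.
have eK : 0 < e / K by rewrite divr_gt0.
have [d d0 Hd] := dl _ eK.
have [n nd] : exists n, (w + h) / 2 ^+ n < d.
  have wh : 0 <= (w + h) / d by apply: divr_ge0; [exact: addr_ge0|exact: ltW].
  have [n nP] : exists n : nat, (w + h) / d < n%:R.
    by exists (Num.bound ((w + h) / d)); rewrite archi_boundP.
  exists n; rewrite ltr_pdivrMr ?exprn_gt0 // -ltr_pdivrMl // mulrC.
  by rewrite (lt_le_trans nP) // -natrX ler_nat ltnW // ltn_expl.
have := Qn n; set p := corner n => Qp; apply: (le_trans Qp).
pose E z := f z - (f (X +i* Y) - l * (X +i* Y) + l * z).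
have cA : gcont (fun z => f (X +i* Y) - l * (X +i* Y) + l * z).
  move=> z; apply: ccontD; first exact: ccont_cst.
  by apply: ccontM; [exact: ccont_cst|exact: ccont_id].
have cE : gcont E by move=> z; apply: ccontB; [exact: cf|exact: cA].
have -> : Q n p = cabs (J E p.1 (p.1 + w / 2 ^+ n) p.2 (p.2 + h / 2 ^+ n)).
  by rewrite JB // J_affine subr0.
have EM x y : p.1 <= x <= p.1 + w / 2 ^+ n -> p.2 <= y <= p.2 + h / 2 ^+ n ->
    cabs (E (x +i* y)) <= e / K * ((w + h) / 2 ^+ n).
  move=> px py.
  have az : cabs ((x +i* y) - (X +i* Y)) <= (w + h) / 2 ^+ n.
    apply: le_trans (cabs_ReIm _) _; rewrite /= mulrDl.
    have := HX n; have := HY n; rewrite -/p => q1 q2.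
    by apply: lerD; rewrite ler_norml; apply/andP; split; lra.
  have -> : E (x +i* y) = f (x +i* y) - f (X +i* Y) - l * ((x +i* y) - (X +i* Y)).
    by rewrite /E; ring.
  apply: le_trans (Hd _ (le_lt_trans az nd)) _.
  by rewrite ler_wpM2l // ltW.
have px : p.1 <= p.1 + w / 2 ^+ n by rewrite lerDl.
have py : p.2 <= p.2 + h / 2 ^+ n by rewrite lerDl.
have := J_bound cE px py EM.
have -> : p.1 + w / 2 ^+ n - p.1 = w / 2 ^+ n by ring.
have -> : p.2 + h / 2 ^+ n - p.2 = h / 2 ^+ n by ring.
move=> JE.
have P4 : (4 : R) ^+ n = 2 ^+ n * 2 ^+ n by rewrite -exprMn; congr (_ ^+ _); lra.
apply: le_trans (ler_wpM2l _ JE) _; first exact: exprn_ge0.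
have -> : 4 ^+ n * (2 * (e / K * ((w + h) / 2 ^+ n)) * (w / 2 ^+ n + h / 2 ^+ n))
   = e / K * (2 * (w + h) ^+ 2).
  by rewrite P4; field; rewrite expf_neq0 ?pnatr_eq0 // gt_eqF.
rewrite -[leRHS](divfK (lt0r_neq0 K0)) ler_wpM2l ?ltW //.
by rewrite /K ltrDl.
Qed.

End Goursat.

Section Strip.
Variable R : realType.
Local Notation C := R[i].
Implicit Types (f g : C -> C).

Lemma goursat_except f x1 x2 y1 y2 px py : gcont f ->
  x1 < px < x2 -> y1 < py < y2 ->
  (forall x y, x1 <= x <= x2 -> y1 <= y <= y2 -> x +i* y != px +i* py ->
    cdiff f (x +i* y)) ->
  J f x1 x2 y1 y2 = 0.
Proof.
move=> cf /andP[px1 px2] /andP[py1 py2] df.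
apply/eqP; rewrite -cabs_eq0 eq_le cabs_ge0 andbT.
apply/ler_addgt0Pr => e e0; rewrite add0r.
have [d0 d00 Hd] := ccont_loc_bound (cf (px +i* py)).
set M := cabs (f (px +i* py)) + 1 in Hd.
have M0 : 0 < M by rewrite ltr_wpDl ?cabs_ge0.
have [d [d_gt0 dd dM d1 [d2 d3 d4]]] : exists d, [/\ 0 < d, 2 * d < d0, 8 * M * d <= e,
    x1 < px - d & [/\ px + d < x2, y1 < py - d & py + d < y2]].
  exists (Num.min (Num.min (d0 / 4) (e / (8 * M)))
    (Num.min (Num.min ((px - x1) / 2) ((x2 - px) / 2))
             (Num.min ((py - y1) / 2) ((y2 - py) / 2)))).
  set d := Num.min _ _.
  have : d <= d by [].
  rewrite {2}/d !le_min => /andP[/andP[a1 a2] /andP[/andP[a3 a4] /andP[a5 a6]]].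
  split; [|lra| |lra|split; lra].
    rewrite /d !lt_min !divr_gt0 //= ?mulr_gt0 //; lra.
  by rewrite mulrC -ler_pdivlMr // mulr_gt0.
rewrite -(J_hcat _ _ (px - d)) -(J_hcat _ (px - d) (px + d)).
have -> : J f x1 (px - d) y1 y2 = 0.
  apply: goursat => //; [lra|lra|move=> x y xx yy]; apply: df; [lra|lra|].
  by apply/eqP => -[xp _]; move: xx; rewrite xp; lra.
have -> : J f (px + d) x2 y1 y2 = 0.
  apply: goursat => //; [lra|lra|move=> x y xx yy]; apply: df; [lra|lra|].
  by apply/eqP => -[xp _]; move: xx; rewrite xp; lra.
rewrite -(J_vcat _ _ _ _ (py - d)) -(J_vcat _ _ _ (py - d) (py + d)).
have -> : J f (px - d) (px + d) y1 (py - d) = 0.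
  apply: goursat => //; [lra|lra|move=> x y xx yy]; apply: df; [lra|lra|].
  by apply/eqP => -[_ yp]; move: yy; rewrite yp; lra.
have -> : J f (px - d) (px + d) (py + d) y2 = 0.
  apply: goursat => //; [lra|lra|move=> x y xx yy]; apply: df; [lra|lra|].
  by apply/eqP => -[_ yp]; move: yy; rewrite yp; lra.
rewrite !add0r !addr0; apply: le_trans dM.
have -> : 8 * M * d = 2 * M * (px + d - (px - d) + (py + d - (py - d))) by ring.
apply: J_bound => //; [lra|lra|move=> x y xx yy].
apply/ltW/Hd; apply: le_lt_trans (cabs_ReIm _) _ => /=.
apply: le_lt_trans dd; have -> : 2 * d = d + d by ring.
by apply: lerD; rewrite ler_norml; lra.
Qed.

Definition clampy (u v : R) (z : C) : C :=
  complex.Re z +i* Num.min v (Num.max u (complex.Im z)).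

Lemma clamp_lip (u v s t : R) :
  `|Num.min v (Num.max u s) - Num.min v (Num.max u t)| <= `|s - t|.
Proof.
have H (a b : R) : a <= b -> 0 <= Num.min v (Num.max u b) - Num.min v (Num.max u a) <= b - a.
  move=> ab; have hx : 0 <= Num.max u b - Num.max u a <= b - a.
    by rewrite /Num.max; do 2! [case: ltP => ?]; lra.
  move: (Num.max u b) (Num.max u a) hx => B A hx.
  by rewrite /Num.min; do 2! [case: ltP => ?]; lra.
have [/H|/ltW/H] := leP s t => h; rewrite ler_norml;
  have := ler_norm (s - t); have := ler_norm (t - s); rewrite (distrC t s); lra.
Qed.

Lemma ccont_clampy u v z : ccont (clampy u v) z.
Proof.
move=> e e0; exists (e / 2); first lra.
move=> w wz; apply: le_lt_trans (cabs_ReIm _) _.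
rewrite cReD cReN cImD cImN /=.
have a : `|complex.Re w - complex.Re z| <= cabs (w - z) by rewrite -cReN -cReD cabs_Re.
have b : `|complex.Im w - complex.Im z| <= cabs (w - z) by rewrite -cImN -cImD cabs_Im.
have := clamp_lip u v (complex.Im w) (complex.Im z); lra.
Qed.

Lemma clampy_id u v z : u <= complex.Im z <= v -> clampy u v z = z.
Proof.
case: z => a b /= /andP[ub bv]; rewrite /clampy /=; congr Complex.
by rewrite max_r // min_r.
Qed.

Lemma clampy_Im u v z : u <= v -> u <= complex.Im (clampy u v z) <= v.
Proof.
move=> uv; rewrite /clampy /= ge_min lexx /= andbT.
by rewrite le_min uv le_max lexx.
Qed.

Lemma strip_int_const g (ys ye u v a px py : R) : ys < u -> u < v -> v < ye ->
  a < px < a + 1 -> u < py < v ->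
  (forall z, ys < complex.Im z < ye -> ccont g z) ->
  (forall z, ys < complex.Im z < ye -> g (z + 1) = g z) ->
  (forall x y, a <= x <= a + 1 -> u <= y <= v -> x +i* y != px +i* py ->
    cdiff g (x +i* y)) ->
  CI (fun t => g (t +i* u)) a (a + 1) = CI (fun t => g (t +i* v)) a (a + 1).
Proof.
move=> ysu uv vye pxa pyu cg per dg.
pose u' := (ys + u) / 2; pose v' := (v + ye) / 2.
have u'v' : u' <= v' by rewrite /u' /v'; lra.
pose f z := g (clampy u' v' z).
have cf : gcont f.
  move=> z; apply: ccont_comp; first exact: ccont_clampy.
  by apply: cg; have := clampy_Im z u'v'; rewrite /u' /v'; lra.
have fE z : u' <= complex.Im z <= v' -> f z = g z by move=> h; rewrite /f clampy_id.
have aa : a < px < a + 1 by [].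
have J0 : J f a (a + 1) u v = 0.
  apply: (goursat_except cf aa pyu) => x y xx yy ne.
  have [d [d0 d1 d2]] : exists d, [/\ 0 < d, d <= (u - ys) / 2 & d <= (ye - v) / 2].
    exists (Num.min ((u - ys) / 2) ((ye - v) / 2)); rewrite lt_min !ge_min !lexx orbT.
    by split=> //; apply/andP; split; lra.
  apply: (cdiff_near d0 _ (dg _ _ xx yy ne)) => w wd; rewrite fE //.
  have := le_lt_trans (cabs_Im _) wd; rewrite cImD cImN /= ltr_norml.
  rewrite /u' /v'; lra.
have fper z : f (z + 1) = f z.
  rewrite /f /clampy cReD cImD cRe1 cIm1 addr0 -[RHS]per.
    by congr g; apply: complex_eq; rewrite /= ?addr0.
  by have := clampy_Im z u'v'; rewrite /clampy /u' /v' /=; lra.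
have fu y : u <= y <= v -> CI (fun t => g (t +i* y)) a (a + 1) = CI (fun t => f (t +i* y)) a (a + 1).
  move=> yy; apply: eq_CI => t; rewrite fE //= /u' /v'; lra.
rewrite !fu; [|lra|lra].
have vper t : f ((a + 1) +i* t) = f (a +i* t).
  by rewrite -[RHS]fper; congr f; apply: complex_eq; rewrite /= ?addr0.
move: J0; rewrite /J (eq_CI u v vper) subrr mulr0 addr0 => /eqP.
by rewrite subr_eq0 => /eqP.
Qed.

End Strip.

(** * Periodic holomorphic functions on a half-plane *)

Section StripTheorem.
Variable R : realType.
Local Notation C := R[i].
Implicit Types (f g : C -> C) (z w : C).

Lemma cabs_small z : (forall e : R, 0 < e -> cabs z <= e) -> z = 0.
Proof.
move=> H; apply/eqP; rewrite -cabs_eq0 eq_le cabs_ge0 andbT.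
by apply/ler_addgt0Pr => e e0; rewrite add0r H.
Qed.

Lemma expR_large (B : R) : exists Y, forall y, Y <= y -> B <= expR (2 * pi * y).
Proof.
exists (Num.max 0 B) => y; rewrite ge_max => /andP[y0 By].
have := expR_ge1Dx (2 * pi * y); apply: le_trans.
have : y <= 2 * pi * y.
  rewrite -{1}[y]mul1r ler_wpM2r //; have := @pi_ge2 R; lra.
lra.
Qed.

Lemma cos_sin_surj (x y : R) : x ^+ 2 + y ^+ 2 = 1 -> exists t, cos t = x /\ sin t = y.
Proof.
move=> xy.
have x1 : x ^+ 2 <= 1 by rewrite -xy lerDl sqr_ge0.
have x2 : -1 <= x <= 1 by rewrite -ler_norml -(ler_pXn2r (n := 2)) ?nnegrE // expr1n real_normK ?num_real.
have sy : Num.sqrt (1 - x ^+ 2) = `|y|.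
  by rewrite -xy [x ^+ 2 + _]addrC addrK sqrtr_sqr.
have cx : cos (acos x) = x by rewrite acosK // in_itv.
have [y0|y0] := leP 0 y.
  by exists (acos x); rewrite cx sin_acos // sy ger0_norm.
by exists (- acos x); rewrite cosN cx sinN sin_acos // sy ltr0_norm // opprK.
Qed.

Lemma e2E z : e2 z = (expR (- (2 * pi * complex.Im z)) * cos (2 * pi * complex.Re z)) +i*
  (expR (- (2 * pi * complex.Im z)) * sin (2 * pi * complex.Re z)).
Proof.
rewrite /e2 (_ : 2 * ('i * pi%:C) = 0 +i* (2 * pi)); last by rewrite -realCn; simpc.
by rewrite /cexp cReM cImM /= !mul0r sub0r add0r.
Qed.

Lemma e2_surj w : w != 0 -> exists z, e2 z = w.
Proof.
move=> w0; have aw : 0 < cabs w by rewrite cabs_gt0.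
have pi0 : 2 * pi != 0 :> R by rewrite mulf_neq0 // ?pnatr_eq0 // gt_eqF // pi_gt0.
have [t [ct st]] : exists t, cos t = complex.Re w / cabs w /\ sin t = complex.Im w / cabs w.
  apply: cos_sin_surj; rewrite !exprMn -mulrDl -cabs_sqr exprVn divff //.
  by rewrite expf_neq0 // gt_eqF.
have [s es] := expR_total aw.
exists ((t / (2 * pi)) +i* (- s / (2 * pi))).
rewrite e2E /= ![2 * pi * (_ / _)]mulrC !divfK // opprK es ct st.
by apply: complex_eq => /=; rewrite mulrC divfK // gt_eqF.
Qed.

Lemma cos_eq1 (x : R) : cos (2 * pi * x) = 1 -> exists n : int, x = n%:~R.
Proof.
move=> cx; exists (Num.floor x).
pose r := x - (Num.floor x)%:~R.
have r0 : 0 <= r < 1.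
  have := floor_le x; have := floorD1_gt x; rewrite intrD /r; lra.
have pi0 := @pi_gt0 R.
have cr : cos (2 * pi * r) = 1.
  have cper n (t : R) : cos (t + 2 * pi * n%:R) = cos t.
    rewrite (_ : 2 * pi * n%:R = (pi *+ 2) *+ n); last by rewrite mulr_natr mulr_natl.
    exact: (periodicn (@cosD2pi R)).
  have E : 2 * pi * r = 2 * pi * x - 2 * pi * (Num.floor x)%:~R by rewrite /r; ring.
  case: (intP (Num.floor x)) E => [|n|n] E; rewrite E.
  - by rewrite mulr0 subr0.
  - by rewrite -(cper n.+1) subrK.
  - by rewrite mulrNz mulrN opprK cper.
suff : r = 0 by rewrite /r => /eqP; rewrite subr_eq0 => /eqP.
have inj (s : R) : 0 <= s <= pi -> cos s = 1 -> s = 0.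
  move=> s0 cs; apply: (@cos_inj R); rewrite ?in_itv /= ?lexx ?pi_ge0 // ?cs ?cos0 //.
have [h|h] := leP (2 * pi * r) pi.
  have /inj -/(_ cr)/eqP : 0 <= 2 * pi * r <= pi.
    case/andP: r0 => r0 r1; rewrite h andbT; apply: mulr_ge0 => //.
    by apply: mulr_ge0 => //; exact: ltW.
  by rewrite mulf_eq0 mulf_eq0 pnatr_eq0 (gt_eqF pi0) /= => /eqP.
have c2 : cos (2 * pi * (1 - r)) = 1.
  rewrite mulrBr mulr1 (_ : 2 * pi - _ = - (2 * pi * r) + pi *+ 2); last by rewrite mulr2n; ring.
  by rewrite cosD2pi cosN.
have /inj -/(_ c2)/eqP : 0 <= 2 * pi * (1 - r) <= pi.
  apply/andP; split; last lra.
  case/andP: r0 => r0 r1; apply: mulr_ge0; last by rewrite subr_ge0 ltW.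
  by apply: mulr_ge0 => //; exact: ltW.
rewrite mulf_eq0 mulf_eq0 pnatr_eq0 (gt_eqF pi0) /= => /eqP; lra.
Qed.

Lemma e2_eq1 z : e2 z = 1 -> exists n : int, z = n%:~R.
Proof.
move=> ez; have Im0 : complex.Im z = 0.
  have := cabs_e2 z; rewrite ez cabs1 -{1}(@expR0 R) => /expR_inj/eqP.
  rewrite eq_sym oppr_eq0 !mulf_eq0 pnatr_eq0 (gt_eqF (@pi_gt0 R)) /=.
  by move/eqP.
have : cos (2 * pi * complex.Re z) = 1.
  by have := congr1 (@complex.Re R) ez; rewrite e2E /= Im0 mulr0 oppr0 expR0 mul1r.
move=> /cos_eq1[n nz]; exists n.
by rewrite -(rmorph_int (real_complex R)) -nz; apply: complex_eq.
Qed.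

Lemma periodic_int g ys z (n : int) :
  (forall z, ys < complex.Im z -> g (z + 1) = g z) ->
  ys < complex.Im z -> g (z + n%:~R) = g z.
Proof.
move=> per yz.
have pn k w : ys < complex.Im w -> g (w + k%:R) = g w.
  move=> yw; elim: k => [|k IH]; first by rewrite addr0.
  rewrite -natr1 addrA per //.
  by rewrite cImD cImn addr0.
case: (intP n) => [|k|k]; first by rewrite addr0.
- exact: pn.
- have := pn k.+1 (z - k.+1%:R); rewrite subrK mulrNz => <- //.
  by rewrite cImD cImN cImn subr0.
Qed.

Lemma kernel_period z1 y : y < complex.Im z1 ->
  CI (fun t => (1 - e2 (z1 - (t +i* y)))^-1) (complex.Re z1 - 1/2) (complex.Re z1 - 1/2 + 1) = 1.
Proof.
move=> yz; set a := complex.Re z1 - 1/2.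
pose K w := (1 - e2 (z1 - w))^-1.
have K0 w : complex.Im w < complex.Im z1 -> 1 - e2 (z1 - w) != 0.
  move=> h; rewrite subr_eq0; apply/eqP => E.
  have := cabs_e2 (z1 - w); rewrite -E cabs1 -{1}(@expR0 R) => /expR_inj.
  rewrite cImD cImN => /esym/eqP; rewrite oppr_eq0 !mulf_eq0 pnatr_eq0.
  rewrite (gt_eqF (@pi_gt0 R)) /= subr_eq0 => /eqP E2; move: h; rewrite E2 ltxx //.
have dK w : complex.Im w < complex.Im z1 -> cdiff K w.
  move=> h; apply: cdiffV; first exact: K0.
  apply: cdiffB; first exact: cdiff_cst.
  apply: (@cdiff_comp _ (fun w => z1 - w) (@e2 R)); last exact: cdiff_e2.
  by apply: cdiffB; [exact: cdiff_cst|exact: cdiff_id].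
have Kper w : K (w + 1) = K w.
  by rewrite /K -[e2 (z1 - w)]e2D1; congr (1 - _)^-1; rewrite -e2D1 opprD addrA subrK e2D1.
have step y' : y' < y -> CI (fun t => K (t +i* y')) a (a + 1) = CI (fun t => K (t +i* y)) a (a + 1).
  move=> yy; apply: (@strip_int_const R K (y' - 1) (complex.Im z1) y' y a (complex.Re z1) ((y + y') / 2)) => //.
  - lra.
  - by rewrite /a; lra.
  - lra.
  - by move=> w /andP[_ w1]; apply: cdiff_cont; exact: dK.
  - by move=> x s _ sy _; apply: dK => /=; lra.
apply/eqP; rewrite -subr_eq0; apply/eqP/cabs_small => e e0.
have [Y HY] := expR_large (1 + e^-1).
pose y' := Num.min (y - 1) (complex.Im z1 - Y).
have y'1 : y' <= y - 1 by rewrite ge_min lexx.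
have y'2 : y' <= complex.Im z1 - Y by rewrite ge_min lexx orbT.
rewrite -(step y'); last lra.
have rK : rcont (fun t => K (t +i* y')).
  apply: rcont_ccont; first exact: rcont_hline.
  by move=> t; apply: cdiff_cont; apply: dK => /=; lra.
have -> : CI (fun t => K (t +i* y')) a (a + 1) - 1 = CI (fun t => K (t +i* y') - 1) a (a + 1).
  rewrite CIB //; last exact: rcont_cst.
  by rewrite CI_cst mul1r (_ : a + 1 - a = 1) //; ring.
have aa : a <= a + 1 by rewrite lerDl.
have -> : e = e * (a + 1 - a) by ring.
apply: CI_bound => // [|t _].
  by apply: rcontD => //; exact: rcont_cst.
have tz : complex.Im (t +i* y') < complex.Im z1 by rewrite /=; lra.
have -> : K (t +i* y') - 1 = - (1 - e2 (- (z1 - (t +i* y'))))^-1.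
  have := K0 _ tz; rewrite /K e2N; set E := e2 _ => E0.
  have E0' : E != 0 by exact: e2_neq0.
  by field; rewrite E0' E0 subr_eq0 -subr_eq0 -opprB oppr_eq0 E0.
rewrite cabsN cabsV -[leRHS]invrK lef_pV2 ?posrE ?invr_gt0 //; last first.
  rewrite cabs_gt0 e2N; have := K0 _ tz; set E := e2 _ => E0.
  have E0' : E != 0 by exact: e2_neq0.
  by apply: contraNneq E0 => /eqP; rewrite subr_eq0 -(inj_eq invr_inj) invr1 invrK => /eqP ->; rewrite subrr.
have /HY h : Y <= complex.Im z1 - y' by lra.
have := cabs_sub_ge (e2 (- (z1 - (t +i* y')))) 1.
rewrite cabs_sym cabs1 cabs_e2 cImN cImD cImN /= mulrN opprK; lra.
Qed.

(* Fourier expansion in the strip: [g] is its constant term up to an error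
   estimated by Cauchy's formula with the kernel 1 / (1 - e2 (w - z)). *)
Lemma strip g ys :
  (forall z, ys < complex.Im z -> cdiff g z) ->
  (forall z, ys < complex.Im z -> g (z + 1) = g z) ->
  (forall e, 0 < e -> exists Y, forall z, Y < complex.Im z ->
     cabs (g z) <= e * expR (2 * pi * complex.Im z)) ->
  exists c, (forall y0, ys < y0 -> CI (fun t => g (t +i* y0)) 0 1 = c) /\
    forall y0 (M : R) z, ys < y0 -> (forall t, cabs (g (t +i* y0)) <= M) ->
      y0 < complex.Im z ->
      let r := expR (- (2 * pi * (complex.Im z - y0))) in
      cabs (g z - c) <= M * (r / (1 - r)).
Proof.
move=> dg per growth.
have cg z : ys < complex.Im z -> ccont g z by move=> h; exact: cdiff_cont (dg _ h).
have rg y : ys < y -> rcont (fun t => g (t +i* y)).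
  by move=> yy; apply: rcont_ccont (rcont_hline y) _ => t; exact: cg.
have rper y t : ys < y -> g ((t + 1) +i* y) = g (t +i* y).
  by move=> yy; rewrite -[RHS]per //; congr g; apply: complex_eq; rewrite /= ?addr0.
have Ishift y a : ys < y ->
    CI (fun t => g (t +i* y)) a (a + 1) = CI (fun t => g (t +i* y)) 0 1.
  move=> yy; rewrite (CI_period a 0 (rg _ yy)) ?add0r // => t; exact: rper.
have Iconst u v : ys < u -> u < v ->
    CI (fun t => g (t +i* u)) 0 1 = CI (fun t => g (t +i* v)) 0 1.
  move=> yu uv; rewrite -[1]add0r.
  apply: (@strip_int_const R g ys (v + 1) u v 0 (1/2) ((u + v) / 2)) => //; try lra.
  - by move=> z /andP[h _]; exact: cg.
  - by move=> z /andP[h _]; exact: per.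
  - by move=> x y _ yy _; apply: dg => /=; lra.
exists (CI (fun t => g (t +i* (ys + 1))) 0 1); split.
  move=> y0 yy; have [h|h|->//] := ltgtP y0 (ys + 1); first exact: Iconst.
  by symmetry; apply: Iconst => //; lra.
move=> y0 M z1 yy0 gM y01 /=; set r := expR _.
have -> : CI (fun t => g (t +i* (ys + 1))) 0 1 = CI (fun t => g (t +i* y0)) 0 1.
  have [h|h|->//] := ltgtP y0 (ys + 1); last by apply: Iconst => //; lra.
  by symmetry; exact: Iconst.
have yz1 : ys < complex.Im z1 by lra.
set a := complex.Re z1 - 1/2; set x1 := complex.Re z1; set y1 := complex.Im z1.
have z1E : z1 = x1 +i* y1 by exact: complex_eq.
have [g' dg'] := dg _ yz1.
have pi0 := @pi_gt0 R.
pose k : C := 2 * ('i * pi%:C).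
have k0 : k != 0.
  by rewrite -cabs_gt0 !cabsM cabs_i cabs_real cabs_nat mul1r gtr0_norm // mulr_gt0.
pose phi w := if e2 w == e2 z1 then g' / k else (g w - g z1) / (1 - e2 (z1 - w)).
have den w : (1 - e2 (z1 - w) == 0) = (e2 w == e2 z1).
  rewrite e2D e2N subr_eq0 eq_sym -(inj_eq (mulIf (e2_neq0 w))) mul1r.
  by rewrite divfK ?e2_neq0 // eq_sym.
have e2per w : e2 (w + 1) = e2 w by exact: e2D1.
have phiper w : ys < complex.Im w -> phi (w + 1) = phi w.
  move=> h; rewrite /phi e2per per //; case: ifP => // _; congr (_ / (1 - _)).
  by rewrite -e2D1 opprD addrA subrK.
have phid w : ys < complex.Im w -> e2 w != e2 z1 -> cdiff phi w.
  move=> h ne.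
  have c1 : ccont (fun w => e2 w - e2 z1) w.
    by apply: ccontB; [apply: cdiff_cont; exact: cdiff_e2|exact: ccont_cst].
  have e0 : 0 < cabs (e2 w - e2 z1) by rewrite cabs_gt0 subr_eq0.
  have [d d0 Hd] := c1 _ e0.
  apply: (cdiff_near (f := fun w => (g w - g z1) / (1 - e2 (z1 - w))) d0).
    move=> w' /Hd h'; rewrite /phi; case: eqP => // E.
    by move: h'; rewrite E subrr sub0r cabsN ltxx.
  apply: cdiffM; first by apply: cdiffB; [exact: dg|exact: cdiff_cst].
  apply: cdiffV; first by rewrite den.
  apply: cdiffB; first exact: cdiff_cst.
  apply: (@cdiff_comp _ (fun w => z1 - w) (@e2 R)); last exact: cdiff_e2.
  by apply: cdiffB; [exact: cdiff_cst|exact: cdiff_id].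
have phic1 : ccont phi z1.
  have [p [gE cp pz]] := (cderivP _ _ _).1 dg'.
  have dK : cderiv (fun w => 1 - e2 (z1 - w)) z1 k.
    have d1 : cderiv (fun w => z1 - w) z1 (-1).
      by have := cderivB (cderiv_cst z1 z1) (cderiv_id z1); rewrite sub0r.
    have := cderivB (cderiv_cst 1 z1) (cderiv_comp d1 (cderiv_e2 _)).
    by rewrite subrr e2_0 mulr1 mulrN1 sub0r opprK.
  have [q [KE cq qz]] := (cderivP _ _ _).1 dK.
  have aq : 0 < cabs k by rewrite cabs_gt0.
  have [d d0 Hd] := cq _ aq.
  have qn0 w : cabs (w - z1) < d -> q w != 0.
    by move=> /Hd h; apply/eqP => E; move: h; rewrite E sub0r cabsN qz ltxx.
  apply: (ccont_near (f := fun w => p w / q w) d0).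
    move=> w wd; rewrite /phi -den KE subrr e2_0 subrr add0r mulf_eq0 (negPf (qn0 _ wd)) /=.
    rewrite subr_eq0; case: eqP => [->|/eqP ne]; first by rewrite pz qz.
    rewrite gE addrC addKr invfM mulrACA divff ?mulr1 // subr_eq0 //.
  apply: ccontM => //; apply: ccontV => //; by rewrite qz.
have phic w : ys < complex.Im w -> ccont phi w.
  move=> h; have [E|ne] := eqVneq (e2 w) (e2 z1); last by apply: cdiff_cont; exact: phid.
  have [n wE] : exists n : int, w = z1 + n%:~R.
    have [n nE] : exists n : int, w - z1 = n%:~R.
      by apply: e2_eq1; rewrite e2D e2N E divff // e2_neq0.
    by exists n; rewrite -nE addrC subrK.
  have d0 : 0 < complex.Im w - ys by lra.
  apply: (ccont_near (f := fun w => phi (w - n%:~R)) d0).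
    move=> w' hw'; have hI : ys < complex.Im w'.
      have := le_lt_trans (cabs_Im _) hw'; rewrite cImD cImN ltr_norml; lra.
    by rewrite -mulrNz (periodic_int _ phiper).
  apply: ccont_comp; first by apply: ccontB; [exact: ccont_id|exact: ccont_cst].
  by rewrite wE addrK.
have aint : a < x1 < a + 1 by rewrite /a; lra.
have Iphi y2 : y1 < y2 ->
    CI (fun t => phi (t +i* y0)) a (a + 1) = CI (fun t => phi (t +i* y2)) a (a + 1).
  move=> y12.
  apply: (@strip_int_const R phi ys (y2 + 1) y0 y2 a x1 y1) => //; try (rewrite /y1; lra).
  - by move=> w /andP[h _]; exact: phic.
  - by move=> w /andP[h _]; exact: phiper.
  move=> x y xx yy ne; apply: phid; first by rewrite /=; lra.
  apply: contra ne => /eqP E; apply/eqP.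
  have [n nE] : exists n : int, (x +i* y) - z1 = n%:~R.
    by apply: e2_eq1; rewrite e2D e2N E divff // e2_neq0.
  move: nE; rewrite -(rmorph_int (real_complex R)) z1E => -[n1 n2].
  have n0 : n = 0.
    have : `|n%:~R| < 1 :> R by rewrite -n1 ltr_norml; move: xx; rewrite /a -/x1; lra.
    by rewrite -intr_norm -[1]/(1%:~R) ltr_int; case: (n) => [[|?]|?].
  congr Complex; [move: n1; rewrite n0 mulr0z|]; move=> *; lra.
have rphi y : ys < y -> rcont (fun t => phi (t +i* y)).
  by move=> h; apply: rcont_ccont (rcont_hline y) _ => t; exact: phic.
have I0 : CI (fun t => phi (t +i* y0)) a (a + 1) = 0.
  apply: cabs_small => e e0.
  have P0 : 0 < expR (2 * pi * y1) by exact: expR_gt0.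
  have e4 : 0 < e / 4 / expR (2 * pi * y1) by rewrite !divr_gt0.
  have [Y HY] := growth _ e4.
  have [Y2 HY2] := expR_large (2 + 4 * cabs (g z1) / e).
  pose y2 := Num.max (Num.max (Y + 1) (y1 + 1)) (y1 + Y2).
  have q1 : Y + 1 <= y2 by rewrite !le_max lexx.
  have q2 : y1 + 1 <= y2 by rewrite !le_max lexx orbT.
  have q3 : y1 + Y2 <= y2 by rewrite !le_max lexx !orbT.
  rewrite (Iphi y2); last lra.
  have -> : e = e * (a + 1 - a) by ring.
  apply: CI_bound => //; [apply: rphi; lra|by rewrite lerDl|].
  move=> t _; set w := t +i* y2.
  have E2 : cabs (e2 (z1 - w)) = expR (2 * pi * (y2 - y1)).
    by rewrite cabs_e2 cImD cImN /= -mulrN opprB.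
  have h2 : 2 + 4 * cabs (g z1) / e <= expR (2 * pi * (y2 - y1)) by apply: HY2; lra.
  set B := expR (2 * pi * (y2 - y1)) in E2 h2.
  have g0 : 0 <= 4 * cabs (g z1) / e by rewrite divr_ge0 ?mulr_ge0 ?cabs_ge0 // ltW.
  have B2 : 2 <= B by lra.
  have ne : e2 w != e2 z1.
    rewrite -den subr_eq0; apply/eqP => E; move: E2; rewrite -E cabs1; lra.
  rewrite /phi (negPf ne) cabsM cabsV ler_pdivrMr; last first.
    by rewrite cabs_gt0 den.
  have k1 : B / 2 <= cabs (1 - e2 (z1 - w)).
    by rewrite cabs_sym; have := cabs_sub_ge (e2 (z1 - w)) 1; rewrite E2 cabs1; lra.
  have k2 : e * (B / 2) <= e * cabs (1 - e2 (z1 - w)) by rewrite ler_pM2l.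
  apply: le_trans k2; apply: le_trans (cabsB _ _) _.
  have Yw : Y < complex.Im w by rewrite /w /=; lra.
  have := HY _ Yw; rewrite /w /=.
  have -> : e / 4 / expR (2 * pi * y1) * expR (2 * pi * y2) = e / 4 * B.
    rewrite /B mulrBr expRB; field; rewrite gt_eqF //.
  have k3 : cabs (g z1) <= e / 4 * B.
    have : 4 * cabs (g z1) / e <= B by lra.
    by rewrite ler_pdivrMr // => h; lra.
  move=> h; lra.
pose K t := (1 - e2 (z1 - (t +i* y0)))^-1.
have CK : CI K a (a + 1) = 1 by exact: kernel_period.
have r1 : r < 1.
  by rewrite /r -{2}(@expR0 R) ltr_expR oppr_lt0 mulr_gt0 ?mulr_gt0 // subr_gt0.
have r0 : 0 < r by exact: expR_gt0.
have Er t : cabs (e2 (z1 - (t +i* y0))) = r.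
  by rewrite cabs_e2 cImD cImN.
have De t : 1 - e2 (z1 - (t +i* y0)) != 0.
  rewrite subr_eq0; apply/eqP => E; move: (Er t); rewrite -E cabs1; lra.
have rE : rcont (fun t => e2 (z1 - (t +i* y0))).
  apply: (@rcont_ccont _ (fun w => e2 (z1 - w))); first exact: rcont_hline.
  move=> t; apply: (@ccont_comp _ (fun w => z1 - w) (@e2 R)).
    by apply: ccontB; [exact: ccont_cst|exact: ccont_id].
  by apply: cdiff_cont; exact: cdiff_e2.
have rK : rcont K.
  apply: (@rcont_ccont _ (fun v => (1 - v)^-1) _ rE) => t.
  apply: ccontV; first exact: De.
  by apply: ccontB; [exact: ccont_cst|exact: ccont_id].
have rM (u v : R -> C) : rcont u -> rcont v -> rcont (fun t => u t * v t).
  move=> cu cv x e e0.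
  have s1 : ccont (fun w => u (complex.Re w)) x%:C.
    by move=> e' /(cu x)[d d0 H]; exists d => // w h; apply: H;
       apply: le_lt_trans h; have := cabs_Re (w - x%:C); rewrite cReD cReN.
  have s2 : ccont (fun w => v (complex.Re w)) x%:C.
    by move=> e' /(cv x)[d d0 H]; exists d => // w h; apply: H;
       apply: le_lt_trans h; have := cabs_Re (w - x%:C); rewrite cReD cReN.
  have [d d0 H] := ccontM s1 s2 e0; exists d => // y yd.
  by apply: (H y%:C); rewrite -realCN -realCD cabs_real.
pose ka t := e2 (z1 - (t +i* y0)) * K t.
have rka : rcont ka by exact: rM.
have phiE t : phi (t +i* y0) = g (t +i* y0) + g (t +i* y0) * ka t - g z1 * K t.
  rewrite /phi; case: ifP => [|_].
    by rewrite -den (negPf (De t)).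
  by rewrite /ka /K; field; exact: De.
move: I0; rewrite (eq_CI _ _ phiE).
have rg0 := rg _ yy0.
rewrite CIB; [|by apply: rcontD => //; exact: rM|exact: rcontZ].
rewrite CID //; last exact: rM.
rewrite CIZ // CK mulr1 Ishift // => /eqP; rewrite subr_eq0 => /eqP <-.
rewrite addrC addKr.
have -> : M * (r / (1 - r)) = M * (r / (1 - r)) * (a + 1 - a) by ring.
apply: CI_bound; [exact: rM|by rewrite lerDl|move=> t _].
rewrite cabsM ler_pM ?cabs_ge0 // /ka cabsM Er /K cabsV ler_pM ?invr_ge0 ?cabs_ge0 //.
  exact: ltW.
rewrite lef_pV2 ?posrE ?cabs_gt0 ?De ?subr_gt0 //.
by have := cabs_sub_ge 1 (e2 (z1 - (t +i* y0))); rewrite cabs1 Er.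
Qed.

End StripTheorem.

(** * Removable singularities and the maximum principle *)

Section Disc.
Variable R : realType.
Local Notation C := R[i].
Implicit Types (f g : C -> C) (z w a : C).

Lemma rcont_bounded (u : R -> C) : rcont u -> (forall t, u (t + 1) = u t) ->
  exists2 M, 0 <= M & forall t, cabs (u t) <= M.
Proof.
move=> cu per.
have cc : continuous (fun t => cabs (u t)).
  apply: rcontP => x e /(cu x)[d d0 H]; exists d => // y /H.
  by apply: le_lt_trans; exact: cabs_dist.
have [c _ Hc] := @EVT_max R (fun t => cabs (u t)) 0 1 ler01 (continuous_subspaceT cc).
exists (cabs (u c)); first exact: cabs_ge0.
have pern (n : nat) t : u (t + n%:R) = u t.
  by elim: n => [|n IH]; rewrite ?addr0 // -natr1 addrA per.
move=> t; have -> : u t = u (t - (Num.floor t)%:~R).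
  case: (intP (Num.floor t)) => [|n|n]; first by rewrite subr0.
    by rewrite -[LHS](subrK n.+1%:R) -(pern n.+1 (t - n.+1%:R)) subrK subrK.
  by rewrite mulrNz opprK pern.
apply: Hc; rewrite in_itv /=.
have := floor_le t; have := floorD1_gt t; rewrite intrD; lra.
Qed.

Definition circ a (r : R) (t : R) : C := a + r%:C * e2 t%:C.

Lemma cabs_circ a r t : 0 <= r -> cabs (circ a r t - a) = r.
Proof.
move=> r0; rewrite /circ addrC addKr cabsM cabs_real ger0_norm //.
by rewrite cabs_e2 cImR mulr0 oppr0 expR0 mulr1.
Qed.

Lemma circP a r w : 0 < r -> cabs (w - a) = r -> exists t, w = circ a r t.
Proof.
move=> r0 wr; have rC : r%:C != 0 by rewrite -cabs_gt0 cabs_real gtr0_norm.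
have w0 : (w - a) / r%:C != 0.
  by rewrite mulf_neq0 ?invr_neq0 // -cabs_gt0 wr.
have [z ez] := e2_surj w0.
have Iz : complex.Im z = 0.
  have := cabs_e2 z; rewrite ez cabsM cabsV cabs_real gtr0_norm // wr.
  rewrite divff ?gt_eqF // -{1}(@expR0 R) => /expR_inj/esym/eqP.
  by rewrite oppr_eq0 !mulf_eq0 pnatr_eq0 (gt_eqF (@pi_gt0 R)) /= => /eqP.
exists (complex.Re z); rewrite /circ.
have -> : (complex.Re z)%:C = z by apply: complex_eq.
by rewrite ez mulrC divfK // addrC subrK.
Qed.

Lemma circ_period a r t : circ a r (t + 1) = circ a r t.
Proof. by rewrite /circ realCD e2D1. Qed.

Lemma rcont_circ a r : rcont (circ a r).
Proof.
apply: (@rcont_ccont _ (fun z => a + r%:C * e2 z) (fun t => t%:C)).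
  exact: (@rcont_hline R 0).
move=> t; apply: ccontD; first exact: ccont_cst.
by apply: ccontM; [exact: ccont_cst|apply: cdiff_cont; exact: cdiff_e2].
Qed.

Lemma circle_bounded f a r : 0 < r -> (forall w, cabs (w - a) = r -> ccont f w) ->
  exists2 M, 0 <= M & forall w, cabs (w - a) = r -> cabs (f w) <= M.
Proof.
move=> r0 cf.
have rf : rcont (fun t => f (circ a r t)).
  apply: rcont_ccont; first exact: rcont_circ.
  by move=> t; apply: cf; exact: cabs_circ (ltW r0).
have [|M M0 HM] := rcont_bounded rf; first by move=> t; rewrite circ_period.
by exists M => // w /(circP r0)[t ->].
Qed.

Lemma disc_gen f a r r' : 0 < r -> r < r' ->
  (forall w, w != a -> cabs (w - a) < r' -> cdiff f w) ->
  (exists B d, 0 < d /\ forall w, w != a -> cabs (w - a) < d -> cabs (f w) <= B) ->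
  exists c, [/\ c = CI (fun t => f (circ a r t)) 0 1,
   forall M, (forall w, cabs (w - a) = r -> cabs (f w) <= M) -> cabs c <= M &
   forall M, (forall w, cabs (w - a) = r -> cabs (f w) <= M) ->
   forall w, w != a -> cabs (w - a) < r ->
     cabs (f w - c) <= M * (cabs (w - a) / r / (1 - cabs (w - a) / r))].
Proof.
move=> r0 rr' df [B [d [d0 HB]]].
have rC : r%:C != 0 by rewrite -cabs_gt0 cabs_real gtr0_norm.
pose G z := a + r%:C * e2 z.
pose g z := f (G z).
have Ga z : cabs (G z - a) = r * expR (- (2 * pi * complex.Im z)).
  by rewrite /G addrC addKr cabsM cabs_real gtr0_norm // cabs_e2.
have Gne z : G z != a.
  by rewrite -subr_eq0 -cabs_gt0 Ga mulr_gt0 // expR_gt0.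
have dG z : cdiff G z.
  by apply: cdiffD; [exact: cdiff_cst|apply: cdiffZ; exact: cdiff_e2].
have q0 : 0 < r' / r by rewrite divr_gt0 // (lt_trans r0).
have [s es] := expR_total q0.
have s0 : 0 < s by rewrite -expR_gt1 es ltr_pdivlMr // mul1r.
have pi0 := @pi_gt0 R; have p2 : 0 < 2 * pi :> R by rewrite mulr_gt0.
pose ys := - (s / (2 * pi)).
have ys0 : ys < 0 by rewrite oppr_lt0 divr_gt0.
have Gr z : ys < complex.Im z -> cabs (G z - a) < r'.
  move=> h; rewrite Ga mulrC -ltr_pdivlMr // -es ltr_expR.
  by rewrite -mulrN mulrC -ltr_pdivlMr // ltrNl.
have dg z : ys < complex.Im z -> cdiff g z.
  by move=> h; apply: cdiff_comp (dG z) _; apply: df => //; exact: Gr.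
have per z : ys < complex.Im z -> g (z + 1) = g z by rewrite /g /G e2D1.
have growth e : 0 < e -> exists Y, forall z, Y < complex.Im z ->
     cabs (g z) <= e * expR (2 * pi * complex.Im z).
  move=> e0; have [Y1 H1] := expR_large (`|B| / e).
  have [Y2 H2] := expR_large (2 * r / d).
  exists (Num.max Y1 Y2) => z; rewrite gt_max => /andP[z1 z2].
  have := H1 _ (ltW z1); rewrite ler_pdivrMr // mulrC; apply: le_trans.
  apply: le_trans (ler_norm _); apply: HB => //.
  rewrite Ga expRN ltr_pdivrMr ?expR_gt0 //.
  have := H2 _ (ltW z2); rewrite ler_pdivrMr // mulrC; lra.
have [c [c1 c2]] := strip dg per growth.
have g0 t : g (t +i* 0) = f (circ a r t) by [].
have cE : c = CI (fun t => f (circ a r t)) 0 1 by rewrite -(c1 _ ys0); exact: eq_CI.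
have rf : rcont (fun t => f (circ a r t)).
  apply: rcont_ccont; first exact: rcont_circ.
  by move=> t; apply: cdiff_cont; apply: (df (G t%:C)) => //; exact: Gr.
exists c; split=> // M HM.
  rewrite cE (_ : M = M * (1 - 0)); last by rewrite subr0 mulr1.
  by apply: CI_bound => // t _; apply: HM; exact: cabs_circ (ltW r0).
move=> w wa wr.
have w0 : (w - a) / r%:C != 0.
  by rewrite mulf_neq0 ?invr_neq0 // subr_eq0.
have [z ez] := e2_surj w0.
have Gz : G z = w by rewrite /G ez mulrC divfK // addrC subrK.
have Ez : expR (- (2 * pi * complex.Im z)) = cabs (w - a) / r.
  by rewrite -cabs_e2 ez cabsM cabsV cabs_real gtr0_norm.
have Iz : 0 < complex.Im z.
  have : expR (- (2 * pi * complex.Im z)) < 1 by rewrite Ez ltr_pdivrMr // mul1r.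
  by rewrite expR_lt1 oppr_lt0 pmulr_rgt0.
have := c2 0 M z ys0 _ Iz; rewrite /= subr0 Ez /g Gz; apply.
by move=> t; apply: HM; exact: cabs_circ (ltW r0).
Qed.

Lemma rho_le (x : R) : 0 <= x <= 1/2 -> x / (1 - x) <= 2 * x.
Proof.
move=> /andP[x0 x1]; rewrite ler_pdivrMr; last lra.
nra.
Qed.

Lemma disc_lip f a r r' : 0 < r -> r < r' ->
  (forall w, w != a -> cabs (w - a) < r' -> cdiff f w) ->
  (exists B d, 0 < d /\ forall w, w != a -> cabs (w - a) < d -> cabs (f w) <= B) ->
  exists c, [/\ c = CI (fun t => f (circ a r t)) 0 1,
   forall M, (forall w, cabs (w - a) = r -> cabs (f w) <= M) -> cabs c <= M &
   forall M, 0 <= M -> (forall w, cabs (w - a) = r -> cabs (f w) <= M) ->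
   forall w, w != a -> cabs (w - a) <= r / 2 ->
     cabs (f w - c) <= 2 * M / r * cabs (w - a)].
Proof.
move=> r0 rr' df bf; have [c [c1 c2 c3]] := disc_gen r0 rr' df bf.
exists c; split=> // M M0 HM w wa wr.
have wr' : cabs (w - a) < r by lra.
apply: le_trans (c3 M HM w wa wr') _.
rewrite (_ : 2 * M / r * cabs (w - a) = M * (2 * (cabs (w - a) / r))); last first.
  by field; rewrite gt_eqF.
rewrite ler_wpM2l // rho_le // divr_ge0 ?cabs_ge0 ?(ltW r0) //=.
by rewrite ler_pdivrMr //; lra.
Qed.

Lemma circle_neq a r w : 0 < r -> cabs (w - a) = r -> w != a.
Proof. by move=> r0 wr; rewrite -subr_eq0 -cabs_gt0 wr. Qed.

Lemma removable f a r' : 0 < r' ->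
  (forall w, w != a -> cabs (w - a) < r' -> cdiff f w) ->
  (exists B d, 0 < d /\ forall w, w != a -> cabs (w - a) < d -> cabs (f w) <= B) ->
  exists c, cdiff (fun w => if w == a then c else f w) a.
Proof.
move=> r0' df bf; have r0 : 0 < r' / 2 by lra.
have rr' : r' / 2 < r' by lra.
have cb (h : C -> C) : (forall w, w != a -> cabs (w - a) < r' -> cdiff h w) ->
   exists2 M, 0 <= M & forall w, cabs (w - a) = r' / 2 -> cabs (h w) <= M.
  move=> dh; apply: circle_bounded => // w wr; apply: cdiff_cont.
  by apply: dh; [exact: circle_neq wr|rewrite wr].
have [c [_ _ c3]] := disc_lip r0 rr' df bf.
have [M M0 HM] := cb _ df.
have {}c3 := c3 M M0 HM.
pose q w := (f w - c) / (w - a).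
have dq w : w != a -> cabs (w - a) < r' -> cdiff q w.
  move=> wa wr; apply: cdiffM.
    by apply: cdiffB; [exact: df|exact: cdiff_cst].
  by apply: cdiffV; [rewrite subr_eq0|apply: cdiffB; [exact: cdiff_id|exact: cdiff_cst]].
have bq : exists B d, 0 < d /\ forall w, w != a -> cabs (w - a) < d -> cabs (q w) <= B.
  exists (2 * M / (r' / 2)), (r' / 2 / 2); split; first lra.
  move=> w wa /ltW/(c3 _ wa) h; rewrite /q cabsM cabsV ler_pdivrMr //.
  by rewrite cabs_gt0 subr_eq0.
have [l [_ _ l3]] := disc_lip r0 rr' dq bq.
have [M' M0' HM'] := cb _ dq.
have {}l3 := l3 M' M0' HM'.
exists c, l => e e0.
pose K := 2 * M' / (r' / 2).
have K0 : 0 <= K by rewrite divr_ge0 ?mulr_ge0 // ltW.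
exists (Num.min (r' / 2 / 2) (e / (K + 1))).
  by rewrite lt_min !divr_gt0 //; lra.
move=> w; rewrite lt_min => /andP[w1 w2]; rewrite eqxx.
case: eqP => [->|/eqP wa]; first by rewrite !subrr mulr0 subrr cabs0 mulr0.
have wa0 : w - a != 0 by rewrite subr_eq0.
have -> : f w - c - l * (w - a) = (q w - l) * (w - a) by rewrite /q; field.
rewrite cabsM ler_wpM2r ?cabs_ge0 //.
apply: le_trans (l3 _ wa (ltW w1)) _; rewrite -/K.
have := ltW w2; rewrite ler_pdivlMr; last lra.
apply: le_trans; rewrite mulrC ler_wpM2l ?cabs_ge0 //; lra.
Qed.

Lemma removable_cont f a r' : 0 < r' ->
  (forall w, w != a -> cabs (w - a) < r' -> cdiff f w) -> ccont f a -> cdiff f a.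
Proof.
move=> r0 df cf.
have [d d0 Hd] := ccont_loc_bound cf.
have [|c dc] := removable r0 df.
  by exists (cabs (f a) + 1), d; split=> // w _ /Hd /ltW.
have cc := cdiff_cont dc.
have E : f a = c.
  apply/eqP; rewrite -subr_eq0; apply/eqP/cabs_small => e e0.
  have e2 : 0 < e / 2 by lra.
  have [d1 d10 H1] := cf _ e2; have [d2 d20 H2] := cc _ e2.
  pose h := Num.min d1 d2 / 2.
  have m0 : 0 < Num.min d1 d2 by rewrite lt_min d10.
  have h0 : 0 < h by rewrite divr_gt0.
  have hm : h < Num.min d1 d2 by rewrite /h; lra.
  have ah : cabs (a + h%:C - a) = h by rewrite addrC addKr cabs_real gtr0_norm.
  have := hm; rewrite lt_min => /andP[h1 h2].
  have := H1 (a + h%:C); rewrite ah => /(_ h1) k1.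
  have := H2 (a + h%:C); rewrite ah => /(_ h2); rewrite eqxx.
  have -> : a + h%:C == a = false.
    by apply/negbTE; rewrite -subr_eq0 -cabs_gt0 ah.
  move=> k2; have -> : f a - c = (f (a + h%:C) - c) - (f (a + h%:C) - f a) by ring.
  by apply: le_trans (cabsB _ _) _; lra.
by apply: eq_cdiff dc => w; case: eqP => // ->.
Qed.

Lemma cauchy_mean f a r r' : 0 < r -> r < r' ->
  (forall w, cabs (w - a) < r' -> cdiff f w) ->
  CI (fun t => f (circ a r t)) 0 1 = f a.
Proof.
move=> r0 rr' df.
have aa : cabs (a - a) < r' by rewrite subrr cabs0 (lt_trans r0).
have cf := cdiff_cont (df _ aa).
have [d d0 Hd] := ccont_loc_bound cf.
have df' w : w != a -> cabs (w - a) < r' -> cdiff f w by move=> _; exact: df.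
have [|c [<- _ c3]] := disc_lip r0 rr' df'.
  by exists (cabs (f a) + 1), d; split=> // w _ /Hd /ltW.
have [M M0 HM] : exists2 M, 0 <= M & forall w, cabs (w - a) = r -> cabs (f w) <= M.
  by apply: circle_bounded => // w wr; apply: cdiff_cont; apply: df; rewrite wr.
have {}c3 := c3 M M0 HM.
apply/esym/eqP; rewrite -subr_eq0; apply/eqP/cabs_small => e e0.
have e2 : 0 < e / 2 by lra.
have [d1 d10 H1] := cf _ e2.
pose K := 2 * M / r; have K0 : 0 <= K by rewrite divr_ge0 ?mulr_ge0 // ltW.
have [h [h0 h1 h2 h3]] : exists h, [/\ 0 < h, h < d1, h <= r / 2 & K * h <= e / 2].
  exists (Num.min (d1 / 2) (Num.min (r / 2) (e / 2 / (K + 1)))).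
  set h := Num.min _ _; have : h <= h by [].
  rewrite {2}/h !le_min => /and3P[a1 a2 a3].
  have h0 : 0 < h by rewrite /h !lt_min !divr_gt0 //; lra.
  split=> //; first lra.
  have := a3; rewrite ler_pdivlMr; last lra.
  by apply: le_trans; rewrite mulrC ler_pM2l //; lra.
have ah : cabs (a + h%:C - a) = h by rewrite addrC addKr cabs_real gtr0_norm.
have := H1 (a + h%:C); rewrite ah => /(_ h1) k1.
have ne : a + h%:C != a by rewrite -subr_eq0 -cabs_gt0 ah.
have := c3 _ ne; rewrite ah => /(_ h2); rewrite -/K => k2.
have -> : f a - c = (f (a + h%:C) - c) - (f (a + h%:C) - f a) by ring.
by apply: le_trans (cabsB _ _) _; lra.
Qed.

Lemma max_modulus f a r' (M : R) :
  (forall w, cabs (w - a) < r' -> cdiff f w) ->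
  (forall w, cabs (w - a) < r' -> cabs (f w) <= M) ->
  cabs (f a) = M -> forall w, cabs (w - a) < r' -> cabs (f w) = M.
Proof.
move=> df fM fa w wr'; have [->//|wa] := eqVneq w a.
pose r := cabs (w - a).
have r0 : 0 < r by rewrite cabs_gt0 subr_eq0.
have mean := cauchy_mean r0 wr' df.
have rf : rcont (fun t => f (circ a r t)).
  apply: rcont_ccont; first exact: rcont_circ.
  by move=> t; apply: cdiff_cont; apply: df; rewrite cabs_circ ?ltW.
have fM' t : cabs (f (circ a r t)) <= M by apply: fM; rewrite cabs_circ ?ltW.
have [t wt] := circP r0 (erefl r).
have e0 : cabs (CI (fun t => f (circ a r t)) t (t + 1)) = M.
  rewrite (CI_period t 0 rf) ?add0r ?mean // => s; by rewrite circ_period.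
have := @CI_extremal R _ t M rf fM' e0 t; rewrite lexx lerDl ler01 /= -wt.
by apply.
Qed.

Lemma taylor_bound f a r r' (M : R) l : 0 < r -> r < r' -> 0 <= M ->
  (forall w, cabs (w - a) < r' -> cdiff f w) ->
  (forall w, cabs (w - a) = r -> cabs (f w) <= M) ->
  cderiv f a l ->
  cabs l <= 2 * M / r /\
  forall w, cabs (w - a) <= r / 2 ->
    cabs (f w - f a - l * (w - a)) <= 4 * M / r ^+ 2 * cabs (w - a) ^+ 2.
Proof.
move=> r0 rr' M0 df HM dl.
have faM : cabs (f a) <= M.
  rewrite -(cauchy_mean r0 rr' df) (_ : M = M * (1 - 0)); last by rewrite subr0 mulr1.
  apply: CI_bound => // [|t _]; last by apply: HM; exact: cabs_circ (ltW r0).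
  apply: rcont_ccont; first exact: rcont_circ.
  by move=> t; apply: cdiff_cont; apply: df; rewrite cabs_circ ?ltW.
pose q w := if w == a then l else (f w - f a) / (w - a).
have [p [fE cp pl]] := (cderivP _ _ _).1 dl.
have qp w : p w = q w.
  rewrite /q; case: eqP => [->//|/eqP wa].
  by rewrite fE addrC addKr mulfK // subr_eq0.
have cq : ccont q a by apply: eq_ccont cp.
have dq w : cabs (w - a) < r' -> cdiff q w.
  have dq1 v : v != a -> cabs (v - a) < r' -> cdiff q v.
    move=> va vr.
    have va0 : 0 < cabs (v - a) by rewrite cabs_gt0 subr_eq0.
    apply: (cdiff_near (f := fun w => (f w - f a) / (w - a)) va0).
      move=> u; rewrite /q; case: eqP => // ->; by rewrite cabs_sym ltxx.
    apply: cdiffM; first by apply: cdiffB; [exact: df|exact: cdiff_cst].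
    by apply: cdiffV; [rewrite subr_eq0|apply: cdiffB; [exact: cdiff_id|exact: cdiff_cst]].
  have [->|wa] := eqVneq w a; last exact: dq1.
  by move=> _; apply: (removable_cont (lt_trans r0 rr') dq1).
have aa : cabs (a - a) < r' by rewrite subrr cabs0 (lt_trans r0).
have bq : exists B d, 0 < d /\ forall w, w != a -> cabs (w - a) < d -> cabs (q w) <= B.
  have [d d0 Hd] := ccont_loc_bound cq.
  by exists (cabs (q a) + 1), d; split=> // w _ /Hd /ltW.
have [|c [cE c2 c3]] := disc_lip r0 rr' _ bq; first by move=> w _; exact: dq.
have cl : c = l by rewrite cE (cauchy_mean r0 rr' dq) /q eqxx.
have qM w : cabs (w - a) = r -> cabs (q w) <= 2 * M / r.
  move=> wr; rewrite /q (negPf (circle_neq r0 wr)) cabsM cabsV wr.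
  rewrite ler_pM2r ?invr_gt0 //; apply: le_trans (cabsB _ _) _.
  by have := HM _ wr; lra.
split; first by rewrite -cl; exact: c2.
move=> w wr; have [->|wa] := eqVneq w a.
  by rewrite !subrr mulr0 subrr cabs0 expr0n /= mulr0.
have wa0 : w - a != 0 by rewrite subr_eq0.
have -> : f w - f a - l * (w - a) = (q w - c) * (w - a).
  by rewrite cl /q (negPf wa); field.
rewrite cabsM.
have M20 : 0 <= 2 * M / r by rewrite divr_ge0 ?mulr_ge0 // ltW.
have := c3 _ M20 qM w wa wr => h.
rewrite (_ : 4 * M / r ^+ 2 * cabs (w - a) ^+ 2 =
   2 * (2 * M / r) / r * cabs (w - a) * cabs (w - a)); last by field; rewrite gt_eqF.
by rewrite ler_wpM2r ?cabs_ge0.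
Qed.

Lemma liouville_periodic g (M : R) : (forall z, cdiff g z) ->
  (forall z, g (z + 1) = g z) -> (forall z, cabs (g z) <= M) ->
  forall z w, g z = g w.
Proof.
move=> dg per gM z w.
have M0 : 0 <= M by apply: le_trans (gM 0); exact: cabs_ge0.
apply/eqP; rewrite -subr_eq0; apply/eqP/cabs_small => e e0.
have [Y HY] := expR_large (2 + 4 * M / e).
pose y0 := Num.min (complex.Im z) (complex.Im w) - Num.max Y 1.
have yY : Y <= Num.max Y 1 by rewrite le_max lexx.
have y1 : 1 <= Num.max Y 1 by rewrite le_max lexx orbT.
have dg' v : y0 - 1 < complex.Im v -> cdiff g v by [].
have per' v : y0 - 1 < complex.Im v -> g (v + 1) = g v by [].
have [|c [_ c2]] := strip dg' per'.
  move=> e' e0'; have [Y' HY'] := expR_large (M / e'); exists Y' => v /ltW/HY'.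
  by rewrite ler_pdivrMr // mulrC; apply: le_trans.
have g0 : 0 <= 4 * M / e by rewrite divr_ge0 ?mulr_ge0 // ltW.
have key v : Num.min (complex.Im z) (complex.Im w) <= complex.Im v -> cabs (g v - c) <= e / 2.
  move=> hv; have h1 : y0 < complex.Im v by rewrite /y0; lra.
  have h2 : y0 - 1 < y0 by lra.
  have := c2 y0 M v h2 (fun=> gM _) h1; set r := expR _ => /= H; apply: le_trans H _.
  have : 2 + 4 * M / e <= expR (2 * pi * (complex.Im v - y0)) by apply: HY; rewrite /y0; lra.
  have -> : r / (1 - r) = (expR (2 * pi * (complex.Im v - y0)) - 1)^-1.
    rewrite /r expRN; set E := expR _; have E1 : 1 < E.
      by rewrite expR_gt1 mulr_gt0 ?mulr_gt0 ?pi_gt0 // subr_gt0.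
    by field; rewrite subr_eq0 !gt_eqF // (lt_trans ltr01).
  set E := expR _ => hE.
  rewrite ler_pdivrMr; last lra.
  have : 4 * M / e <= E by lra.
  rewrite ler_pdivrMr // => h3; nra.
have -> : g z - g w = (g z - c) - (g w - c) by ring.
apply: le_trans (cabsB _ _) _.
have := key z; have := key w; rewrite !ge_min !lexx orbT => /(_ isT) k1 /(_ isT) k2.
lra.
Qed.

End Disc.

(** * Geometrically convergent series *)

Section Series.
Variable R : realType.
Local Notation C := R[i].
Implicit Types (u v : nat -> C) (f : nat -> C -> C) (rho : R).

Definition psum u n : C := \sum_(k < n) u k.

Definition ctends u (l : C) := forall e : R, 0 < e ->
  exists N, forall n, (N <= n)%N -> cabs (u n - l) <= e.

Definition csum u : C := xget 0 [set l | ctends (psum u) l].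

Definition geom u (B : R) rho := forall k, cabs (u k) <= B * rho ^+ k.

Lemma ctends_uniq u l m : ctends u l -> ctends u m -> l = m.
Proof.
move=> ul um; apply/eqP; rewrite -subr_eq0; apply/eqP/cabs_small => e e0.
have e2 : 0 < e / 2 by lra.
have [N1 H1] := ul _ e2; have [N2 H2] := um _ e2.
have := H1 (maxn N1 N2) (leq_maxl _ _); have := H2 (maxn N1 N2) (leq_maxr _ _).
set x := u _ => h1 h2; have -> : l - m = (x - m) - (x - l) by ring.
by apply: le_trans (cabsB _ _) _; lra.
Qed.

Lemma csum_eq u l : ctends (psum u) l -> csum u = l.
Proof. by move=> ul; apply: (@ctends_uniq (psum u)) => //; exact: xgetI ul. Qed.

Lemma eq_csum u v : u =1 v -> csum u = csum v.
Proof. by move=> /funext ->. Qed.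

Lemma geom_small rho (K e : R) : 0 <= rho < 1 -> 0 < e ->
  exists N, forall n, (N <= n)%N -> K * rho ^+ n <= e.
Proof.
move=> /andP[r0 r1] e0.
have : (fun n => K * rho ^+ n) @ \oo --> (K * 0).
  apply: cvgMr; apply: cvg_expr; by rewrite ger0_norm.
rewrite mulr0 => /cvgrPdist_le /(_ _ e0) [N _ HN]; exists N => n /HN /=.
by rewrite sub0r normrN => h; apply: le_trans h; exact: ler_norm.
Qed.

Lemma psum_geom u B rho m n : 0 <= rho < 1 -> geom u B rho -> (m <= n)%N ->
  cabs (psum u n - psum u m) <= B * rho ^+ m / (1 - rho).
Proof.
move=> /andP[r0 r1] gu mn.
have B0 : 0 <= B by have := gu 0%N; rewrite expr0 mulr1; apply: le_trans; exact: cabs_ge0.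
have : cabs (psum u n - psum u m) <= B * (rho ^+ m - rho ^+ n) / (1 - rho).
  move: mn => /subnK <-; elim: (n - m)%N => [|k IH].
    by rewrite add0n !subrr cabs0 mulr0 mul0r.
  rewrite addSn /psum big_ord_recr /= -!/(psum u _).
  rewrite (_ : _ - _ = (psum u (k + m) - psum u m) + u (k + m)%N); last by ring.
  apply: le_trans (cabsD _ _) _; apply: le_trans (lerD IH (gu _)) _.
  rewrite exprS le_eqVlt; apply/orP; left; apply/eqP; field.
  by rewrite subr_eq0 gt_eqF.
move/le_trans; apply.
rewrite ler_pM2r ?invr_gt0 ?subr_gt0 // ler_wpM2l // gerBl exprn_ge0 //.
Qed.

Lemma cauchy_tends u : (forall e, 0 < e -> exists N, forall m n, (N <= m)%N ->
    (N <= n)%N -> cabs (u n - u m) <= e) -> exists l, ctends u l.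
Proof.
move=> H.
have real_case (v : nat -> R) : (forall e, 0 < e -> exists N, forall m n, (N <= m)%N ->
    (N <= n)%N -> `|v n - v m| <= e) -> exists l, forall e, 0 < e ->
    exists N, forall n, (N <= n)%N -> `|v n - l| <= e.
  move=> Hv; have cv : cvgn v.
    apply/cauchy_cvgP/cauchy_ballP => e e0.
    have e2 : 0 < e / 2 by lra.
    have [N HN] := Hv _ e2; exists (v @` [set n | (N <= n)%N], v @` [set n | (N <= n)%N]).
      by split; exists N => // n h; exists n.
    move=> [x y] /= [[m h1 <-] [n h2 <-]]; rewrite /ball /= distrC.
    apply: le_lt_trans (HN _ _ h1 h2) _; lra.
  exists (limn v) => e e0.
  have /cvgrPdist_le /(_ _ e0)[N _ HN] : v @ \oo --> limn v by exact: cv.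
  by exists N => n /HN /=; rewrite distrC.
have [|a Ha] := real_case (fun n => complex.Re (u n)).
  move=> e /H[N HN]; exists N => m n h1 h2; apply: le_trans (HN m n h1 h2).
  by rewrite -cReN -cReD cabs_Re.
have [|b Hb] := real_case (fun n => complex.Im (u n)).
  move=> e /H[N HN]; exists N => m n h1 h2; apply: le_trans (HN m n h1 h2).
  by rewrite -cImN -cImD cabs_Im.
exists (a +i* b) => e e0; have e2 : 0 < e / 2 by lra.
have [N1 H1] := Ha _ e2; have [N2 H2] := Hb _ e2.
exists (maxn N1 N2) => n; rewrite geq_max => /andP[/H1 h1 /H2 h2].
by apply: le_trans (cabs_ReIm _) _; rewrite cReD cImD cReN cImN /=; lra.
Qed.

Lemma csum_geom u B rho : 0 <= rho < 1 -> geom u B rho -> ctends (psum u) (csum u).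
Proof.
move=> r01 gu; have [|l ul] := @cauchy_tends (psum u); last by rewrite (csum_eq ul).
move=> e e0; have [N HN] := geom_small (B / (1 - rho)) r01 e0.
have key m n : (N <= m)%N -> (m <= n)%N -> cabs (psum u n - psum u m) <= e.
  move=> Nm mn; apply: le_trans (psum_geom r01 gu mn) _.
  by rewrite mulrAC; exact: HN.
exists N => m n h1 h2; have [mn|/ltnW nm] := leqP m n; first exact: key.
by rewrite cabs_sym; exact: key.
Qed.

Lemma csum_bound u B rho : 0 <= rho < 1 -> geom u B rho -> cabs (csum u) <= B / (1 - rho).
Proof.
move=> r01 gu; have ul := csum_geom r01 gu.
apply/ler_addgt0Pr => e e0; have [N HN] := ul _ e0.
have := HN N (leqnn _); have := psum_geom r01 gu (leq0n N).
rewrite expr0 mulr1 /psum big_ord0 subr0 -/(psum u N) => h1 h2.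
have -> : csum u = psum u N - (psum u N - csum u) by ring.
by apply: le_trans (cabsB _ _) _; lra.
Qed.

Lemma csumD u v B B' rho rho' : 0 <= rho < 1 -> 0 <= rho' < 1 ->
  geom u B rho -> geom v B' rho' -> csum (fun k => u k + v k) = csum u + csum v.
Proof.
move=> r1 r2 gu gv; apply: csum_eq => e e0; have e2 : 0 < e / 2 by lra.
have [N1 H1] := csum_geom r1 gu e2; have [N2 H2] := csum_geom r2 gv e2.
exists (maxn N1 N2) => n; rewrite geq_max => /andP[/H1 h1 /H2 h2].
have -> : psum (fun k => u k + v k) n - (csum u + csum v) =
  (psum u n - csum u) + (psum v n - csum v) by rewrite /psum big_split /=; ring.
by apply: le_trans (cabsD _ _) _; lra.
Qed.

Lemma csumZ (c : C) u B rho : 0 <= rho < 1 -> geom u B rho ->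
  csum (fun k => c * u k) = c * csum u.
Proof.
move=> r1 gu; apply: csum_eq => e e0.
have K0 : 0 < cabs c + 1 by rewrite ltr_wpDl ?cabs_ge0.
have e2 : 0 < e / (cabs c + 1) by rewrite divr_gt0.
have [N H] := csum_geom r1 gu e2; exists N => n /H h.
rewrite /psum -mulr_sumr -/(psum u n) -mulrBr cabsM.
have := h; rewrite ler_pdivlMr // mulrC; apply: le_trans.
by rewrite ler_wpM2r ?cabs_ge0 // lerDl.
Qed.

Lemma geomZ (c : C) u B rho : geom u B rho -> geom (fun k => c * u k) (cabs c * B) rho.
Proof. by move=> gu k; rewrite cabsM -mulrA ler_wpM2l ?cabs_ge0. Qed.

Lemma geomD u v B B' rho : geom u B rho -> geom v B' rho ->
  geom (fun k => u k + v k) (B + B') rho.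
Proof. by move=> gu gv k; apply: le_trans (cabsD _ _) _; rewrite mulrDl lerD. Qed.

Lemma csumN u B rho : 0 <= rho < 1 -> geom u B rho ->
  csum (fun k => - u k) = - csum u.
Proof.
move=> r1 gu; rewrite -mulN1r -(csumZ _ r1 gu).
by apply: eq_csum => k; rewrite mulN1r.
Qed.

Lemma csum_cderiv f a (l : nat -> C) (r B rho : R) : 0 < r -> 0 <= rho < 1 ->
  (forall k w, cabs (w - a) < r -> cdiff (f k) w) ->
  (forall w, cabs (w - a) < r -> geom (f^~ w) B rho) ->
  (forall k, cderiv (f k) a (l k)) ->
  cderiv (fun w => csum (f^~ w)) a (csum l).
Proof.
move=> r0 r1 df gf Hl.
have B0 : 0 <= B.
  have := gf a; rewrite subrr cabs0 => /(_ r0 0%N); rewrite expr0 mulr1.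
  by apply: le_trans; exact: cabs_ge0.
have rho0 k : 0 <= rho ^+ k by rewrite exprn_ge0 //; case/andP: r1.
pose s := r / 2; have s0 : 0 < s by rewrite divr_gt0.
have sr : s < r by rewrite /s; lra.
have tb k := @taylor_bound R (f k) a s r (B * rho ^+ k) (l k) s0 sr
  (mulr_ge0 B0 (rho0 k)) (df k).
have {}tb k : cabs (l k) <= 2 * (B * rho ^+ k) / s /\
  forall w, cabs (w - a) <= s / 2 -> cabs (f k w - f k a - l k * (w - a))
    <= 4 * (B * rho ^+ k) / s ^+ 2 * cabs (w - a) ^+ 2.
  apply: tb => // w ws; apply: gf; by rewrite ws.
have gl : geom l (2 * B / s) rho.
  by move=> k; have [h _] := tb k; rewrite (_ : _ * _ = 2 * (B * rho ^+ k) / s) //; ring.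
have r1' : 0 < 1 - rho by rewrite subr_gt0; case/andP: r1.
pose K := 4 * B / s ^+ 2 / (1 - rho).
have K0 : 0 <= K by rewrite !divr_ge0 ?mulr_ge0 ?exprn_ge0 // ltW.
move=> e e0; exists (Num.min (s / 2) (e / (K + 1))).
  by rewrite lt_min !divr_gt0 //; lra.
move=> w; rewrite lt_min => /andP[w1 w2].
have wr : cabs (w - a) < r by lra.
have ar : cabs (a - a) < r by rewrite subrr cabs0.
have g1 := gf _ wr; have g2 := gf _ ar.
have -> : csum (f^~ w) - csum (f^~ a) - csum l * (w - a) =
   csum (fun k => f k w - f k a - l k * (w - a)).
  have g2' : geom (fun k => - f k a) B rho by move=> k; rewrite cabsN; exact: g2.
  have g3 : geom (fun k => - (l k * (w - a))) (2 * B / s * cabs (w - a)) rho.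
    move=> k; rewrite cabsN cabsM mulrAC ler_wpM2r ?cabs_ge0 //; exact: gl.
  rewrite (csumD r1 r1 (geomD g1 g2') g3) (csumD r1 r1 g1 g2') (csumN r1 g2).
  congr (_ - _ + _); rewrite mulrC -mulNr -(csumZ _ r1 gl).
  by apply: eq_csum => k; rewrite mulNr mulrC.
have gg : geom (fun k => f k w - f k a - l k * (w - a))
   (4 * B / s ^+ 2 * cabs (w - a) ^+ 2) rho.
  move=> k; have [_ /(_ w (ltW w1)) h] := tb k; apply: le_trans h _.
  by rewrite le_eqVlt; apply/orP; left; apply/eqP; field; rewrite gt_eqF.
apply: le_trans (csum_bound r1 gg) _.
rewrite (_ : _ / _ = K * cabs (w - a) * cabs (w - a)); last first.
  by rewrite /K; field; rewrite !gt_eqF.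
rewrite ler_wpM2r ?cabs_ge0 //.
have := ltW w2; rewrite ler_pdivlMr; last lra.
apply: le_trans; rewrite mulrC ler_wpM2l ?cabs_ge0 //; lra.
Qed.

Lemma csum_cdiff f a (r B rho : R) : 0 < r -> 0 <= rho < 1 ->
  (forall k w, cabs (w - a) < r -> cdiff (f k) w) ->
  (forall w, cabs (w - a) < r -> geom (f^~ w) B rho) ->
  cdiff (fun w => csum (f^~ w)) a.
Proof.
move=> r0 r1 df gf.
have dl k : cdiff (f k) a by apply: df; rewrite subrr cabs0.
have [l Hl] := choice dl.
by exists (csum l); exact: csum_cderiv r0 r1 df gf Hl.
Qed.

Lemma eps_is_derive (f : R -> R) (x l : R) : (forall e, 0 < e ->
  exists2 d, 0 < d & forall h, `|h| < d -> `|f (x + h) - f x - l * h| <= e * `|h|) ->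
  is_derive x 1 f l.
Proof.
move=> H.
have c : (fun h => h^-1 *: ((f \o shift x) (h *: 1) - f x)) @ 0^' --> l.
  apply/cvgrPdist_le => /= e e0; have [d d0 Hd] := H e e0.
  rewrite /dnbhs /within /=; apply/nbhs_ballP; exists d => // h.
  rewrite /ball /= sub0r normrN => hd h0.
  have h1 : 0 < `|h| by rewrite normr_gt0.
  rewrite /GRing.scale /= mulr1.
  have -> : l - h^-1 * (f (h + x) - f x) = - ((f (x + h) - f x - l * h) / h).
    by rewrite (addrC h); field.
  by rewrite normrN normrM normfV ler_pdivrMr //; exact: Hd.
apply: DeriveDef; first by apply/cvg_ex; exists l.
by apply/cvg_lim.
Qed.

Lemma cderiv0_const (F : C -> C) (r : R) : 0 < r ->
  (forall w, cabs w < r -> cderiv F w 0) -> forall w, cabs w < r -> F w = F 0.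
Proof.
move=> r0 dF w wr.
have [->//|w0] := eqVneq w 0.
have aw : 0 < cabs w by rewrite cabs_gt0.
suff H (phi : C -> R) : (forall x y, phi (x - y) = phi x - phi y) ->
    (forall x, `|phi x| <= cabs x) -> phi (F w) = phi (F 0).
  apply: complex_eq; apply: H => [x y|x]; rewrite ?cReD ?cReN ?cImD ?cImN //.
    exact: cabs_Re.
  exact: cabs_Im.
move=> phiB phile.
pose h (t : R) := phi (F (t%:C * w)).
have dh (t : R) : `|t| * cabs w < r -> is_derive t 1 h 0.
  move=> tr; have tw : cabs (t%:C * w) < r by rewrite cabsM cabs_real.
  apply: eps_is_derive => e e0.
  have e1 : 0 < e / cabs w by rewrite divr_gt0.
  have [d d0 Hd] := dF _ tw _ e1.
  exists (d / cabs w); first by rewrite divr_gt0.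
  move=> s sd; rewrite mul0r subr0 /h -phiB; apply: le_trans (phile _) _.
  have dist : (t + s)%:C * w - t%:C * w = s%:C * w by rewrite realCD; ring.
  have := Hd ((t + s)%:C * w); rewrite dist cabsM cabs_real mul0r subr0.
  have h1 : `|s| * cabs w < d by rewrite -ltr_pdivlMr.
  rewrite (_ : e / cabs w * (`|s| * cabs w) = e * `|s|); first exact.
  by field; rewrite gt_eqF.
have [||c _] := @MVT R h (fun=> 0) 0 1 ltr01.
- move=> t; rewrite in_itv /= => /andP[t0 t1]; apply: dh.
  apply: le_lt_trans wr; rewrite ger0_norm; last exact: ltW.
  by rewrite ler_piMl ?cabs_ge0 // ltW.
- apply: derivable_within_continuous => t; rewrite in_itv /= => /andP[t0 t1].
  have [|hd _] := dh t; last exact: hd.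
  by apply: le_lt_trans wr; rewrite ger0_norm // ler_piMl ?cabs_ge0.
by rewrite mul0r /h mul1r mul0r => /eqP; rewrite subr_eq0 => /eqP.
Qed.

Lemma csum_geometric (x : C) : cabs x < 1 -> csum (fun k => x ^+ k) = (1 - x)^-1.
Proof.
move=> x1; have x0 : 1 - x != 0.
  by rewrite subr_eq0; apply: contraTneq x1 => <-; rewrite cabs1 ltxx.
apply: csum_eq => e e0.
have ax : 0 <= cabs x < 1 by rewrite cabs_ge0.
have [N H] := geom_small (cabs (1 - x))^-1 ax e0; exists N => n /H h.
have -> : psum (fun k => x ^+ k) n = (1 - x ^+ n) / (1 - x).
  by apply: (mulIf x0); rewrite divfK // /psum -[1 - x ^+ n]opprB subrX1 -mulNr opprB mulrC.
have -> : (1 - x ^+ n) / (1 - x) - (1 - x)^-1 = - (x ^+ n / (1 - x)) by field.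
by rewrite cabsN cabsM cabsX cabsV mulrC.
Qed.

Definition logser (x : C) : C := csum (fun k => x ^+ k.+1 / k.+1%:R).

Lemma geom_pow (x : C) : geom (fun k => x ^+ k.+1 / k.+1%:R) (cabs x) (cabs x).
Proof.
move=> k; rewrite cabsM cabsX cabsV cabs_nat exprS ler_piMr ?mulr_ge0 ?exprn_ge0 ?cabs_ge0 //.
by rewrite invf_le1 ?ler1n ?ltr0n.
Qed.

Lemma cderiv_logser (x : C) : cabs x < 1 -> cderiv logser x (1 - x)^-1.
Proof.
move=> x1; rewrite -csum_geometric //.
pose s := (1 + cabs x) / 2; have s1 : s < 1 by rewrite /s; lra.
have s0 : 0 <= s by rewrite divr_ge0 ?addr_ge0 ?cabs_ge0.
apply: (@csum_cderiv (fun k w => w ^+ k.+1 / k.+1%:R) x _ (s - cabs x) s s).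
- by rewrite /s; lra.
- by rewrite s0.
- by move=> k w _; apply: cdiffM; [exact: cdiffX|exact: cdiff_cst].
- move=> w wx k; apply: le_trans (geom_pow w k) _.
  have ws : cabs w <= s by have := cabs_sub_ge w x; lra.
  by rewrite ler_pM ?cabs_ge0 ?exprn_ge0 ?cabs_ge0 // lerXn2r ?nnegrE ?cabs_ge0.
move=> k; have := cderivZ k.+1%:R^-1 (cderivX k.+1 x).
rewrite mulKf ?pnatr_eq0 //=.
by apply: eq_cderiv => w; rewrite mulrC.
Qed.

Lemma cexp_logser (x : C) : cabs x < 1 -> cexp (- logser x) = 1 - x.
Proof.
move=> x1; pose F w := (1 - w) * cexp (logser w).
have dF w : cabs w < 1 -> cderiv F w 0.
  move=> w1; have w0 : 1 - w != 0.
    by rewrite subr_eq0; apply: contraTneq w1 => <-; rewrite cabs1 ltxx.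
  have := cderivM (cderivB (cderiv_cst 1 w) (cderiv_id w))
     (cderiv_comp (cderiv_logser w1) (cderiv_cexp _)).
  by congr cderiv; rewrite sub0r mulN1r mulrCA divff // mulr1 addNr.
have := cderiv0_const ltr01 dF x1; rewrite /F subr0 mul1r.
have -> : logser 0 = 0.
  apply: csum_eq => e e0; exists 0%N => n _; rewrite subr0 /psum big1 ?cabs0 ?ltW //.
  by move=> k _; rewrite expr0n /= mul0r.
rewrite cexp0 cexpN => E; apply: (mulIf (cexp_neq0 (logser x))).
by rewrite mulVf ?cexp_neq0.
Qed.

End Series.

(** * Theta functions and their modular laws *)

Section ThetaSeries.
Variable R : realType.
Local Notation C := R[i].
Implicit Types (z w x q h : C) (tau : C).

Definition e1 z : C := cexp ('i * pi%:C * z).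

Lemma e1D z w : e1 (z + w) = e1 z * e1 w.
Proof. by rewrite /e1 mulrDr cexpD. Qed.

Lemma e1N z : e1 (- z) = (e1 z)^-1.
Proof. by rewrite /e1 mulrN cexpN. Qed.

Lemma e1_neq0 z : e1 z != 0.
Proof. exact: cexp_neq0. Qed.

Lemma e1_0 : e1 0 = 1.
Proof. by rewrite /e1 mulr0 cexp0. Qed.

Lemma e1_1 : e1 1 = -1.
Proof. by rewrite /e1 mulr1 cexp_ipi. Qed.

Lemma e2_e1 z : e2 z = e1 (2 * z).
Proof. by rewrite /e2 /e1; congr cexp; ring. Qed.

Lemma e2_sqr z : e2 z = e1 z * e1 z.
Proof. by rewrite e2_e1 -e1D; congr e1; ring. Qed.

Lemma e1_half : e1 (1 / 2) = 'i%R.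
Proof.
have -> : 1 / 2 = (1 / 2)%:C :> C by rewrite realCM realCV realCn.
rewrite /e1 /cexp (_ : 'i * pi%:C * (1/2)%:C = 0 +i* (pi / 2)).
  by rewrite /= expR0 cos_pihalf sin_pihalf mulr0 mulr1 -complexiE.
by simpc; apply: complex_eq => /=; ring.
Qed.

Lemma cabs_e1 z : cabs (e1 z) = expR (- (pi * complex.Im z)).
Proof.
rewrite /e1 cabs_cexp (_ : 'i * pi%:C = 0 +i* pi); last by simpc.
by congr expR; rewrite cReM /= mul0r sub0r.
Qed.

Lemma cdiff_e1 z : cdiff e1 z.
Proof.
apply: (@cdiff_comp _ (fun z => 'i * pi%:C * z) (@cexp R)); last exact: cdiff_cexp.
by apply: cdiffZ; exact: cdiff_id.
Qed.

Lemma cabs_e2_lt1 z : 0 < complex.Im z -> cabs (e2 z) < 1.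
Proof.
by move=> h; rewrite cabs_e2 expR_lt1 oppr_lt0 mulr_gt0 ?mulr_gt0 ?pi_gt0.
Qed.

Lemma den_bound q n (p : R) : cabs q <= p -> p < 1 -> 1 - p <= cabs (1 - q ^+ n.+1).
Proof.
move=> qp p1; have q1 := le_trans qp (ltW p1); have := cabs_sub_ge 1 (q ^+ n.+1); rewrite cabs1; apply: le_trans.
rewrite lerB // cabsX exprS.
have p0 : 0 <= p by apply: le_trans qp; exact: cabs_ge0.
apply: le_trans qp; rewrite ler_piMr ?cabs_ge0 // exprn_ile1 ?cabs_ge0 //.
Qed.

Lemma den_neq0 q n : cabs q < 1 -> 1 - q ^+ n.+1 != 0.
Proof.
move=> q1; rewrite -cabs_gt0; apply: lt_le_trans (den_bound n (lexx _) q1).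
by rewrite subr_gt0.
Qed.

(* [Lam x q] is minus the logarithm of the product over n >= 1 of
   (1 - x q^n) (1 - q^n / x). *)
Definition lam x q (k : nat) : C :=
  (x ^+ k.+1 + x^-1 ^+ k.+1) * q ^+ k.+1 / (1 - q ^+ k.+1) / k.+1%:R.

Definition Lam x q : C := csum (lam x q).

Lemma geom_lam x q (p s : R) : cabs q <= p -> p < 1 -> cabs (x * q) <= s ->
  cabs (x^-1 * q) <= s -> geom (lam x q) (2 * s / (1 - p)) s.
Proof.
move=> qp p1 s1 s2 k.
have s0 : 0 <= s by apply: le_trans s1; exact: cabs_ge0.
have p0 : 0 < 1 - p by rewrite subr_gt0.
rewrite /lam !cabsM !cabsV cabs_nat.
rewrite (_ : 2 * s / (1 - p) * s ^+ k = 2 * s ^+ k.+1 / (1 - p) * 1); last first.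
  by rewrite exprS; field; rewrite gt_eqF.
rewrite ler_pM ?mulr_ge0 ?invr_ge0 ?cabs_ge0 ?ler0n //; last first.
  by rewrite invf_le1 ?ler1n ?ltr0n.
rewrite ler_pM ?mulr_ge0 ?invr_ge0 ?cabs_ge0 //; last first.
  rewrite lef_pV2 ?posrE //; first exact: den_bound.
  by rewrite cabs_gt0 den_neq0 // (le_lt_trans qp).
rewrite -cabsM mulrDl -!exprMn; apply: le_trans (cabsD _ _) _; rewrite !cabsX.
rewrite (_ : 2 * s ^+ k.+1 = s ^+ k.+1 + s ^+ k.+1); last by ring.
by rewrite lerD // lerXn2r ?nnegrE ?cabs_ge0.
Qed.

Lemma Lam_inv x q : Lam x^-1 q = Lam x q.
Proof. by apply: eq_csum => k; rewrite /lam invrK addrC. Qed.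

Lemma Lam_shift x q : x != 0 -> q != 0 -> cabs q < 1 -> 1 < cabs x -> cabs (x * q) < 1 ->
  Lam (x * q) q = Lam x q - logser (x * q) + logser x^-1.
Proof.
move=> x0 q0 q1 x1 xq1.
have ax : 0 < cabs x by rewrite cabs_gt0.
have vx1 : cabs x^-1 < 1 by rewrite cabsV invf_lt1.
pose s := Num.max (cabs (x * q)) (Num.max (cabs x^-1) (cabs q)).
have s1 : s < 1 by rewrite !gt_max xq1 vx1 q1.
have sxq : cabs (x * q) <= s by rewrite le_max lexx.
have svx : cabs x^-1 <= s by rewrite !le_max lexx orbT.
have sq : cabs q <= s by rewrite !le_max lexx !orbT.
have s0 : 0 <= s by apply: le_trans sq; exact: cabs_ge0.
have s01 : 0 <= s < 1 by rewrite s0.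
have gx : geom (lam x q) (2 * s / (1 - cabs q)) s.
  apply: geom_lam => //; rewrite cabsM; apply: le_trans svx.
  by rewrite ler_piMr ?cabs_ge0 // ltW.
have gp y : cabs y <= s -> geom (fun k => y ^+ k.+1 / k.+1%:R) s s.
  move=> ys k; apply: le_trans (geom_pow y k) _.
  by rewrite ler_pM ?cabs_ge0 ?exprn_ge0 ?cabs_ge0 // lerXn2r ?nnegrE ?cabs_ge0.
have g1 := gp _ sxq; have g2 := gp _ svx.
have g1' : geom (fun k => - ((x * q) ^+ k.+1 / k.+1%:R)) s s.
  by move=> k; rewrite cabsN; exact: g1.
rewrite /Lam /logser -(csumN s01 g1) -(csumD s01 s01 gx g1').
rewrite -(csumD s01 s01 (geomD gx g1') g2); apply: eq_csum => k; rewrite /lam.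
have d0 := den_neq0 k q1.
have n0 : k.+1%:R != 0 :> C by rewrite pnatr_eq0.
rewrite invfM !exprMn !exprVn; move: d0 n0.
have : x ^+ k.+1 != 0 by rewrite expf_neq0.
have : q ^+ k.+1 != 0 by rewrite expf_neq0.
move: (q ^+ k.+1) (x ^+ k.+1) (k.+1%:R) => Q X K Q0 X0 d0 K0.
by field; rewrite Q0 X0 d0 K0.
Qed.

Lemma cdiff_Lam tau z : 0 < complex.Im tau ->
  - complex.Im tau < complex.Im z < complex.Im tau ->
  cdiff (fun z => Lam (e2 z) (e2 tau)) z.
Proof.
move=> t0 zt; set q := e2 tau.
have q1 : cabs q < 1 by exact: cabs_e2_lt1.
have az : `|complex.Im z| < complex.Im tau by rewrite ltr_norml.
pose r := (complex.Im tau - `|complex.Im z|) / 2.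
have r0 : 0 < r by rewrite /r; lra.
have rE : 2 * r = complex.Im tau - `|complex.Im z| by rewrite /r; field.
pose s := expR (- (2 * pi * r)).
have pi0 := @pi_gt0 R; have p20 : 0 < 2 * pi :> R by rewrite mulr_gt0.
have s1 : s < 1 by rewrite expR_lt1 oppr_lt0 mulr_gt0.
have s0 : 0 < s by exact: expR_gt0.
apply: (@csum_cdiff _ (fun k w => lam (e2 w) q k) z r (2 * s / (1 - cabs q)) s) => //.
- by rewrite ltW.
- move=> k w _; apply: cdiffM; last exact: cdiff_cst.
  apply: cdiffM; last exact: cdiff_cst.
  apply: cdiffM; last exact: cdiff_cst.
  apply: cdiffD; last first.
    apply: (@cdiff_comp _ (fun w => (e2 w)^-1) (fun v => v ^+ k.+1)); last exact: cdiffX.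
    by apply: cdiffV; [exact: e2_neq0|exact: cdiff_e2].
  by apply: (@cdiff_comp _ (@e2 R) (fun v => v ^+ k.+1)); [exact: cdiff_e2|exact: cdiffX].
move=> w wz.
have hI := le_lt_trans (cabs_Im _) wz; rewrite cImD cImN in hI.
have hw : `|complex.Im w| <= `|complex.Im z| + r.
  rewrite -[complex.Im w](subrK (complex.Im z)) addrC; apply: le_trans (ler_normD _ _) _.
  by rewrite lerD2l ltW.
have := ler_norm (complex.Im w); have := ler_norm (- complex.Im w); rewrite normrN => h1 h2.
apply: geom_lam => //; rewrite ?cabsM ?cabsV !cabs_e2 -?expRN ?opprK -expRD ler_expR.
  by rewrite -opprD lerN2 -mulrDr ler_pM2l //; lra.
rewrite -lerN2 opprK opprD opprK addrC -mulrBr ler_pM2l //; lra.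
Qed.

(* Jacobi's triple product for theta_1, up to a factor depending only on [tau]. *)
Definition th z tau : C := (e1 z - e1 (- z)) * cexp (- Lam (e2 z) (e2 tau)).

Lemma th_odd z tau : th (- z) tau = - th z tau.
Proof. by rewrite /th opprK e2N Lam_inv -mulNr opprB. Qed.

Lemma th_add1 z tau : th (z + 1) tau = - th z tau.
Proof.
rewrite /th e2D1 -mulNr; congr (_ * _).
by rewrite opprD !e1D (e1N 1) e1_1 invrN1 !mulrN1; ring.
Qed.

Lemma e1_factor z : e1 z - e1 (- z) = - e1 (- z) * (1 - e2 z).
Proof.
by rewrite e2_sqr mulrBr mulr1 mulNr mulrA -e1D addNr e1_0; ring.
Qed.

Lemma th_addtau z tau : 0 < complex.Im tau ->
  - complex.Im tau < complex.Im z < 0 ->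
  th (z + tau) tau = - e1 (- (2 * z) - tau) * th z tau.
Proof.
move=> t0 /andP[z1 z2]; rewrite /th e2D.
have pi0 := @pi_gt0 R; have p20 : 0 < 2 * pi :> R by rewrite mulr_gt0.
have xq1 : cabs (e2 z * e2 tau) < 1 by rewrite -e2D cabs_e2_lt1 // cImD; lra.
have x1 : 1 < cabs (e2 z).
  by rewrite cabs_e2 expR_gt1 -mulrN mulr_gt0 // oppr_gt0.
have vx1 : cabs (e2 z)^-1 < 1 by rewrite cabsV invf_lt1 // cabs_gt0 e2_neq0.
rewrite Lam_shift ?e2_neq0 ?cabs_e2_lt1 //.
have negE (a b c : C) : - (a - b + c) = - a + b + - c by ring.
rewrite negE {negE}.
rewrite !cexpD (cexp_logser vx1).
rewrite (e1_factor (z + tau)) e2D -[1 - e2 z * _](cexp_logser xq1).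
have -> : 1 - (e2 z)^-1 = e1 (- z) * (e1 z - e1 (- z)).
  by rewrite mulrBr -!e1D addNr e1_0 -e2N e2_e1; congr (1 - e1 _); ring.
have -> : e1 (- (2 * z) - tau) = e1 (- (z + tau)) * e1 (- z).
  by rewrite -e1D; congr e1; ring.
rewrite cexpN; have := cexp_neq0 (logser (e2 z * e2 tau)) => n0.
by field.
Qed.

(* [Mser h] is minus the logarithm of the product over odd n >= 1 of (1 - h^n)^2. *)
Definition Mser h : C := csum (fun k => 2 * h ^+ k.+1 / (1 - h ^+ k.+1 ^+ 2) / k.+1%:R).

Lemma geom_Mser h (p : R) : cabs h <= p -> p < 1 ->
  geom (fun k => 2 * h ^+ k.+1 / (1 - h ^+ k.+1 ^+ 2) / k.+1%:R) (2 * p / (1 - p)) p.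
Proof.
move=> hp p1 k.
have p00 : 0 <= p by apply: le_trans hp; exact: cabs_ge0.
have p0 : 0 < 1 - p by rewrite subr_gt0.
rewrite -exprM mulnC; have -> : (2 * k.+1 = (2 * k).+1.+1)%N by lia.
rewrite !cabsM !cabsV !cabs_nat.
rewrite (_ : 2 * p / (1 - p) * p ^+ k = 2 * p ^+ k.+1 / (1 - p) * 1); last first.
  by rewrite exprS; field; rewrite gt_eqF.
rewrite ler_pM ?mulr_ge0 ?invr_ge0 ?cabs_ge0 ?ler0n //; last first.
  by rewrite invf_le1 ?ler1n ?ltr0n.
rewrite ler_pM ?mulr_ge0 ?invr_ge0 ?cabs_ge0 //; last first.
  rewrite lef_pV2 ?posrE //; first exact: den_bound.
  by rewrite cabs_gt0 den_neq0 // (le_lt_trans hp).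
by rewrite ler_pM2l // cabsX lerXn2r ?nnegrE ?cabs_ge0.
Qed.

Lemma Lam_half h : h != 0 -> cabs h < 1 -> Lam h (h ^+ 2) + logser h = Mser h.
Proof.
move=> h0 h1; rewrite /Lam /Mser /logser.
have h01 : 0 <= cabs h < 1 by rewrite cabs_ge0.
have hh : cabs (h ^+ 2) <= cabs h.
  by rewrite cabsX expr2 ler_piMr ?cabs_ge0 // ltW.
have g : geom (lam h (h ^+ 2)) (2 * cabs h / (1 - cabs h)) (cabs h).
  apply: geom_lam => //.
    apply: le_trans hh; rewrite cabsM ler_piMl ?cabs_ge0 // ltW //.
  by rewrite expr2 mulKf.
rewrite -(csumD h01 h01 g (geom_pow h)); apply: eq_csum => k; rewrite /lam.
have d0 : 1 - h ^+ k.+1 ^+ 2 != 0.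
  rewrite -exprM mulnC; have -> : (2 * k.+1 = (2 * k).+1.+1)%N by lia.
  exact: den_neq0.
have n0 : k.+1%:R != 0 :> C by rewrite pnatr_eq0.
rewrite -exprM mulnC exprM exprVn; move: d0 n0.
have : h ^+ k.+1 != 0 by rewrite expf_neq0.
move: (h ^+ k.+1) (k.+1%:R) => X K X0 d0 K0.
by field; rewrite X0 d0 K0.
Qed.

End ThetaSeries.

Section Torus.
Variable R : realType.
Local Notation C := R[i].
Implicit Types (z w : C) (F : C -> C).

Lemma gcont_max F (x1 x2 y1 y2 : R) : gcont F -> x1 <= x2 -> y1 <= y2 ->
  exists x0 y0, [/\ x1 <= x0 <= x2, y1 <= y0 <= y2 &
    forall x y, x1 <= x <= x2 -> y1 <= y <= y2 ->
      cabs (F (x +i* y)) <= cabs (F (x0 +i* y0))].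
Proof.
move=> cF x12 y12.
pose A : set (R * R) := `[x1, x2]%classic `*` `[y1, y2]%classic.
have cA : compact A by apply: compact_setX; exact: segment_compact.
pose f (p : R * R) : R := cabs (F (p.1 +i* p.2)).
have cf : continuous f.
  move=> p; apply/cvgrPdist_lt => e e0.
  have [d d0 Hd] := cF (p.1 +i* p.2) e e0.
  have d2 : 0 < d / 2 by rewrite divr_gt0.
  exists (ball p.1 (d / 2), ball p.2 (d / 2)).
    by split; exact: nbhsx_ballx.
  move=> q [] /=; rewrite /ball /= => q1 q2; apply: le_lt_trans (cabs_dist _ _) _.
  rewrite cabs_sym; apply: Hd; apply: le_lt_trans (cabs_ReIm _) _.
  by rewrite /= distrC (distrC q.2); lra.
have A0 : A !=set0.
  by exists (x1, y1); split; rewrite /= in_itv /= lexx ?x12 ?y12.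
have [[x0 y0]] := compact_EVT_max A0 cA (continuous_subspaceT cf).
rewrite inE => -[] /=; rewrite !in_itv /= => h1 h2 H.
exists x0, y0; split=> // x y xx yy; apply: (H (x, y)).
by rewrite inE; split; rewrite /= in_itv.
Qed.

Lemma floor_eq (x : R) (n : int) : n%:~R <= x < n%:~R + 1 -> Num.floor x = n.
Proof. by move=> h; apply: floor_def; rewrite intrD. Qed.

Variable tau : C.
Hypothesis tau0 : 0 < complex.Im tau.

(* Coordinates of [z] in the real basis (1, tau): z = sc z + tc z * tau. *)
Definition tc z : R := complex.Im z / complex.Im tau.
Definition sc z : R := complex.Re z - tc z * complex.Re tau.

Lemma tcD z w : tc (z + w) = tc z + tc w.
Proof. by rewrite /tc cImD mulrDl. Qed.
Lemma scD z w : sc (z + w) = sc z + sc w.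
Proof. by rewrite /sc tcD cReD; ring. Qed.
Lemma tc_real (x : R) : tc x%:C = 0.
Proof. by rewrite /tc cImR mul0r. Qed.
Lemma sc_real (x : R) : sc x%:C = x.
Proof. by rewrite /sc tc_real mul0r subr0. Qed.
Lemma tc_tau (x : R) : tc (x%:C * tau) = x.
Proof. by rewrite /tc cImZ mulfK // gt_eqF. Qed.
Lemma sc_tau (x : R) : sc (x%:C * tau) = 0.
Proof. by rewrite /sc tc_tau cReZ subrr. Qed.
Lemma tcN z : tc (- z) = - tc z.
Proof. by rewrite /tc cImN mulNr. Qed.
Lemma scN z : sc (- z) = - sc z.
Proof. by rewrite /sc tcN cReN; ring. Qed.
Lemma sctcE z : z = (sc z)%:C + (tc z)%:C * tau.
Proof.
have Im0 : complex.Im tau != 0 by rewrite gt_eqF.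
apply: complex_eq; rewrite ?cReD ?cImD ?cReZ ?cImZ /sc /tc /=; first ring.
by rewrite add0r divfK.
Qed.

Definition red z : C := z - (Num.floor (sc z + 1/2))%:~R%:C
   - (Num.floor (tc z + 1/2))%:~R%:C * tau.

Lemma sc_red z : -(1/2) <= sc (red z) <= 1/2.
Proof.
rewrite /red !scD !scN sc_real sc_tau.
have := floor_le (sc z + 1/2); have := floorD1_gt (sc z + 1/2).
rewrite intrD; lra.
Qed.

Lemma tc_red z : -(1/2) <= tc (red z) <= 1/2.
Proof.
rewrite /red !tcD !tcN tc_real tc_tau.
have := floor_le (tc z + 1/2); have := floorD1_gt (tc z + 1/2).
rewrite intrD; lra.
Qed.

Lemma red_shift z (n m : int) : red (z + n%:~R%:C + m%:~R%:C * tau) = red z.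
Proof.
rewrite /red !scD !tcD !sc_real !tc_real sc_tau tc_tau !addr0.
have sh (x y : R) (k : int) : x = y + k%:~R -> Num.floor x = Num.floor y + k.
  move=> ->; apply: floor_eq; rewrite intrD.
  have := floor_le y; have := floorD1_gt y; rewrite intrD; lra.
rewrite (sh (sc z + n%:~R + 1/2) (sc z + 1/2) n); last by ring.
rewrite (sh (tc z + m%:~R + 1/2) (tc z + 1/2) m); last by ring.
by rewrite !intrD !realCD; ring.
Qed.

Lemma torus_const F :
  (forall z, -1 < sc z < 1 -> -1 < tc z < 1 -> cdiff F z) ->
  (forall z, -1 < sc z < 0 -> -1 < tc z < 1 -> F (z + 1) = F z) ->
  (forall z, -1 < sc z < 1 -> -1 < tc z < 0 -> F (z + tau) = F z) ->
  forall z w, -1 < sc z < 1 -> -1 < tc z < 1 -> -1 < sc w < 1 -> -1 < tc w < 1 ->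
  F z = F w.
Proof.
move=> dF per1 pert.
pose G z := F (red z).
have one1 : 1 = (1 : R)%:C by [].
have tau1 : tau = (1 : R)%:C * tau by rewrite mul1r.
have sc1 z : sc (z + 1) = sc z + 1 by rewrite scD one1 sc_real.
have tc1 z : tc (z + 1) = tc z by rewrite tcD one1 tc_real addr0.
have sct z : sc (z + tau) = sc z by rewrite scD {1}tau1 sc_tau addr0.
have tct z : tc (z + tau) = tc z + 1 by rewrite tcD {1}tau1 tc_tau.
have GD z : -1 < sc z < 1 -> -1 < tc z < 1 -> G z = F z.
  move=> sz tz; rewrite /G /red.
  set n := Num.floor _; set m := Num.floor _.
  have step1 : F (z - n%:~R%:C) = F z /\ -1 < sc (z - n%:~R%:C) < 1.
    have [h|h] := ltP (sc z) (-(1/2)).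
      have -> : n = -1 by apply: floor_eq; rewrite mulrN1z; lra.
      rewrite mulrN1z realCN opprK -one1 sc1; split; last lra.
      by apply: per1 => //; lra.
    have [h'|h'] := ltP (sc z) (1/2).
      have -> : n = 0 by apply: floor_eq; rewrite mulr0z; lra.
      by rewrite mulr0z subr0.
    have -> : n = 1 by apply: floor_eq; rewrite mulr1z; lra.
    rewrite mulr1z -one1.
    have s' : sc (z - 1) = sc z - 1 by rewrite scD scN one1 sc_real.
    have t' : tc (z - 1) = tc z by rewrite tcD tcN one1 tc_real subr0.
    rewrite s'; split; last lra.
    by rewrite -[z in RHS](subrK 1) per1 ?s' ?t' //; lra.
  case: step1 => <-; set z' := z - n%:~R%:C => sz'.
  have tz' : tc z' = tc z by rewrite tcD tcN tc_real subr0.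
  have [h|h] := ltP (tc z) (-(1/2)).
    have -> : m = -1 by apply: floor_eq; rewrite mulrN1z; lra.
    rewrite mulrN1z realCN mulNr opprK -one1 mul1r.
    by apply: pert => //; rewrite tz'; lra.
  have [h'|h'] := ltP (tc z) (1/2).
    have -> : m = 0 by apply: floor_eq; rewrite mulr0z; lra.
    by rewrite mulr0z mul0r subr0.
  have -> : m = 1 by apply: floor_eq; rewrite mulr1z; lra.
  rewrite mulr1z -one1 mul1r.
  have s' : sc (z' - tau) = sc z' by rewrite scD scN {1}tau1 sc_tau subr0.
  have t' : tc (z' - tau) = tc z - 1 by rewrite tcD tcN tz' {1}tau1 tc_tau.
  by rewrite -[z' in RHS](subrK tau) pert ?s' ?t' //; lra.
have Gsh z (n m : int) : G (z + n%:~R%:C + m%:~R%:C * tau) = G z.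
  by rewrite /G red_shift.
have K0 : 0 < 1 / complex.Im tau + 1 + `|complex.Re tau| / complex.Im tau.
  by rewrite -addrA ltr_pwDl ?divr_gt0 // addr_ge0 // divr_ge0 // ltW.
set K := 1 / _ + 1 + _ in K0.
have dist z w : cabs (w - z) < 1 / 2 / K -> `|sc w - sc z| < 1/2 /\ `|tc w - tc z| < 1/2.
  rewrite ltr_pdivlMr // => h.
  have b1 : `|tc w - tc z| <= cabs (w - z) / complex.Im tau.
    rewrite -tcN -tcD /tc normrM normfV (gtr0_norm tau0) ler_pM2r ?invr_gt0 //.
    exact: cabs_Im.
  have b2 : `|sc w - sc z| <= cabs (w - z) + cabs (w - z) / complex.Im tau * `|complex.Re tau|.
    rewrite -scN -scD /sc; apply: le_trans (ler_normB _ _) _; apply: lerD; first exact: cabs_Re.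
    by rewrite normrM ler_wpM2r // tcD tcN.
  have E : cabs (w - z) * K = cabs (w - z) / complex.Im tau + cabs (w - z)
     + cabs (w - z) / complex.Im tau * `|complex.Re tau|.
    by rewrite /K; field; rewrite gt_eqF.
  have p1 : 0 <= cabs (w - z) by exact: cabs_ge0.
  have p2 : 0 <= cabs (w - z) / complex.Im tau by rewrite divr_ge0 // ltW.
  have p3 : 0 <= cabs (w - z) / complex.Im tau * `|complex.Re tau| by rewrite mulr_ge0.
  by split; lra.
have dG z : cdiff G z.
  pose n := Num.floor (sc z + 1/2); pose m := Num.floor (tc z + 1/2).
  have zr : z - n%:~R%:C - m%:~R%:C * tau = red z by [].
  have r0 : 0 < 1 / 2 / K by rewrite !divr_gt0.
  apply: (cdiff_near (f := fun w => F (w - n%:~R%:C - m%:~R%:C * tau)) r0).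
    move=> w wz.
    have -> : G w = G (w - n%:~R%:C - m%:~R%:C * tau).
      have := Gsh (w - n%:~R%:C - m%:~R%:C * tau) n m.
      have -> : w - n%:~R%:C - m%:~R%:C * tau + n%:~R%:C + m%:~R%:C * tau = w by ring.
      by [].
    have [] := dist (red z) (w - n%:~R%:C - m%:~R%:C * tau).
      have -> : w - n%:~R%:C - m%:~R%:C * tau - red z = w - z by rewrite -zr; ring.
      by [].
    rewrite !ltr_norml; have := sc_red z; have := tc_red z => h1 h2 h3 h4.
    by rewrite GD //; lra.
  apply: (@cdiff_comp _ (fun w => w - n%:~R%:C - m%:~R%:C * tau) F).
    by apply: cdiffB; [apply: cdiffB; [exact: cdiff_id|exact: cdiff_cst]|exact: cdiff_cst].
  rewrite zr; have := sc_red z; have := tc_red z => h1 h2.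
  by apply: dF; lra.
have cG' : gcont (fun w => G ((complex.Re w)%:C + (complex.Im w)%:C * tau)).
  move=> w; apply: (@ccont_comp _ (fun w => (complex.Re w)%:C + (complex.Im w)%:C * tau) G).
    apply: ccontD.
      move=> e e0; exists e => // v; apply: le_lt_trans.
      by rewrite -realCN -realCD cabs_real -cReN -cReD cabs_Re.
    apply: ccontM; last exact: ccont_cst.
    move=> e e0; exists e => // v; apply: le_lt_trans.
    by rewrite -realCN -realCD cabs_real -cImN -cImD cabs_Im.
  exact: cdiff_cont.
have hh : -(1/2) <= 1/2 :> R by lra.
have [x0 [y0 [_ _ HM]]] := gcont_max cG' hh hh.
set M := cabs _ in HM.
have GM z : cabs (G z) <= M.
  have := HM _ _ (sc_red z) (tc_red z) => /=; rewrite -sctcE.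
  by rewrite GD //; [have := sc_red z; lra|have := tc_red z; lra].
have Gper z : G (z + 1) = G z.
  by have := Gsh z 1 0; rewrite mulr1z mulr0z mul0r addr0 -one1.
move=> z w s1 t1 s2 t2.
by rewrite -(GD z) // -(GD w) //; exact: liouville_periodic dG Gper GM z w.
Qed.

End Torus.

Section ThetaBasics.
Variable R : realType.
Local Notation C := R[i].
Implicit Types (z w tau : C).

Definition Sinv tau : C := - tau^-1.

Lemma Im_Sinv tau : complex.Im (Sinv tau) = complex.Im tau / cabs tau ^+ 2.
Proof. by rewrite cImN cImV mulNr opprK. Qed.

Lemma upper_neq0 tau : 0 < complex.Im tau -> tau != 0.
Proof. by apply: contraTneq => ->; rewrite /= ltxx. Qed.

Lemma upper_Sinv tau : 0 < complex.Im tau -> 0 < complex.Im (Sinv tau).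
Proof.
move=> t0; rewrite Im_Sinv divr_gt0 // exprn_gt0 // cabs_gt0.
exact: upper_neq0.
Qed.

Lemma SinvK : involutive Sinv.
Proof. by move=> tau; rewrite /Sinv invrN invrK opprK. Qed.

Definition sh z : C := e1 z - e1 (- z).

Lemma cdiff_sh z : cdiff sh z.
Proof.
apply: cdiffB; first exact: cdiff_e1.
apply: (@cdiff_comp _ (fun z => - z) (@e1 R)); last exact: cdiff_e1.
by apply: cdiffN; exact: cdiff_id.
Qed.

Lemma cderiv_sh0 : cderiv sh 0 (2 * ('i * pi%:C)).
Proof.
pose k : C := 'i * pi%:C.
have d1 : cderiv (@e1 R) 0 k.
  have dl : cderiv (fun w => k * w) 0 k by have := cderivZ k (cderiv_id 0); rewrite mulr1.
  have := cderiv_comp dl (cderiv_cexp _); rewrite mulr0 cexp0 mul1r; exact.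
have d2 : cderiv (fun z : C => e1 (- z)) 0 (- k).
  have dl : cderiv (fun w : C => - w) 0 (- 1) by exact: cderivN (cderiv_id 0).
  have d1' := d1; rewrite -oppr0 in d1'.
  by have := cderiv_comp dl d1'; rewrite mulrN1.
have := cderivB d1 d2; rewrite opprK.
by congr cderiv; rewrite /k; ring.
Qed.

Lemma sh_eq0 z : sh z = 0 -> exists n : int, z = n%:~R.
Proof.
move=> /eqP; rewrite subr_eq0 => /eqP E; apply: e2_eq1.
by rewrite e2_sqr {2}E -e1D subrr e1_0.
Qed.

Lemma thE z tau : th z tau = sh z * cexp (- Lam (e2 z) (e2 tau)).
Proof. by []. Qed.

End ThetaBasics.

Section ThetaValues.
Variable R : realType.
Local Notation C := R[i].
Implicit Types (z w tau : C).

Lemma th_half tau : 0 < complex.Im tau ->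
  th (tau / 2) tau = - e1 (- (tau / 2)) * cexp (- Mser (e1 tau)).
Proof.
move=> t0; rewrite /th e1_factor.
have h0 : e2 (tau / 2) = e1 tau by rewrite e2_e1; congr e1; field.
have hq : e2 tau = e1 tau ^+ 2 by rewrite e2_sqr expr2.
have h1 : cabs (e1 tau) < 1.
  by rewrite cabs_e1 expR_lt1 oppr_lt0 mulr_gt0 ?pi_gt0.
have E : cexp (- Lam (e1 tau) (e1 tau ^+ 2)) * (1 - e1 tau) = cexp (- Mser (e1 tau)).
  by rewrite -(cexp_logser h1) -cexpD -opprD Lam_half ?e1_neq0.
by rewrite h0 hq -E; ring.
Qed.

Lemma e1_Nhalf : e1 (- (1 / 2)) = - 'i :> C.
Proof.
rewrite e1N e1_half; apply: (mulIf (x := 'i%R : C)); first by rewrite -cabs_gt0 cabs_i.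
by rewrite mulVf -?cabs_gt0 ?cabs_i // mulNr -expr2 sqrCi opprK.
Qed.

Lemma th_half1 tau : 0 < complex.Im tau ->
  th (1 / 2 + tau / 2) tau = 'i * e1 (- (tau / 2)) * cexp (- Mser (- e1 tau)).
Proof.
move=> t0; rewrite /th.
have h0 : e2 (1 / 2 + tau / 2) = - e1 tau.
  rewrite e2_e1 (_ : 2 * _ = 1 + tau); last by field.
  by rewrite e1D e1_1 mulN1r.
have hq : e2 tau = (- e1 tau) ^+ 2 by rewrite sqrrN e2_sqr expr2.
have h1 : cabs (- e1 tau) < 1.
  by rewrite cabsN cabs_e1 expR_lt1 oppr_lt0 mulr_gt0 ?pi_gt0.
have -> : e1 (1 / 2 + tau / 2) - e1 (- (1 / 2 + tau / 2)) =
   'i * e1 (- (tau / 2)) * (1 - - e1 tau).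
  rewrite opprD !e1D e1_half e1_Nhalf.
  have -> : e1 (tau / 2) = e1 (- (tau / 2)) * e1 tau by rewrite -e1D; congr e1; field.
  by ring.
have E : cexp (- Lam (- e1 tau) ((- e1 tau) ^+ 2)) * (1 - - e1 tau) = cexp (- Mser (- e1 tau)).
  by rewrite -(cexp_logser h1) -cexpD -opprD Lam_half ?oppr_eq0 ?e1_neq0.
by rewrite h0 hq -E; ring.
Qed.

Lemma th_one_half tau : th (1 / 2) tau = 2 * 'i * cexp (- Lam (-1) (e2 tau)).
Proof.
rewrite /th e1_half e1_Nhalf e2_e1 (_ : 2 * (1 / 2) = 1); last by field.
by rewrite e1_1; congr (_ * _); ring.
Qed.

(* Logarithms of theta_2 / eta, theta_4 / eta, theta_3 / eta and eta^2. *)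
Definition W2 tau : C := (ln 2)%:C + 'i * pi%:C * (tau / 6) - Lam (-1) (e2 tau).
Definition W4 tau : C := - ('i * pi%:C * (tau / 12)) - Mser (e1 tau).
Definition W3 tau : C := - ('i * pi%:C * (tau / 12)) - Mser (- e1 tau).
Definition l0 tau : C := 'i * pi%:C * (tau / 6) - Lam 1 (e2 tau).

Lemma cexp_W2 tau : cexp (W2 tau) = 2 * e1 (tau / 6) * cexp (- Lam (-1) (e2 tau)).
Proof.
rewrite /W2 !cexpD -/(e1 _); congr (_ * _ * _).
by rewrite cexp_real lnK ?posrE // realCn.
Qed.

Lemma cexp_W4 tau : cexp (W4 tau) = e1 (- (tau / 12)) * cexp (- Mser (e1 tau)).
Proof. by rewrite /W4 cexpD -mulrN. Qed.

Lemma cexp_W3 tau : cexp (W3 tau) = e1 (- (tau / 12)) * cexp (- Mser (- e1 tau)).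
Proof. by rewrite /W3 cexpD -mulrN. Qed.

Lemma cexp_l0 tau : cexp (l0 tau) = e1 (tau / 6) * cexp (- Lam 1 (e2 tau)).
Proof. by rewrite /l0 cexpD. Qed.

End ThetaValues.

Local Opaque csum cexp Lam Mser e1 e2 th W2 W3 W4 l0.

Section ThetaLaws.
Variable R : realType.
Local Notation C := R[i].
Implicit Types (z w tau : C).

Variable tau : C.
Hypothesis tau0 : 0 < complex.Im tau.
Let sig := Sinv tau.
Let tn0 : tau != 0 := upper_neq0 tau0.
Let sig0 : 0 < complex.Im sig := upper_Sinv tau0.

Let Im_zt z : complex.Im (z / tau) = - sc tau z * complex.Im sig.
Proof.
have Im0 : complex.Im tau != 0 by rewrite gt_eqF.
have a0 : cabs tau != 0 by rewrite cabs_eq0.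
rewrite Im_Sinv cImM cReV cImV /sc /tc.
by field; rewrite Im0 a0.
Qed.

Let ImE z : complex.Im z = tc tau z * complex.Im tau.
Proof. by rewrite /tc divfK // gt_eqF. Qed.

Let sh_n0 z : -1 < sc tau z < 1 -> -1 < tc tau z < 1 -> z != 0 -> sh z != 0.
Proof.
move=> s1 t1; apply: contra => /eqP/sh_eq0[n zn].
move: s1; rewrite zn -(rmorph_int (real_complex R)) sc_real => /andP[n1 n2].
have : `|n%:~R| < 1 :> R by rewrite ltr_norml n1 n2.
rewrite -intr_norm -[1]/(1%:~R) ltr_int => h.
by have -> : n = 0 by case: (n) h => [[|?]|?].
Qed.

(* The quotient th (z / tau) (-1 / tau) * e1 (- z^2 / tau) / th z tau, with its
   singularity at 0 removed; it is elliptic without poles, hence constant. *)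
Definition thquo z : C :=
  (if z == 0 then tau^-1 else sh (z / tau) / sh z) *
  (cexp (- Lam (e2 (z / tau)) (e2 sig)) * cexp (Lam (e2 z) (e2 tau)) *
   e1 (- (z ^+ 2 / tau))).

Lemma cexpNV z : cexp z = (cexp (- z))^-1.
Proof. by rewrite cexpN invrK. Qed.

Lemma quo_rearrange (s t a b e : C) : s / t * (a / b * e) = s * a * e / (t * b).
Proof. by rewrite invfM; ring. Qed.

Lemma quo_cancel (t e g T : C) : e != 0 -> - t * (e * g) / (- e * T) = t * g / T.
Proof.
by move=> e0; rewrite !mulNr invrN mulrN opprK mulrCA -mulf_div divff // mul1r.
Qed.

Lemma sub1_scale (a b : R) : 0 < b -> -1 < a < 1 -> - b < a * b < b.
Proof. by move=> b0 /andP[a1 a2]; apply/andP; split; nra. Qed.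

Lemma sub0_scale (a b : R) : 0 < b -> -1 < a < 0 -> - b < a * b < 0.
Proof. by move=> b0 /andP[a1 a2]; apply/andP; split; nra. Qed.

Let thquoE z : z != 0 -> thquo z = th (z / tau) sig * e1 (- (z ^+ 2 / tau)) / th z tau.
Proof.
move=> z0; rewrite /thquo (negPf z0) !thE -quo_rearrange.
by rewrite [cexp (Lam (e2 z) _)]cexpNV.
Qed.

Let cdiff_thquo z : -1 < sc tau z < 1 -> -1 < tc tau z < 1 -> cdiff thquo z.
Proof.
pose A z := if z == 0 then tau^-1 else sh (z / tau) / sh z.
have dzt w : cdiff (fun w => w / tau) w.
  by apply: cdiffM; [exact: cdiff_id|exact: cdiff_cst].
have dA w : w != 0 -> -1 < sc tau w < 1 -> -1 < tc tau w < 1 -> cdiff A w.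
  move=> w0 s1 t1; have aw : 0 < cabs w by rewrite cabs_gt0.
  apply: (cdiff_near (f := fun z => sh (z / tau) / sh z) aw).
    by move=> v vw; rewrite /A; case: eqP vw => // ->; rewrite sub0r cabsN ltxx.
  apply: cdiffM.
    by apply: (@cdiff_comp _ (fun w => w / tau) (@sh R)); [exact: dzt|exact: cdiff_sh].
  by apply: cdiffV; [exact: sh_n0|exact: cdiff_sh].
have cA0 : ccont A 0.
  have [p [pE cp p0]] := (cderivP _ _ _).1 (@cderiv_sh0 R).
  have sh00 : sh (0 : C) = 0 by rewrite /sh (@oppr0 C) subrr.
  have {}pE w : sh w = p w * w by rewrite pE sh00 add0r subr0.
  have k0 : p 0 != 0.
    rewrite p0 -cabs_gt0 !cabsM cabs_i cabs_real cabs_nat mul1r.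
    by rewrite mulr_gt0 // gtr0_norm pi_gt0.
  have ak : 0 < cabs (p 0) by rewrite cabs_gt0.
  have [d d0 Hd] := cp _ ak.
  apply: (ccont_near (f := fun w => p (w / tau) / (tau * p w)) d0).
    move=> w /Hd h; have pw : p w != 0.
      by apply: contraTneq h => ->; rewrite sub0r cabsN ltxx.
    rewrite /A; case: eqP => [->|/eqP w0]; first by rewrite mul0r; field; rewrite tn0 k0.
    by rewrite !pE; field; rewrite tn0 pw w0.
  apply: ccontM.
    apply: (@ccont_comp _ (fun w => w / tau) p); first by apply: cdiff_cont; exact: dzt.
    by rewrite mul0r.
  apply: ccontV; first by rewrite mulf_neq0.
  by apply: ccontM => //; exact: ccont_cst.
have small : exists2 r, 0 < r & forall w, cabs w < r ->
    -1 < sc tau w < 1 /\ -1 < tc tau w < 1.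
  have ct : ccont (fun w => (tc tau w)%:C) 0.
    have -> : (fun w => (tc tau w)%:C) = (fun w => (complex.Im w)%:C * (complex.Im tau)%:C^-1).
      by apply/funext => w; rewrite /tc realCM realCV.
    apply: ccontM; last exact: ccont_cst.
    by move=> e e0; exists e => // w; rewrite !subr0 cabs_real; exact: le_lt_trans (cabs_Im w).
  have cs : ccont (fun w => (sc tau w)%:C) 0.
    have -> : (fun w => (sc tau w)%:C) = (fun w => (complex.Re w)%:C - (tc tau w)%:C * (complex.Re tau)%:C).
      by apply/funext => w; rewrite /sc realCD realCN realCM.
    apply: ccontB; last by apply: ccontM => //; exact: ccont_cst.
    by move=> e e0; exists e => // w; rewrite !subr0 cabs_real; exact: le_lt_trans (cabs_Re w).
  have [d1 d10 H1] := ct _ ltr01; have [d2 d20 H2] := cs _ ltr01.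
  exists (Num.min d1 d2); first by rewrite lt_min d10.
  move=> w; rewrite lt_min => /andP[w1 w2].
  have := H1 w; rewrite subr0 => /(_ w1).
  have := H2 w; rewrite subr0 => /(_ w2).
  rewrite -!realCN -!realCD !cabs_real.
  have t00 : tc tau 0 = 0 by rewrite /tc mul0r.
  have s00 : sc tau 0 = 0 by rewrite /sc t00 mul0r subrr.
  by rewrite t00 s00 !subr0 !ltr_norml.
move=> s1 t1; apply: cdiffM.
  have [->|z0] := eqVneq z 0; last exact: dA.
  have [r r0 Hr] := small; apply: (removable_cont r0) => // w w0; rewrite subr0.
  by move=> /Hr[? ?]; exact: dA.
have Iz1 : - complex.Im tau < complex.Im z < complex.Im tau by rewrite (ImE z); exact: sub1_scale.
have Iz2 : - complex.Im sig < complex.Im (z / tau) < complex.Im sig by rewrite Im_zt; apply: sub1_scale => //; lra.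
apply: cdiffM; first apply: cdiffM.
- apply: (@cdiff_comp _ (fun z => - Lam (e2 (z / tau)) (e2 sig)) (@cexp R)); last exact: cdiff_cexp.
  apply: cdiffN; apply: (@cdiff_comp _ (fun z => z / tau) (fun z => Lam (e2 z) (e2 sig))) => //.
  exact: cdiff_Lam.
- apply: (@cdiff_comp _ (fun z => Lam (e2 z) (e2 tau)) (@cexp R)); last exact: cdiff_cexp.
  exact: cdiff_Lam.
apply: (@cdiff_comp _ (fun z => - (z ^+ 2 / tau)) (@e1 R)); last exact: cdiff_e1.
by apply: cdiffN; apply: cdiffM; [exact: cdiffX|exact: cdiff_cst].
Qed.

Let thquo_add1 z : -1 < sc tau z < 0 -> -1 < tc tau z < 1 -> thquo (z + 1) = thquo z.
Proof.
move=> s1 t1.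
have z0 : z != 0.
  by apply: contraTneq s1 => ->; rewrite -[0]/(0%:C) sc_real ltxx andbF.
have z1 : z + 1 != 0.
  apply: contraTneq s1 => /eqP; rewrite addr_eq0 => /eqP ->.
  by rewrite -[1 : C]/((1 : R)%:C) -realCN sc_real ltxx.
rewrite (thquoE z1) (thquoE z0) (th_add1 z tau).
have E : (z + 1) / tau = z / tau - sig by rewrite /sig /Sinv mulrDl mul1r opprK.
have Iu : - complex.Im sig < complex.Im (z / tau - sig) < 0.
  rewrite cImD [complex.Im (- sig)]cImN Im_zt.
  have -> : - sc tau z * complex.Im sig - complex.Im sig = (- sc tau z - 1) * complex.Im sig by ring.
  by apply: sub0_scale => //; lra.
have := th_addtau sig0 Iu; rewrite subrK => ->; rewrite E.
set P := th _ sig.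
have -> : e1 (- ((z + 1) ^+ 2 / tau)) =
  e1 (- (2 * (z / tau - sig)) - sig) * e1 (- (z ^+ 2 / tau)).
  by rewrite -e1D; congr e1; rewrite /sig /Sinv; field.
by rewrite invrN; ring.
Qed.

Let thquo_addtau z : -1 < sc tau z < 1 -> -1 < tc tau z < 0 -> thquo (z + tau) = thquo z.
Proof.
move=> s1 t1.
have z0 : z != 0.
  by apply: contraTneq t1 => ->; rewrite -[0]/(0%:C) tc_real ltxx andbF.
have z1 : z + tau != 0.
  apply: contraTneq t1 => /eqP; rewrite addr_eq0 => /eqP ->.
  have E : tc tau tau = 1 by have := tc_tau tau0 1; rewrite mul1r.
  by rewrite tcN E ltxx.
rewrite (thquoE z1) (thquoE z0).
have Iu : - complex.Im tau < complex.Im z < 0 by rewrite (ImE z); exact: sub0_scale.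
rewrite (th_addtau tau0 Iu) mulrDl divff // th_add1.
have -> : e1 (- ((z + tau) ^+ 2 / tau)) = e1 (- (2 * z) - tau) * e1 (- (z ^+ 2 / tau)).
  by rewrite -e1D; congr e1; field.
have n0 := e1_neq0 (- (2 * z) - tau).
exact: quo_cancel.
Qed.

Let inD0 : -1 < sc tau 0 < 1 /\ -1 < tc tau 0 < 1.
Proof. rewrite -[0 : C]/((0 : R)%:C) sc_real tc_real; lra. Qed.

Let inDh (x y : R) : -1 < x < 1 -> -1 < y < 1 ->
  -1 < sc tau (x%:C + y%:C * tau) < 1 /\ -1 < tc tau (x%:C + y%:C * tau) < 1.
Proof. by rewrite scD // tcD // sc_real tc_real sc_tau // tc_tau // addr0 add0r. Qed.

Let half : (1 / 2)%:C = 1 / 2 :> C.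
Proof. by rewrite realCM realCV realCn. Qed.

Lemma thquo_const (x y : R) : -1 < x < 1 -> -1 < y < 1 -> thquo (x%:C + y%:C * tau) = thquo 0.
Proof.
move=> /inDh H /H[s1 t1]; case: inD0 => s0 t0.
exact: (torus_const tau0 cdiff_thquo thquo_add1 thquo_addtau).
Qed.

End ThetaLaws.

Section ThetaS.
Variable R : realType.
Local Notation C := R[i].
Implicit Types (z w tau : C).

Lemma half_algebra (i x1 x2 x3 x4 x5 x6 x7 x8 : C) : i != 0 -> x1 != 0 -> x2 != 0 ->
  x3 != 0 -> x4 != 0 -> x5 != 0 ->
  i / x2 * x6 * (- i * (x2 * x1 * x8 * x3 * x7 / x4)) / (i * x1 * x5) =
  - i * (x7 / x4) * (x8 * x6 / (x3^-1 * x5)).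
Proof. by move=> a0 a1 a2 a3 a4 a5; field; rewrite a1 a2 a3 a4 a5 a0. Qed.

Lemma zero_algebra (t A x y B : C) : x != 0 -> y != 0 -> B != 0 ->
  t^-1 * (A * B^-1) = t^-1 * (x / y) * (y * A / (x * B)).
Proof. by move=> x0 y0 B0; rewrite -mulrA; congr (_ * _); field; rewrite x0 y0 B0. Qed.

Lemma theta_S tau sig : 0 < complex.Im tau -> sig = Sinv tau ->
  [/\ cexp (W4 sig - W2 tau) = cexp (W2 sig - W4 tau),
      cexp (W4 sig - W2 tau) = cexp (W3 sig - W3 tau) &
      cexp (l0 sig - l0 tau) = - 'i * tau * cexp (W4 sig - W2 tau)].
Proof.
move=> t0 sigE; have s0 : 0 < complex.Im sig by rewrite sigE; exact: upper_Sinv.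
have tn0 := upper_neq0 t0.
have i0 : ('i%R : C) != 0 by rewrite -cabs_gt0 cabs_i.
have ii : ('i%R : C) * 'i = -1 by rewrite -expr2 sqrCi.
have half : (1 / 2)%:C = 1 / 2 :> C by rewrite realCM realCV realCn.
have tq z : z != 0 -> thquo tau z = th (z / tau) sig * e1 (- (z ^+ 2 / tau)) / th z tau.
  move=> z0; rewrite /thquo (negPf z0) -sigE !thE -quo_rearrange.
  by rewrite [cexp (Lam (e2 z) _)]cexpNV.
set K := e1 ((tau - sig) / 6).
have c1 : thquo tau (1 / 2) = - 'i * K * cexp (W4 sig - W2 tau).
  rewrite tq ?mulf_neq0 ?oner_eq0 ?invr_eq0 ?pnatr_eq0 //.
  have -> : 1 / 2 / tau = - (sig / 2) by rewrite sigE /Sinv; field.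
  rewrite th_odd (th_half s0) th_one_half cexpB cexp_W4 cexp_W2.
  have -> : e1 (- ((1 / 2) ^+ 2 / tau)) = e1 (- (sig / 12)) * e1 (- (sig / 6)) * (e1 (sig / 2)).
    by rewrite -!e1D; congr e1; rewrite sigE /Sinv; field.
  have -> : K = e1 (tau / 6) * e1 (- (sig / 6)) by rewrite -e1D; congr e1; field.
  rewrite (e1N (sig / 2)).
  move: (e1_neq0 (sig / 2)) (e1_neq0 (tau / 6)) (cexp_neq0 (- Lam (-1) (e2 tau))) => a1 a2 a3.
  have -> : - 'i%R = 'i%R^-1 :> C by apply: (mulIf i0); rewrite mulVf // mulNr ii opprK.
  by field; rewrite a1 a2 a3 i0.
have c2 : thquo tau (tau / 2) = - 'i * K * cexp (W2 sig - W4 tau).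
  rewrite tq ?mulf_neq0 ?invr_eq0 ?pnatr_eq0 //.
  have -> : tau / 2 / tau = 1 / 2 by field.
  rewrite th_one_half (th_half t0) cexpB cexp_W4 cexp_W2.
  have -> : e1 (- ((tau / 2) ^+ 2 / tau)) = e1 (- (tau / 2)) * e1 (tau / 6) / e1 (- (tau / 12)).
    by rewrite -e1N -!e1D; congr e1; field.
  have -> : K = e1 (tau / 6) / e1 (sig / 6) by rewrite -e1N -e1D; congr e1; field.
  move: (e1_neq0 (- (tau / 2))) (e1_neq0 (- (tau / 12))) (e1_neq0 (sig / 6)) (cexp_neq0 (- Mser (e1 tau))) => a1 a2 a3 a4.
  by field; rewrite a1 a2 a3 a4.
have c3 : thquo tau (1 / 2 + tau / 2) = - 'i * K * cexp (W3 sig - W3 tau).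
  have z0 : 1 / 2 + tau / 2 != 0.
    apply: upper_neq0; rewrite cImD -half cImR add0r.
    rewrite (_ : tau / 2 = (1 / 2)%:C * tau) ?cImZ ?mulr_gt0 //; last by rewrite half; field.
  rewrite (tq _ z0).
  have -> : (1 / 2 + tau / 2) / tau = - (- (1 / 2) + sig / 2) by rewrite sigE /Sinv; field.
  rewrite th_odd -th_add1 (_ : - (1/2) + sig / 2 + 1 = 1/2 + sig / 2); last by field.
  rewrite (th_half1 t0) (th_half1 s0).
  rewrite [cexp (W3 sig - _)]cexpB.
  rewrite (cexp_W3 sig) (cexp_W3 tau).
  have -> : e1 (- ((1 / 2 + tau / 2) ^+ 2 / tau)) = e1 (- (1 / 2)) *
     (e1 (sig / 2) * e1 (- (tau / 2)) * e1 (- (sig / 12)) * e1 (tau / 12) * e1 (tau / 6) / e1 (sig / 6)).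
    by rewrite -e1N -!e1D; congr e1; rewrite sigE /Sinv; field.
  have -> : K = e1 (tau / 6) / e1 (sig / 6) by rewrite -e1N -e1D; congr e1; field.
  rewrite (e1N (sig / 2)) (e1N (tau / 12)) e1_Nhalf.
  move: (e1_neq0 (- (tau / 2))) (e1_neq0 (sig / 2)) (e1_neq0 (tau / 12)) (e1_neq0 (sig / 6)) (cexp_neq0 (- Mser (- e1 tau))) => a1 a2 a3 a4 a5.
  exact (@half_algebra _ _ _ _ _ _ (cexp (- Mser (- e1 sig))) (e1 (tau / 6)) (e1 (- (sig / 12))) i0 a1 a2 a3 a4 a5).
have c0 : thquo tau 0 = tau^-1 * K * cexp (l0 sig - l0 tau).
  rewrite /thquo eqxx mul0r e2_0 expr0n /= mul0r oppr0 e1_0 mulr1 -sigE.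
  rewrite [cexp (l0 sig - l0 tau)]cexpB (cexp_l0 sig) (cexp_l0 tau).
  have -> : K = e1 (tau / 6) / e1 (sig / 6) by rewrite -e1N -e1D; congr e1; field.
  rewrite [cexp (Lam 1 (e2 tau))]cexpNV.
  exact: (zero_algebra _ _ (e1_neq0 (tau / 6)) (e1_neq0 (sig / 6)) (cexp_neq0 (- Lam 1 (e2 tau)))).
have hh : -1 < (1/2 : R) < 1 by lra.
have h0 : -1 < (0 : R) < 1 by lra.
have := thquo_const t0 hh h0; rewrite mul0r addr0 half c1 c0 => e1'.
have := thquo_const t0 h0 hh; rewrite add0r half (_ : 1 / 2 * tau = tau / 2) ?c2 ?c0; last by field.
move=> e2'.
have := thquo_const t0 hh hh; rewrite half (_ : 1 / 2 * tau = tau / 2) ?c3 ?c0; last by field.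
move=> e3'.
have K0 : - 'i * K != 0 by rewrite mulf_neq0 ?oppr_eq0 ?e1_neq0.
split.
- by apply: (mulfI K0); rewrite e1' e2'.
- by apply: (mulfI K0); rewrite e1' e3'.
have KK : tau^-1 * K != 0 by rewrite mulf_neq0 ?invr_eq0 ?e1_neq0.
by apply: (mulfI KK); rewrite -e1'; field.
Qed.

End ThetaS.

Local Transparent csum cexp Lam Mser e1 e2 th W2 W3 W4 l0.

Section ModularLogs.
Variable R : realType.
Local Notation C := R[i].
Implicit Types (z w q h tau sig : C).

Lemma csum_even (v : nat -> C) (B rho : R) : 0 <= rho < 1 ->
  geom (fun k => v k.+1) B rho ->
  csum (fun k => (1 + (-1) ^+ k.+1) * v k.+1) = 2 * csum (fun j => v (2 * j.+1)%N).
Proof.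
move=> r01 gv; have /andP[r0 r1] := r01.
have B0 : 0 <= B by have := gv 0%N; rewrite expr0 mulr1; apply: le_trans; exact: cabs_ge0.
have gu : geom (fun k => (1 + (-1) ^+ k.+1) * v k.+1) (2 * B) rho.
  move=> k; rewrite cabsM -mulrA ler_pM ?cabs_ge0 //.
  by apply: le_trans (cabsD _ _) _; rewrite cabsX cabsN cabs1 expr1n.
have gw : geom (fun j => v (2 * j.+1)%N) B rho.
  move=> j; have -> : (2 * j.+1 = (2 * j + 1).+1)%N by lia.
  apply: le_trans (gv _) _; rewrite ler_wpM2l //.
  by apply: ler_wiXn2l => //; [exact: ltW|lia].
rewrite -(csumZ _ r01 gw); symmetry; apply: csum_eq => e e0.
have [N HN] := csum_geom r01 gu e0; exists N => n Nn.
have -> : psum (fun k => 2 * v (2 * k.+1)%N) n =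
    psum (fun k => (1 + (-1) ^+ k.+1) * v k.+1) (2 * n).
  elim: n {Nn} => [|n IH]; first by rewrite /psum muln0 !big_ord0.
  have psumS (u : nat -> C) m : psum u m.+1 = psum u m + u m by rewrite /psum big_ord_recr.
  rewrite psumS IH.
  have -> : (2 * n.+1 = (2 * n).+2)%N by lia.
  rewrite 2!psumS.
  rewrite -addrA; congr (_ + _).
  have o1 : (-1 : C) ^+ (2 * n).+1 = -1 by rewrite exprS exprM sqrrN expr1n expr1n mulr1.
  have o2 : (-1 : C) ^+ (2 * n).+2 = 1 by rewrite exprS o1 mulrNN mulr1.
  by rewrite o1 o2 subrr mul0r add0r.
by apply: HN; lia.
Qed.

Lemma Lam_Mser_sum h : h != 0 -> cabs h < 1 -> Lam (-1) (h ^+ 2) + Mser h + Mser (- h) = 0.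
Proof.
move=> h0 h1; set q := h ^+ 2.
have q1 : cabs q < 1 by rewrite cabsX exprn_ilt1 // cabs_ge0.
have h01 : 0 <= cabs h < 1 by rewrite cabs_ge0.
have q01 : 0 <= cabs q < 1 by rewrite cabs_ge0.
have pm n : (-1 : C)^-1 ^+ n = (-1) ^+ n by rewrite invrN1.
pose v n : C := 2 * h ^+ n / (1 - h ^+ n ^+ 2) / n%:R.
pose w n : C := 2 * q ^+ n / (1 - q ^+ n) / n%:R.
have gv := geom_Mser (lexx _) h1.
have gv' : geom (fun k => 2 * (- h) ^+ k.+1 / (1 - (- h) ^+ k.+1 ^+ 2) / k.+1%:R)
    (2 * cabs h / (1 - cabs h)) (cabs h).
  by apply: geom_Mser; rewrite ?cabsN.
have gw : geom (fun k => w k.+1) (2 * cabs q / (1 - cabs q)) (cabs q).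
  have g1 : geom (lam 1 q) (2 * cabs q / (1 - cabs q)) (cabs q).
    by apply: geom_lam; rewrite ?invr1 ?mul1r.
  move=> k; apply: le_trans (g1 k).
  by rewrite /lam /w invr1 expr1n.
have EM : Mser h + Mser (- h) = 2 * csum (fun j => v (2 * j.+1)%N).
  rewrite /Mser -(csumD h01 h01 gv gv') -(csum_even h01 (v := v) gv); apply: eq_csum => k.
  have -> : (- h) ^+ k.+1 = (-1) ^+ k.+1 * h ^+ k.+1 by exact: exprNn.
  have s1 : ((-1) ^+ k.+1 * h ^+ k.+1) ^+ 2 = h ^+ k.+1 ^+ 2.
    by rewrite exprMn sqrr_sign mul1r.
  by rewrite s1 /v; ring.
have EL : Lam (-1) q = 2 * csum (fun j => w (2 * j.+1)%N) - csum (fun k => w k.+1).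
  have gN : geom (fun k => - w k.+1) (2 * cabs q / (1 - cabs q)) (cabs q).
    by move=> k; rewrite cabsN; exact: gw.
  have ge : geom (fun k => (1 + (-1) ^+ k.+1) * w k.+1) (2 * (2 * cabs q / (1 - cabs q))) (cabs q).
    move=> k; rewrite cabsM -mulrA ler_pM ?cabs_ge0 //.
    by apply: le_trans (cabsD _ _) _; rewrite cabsX cabsN cabs1 expr1n.
  rewrite -(csum_even q01 gw) -(csumN q01 gw) -(csumD q01 q01 ge gN).
  by apply: eq_csum => k; rewrite /lam /w pm; ring.
have gw2 : geom (fun j => w (2 * j.+1)%N) (2 * cabs q / (1 - cabs q)) (cabs q).
  move=> j; have -> : (2 * j.+1 = (2 * j + 1).+1)%N by lia.
  apply: le_trans (gw _) _; rewrite ler_wpM2l //.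
    by rewrite divr_ge0 ?mulr_ge0 ?cabs_ge0 // subr_ge0 ltW.
  by apply: ler_wiXn2l; rewrite ?cabs_ge0 ?(ltW q1) //; lia.
have gv2 : geom (fun j => v (2 * j.+1)%N) (2 * cabs h / (1 - cabs h)) (cabs h).
  move=> j; have -> : (2 * j.+1 = (2 * j + 1).+1)%N by lia.
  apply: le_trans (gv _) _; rewrite ler_wpM2l //.
    by rewrite divr_ge0 ?mulr_ge0 ?cabs_ge0 // subr_ge0 ltW.
  by apply: ler_wiXn2l; rewrite ?cabs_ge0 ?(ltW h1) //; lia.
rewrite -addrA EM EL -addrAC -(csumZ _ q01 gw2) -(csumZ _ h01 gv2).
rewrite -(csumD q01 h01 (geomZ 2 gw2) (geomZ 2 gv2)).
apply/eqP; rewrite subr_eq0; apply/eqP; apply: eq_csum => k.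
rewrite /v /w.
have d1 := den_neq0 k q1.
have d2 : 1 - q ^+ (2 * k.+1) != 0.
  by rewrite (_ : (2 * k.+1 = (2 * k + 1).+1)%N); [exact: den_neq0|lia].
have hq : h ^+ (2 * k.+1) = q ^+ k.+1 by rewrite exprM.
have q2 : q ^+ (2 * k.+1) = q ^+ k.+1 ^+ 2 by rewrite mulnC exprM.
rewrite q2 in d2; rewrite hq q2 natrM.
have n0 : k.+1%:R != 0 :> C by rewrite pnatr_eq0.
move: (q ^+ k.+1) (k.+1%:R) d1 d2 n0 => Q K d1 d2 n0.
have t0 : (2 : C) != 0 by rewrite pnatr_eq0.
by field; rewrite d1 d2 n0.
Qed.

Lemma cabs_e1_lt1 tau : 0 < complex.Im tau -> cabs (e1 tau) < 1.
Proof. by move=> h; rewrite cabs_e1 expR_lt1 oppr_lt0 mulr_gt0 ?pi_gt0. Qed.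

Lemma W_sum tau : 0 < complex.Im tau -> W2 tau + W3 tau + W4 tau = (ln 2)%:C.
Proof.
move=> t0; have := Lam_Mser_sum (e1_neq0 tau) (cabs_e1_lt1 t0).
have -> : e1 tau ^+ 2 = e2 tau by rewrite e2_sqr expr2.
rewrite /W2 /W3 /W4; move: (Lam _ _) (Mser (e1 tau)) (Mser (- _)) => L M M' E.
have -> : L = - M - M' by apply/eqP; rewrite -subr_eq0 -E; apply/eqP; ring.
by field.
Qed.

Lemma e1D1 tau : e1 (tau + 1) = - e1 tau.
Proof. by rewrite e1D e1_1 mulrN1. Qed.

Lemma W2_T tau : W2 (tau + 1) = W2 tau + 'i * pi%:C / 6.
Proof. by rewrite /W2 e2D1; ring. Qed.

Lemma W4_T tau : W4 (tau + 1) = W3 tau - 'i * pi%:C / 12.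
Proof. by rewrite /W4 /W3 e1D1; ring. Qed.

Lemma W3_T tau : W3 (tau + 1) = W4 tau - 'i * pi%:C / 12.
Proof. by rewrite /W4 /W3 e1D1 opprK; ring. Qed.

Lemma l0_T tau : l0 (tau + 1) = l0 tau + 'i * pi%:C / 6.
Proof. by rewrite /l0 e2D1; ring. Qed.

Lemma cdiff_Lam_q (x q : C) : cabs x = 1 -> cabs q < 1 -> cdiff (Lam x) q.
Proof.
move=> x1 q1; pose s := (1 + cabs q) / 2.
have s1 : s < 1 by rewrite /s; lra.
have sq : cabs q < s by rewrite /s; lra.
have s0 : 0 <= s by apply: le_trans (ltW sq); exact: cabs_ge0.
apply: (@csum_cdiff _ (fun k w => lam x w k) q (s - cabs q) (2 * s / (1 - s)) s).
- by rewrite subr_gt0.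
- by rewrite s0.
- move=> k w wq; have w1 : cabs w < 1 by have := cabs_sub_ge w q; lra.
  apply: cdiffM; last exact: cdiff_cst.
  apply: cdiffM; first by apply: cdiffM; [exact: cdiff_cst|exact: cdiffX].
  apply: cdiffV; first exact: den_neq0.
  by apply: cdiffB; [exact: cdiff_cst|exact: cdiffX].
move=> w wq; have ws : cabs w <= s by have := cabs_sub_ge w q; lra.
by apply: geom_lam => //; rewrite cabsM ?cabsV x1 ?invr1 mul1r.
Qed.

Lemma cdiff_Mser_h h : cabs h < 1 -> cdiff (@Mser R) h.
Proof.
move=> q1; pose s := (1 + cabs h) / 2.
have s1 : s < 1 by rewrite /s; lra.
have sq : cabs h < s by rewrite /s; lra.
have s0 : 0 <= s by apply: le_trans (ltW sq); exact: cabs_ge0.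
apply: (@csum_cdiff _ (fun k w => 2 * w ^+ k.+1 / (1 - w ^+ k.+1 ^+ 2) / k.+1%:R)
   h (s - cabs h) (2 * s / (1 - s)) s).
- by rewrite subr_gt0.
- by rewrite s0.
- move=> k w wq; have w1 : cabs w < 1 by have := cabs_sub_ge w h; lra.
  apply: cdiffM; last exact: cdiff_cst.
  apply: cdiffM; first by apply: cdiffM; [exact: cdiff_cst|exact: cdiffX].
  apply: cdiffV; first by rewrite -exprM (_ : (k.+1 * 2 = (2 * k).+1.+1)%N) ?den_neq0 //; lia.
  apply: cdiffB; first exact: cdiff_cst.
  by apply: (@cdiff_comp _ (fun w => w ^+ k.+1) (fun w => w ^+ 2)); exact: cdiffX.
move=> w wq; have ws : cabs w <= s by have := cabs_sub_ge w h; lra.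
exact: geom_Mser.
Qed.

Section Cdiff.
Variable tau : C.
Hypothesis t0 : 0 < complex.Im tau.

Let lin (k : C) : cdiff (fun tau => 'i * pi%:C * (tau / k)) tau.
Proof. by apply: cdiffZ; apply: cdiffM; [exact: cdiff_id|exact: cdiff_cst]. Qed.

Let lamc (x : C) : cabs x = 1 -> cdiff (fun tau => Lam x (e2 tau)) tau.
Proof.
move=> x1; apply: (@cdiff_comp _ (@e2 R) (Lam x)); first exact: cdiff_e2.
by apply: cdiff_Lam_q => //; exact: cabs_e2_lt1.
Qed.

Lemma cdiff_W2 : cdiff (@W2 R) tau.
Proof.
apply: cdiffB; last by apply: lamc; rewrite cabsN cabs1.
by apply: cdiffD; [exact: cdiff_cst|exact: lin].
Qed.

Lemma cdiff_l0 : cdiff (@l0 R) tau.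
Proof. by apply: cdiffB; [exact: lin|apply: lamc; rewrite cabs1]. Qed.

Lemma cdiff_W4 : cdiff (@W4 R) tau.
Proof.
apply: cdiffB; first by apply: cdiffN; exact: lin.
apply: (@cdiff_comp _ (@e1 R) (@Mser R)); first exact: cdiff_e1.
by apply: cdiff_Mser_h; exact: cabs_e1_lt1.
Qed.

Lemma cdiff_W3 : cdiff (@W3 R) tau.
Proof.
apply: cdiffB; first by apply: cdiffN; exact: lin.
apply: (@cdiff_comp _ (fun tau => - e1 tau) (@Mser R)); first by apply: cdiffN; exact: cdiff_e1.
by apply: cdiff_Mser_h; rewrite cabsN; exact: cabs_e1_lt1.
Qed.

End Cdiff.

Lemma cexp_eq1 w : cexp w = 1 -> exists n : int, w = 2 * ('i * pi%:C) * n%:~R.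
Proof.
have k0 : 2 * ('i * pi%:C) != 0 :> C.
  rewrite -cabs_gt0 !cabsM cabs_i cabs_real cabs_nat mul1r mulr_gt0 //.
  by rewrite gtr0_norm pi_gt0.
move=> E; have [n nE] : exists n : int, w / (2 * ('i * pi%:C)) = n%:~R.
  by apply: e2_eq1; rewrite /e2 mulrC divfK.
by exists n; rewrite -nE mulrC divfK.
Qed.

Lemma int_valued_const (f : R -> R) : continuous f ->
  (forall t, exists n : int, f t = n%:~R) -> f 0 = f 1.
Proof.
move=> cf fi; have [n0 e0] := fi 0; have [n1 e1'] := fi 1.
rewrite e0 e1'; congr (_%:~R).
have no_half (m : int) c : f c != m%:~R + 1 / 2.
  have [k ->] := fi c; apply/eqP => E.
  have : (k * 2)%:~R = (m * 2 + 1)%:~R :> R by rewrite intrD !intrM E; lra.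
  by move=> /intr_inj; lia.
have key (a b : R) (m : int) : f a < m%:~R + 1/2 -> m%:~R + 1/2 < f b -> a <= b -> False.
  move=> h1 h2 ab.
  have [|c _ /eqP] := @IVT R f a b (m%:~R + 1/2) ab (continuous_subspaceT cf).
    by rewrite ge_min le_max (ltW h1) (ltW h2) orbT.
  by rewrite (negPf (no_half m c)).
have key' (a b : R) (m : int) : f b < m%:~R + 1/2 -> m%:~R + 1/2 < f a -> a <= b -> False.
  move=> h1 h2 ab.
  have [|c _ /eqP] := @IVT R f a b (m%:~R + 1/2) ab (continuous_subspaceT cf).
    by rewrite ge_min le_max (ltW h1) (ltW h2) orbT.
  by rewrite (negPf (no_half m c)).
have [h|h|//] := ltgtP n0 n1.
- exfalso; apply: (@key 0 1 n0) => //; rewrite ?e0 ?e1'; first lra.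
  have : (n0 + 1)%:~R <= n1%:~R :> R by rewrite ler_int; lia.
  by rewrite intrD; lra.
- exfalso; apply: (@key' 0 1 n1) => //; rewrite ?e0 ?e1'; first lra.
  have : (n1 + 1)%:~R <= n0%:~R :> R by rewrite ler_int; lia.
  by rewrite intrD; lra.
Qed.

Lemma csum_real (u : nat -> C) (B rho : R) : 0 <= rho < 1 -> geom u B rho ->
  (forall k, complex.Im (u k) = 0) -> complex.Im (csum u) = 0.
Proof.
move=> r1 gu u0; apply/eqP; rewrite -normr_eq0 eq_le normr_ge0 andbT.
apply/ler_addgt0Pr => e e0; rewrite add0r; have [N /(_ N (leqnn _)) h] := csum_geom r1 gu e0.
have P0 : complex.Im (psum u N) = 0.
  rewrite /psum; elim: N {h} => [|n IH]; first by rewrite big_ord0.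
  by rewrite big_ord_recr /= cImD IH u0 addr0.
by apply: le_trans h; have := cabs_Im (psum u N - csum u); rewrite cImD cImN P0 sub0r normrN.
Qed.

Lemma Im_real_rational (x : R) (n : nat) (a : C) : complex.Im a = 0 ->
  complex.Im (a * x%:C ^+ n.+1 / (1 - x%:C ^+ n.+1) / n.+1%:R) = 0 /\
  complex.Im (a * x%:C ^+ n.+1 / (1 - x%:C ^+ n.+1 ^+ 2) / n.+1%:R) = 0.
Proof.
move=> a0; have -> : a = (complex.Re a)%:C by apply: complex_eq.
have XE m : x%:C ^+ m = (x ^+ m)%:C by rewrite rmorphXn.
have X2 m : x%:C ^+ m ^+ 2 = (x ^+ m ^+ 2)%:C by rewrite !rmorphXn.
split.
  by rewrite XE -(realCn _ n.+1) -(rmorph1 (real_complex R)) -realCN -realCD -!realCV -!realCM.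
by rewrite X2 XE -(realCn _ n.+1) -(rmorph1 (real_complex R)) -realCN -realCD -!realCV -!realCM.
Qed.

Lemma cube_aux (a b c a' b' c' s : C) : cexp (c' - a) = cexp (a' - c) ->
  cexp (c' - a) = cexp (b' - b) -> a + b + c = s -> a' + b' + c' = s ->
  cexp (c' - a) * (cexp (c' - a) * cexp (c' - a)) = 1.
Proof.
move=> h1 h2 e1 e2; have -> : cexp (c' - a) * (cexp (c' - a) * cexp (c' - a)) =
    cexp (c' - a) * (cexp (a' - c) * cexp (b' - b)) by rewrite -h1 -h2.
rewrite -!cexpD -(cexp0 R); congr cexp.
have -> : b' = s - a' - c' by rewrite -e2; ring.
have -> : b = s - a - c by rewrite -e1; ring.
ring.
Qed.

Lemma W4_S tau : 0 < complex.Im tau -> W4 (Sinv tau) = W2 tau.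
Proof.
pose D tau : C := W4 (Sinv tau) - W2 tau.
have cube t : 0 < complex.Im t -> cexp (3 * D t) = 1.
  move=> t0; have [a b _] := theta_S t0 (erefl _).
  have s0 := upper_Sinv t0.
  rewrite (cexp_natM 3) !exprS expr0 mulr1.
  exact: (cube_aux a b (W_sum t0) (W_sum s0)).
have pi0 := @pi_gt0 R.
pose k : C := 2 * ('i * pi%:C).
have k0 : k != 0.
  rewrite -cabs_gt0 !cabsM cabs_i cabs_real cabs_nat mul1r mulr_gt0 //.
  by rewrite gtr0_norm pi_gt0.
have Dint t : 0 < complex.Im t -> exists n : int, 3 * D t / k = n%:~R.
  by move=> /cube/cexp_eq1[n ->]; exists n; rewrite mulrC mulKf.
have dD t : 0 < complex.Im t -> cdiff D t.
  move=> t0; apply: cdiffB; last exact: cdiff_W2.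
  apply: (@cdiff_comp _ (@Sinv R) (@W4 R)); last by apply: cdiff_W4; exact: upper_Sinv.
  by apply: cdiffN; apply: cdiffV; [exact: upper_neq0|exact: cdiff_id].
have D0 t : 0 < complex.Im t -> D t = 0.
  move=> t0.
  pose cl (x : R) := Num.min 1 (Num.max 0 x).
  have cl01 x : 0 <= cl x <= 1.
    rewrite /cl ge_min lexx /= le_min ler01 le_max lexx //.
  pose p (x : R) : C := 'i + (cl x)%:C * (t - 'i).
  have pI x : 0 < complex.Im (p x).
    have Ii : complex.Im ('i : C) = 1 by [].
    rewrite /p cImD cImZ cImD cImN Ii; have /andP[c0 c1] := cl01 x.
    have -> : 1 + cl x * (complex.Im t - 1) = (1 - cl x) + cl x * complex.Im t by ring.
    have [->|c2] := eqVneq (cl x) 0; first by rewrite mul0r; lra.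
    have c3 : 0 < cl x by rewrite lt_neqAle eq_sym c2.
    by rewrite ltr_wpDl ?mulr_gt0 //; lra.
  have cp : rcont p.
    move=> x e e0; have K0 : 0 < cabs (t - 'i) + 1 by rewrite ltr_wpDl ?cabs_ge0.
    exists (e / (cabs (t - 'i) + 1)); first by rewrite divr_gt0.
    move=> y; rewrite ltr_pdivlMr // => h.
    have -> : p y - p x = (cl y - cl x)%:C * (t - 'i) by rewrite /p realCD realCN; ring.
    rewrite cabsM cabs_real; apply: le_lt_trans h; apply: ler_pM => //.
    - exact: cabs_ge0.
    - exact: clamp_lip.
    - by rewrite lerDl.
  pose f x := complex.Re (3 * D (p x) / k).
  have cf : continuous f.
    apply: rcont_Re; apply: (@rcont_ccont _ (fun t => 3 * D t / k)) => // x.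
    by apply: ccontM; [apply: ccontM; [exact: ccont_cst|apply: cdiff_cont; exact: dD]|exact: ccont_cst].
  have fi x : exists n : int, f x = n%:~R.
    have [n nE] := Dint _ (pI x); exists n; rewrite /f nE.
    by rewrite -(rmorph_int (real_complex R)).
  have := int_valued_const cf fi.
  have -> : f 0 = complex.Re (3 * D 'i / k).
    congr (complex.Re (3 * D _ / k)); have c0 : cl 0 = 0 by rewrite /cl maxxx min_r ?ler01.
    by rewrite /p c0 mul0r addr0.
  have -> : f 1 = complex.Re (3 * D t / k).
    congr (complex.Re (3 * D _ / k)); have c0 : cl 1 = 1 by rewrite /cl max_r ?ler01 // minxx.
    by rewrite /p c0 mul1r addrC subrK.
  have Di0 : complex.Re (3 * D 'i / k) = 0.
    have Si : Sinv ('i : C) = 'i.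
      apply: complex_eq; rewrite /Sinv ?cReN ?cImN ?cReV ?cImV cabs_i expr1n divr1 /=; ring.
    have e1i : e1 ('i : C) = (expR (- pi))%:C.
      rewrite /e1 (_ : 'i * pi%:C * 'i = (- pi)%:C) ?cexp_real //.
      by simpc; apply: complex_eq => /=; ring.
    have h1 : cabs (e1 ('i : C)) < 1 by exact: cabs_e1_lt1.
    have q1 : cabs (e2 ('i : C)) < 1 by exact: cabs_e2_lt1.
    have e2i : e2 ('i : C) = (expR (- pi) * expR (- pi))%:C by rewrite e2_sqr e1i realCM.
    have r1 : complex.Im (Mser (e1 ('i : C))) = 0.
      apply: csum_real (geom_Mser (lexx _) h1) _; first by rewrite cabs_ge0.
      move=> n; rewrite e1i; apply: (Im_real_rational _ _ _).2.
      by rewrite -(realCn _ 2).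
    have r2 : complex.Im (Lam (-1) (e2 ('i : C))) = 0.
      have g : geom (lam (-1) (e2 ('i : C))) (2 * cabs (e2 ('i : C)) / (1 - cabs (e2 ('i : C)))) (cabs (e2 ('i : C))).
        by apply: geom_lam => //; rewrite ?invrN1 mulN1r cabsN.
      apply: csum_real g _; first by rewrite cabs_ge0.
      move=> n; rewrite /lam e2i; apply: (Im_real_rational _ _ _).1.
      by rewrite invrN1 -signr_odd; case: (odd _) => /=; ring.
    have aux (a m l b c : C) : complex.Im a = 0 -> complex.Im m = 0 -> complex.Im l = 0 ->
        complex.Im b = 0 -> complex.Im c = 0 -> complex.Im (- a - m - (l + b - c)) = 0.
      by rewrite !(cImD, cImN) => -> -> -> -> ->; ring.
    have ID : complex.Im (D 'i) = 0.
      rewrite /D Si /W4 /W2; apply: aux => //.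
      - have -> : 'i * pi%:C * ('i / 12) = (- pi / 12)%:C :> C.
          rewrite realCM realCV realCn mulrA; congr (_ / _).
          by simpc; apply: complex_eq => /=; ring.
        by rewrite cImR.
      - have -> : 'i * pi%:C * ('i / 6) = (- pi / 6)%:C :> C.
          rewrite realCM realCV realCn mulrA; congr (_ / _).
          by simpc; apply: complex_eq => /=; ring.
        by rewrite cImR.
    have DE : D 'i = (complex.Re (D 'i))%:C by apply: complex_eq; rewrite ?ID.
    have -> : 3 * D 'i / k = (3 * complex.Re (D 'i))%:C / k by rewrite realCM -DE realCn.
    have -> : k = 0 +i* (2 * pi) by rewrite /k -realCn; simpc.
    by rewrite cReM cReR cImR mul0r subr0 cReV /= mul0r mulr0.
  move=> E0; have E := etrans (esym Di0) E0; have [n nE] := Dint t t0.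
  have h : 3 * D t / k = 0 -> D t = 0.
    by move=> /eqP; rewrite mulf_eq0 invr_eq0 (negPf k0) orbF mulf_eq0 pnatr_eq0 => /eqP.
  clear Di0 E0; apply: h; move: (3 * D t / k) nE E => z -> E.
  move: E; rewrite -(rmorph_int (real_complex R)) /= => /esym/eqP.
  by rewrite intr_eq0 => /eqP ->; rewrite mulr0z.
by move=> t0; apply/eqP; rewrite -subr_eq0 -/(D tau) D0.
Qed.

Let W3_aux (a b c a' b' c' s : C) : a + b + c = s -> a' + b' + c' = s -> a' = c -> c' = a -> b' = b.
Proof. move=> h h' e e'; have -> : b' = s - a' - c' by rewrite -h'; ring.
by rewrite e e' -h; ring. Qed.

Lemma modular_S tau : 0 < complex.Im tau ->
  [/\ W4 (Sinv tau) = W2 tau, W2 (Sinv tau) = W4 tau, W3 (Sinv tau) = W3 tau &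
      cexp (l0 (Sinv tau)) = - 'i%R * tau * cexp (l0 tau)].
Proof.
move=> t0; have s0 := upper_Sinv t0.
have [a b c] := theta_S t0 (erefl _).
have e4 := W4_S t0.
have e2' : W2 (Sinv tau) = W4 tau by rewrite -(W4_S s0) SinvK.
split; [exact: e4|exact: e2'|exact: (W3_aux (W_sum t0) (W_sum s0) e2' e4)|].
have z : W4 (Sinv tau) - W2 tau = 0 by rewrite e4 addrN.
move: c; rewrite z cexp0 mulr1 cexpB => <-.
by rewrite divfK // cexp_neq0.
Qed.

End ModularLogs.

(** * The groups SL_2(Z) and Gamma(2) *)

Section Matrices.
Implicit Types (a b c d : int) (g h : M2Z).

Lemma mx22E a b c d : [/\ mx22 a b c d 0 0 = a, mx22 a b c d 0 1 = b,
  mx22 a b c d 1 0 = c & mx22 a b c d 1 1 = d].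
Proof. by split; rewrite mxE. Qed.

Lemma ord2P (i : 'I_2) : i = 0 \/ i = 1.
Proof. by case: i => [[|[|//]]] ?; [left|right]; apply: val_inj. Qed.

Lemma mx22_eq g h : g 0 0 = h 0 0 -> g 0 1 = h 0 1 -> g 1 0 = h 1 0 -> g 1 1 = h 1 1 -> g = h.
Proof.
move=> h1 h2 h3 h4; apply/matrixP => i j.
by case: (ord2P i) => ->; case: (ord2P j) => ->.
Qed.

Lemma mx22_eta g : g = mx22 (g 0 0) (g 0 1) (g 1 0) (g 1 1).
Proof. by apply: mx22_eq; rewrite mxE. Qed.

Lemma mulmx22 a b c d a' b' c' d' : mx22 a b c d * mx22 a' b' c' d' =
  mx22 (a * a' + b * c') (a * b' + b * d') (c * a' + d * c') (c * b' + d * d').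
Proof.
have lift0 : lift ord0 ord0 = 1 :> 'I_2 by apply: val_inj.
by apply: mx22_eq; rewrite mxE !big_ord_recl big_ord0 addr0 lift0 !mxE.
Qed.

Lemma oppmx22 a b c d : - mx22 a b c d = mx22 (- a) (- b) (- c) (- d).
Proof. by apply: mx22_eq; rewrite !mxE. Qed.

Lemma onemx22 : 1 = mx22 1 0 0 1.
Proof. by apply: mx22_eq; rewrite !mxE. Qed.

Lemma det_mx22 a b c d : \det (mx22 a b c d) = a * d - b * c.
Proof.
rewrite (expand_det_row _ 0) !big_ord_recl big_ord0 addr0 /cofactor.
have lift0 : lift ord0 ord0 = 1 :> 'I_2 by apply: val_inj.
rewrite lift0 /= !det_mx11 !mxE /=; ring.
Qed.

Lemma SL2Z1 : SL2Z 1.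
Proof. exact: det1. Qed.

Lemma SL2ZM g h : SL2Z g -> SL2Z h -> SL2Z (g * h).
Proof. by move=> g1 h1; rewrite /SL2Z /= det_mulmx g1 h1. Qed.

Lemma SL2Z_unit g : SL2Z g -> g \is a GRing.unit.
Proof. by move=> g1; rewrite unitmxE g1 unitr1. Qed.

Lemma mulVSL g : SL2Z g -> g^-1 * g = 1.
Proof. by move=> /SL2Z_unit; exact: mulVr. Qed.

Lemma mulSLV g : SL2Z g -> g * g^-1 = 1.
Proof. by move=> /SL2Z_unit; exact: mulrV. Qed.

Lemma SL2ZV g : SL2Z g -> SL2Z g^-1.
Proof. by move=> g1; rewrite /SL2Z /= det_inv g1 invr1. Qed.

Lemma SL2ZX g n : SL2Z g -> SL2Z (g ^+ n).
Proof.
by move=> g1; elim: n => [|n IH]; rewrite ?expr0 ?exprS; [exact: SL2Z1|exact: SL2ZM].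
Qed.

Lemma SL2ZP a b c d : SL2Z (mx22 a b c d) <-> a * d - b * c = 1.
Proof. by rewrite /SL2Z /= det_mx22. Qed.

Lemma SL2Z_mx22P g : SL2Z g -> exists a b c d, g = mx22 a b c d /\ a * d - b * c = 1.
Proof.
move=> g1; exists (g 0 0), (g 0 1), (g 1 0), (g 1 1); split; first exact: mx22_eta.
by apply/SL2ZP; rewrite -mx22_eta.
Qed.

Lemma invmx22 a b c d : a * d - b * c = 1 -> (mx22 a b c d)^-1 = mx22 d (- b) (- c) a.
Proof.
move=> e; have u : SL2Z (mx22 a b c d) by apply/SL2ZP.
rewrite -[RHS]mul1r -(mulVSL u) -mulrA mulmx22.
have -> : mx22 (a * d + b * - c) (a * - b + b * a) (c * d + d * - c) (c * - b + d * a) = 1.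
  by rewrite onemx22; apply: mx22_eq; rewrite !mxE /= -?e; ring.
by rewrite mulr1.
Qed.

Definition matT : M2Z := mx22 1 1 0 1.

Lemma SL2Z_S : SL2Z matS. Proof. by apply/SL2ZP. Qed.
Lemma SL2Z_T : SL2Z matT. Proof. by apply/SL2ZP. Qed.
Lemma SL2Z_A : SL2Z matA. Proof. by apply/SL2ZP. Qed.
Lemma SL2Z_B : SL2Z matB. Proof. by apply/SL2ZP. Qed.
Lemma SL2Z_U : SL2Z matU. Proof. by apply/SL2ZP. Qed.

Lemma SL2ZN g : SL2Z g -> SL2Z (- g).
Proof.
case/SL2Z_mx22P => a [b [c [d [-> e]]]]; rewrite oppmx22; apply/SL2ZP; rewrite -e; ring.
Qed.

Lemma matSS : matS * matS = -1.
Proof. by rewrite mulmx22 onemx22 oppmx22; congr mx22. Qed.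

Lemma matTT : matT * matT = matA.
Proof. by rewrite mulmx22; congr mx22. Qed.

Lemma matV : [/\ matS^-1 = - matS, matT^-1 = mx22 1 (-1) 0 1, matA^-1 = mx22 1 (-2) 0 1,
  matB^-1 = mx22 1 0 2 1 & matU^-1 = mx22 1 (-1) (-1) 2].
Proof. by split; rewrite invmx22 // oppmx22; congr mx22. Qed.

Lemma matSAS : matS * matA * matS^-1 = matB.
Proof. by have [-> _ _ _ _] := matV; rewrite oppmx22 !mulmx22; congr mx22. Qed.

Lemma matTBT : matT * matB * matT^-1 = - (matB^-1 * matA^-1).
Proof. by have [_ -> -> -> _] := matV; rewrite !mulmx22 oppmx22; congr mx22. Qed.

Lemma matU_ST : matU = matT * (matS * matT^-1 * matS^-1).
Proof. by have [-> -> _ _ _] := matV; rewrite oppmx22 !mulmx22; congr mx22. Qed.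

Lemma matTX n : matT ^+ n = mx22 1 n%:Z 0 1.
Proof.
elim: n => [|n IH]; first by rewrite expr0 onemx22.
by rewrite exprS IH mulmx22; congr mx22; lia.
Qed.

Lemma matAX n : matA ^+ n = mx22 1 (2 * n%:Z) 0 1.
Proof.
elim: n => [|n IH]; first by rewrite expr0 onemx22.
by rewrite exprS IH mulmx22; congr mx22; lia.
Qed.

Lemma SL2Z_ind (P : M2Z -> Prop) : P 1 -> P matS -> P matT -> P matT^-1 ->
  (forall g h, SL2Z g -> SL2Z h -> P g -> P h -> P (g * h)) -> forall g, SL2Z g -> P g.
Proof.
move=> P1 PS PT PT' PM.
have SS := SL2Z_S; have ST := SL2Z_T; have ST' := SL2ZV ST.
have PN g : SL2Z g -> P g -> P (- g).
  move=> gS Pg; rewrite -mulrN1 -matSS; apply: (PM) => //; first exact: SL2ZM.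
  exact: PM.
have PS' : P matS^-1 by have [-> _ _ _ _] := matV; exact: PN.
have PTn n : P (mx22 1 n 0 1).
  case: n => n; first rewrite -matTX; last first.
    have -> : mx22 1 (Negz n) 0 1 = matT^-1 ^+ n.+1.
      by rewrite exprVn matTX invmx22 ?NegzE; [congr mx22; ring|ring].
    elim: n => [|n IH]; first by rewrite expr1.
    by rewrite exprS; apply: PM => //; exact: SL2ZX.
  elim: n => [|n IH]; first by rewrite expr0.
  by rewrite exprS; apply: PM => //; exact: SL2ZX.
move=> g; case/SL2Z_mx22P => a [b [c [d [-> e]]]].
have [k] := ubnP (absz c); elim: k a b c d e => // k IH a b c d e ck.
have [c0|c0] := eqVneq c 0.
  have [[ea ed]|[ea ed]] : (a = 1 /\ d = 1) \/ (a = -1 /\ d = -1).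
    have : a * d = 1 by rewrite -e c0; ring.
    by move=> h; have : (absz a * absz d = 1)%N; [rewrite -abszM h|move/eqP; rewrite muln_eq1; lia].
  - by rewrite ea ed c0.
  - rewrite ea ed c0; have -> : mx22 (-1) b 0 (-1) = - mx22 1 (- b) 0 1.
      by rewrite oppmx22; congr mx22; lia.
    by apply: PN => //; apply/SL2ZP; lia.
pose q := - (d %/ c)%Z.
have mE : d + q * c = (d %% c)%Z by rewrite {1}(divz_eq d c) /q; ring.
have mlt : (absz (d + q * c)%R < absz c)%N.
  by rewrite mE; have := ltz_mod d c0; have := modz_ge0 d c0; lia.
have -> : mx22 a b c d = mx22 (b + q * a) (- a) (d + q * c) (- c) * matS^-1 * mx22 1 (- q) 0 1.
  by have [-> _ _ _ _] := matV; rewrite oppmx22 !mulmx22; congr mx22; ring.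
have e' : (b + q * a) * (- c) - (- a) * (d + q * c) = 1 by rewrite -e; ring.
apply: (PM) => //; try (by apply/SL2ZP; ring).
  by apply: SL2ZM; [apply/SL2ZP|exact: SL2ZV].
apply: PM => //; [by apply/SL2ZP|exact: SL2ZV|].
by apply: IH => //; lia.
Qed.

Lemma Gamma2P a b c d : Gamma2 (mx22 a b c d) <->
  [/\ a * d - b * c = 1, (a %% 2)%Z = 1, (b %% 2)%Z = 0, (c %% 2)%Z = 0 & (d %% 2)%Z = 1].
Proof.
have [ea eb ec ed] := mx22E a b c d.
have [oa ob oc od] : [/\ (1 : M2Z) 0 0 = 1, (1 : M2Z) 0 1 = 0, (1 : M2Z) 1 0 = 0 & (1 : M2Z) 1 1 = 1].
  by split; rewrite mxE.
split=> [[/SL2ZP h1 h2]|[h1 h2 h3 h4 h5]].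
  have := (h2 0 0, h2 0 1, h2 1 0, h2 1 1).
  by rewrite ea eb ec ed oa ob oc od => -[[[-> ->] ->] ->].
split; first exact/SL2ZP.
move=> i j; case: (ord2P i) => ->; case: (ord2P j) => ->;
  by rewrite ?ea ?eb ?ec ?ed ?oa ?ob ?oc ?od ?h2 ?h3 ?h4 ?h5.
Qed.

Lemma Gamma2SL g : Gamma2 g -> SL2Z g.
Proof. by case. Qed.

Lemma Gamma2_mx22P g : Gamma2 g -> exists a b c d, g = mx22 a b c d /\
  [/\ a * d - b * c = 1, (a %% 2)%Z = 1, (b %% 2)%Z = 0, (c %% 2)%Z = 0 & (d %% 2)%Z = 1].
Proof.
move=> h; exists (g 0 0), (g 0 1), (g 1 0), (g 1 1); split; first exact: mx22_eta.
by apply/Gamma2P; rewrite -mx22_eta.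
Qed.

Lemma Gamma2_1 : Gamma2 1. Proof. by split => //; exact: SL2Z1. Qed.

Lemma Gamma2_N1 : Gamma2 (-1).
Proof. by rewrite onemx22 oppmx22; apply/Gamma2P; split. Qed.

Lemma Gamma2_A : Gamma2 matA. Proof. by apply/Gamma2P. Qed.
Lemma Gamma2_B : Gamma2 matB. Proof. by apply/Gamma2P. Qed.

Lemma Gamma2M g h : Gamma2 g -> Gamma2 h -> Gamma2 (g * h).
Proof.
move=> gG hG; have gS := Gamma2SL (gG); have hS := Gamma2SL hG.
have := SL2ZM gS hS.
case/Gamma2_mx22P: gG => a [b [c [d [-> [e1 e2 e3 e4 e5]]]]].
case/Gamma2_mx22P: hG => a' [b' [c' [d' [-> [e1' e2' e3' e4' e5']]]]].
rewrite mulmx22 => /SL2ZP h1; apply/Gamma2P; split=> //.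
- by rewrite -modzDm -modzMm e2 e2' -[(b * c' %% 2)%Z]modzMm e3 e4'.
- by rewrite -modzDm -modzMm e2 e3' -[(b * d' %% 2)%Z]modzMm e3 e5'.
- by rewrite -modzDm -modzMm e2' e4 -[(d * c' %% 2)%Z]modzMm e4' e5.
- by rewrite -modzDm -modzMm e4 e3' -[(d * d' %% 2)%Z]modzMm e5 e5'.
Qed.

Lemma Gamma2V g : Gamma2 g -> Gamma2 g^-1.
Proof.
case/Gamma2_mx22P => a [b [c [d [-> [e1 e2 e3 e4 e5]]]]].
rewrite invmx22 //; apply/Gamma2P; split; lia.
Qed.

Lemma Gamma2X g n : Gamma2 g -> Gamma2 (g ^+ n).
Proof.
by move=> g1; elim: n => [|n IH]; rewrite ?expr0 ?exprS; [exact: Gamma2_1|exact: Gamma2M].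
Qed.

Lemma Gamma2J g h : SL2Z g -> Gamma2 h -> Gamma2 (g * h * g^-1).
Proof.
move=> gS hG; have := SL2ZM (SL2ZM gS (Gamma2SL hG)) (SL2ZV gS).
case/SL2Z_mx22P: gS => a [b [c [d [-> e]]]].
case/Gamma2_mx22P: hG => a' [b' [c' [d' [-> [e1 e2 e3 e4 e5]]]]].
rewrite invmx22 // !mulmx22 => /SL2ZP h0; apply/Gamma2P; split=> //.
- have [x ex] : exists x : int, a' = 1 + 2 * x by exists (a' %/ 2)%Z; lia.
  have [y ey] : exists y : int, d' = 1 + 2 * y by exists (d' %/ 2)%Z; lia.
  have [z ez] : exists z : int, b' = 2 * z by exists (b' %/ 2)%Z; lia.
  have [t et] : exists t : int, c' = 2 * t by exists (c' %/ 2)%Z; lia.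
  have -> : (a * a' + b * c') * d + (a * b' + b * d') * - c =
     (a * d - b * c) + 2 * (a * d * x + b * d * t - a * c * z - b * c * y).
    by rewrite ex ey ez et; ring.
  by rewrite e; lia.
- have [x ex] : exists x : int, a' = 1 + 2 * x by exists (a' %/ 2)%Z; lia.
  have [y ey] : exists y : int, d' = 1 + 2 * y by exists (d' %/ 2)%Z; lia.
  have [z ez] : exists z : int, b' = 2 * z by exists (b' %/ 2)%Z; lia.
  have [t et] : exists t : int, c' = 2 * t by exists (c' %/ 2)%Z; lia.
  have -> : (a * a' + b * c') * - b + (a * b' + b * d') * a =
     2 * (- (a * b * x) - b * b * t + a * a * z + a * b * y).
    by rewrite ex ey ez et; ring.
  by lia.
- have [x ex] : exists x : int, a' = 1 + 2 * x by exists (a' %/ 2)%Z; lia.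
  have [y ey] : exists y : int, d' = 1 + 2 * y by exists (d' %/ 2)%Z; lia.
  have [z ez] : exists z : int, b' = 2 * z by exists (b' %/ 2)%Z; lia.
  have [t et] : exists t : int, c' = 2 * t by exists (c' %/ 2)%Z; lia.
  have -> : (c * a' + d * c') * d + (c * b' + d * d') * - c =
     2 * (c * d * x + d * d * t - c * c * z - c * d * y).
    by rewrite ex ey ez et; ring.
  by lia.
- have [x ex] : exists x : int, a' = 1 + 2 * x by exists (a' %/ 2)%Z; lia.
  have [y ey] : exists y : int, d' = 1 + 2 * y by exists (d' %/ 2)%Z; lia.
  have [z ez] : exists z : int, b' = 2 * z by exists (b' %/ 2)%Z; lia.
  have [t et] : exists t : int, c' = 2 * t by exists (c' %/ 2)%Z; lia.
  have -> : (c * a' + d * c') * - b + (c * b' + d * d') * a =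
     (a * d - b * c) + 2 * (- (b * c * x) - b * d * t + a * c * z + a * d * y).
    by rewrite ex ey ez et; ring.
  by rewrite e; lia.
Qed.

Let shrink c d : c != 0 -> (absz c < absz d)%N ->
  (absz (d + 2 * c)%R < absz d)%N \/ (absz (d - 2 * c)%R < absz d)%N.
Proof. by move=> /eqP; lia. Qed.

Lemma Gamma2_ind (P : M2Z -> Prop) : P (-1) -> P matA -> P matA^-1 -> P matB -> P matB^-1 ->
  (forall g h, Gamma2 g -> Gamma2 h -> P g -> P h -> P (g * h)) -> forall g, Gamma2 g -> P g.
Proof.
move=> PN PA PA' PB PB' PM.
have GA := Gamma2_A; have GB := Gamma2_B; have GA' := Gamma2V GA; have GB' := Gamma2V GB.
have P1 : P 1 by rewrite -(mulSLV SL2Z_A); exact: PM.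
have PAn n : P (mx22 1 (2 * n) 0 1).
  case: n => n; first rewrite -matAX; last first.
    have -> : mx22 1 (2 * Negz n) 0 1 = matA^-1 ^+ n.+1.
      by rewrite exprVn matAX invmx22 ?NegzE; [congr mx22; ring|ring].
    elim: n => [|n IH]; first by rewrite expr1.
    by rewrite exprS; apply: PM => //; exact: Gamma2X.
  elim: n => [|n IH]; first by rewrite expr0.
  by rewrite exprS; apply: PM => //; exact: Gamma2X.
have [_ _ EA EB _] := matV.
have stepA a b c d : a * d - b * c = 1 -> (a %% 2)%Z = 1 -> (b %% 2)%Z = 0 ->
    (c %% 2)%Z = 0 -> (d %% 2)%Z = 1 -> P (mx22 a (b + 2 * a) c (d + 2 * c)) -> P (mx22 a b c d).
  move=> h1 h2 h3 h4 h5 h.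
  have -> : mx22 a b c d = mx22 a (b + 2 * a) c (d + 2 * c) * matA^-1.
    by rewrite EA mulmx22; congr mx22; ring.
  by apply: PM => //; apply/Gamma2P; split; try lia; rewrite -h1; ring.
have stepA' a b c d : a * d - b * c = 1 -> (a %% 2)%Z = 1 -> (b %% 2)%Z = 0 ->
    (c %% 2)%Z = 0 -> (d %% 2)%Z = 1 -> P (mx22 a (b - 2 * a) c (d - 2 * c)) -> P (mx22 a b c d).
  move=> h1 h2 h3 h4 h5 h.
  have -> : mx22 a b c d = mx22 a (b - 2 * a) c (d - 2 * c) * matA.
    by rewrite mulmx22; congr mx22; ring.
  by apply: PM => //; apply/Gamma2P; split; try lia; rewrite -h1; ring.
have stepB a b c d : a * d - b * c = 1 -> (a %% 2)%Z = 1 -> (b %% 2)%Z = 0 ->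
    (c %% 2)%Z = 0 -> (d %% 2)%Z = 1 -> P (mx22 (a - 2 * b) b (c - 2 * d) d) -> P (mx22 a b c d).
  move=> h1 h2 h3 h4 h5 h.
  have -> : mx22 a b c d = mx22 (a - 2 * b) b (c - 2 * d) d * matB^-1.
    by rewrite EB mulmx22; congr mx22; ring.
  by apply: PM => //; apply/Gamma2P; split; try lia; rewrite -h1; ring.
have stepB' a b c d : a * d - b * c = 1 -> (a %% 2)%Z = 1 -> (b %% 2)%Z = 0 ->
    (c %% 2)%Z = 0 -> (d %% 2)%Z = 1 -> P (mx22 (a + 2 * b) b (c + 2 * d) d) -> P (mx22 a b c d).
  move=> h1 h2 h3 h4 h5 h.
  have -> : mx22 a b c d = mx22 (a + 2 * b) b (c + 2 * d) d * matB.
    by rewrite mulmx22; congr mx22; ring.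
  by apply: PM => //; apply/Gamma2P; split; try lia; rewrite -h1; ring.
move=> g /Gamma2_mx22P[a [b [c [d [-> [h1 h2 h3 h4 h5]]]]]].
have [k] := ubnP (absz c + absz d)%N.
elim: k a b c d h1 h2 h3 h4 h5 => // k IH a b c d h1 h2 h3 h4 h5 ck.
have [c0|c0] := eqVneq c 0.
  have [[ea ed]|[ea ed]] : (a = 1 /\ d = 1) \/ (a = -1 /\ d = -1).
    have : a * d = 1 by rewrite -h1 c0; ring.
    by move=> h; have : (absz a * absz d = 1)%N; [rewrite -abszM h|move/eqP; rewrite muln_eq1; lia].
  - have -> : b = 2 * (b %/ 2)%Z by lia.
    by rewrite ea ed c0.
  - rewrite ea ed c0; have -> : mx22 (-1) b 0 (-1) = -1 * mx22 1 (2 * (- (b %/ 2)%Z)) 0 1.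
      by rewrite onemx22 oppmx22 mulmx22; congr mx22; lia.
    by apply: PM => //; [exact: Gamma2_N1|apply/Gamma2P; split; lia].
have [cd|cd] := ltnP (absz c) (absz d).
  have [s|s] : (absz (d + 2 * c)%R < absz d)%N \/ (absz (d - 2 * c)%R < absz d)%N by exact: shrink.
  - by apply: stepA => //; apply: IH; try lia; rewrite -h1; ring.
  - by apply: stepA' => //; apply: IH; try lia; rewrite -h1; ring.
have [s|s] : (absz (c - 2 * d)%R < absz c)%N \/ (absz (c + 2 * d)%R < absz c)%N.
  by apply/or_comm/shrink; [lia|lia].
- by apply: stepB => //; apply: IH; try lia; rewrite -h1; ring.
- by apply: stepB' => //; apply: IH; try lia; rewrite -h1; ring.
Qed.

Definition six : seq M2Z :=
  [:: 1; matU; matU ^+ 2; matS; matS * matU; matS * matU ^+ 2].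

Lemma six_mx22 : six = [:: mx22 1 0 0 1; mx22 2 1 1 1; mx22 5 3 3 2;
  mx22 0 (-1) 1 0; mx22 (-1) (-1) 2 1; mx22 (-3) (-2) 5 3].
Proof.
have e2 : matU ^+ 2 = mx22 5 3 3 2 by rewrite expr2 mulmx22; congr mx22.
by rewrite /six e2 onemx22 !mulmx22; congr [:: _; _; _; _; _; _]; congr mx22.
Qed.

Lemma six_SL w : w \in six -> SL2Z w.
Proof.
by rewrite six_mx22 !inE => /or4P[|||/or3P[]] /eqP ->; apply/SL2ZP.
Qed.

Lemma six_cover g : SL2Z g -> exists2 w, w \in six & Gamma2 (w^-1 * g).
Proof.
case/SL2Z_mx22P => a [b [c [d [-> e]]]].
suff : exists w : int * int * int * int, let: (x, y, z, t) := w in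
    [/\ mx22 x y z t \in six, x * t - y * z = 1 &
     [/\ ((t * a - y * c) %% 2)%Z = 1, ((t * b - y * d) %% 2)%Z = 0,
         ((x * c - z * a) %% 2)%Z = 0 & ((x * d - z * b) %% 2)%Z = 1]].
  move=> [[[[x y] z] t] [h1 h2 [h3 h4 h5 h6]]]; exists (mx22 x y z t) => //.
  rewrite invmx22 // mulmx22; apply/Gamma2P; split.
  - have -> : 1 = (x * t - y * z) * (a * d - b * c) by rewrite e h2.
    ring.
  - by apply: etrans h3; congr modz; ring.
  - by apply: etrans h4; congr modz; ring.
  - by apply: etrans h5; congr modz; ring.
  - by apply: etrans h6; congr modz; ring.
have par (x : int) : exists x' : int, x = 2 * x' \/ x = 2 * x' + 1 by exists (x %/ 2)%Z; lia.
have [a' ha] := par a; have [b' hb] := par b; have [c' hc] := par c; have [d' hd] := par d.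
rewrite six_mx22.
case: ha e => ->; case: hb => ->; case: hc => ->; case: hd => -> e.
all: try (exfalso; move: e; rewrite !(mulrDl, mulrDr, mulr1, mul1r); lia).
all: first
 [ by exists (1, 0, 0, 1); rewrite !inE eqxx ?orbT; split => //; split; lia
 | by exists (2, 1, 1, 1); rewrite !inE eqxx ?orbT; split => //; split; lia
 | by exists (5, 3, 3, 2); rewrite !inE eqxx ?orbT; split => //; split; lia
 | by exists (0, -1, 1, 0); rewrite !inE eqxx ?orbT; split => //; split; lia
 | by exists (-1, -1, 2, 1); rewrite !inE eqxx ?orbT; split => //; split; lia
 | by exists (-3, -2, 5, 3); rewrite !inE eqxx ?orbT; split => //; split; lia ].
Qed.

Lemma six_inj w w' : w \in six -> w' \in six -> Gamma2 (w^-1 * w') -> w = w'.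
Proof.
rewrite six_mx22 !inE.
have E a b c d a' b' c' d' : a * d - b * c = 1 ->
  Gamma2 ((mx22 a b c d)^-1 * mx22 a' b' c' d') ->
  ((d * a' + - b * c') %% 2)%Z = 1 /\ ((d * b' + - b * d') %% 2)%Z = 0 /\
  ((- c * a' + a * c') %% 2)%Z = 0.
  by move=> h; rewrite invmx22 // mulmx22 => /Gamma2P[].
do 5?[case/orP]; move=> /eqP ->; do 5?[case/orP]; move=> /eqP -> //; by move/E => -[] // h [h2 h3]; exfalso; move: h h2 h3; lia.
Qed.

Lemma six_uniq : uniq six.
Proof.
have ne a b c d a' b' c' d' : (a != a') || (b != b') -> mx22 a b c d != mx22 a' b' c' d'.
  move=> h; apply/eqP => E; have [e1 e2 _ _] := mx22E a b c d.
  have [e1' e2' _ _] := mx22E a' b' c' d'; rewrite E in e1 e2.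
  by move: h; rewrite -e1 -e2 e1' e2' !eqxx.
by rewrite six_mx22 /= !inE !negb_or !ne.
Qed.

End Matrices.

(** * Products of powers of theta constants *)

Section Slash.
Variable R : realType.
Local Notation C := R[i].
Implicit Types (z w k : C) (g h : M2Z) (f : C -> C).

Definition den g z : C := (g 1 0)%:~R * z + (g 1 1)%:~R.
Definition mob g z : C := ((g 0 0)%:~R * z + (g 0 1)%:~R) / den g z.

Lemma slashE g f z : slash g f z = f (mob g z) / den g z ^+ 2.
Proof. by []. Qed.

Definition zoff f := forall z, ~~ upper z -> f z = 0.
Definition cscale k f : C -> C := fun z => k * f z.

Lemma cIm_int (n : int) z : complex.Im (n%:~R * z) = n%:~R * complex.Im z.
Proof. by rewrite -(rmorph_int (real_complex R)) cImZ. Qed.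

Lemma cIm_intr (n : int) : complex.Im (n%:~R : C) = 0.
Proof. by rewrite -(rmorph_int (real_complex R)). Qed.

Lemma cRe_int (n : int) z : complex.Re (n%:~R * z) = n%:~R * complex.Re z.
Proof. by rewrite -(rmorph_int (real_complex R)) cReZ. Qed.

Lemma cRe_intr (n : int) : complex.Re (n%:~R : C) = n%:~R.
Proof. by rewrite -(rmorph_int (real_complex R)). Qed.

Lemma den_upper_neq0 g z : SL2Z g -> upper z -> den g z != 0.
Proof.
case/SL2Z_mx22P => a [b [c [d [-> e]]]] z0; have [_ _ ec ed] := mx22E a b c d.
apply/eqP; rewrite /den ec ed => E.
have := congr1 (@complex.Im R) E; rewrite cImD cIm_int cIm_intr addr0 => /eqP.
rewrite mulf_eq0 (gt_eqF z0) orbF intr_eq0 => /eqP c0.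
move: E; rewrite c0 mul0r add0r => /eqP; rewrite intr_eq0 => /eqP d0.
by move: e; rewrite c0 d0; lia.
Qed.

Lemma Im_mob g z : SL2Z g -> complex.Im (mob g z) = complex.Im z / cabs (den g z) ^+ 2.
Proof.
case/SL2Z_mx22P => a [b [c [d [-> e]]]]; have [ea eb ec ed] := mx22E a b c d.
rewrite /mob cImM cImV cReV !mulrA -mulrDl; congr (_ / _).
rewrite /den ea eb ec ed !cImD !cReD !cIm_int !cRe_int !cIm_intr !cRe_intr.
have := congr1 (fun n : int => n%:~R : R) e; rewrite rmorphB !rmorphM /= mulr1z => E.
move: (a%:~R) (b%:~R) (c%:~R) (d%:~R) E => a' b' c' d' E.
by rewrite -[RHS]mul1r -E; ring.
Qed.

Lemma upper_mob g z : SL2Z g -> upper z -> upper (mob g z).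
Proof.
by move=> gS z0; rewrite /upper Im_mob // divr_gt0 // exprn_gt0 // cabs_gt0 den_upper_neq0.
Qed.

Lemma slash_zoff g f : SL2Z g -> zoff f -> zoff (slash g f).
Proof.
move=> gS f0 z z0; rewrite slashE f0 ?mul0r //.
rewrite /upper Im_mob // -leNgt mulr_le0_ge0 ?invr_ge0 ?exprn_ge0 ?cabs_ge0 //.
by rewrite leNgt.
Qed.

Lemma slashM g h f : SL2Z g -> SL2Z h -> zoff f -> slash (g * h) f = slash h (slash g f).
Proof.
move=> gS hS f0; have ghS := SL2ZM gS hS; apply/funext => z.
have [z0|z0] := boolP (upper z); last first.
  by rewrite (slash_zoff ghS f0 z0) (slash_zoff hS (slash_zoff gS f0) z0).
have hz := den_upper_neq0 hS z0; have uh := upper_mob hS z0.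
have gz := den_upper_neq0 gS uh.
suff [E1 E2] : den (g * h) z = den g (mob h z) * den h z /\ mob (g * h) z = mob g (mob h z).
  by rewrite !slashE E1 E2; field; rewrite hz gz.
have ED : den (g * h) z = den g (mob h z) * den h z.
  rewrite {1 2}/den /mob; rewrite /den in hz *.
  rewrite (mx22_eta g) (mx22_eta h) mulmx22 !mxE /=.
  by rewrite !rmorphD !rmorphM /=; field.
split=> //; rewrite {1}/mob ED.
apply: (mulIf (mulf_neq0 gz hz)); rewrite divfK ?mulf_neq0 //.
rewrite {2}/mob mulrA divfK //.
rewrite /mob (mx22_eta g) (mx22_eta h) mulmx22 !mxE /=.
rewrite /den in hz *; rewrite !mxE /= in hz *.
by rewrite !rmorphD !rmorphM /=; field.
Qed.

Lemma slash_opp g f : slash (- g) f = slash g f.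
Proof.
apply/funext => z; rewrite !slashE /mob.
have -> : den (- g) z = - den g z by rewrite /den !mxE !rmorphN mulNr -opprD.
by rewrite !mxE !rmorphN mulNr -opprD sqrrN invrN mulrNN.
Qed.

Lemma slash1 f : slash 1 f = f.
Proof.
apply/funext => z; rewrite slashE /mob /den onemx22 !mxE /=.
by rewrite mul0r add0r mul1r addr0 expr1n !divr1.
Qed.

Lemma slash_N1 f : slash (-1) f = f.
Proof. by rewrite slash_opp slash1. Qed.

Lemma slash_S f z : slash matS f z = f (Sinv z) / z ^+ 2.
Proof.
rewrite slashE /mob /den !mxE /= mul0r add0r mul1r addr0.
by rewrite /Sinv rmorphN1 mulN1r.
Qed.

Lemma slash_upperT (n : int) f z : slash (mx22 1 n 0 1) f z = f (z + n%:~R).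
Proof. by rewrite slashE /mob /den !mxE /= mul0r add0r mul1r expr1n !divr1. Qed.

Lemma slash_T f z : slash matT f z = f (z + 1).
Proof. by rewrite slash_upperT. Qed.

Lemma slash_A f z : slash matA f z = f (z + 2).
Proof. by rewrite slash_upperT. Qed.

Lemma slash_scale g k f : slash g (cscale k f) = cscale k (slash g f).
Proof. by apply/funext => z; rewrite slashE /cscale -mulrA. Qed.

Lemma slash_lincomb g n (e : 'I_n -> C -> C) (c : 'I_n -> C) :
  slash g (lincomb e c) = lincomb (fun i => slash g (e i)) c.
Proof.
apply/funext => z; rewrite slashE /lincomb mulr_suml; apply: eq_bigr => i _.
by rewrite -mulrA.
Qed.

Lemma cscaleA k l f : cscale k (cscale l f) = cscale (k * l) f.
Proof. by apply/funext => z; rewrite /cscale mulrA. Qed.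

Lemma cscale1 f : cscale 1 f = f.
Proof. by apply/funext => z; rewrite /cscale mul1r. Qed.

Lemma slashVK g f : SL2Z g -> zoff f -> slash g^-1 (slash g f) = f.
Proof. by move=> gS f0; rewrite -slashM ?mulSLV ?slash1 //; exact: SL2ZV. Qed.

Lemma slashV_scale g k f : SL2Z g -> zoff f -> k != 0 ->
  slash g f = cscale k f -> slash g^-1 f = cscale k^-1 f.
Proof.
move=> gS f0 k0 E; rewrite -[f in LHS](cscale1 f) -(mulVf k0) -cscaleA -E slash_scale.
by rewrite slashVK.
Qed.

Lemma upper_Sinvb z : upper (Sinv z) = upper z.
Proof.
have h w : upper w -> upper (Sinv w) by exact: upper_Sinv.
by apply/idP/idP => [/h|/h//]; rewrite SinvK.
Qed.

Lemma upper_addr (x : R) z : upper (z + x%:C) = upper z.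
Proof. by rewrite /upper cImD cImR addr0. Qed.

End Slash.

Lemma W2E (R : realType) (z : R[i]) :
  W2 z = (ln 2)%:C + 'i * pi%:C * (z / 6) - Lam (-1) (e2 z).
Proof. by []. Qed.

Lemma W4E (R : realType) (z : R[i]) : W4 z = - ('i * pi%:C * (z / 12)) - Mser (e1 z).
Proof. by []. Qed.

Lemma W3E (R : realType) (z : R[i]) : W3 z = - ('i * pi%:C * (z / 12)) - Mser (- e1 z).
Proof. by []. Qed.

Lemma l0E (R : realType) (z : R[i]) : l0 z = 'i * pi%:C * (z / 6) - Lam 1 (e2 z).
Proof. by []. Qed.

Local Opaque csum cexp Lam Mser e1 e2 th W2 W3 W4 l0.

Section BasicForms.
Variable R : realType.
Local Notation C := R[i].
Implicit Types (z w k : C) (g h : M2Z) (f : C -> C) (a b c : C).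

(* For a + b + c = 4 this is theta_2^a theta_4^b theta_3^c (not an Eisenstein
   series); real exponents are allowed, the theta constants having no zeros. *)
Definition logE a b c z : C := 2 * l0 z + (a * W2 z + b * W4 z + c * W3 z).
Definition E4 a b c z : C := if upper z then cexp (logE a b c z) else 0.

Lemma E4_zoff a b c : zoff (E4 a b c).
Proof. by move=> z /negPf z0; rewrite /E4 z0. Qed.

Lemma E4_neq0 a b c z : upper z -> E4 a b c z != 0.
Proof. by move=> z0; rewrite /E4 z0 cexp_neq0. Qed.

Let E4_S_aux z x1 x2 x3 x4 : z != 0 ->
  -1 * z ^+ 2 * x1 ^+ 2 * (x3 * x2 * x4) / z ^+ 2 = -1 * (x1 ^+ 2 * (x2 * x3 * x4)).
Proof. by move=> z0; field. Qed.

Lemma E4_S a b c : slash matS (E4 a b c) = cscale (-1) (E4 b a c).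
Proof.
apply/funext => z; rewrite slash_S /cscale /E4 upper_Sinvb.
case: ifP => z0; last by rewrite mul0r mulr0.
have [h1 h2 h3 h4] := modular_S z0; have zn0 := upper_neq0 z0.
rewrite /logE h1 h2 h3 !cexpD (cexp_natM 2) h4 (cexp_natM 2).
have ii : ('i%R : C) ^+ 2 = -1 by exact: sqrCi.
rewrite !exprMn sqrrN ii.
exact: E4_S_aux.
Qed.

Let logE_T_aux (p a b c l w2 w3 w4 : C) : a + b + c = 4 ->
  2 * (l + p / 6) + (a * (w2 + p / 6) + b * (w3 - p / 12) + c * (w4 - p / 12)) =
  p * (a / 4) + (2 * l + (a * w2 + c * w4 + b * w3)).
Proof.
move=> h; have -> : c = 4 - a - b by rewrite -h; ring.
by field.
Qed.

Lemma E4_T a b c : a + b + c = 4 ->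
  slash matT (E4 a b c) = cscale (cexp ('i * pi%:C * (a / 4))) (E4 a c b).
Proof.
move=> h; apply/funext => z; rewrite slash_T /cscale /E4 (upper_addr 1).
case: ifP => z0; last by rewrite mulr0.
by rewrite -cexpD /logE l0_T W2_T W4_T W3_T (logE_T_aux _ _ _ _ _ h).
Qed.

Lemma E4_A a b c : a + b + c = 4 -> slash matA (E4 a b c) = cscale (e2 (a / 4)) (E4 a b c).
Proof.
move=> h; rewrite -matTT slashM; try exact: SL2Z_T; last exact: E4_zoff.
rewrite E4_T // slash_scale E4_T ?cscaleA; last by rewrite addrAC.
congr cscale; rewrite -cexpD; congr cexp; ring.
Qed.

Lemma E4_B a b c : a + b + c = 4 -> slash matB (E4 a b c) = cscale (e2 (b / 4)) (E4 a b c).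
Proof.
move=> h; have SS := SL2Z_S; have SA := SL2Z_A; have Z := E4_zoff.
rewrite -matSAS slashM; try exact: Z; [|exact: SL2ZM|exact: SL2ZV].
have [-> _ _ _ _] := matV; rewrite slash_opp slashM // E4_S !slash_scale.
rewrite E4_A; last by rewrite addrC addrA addrAC -h; ring.
by rewrite !slash_scale E4_S !cscaleA; congr cscale; ring.
Qed.

Lemma cdiff_E4 a b c z : upper z -> cdiff (E4 a b c) z.
Proof.
move=> z0; apply: (@cdiff_near _ (fun z => cexp (logE a b c z)) _ _ (complex.Im z)) => //.
  move=> w wz; rewrite /E4; have -> // : upper w.
  have := le_lt_trans (cabs_Im (w - z)) wz; rewrite cImD cImN ltr_norml /upper => /andP[]; lra.
apply: (@cdiff_comp _ (logE a b c) (@cexp R)); last exact: cdiff_cexp.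
apply: cdiffD; first by apply: cdiffZ; exact: cdiff_l0.
apply: cdiffD; last by apply: cdiffZ; exact: cdiff_W3.
by apply: cdiffD; apply: cdiffZ; [exact: cdiff_W2|exact: cdiff_W4].
Qed.

Lemma cabs_Lam1 x q (p : R) : cabs x = 1 -> cabs q <= p -> p < 1 ->
  cabs (Lam x q) <= 2 * p / (1 - p) / (1 - p).
Proof.
move=> x1 qp p1; have p0 : 0 <= p by apply: le_trans qp; exact: cabs_ge0.
apply: csum_bound; first by rewrite p0.
by apply: geom_lam => //; rewrite cabsM ?cabsV x1 ?invr1 mul1r.
Qed.

Lemma cabs_Mser q (p : R) : cabs q <= p -> p < 1 ->
  cabs (Mser q) <= 2 * p / (1 - p) / (1 - p).
Proof.
move=> qp p1; have p0 : 0 <= p by apply: le_trans qp; exact: cabs_ge0.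
by apply: csum_bound; [rewrite p0|exact: geom_Mser].
Qed.

(* [ordE x y w] is the order of [E4 x y w] at infinity in e2 (tau / 2), and
   [restE] the remaining, bounded part of its logarithm. *)
Definition ordE (x y w : R) : R := 1 / 3 + x / 6 - y / 12 - w / 12.

Definition restE (x y w : R) z : C := x%:C * (ln 2)%:C - 2 * Lam 1 (e2 z)
  - x%:C * Lam (-1) (e2 z) - y%:C * Mser (e1 z) - w%:C * Mser (- e1 z).

Let logE_rest_aux (p x y w z l L1 L2 M1 M2 : C) :
  2 * (p * (z / 6) - L1) + (x * (l + p * (z / 6) - L2) +
     y * (- (p * (z / 12)) - M1) + w * (- (p * (z / 12)) - M2)) =
  p * ((1 / 3 + x / 6 - y / 12 - w / 12) * z) +
  (x * l - 2 * L1 - x * L2 - y * M1 - w * M2).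
Proof. by field. Qed.

Lemma ordEC (x y w : R) :
  (ordE x y w)%:C = 1 / 3 + x%:C / 6 - y%:C / 12 - w%:C / 12.
Proof. by rewrite /ordE !(realCD, realCN, realCM, realCV, realCn) rmorph1. Qed.

Lemma logE_rest (x y w : R) z :
  logE x%:C y%:C w%:C z = 'i * pi%:C * ((ordE x y w)%:C * z) + restE x y w z.
Proof. by rewrite ordEC /logE W2E W3E W4E l0E logE_rest_aux. Qed.

Let restE_aux (x y w l b : R) (L1 L2 M1 M2 : C) : cabs L1 <= b -> cabs L2 <= b ->
  cabs M1 <= b -> cabs M2 <= b ->
  cabs (x%:C * l%:C - 2 * L1 - x%:C * L2 - y%:C * M1 - w%:C * M2) <=
  `|x| * `|l| + 2 * b + `|x| * b + `|y| * b + `|w| * b.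
Proof.
move=> h1 h2 h3 h4.
apply: le_trans (cabsB _ _) (lerD _ _); last by rewrite cabsM cabs_real ler_wpM2l.
apply: le_trans (cabsB _ _) (lerD _ _); last by rewrite cabsM cabs_real ler_wpM2l.
apply: le_trans (cabsB _ _) (lerD _ _); last by rewrite cabsM cabs_real ler_wpM2l.
apply: le_trans (cabsB _ _) (lerD _ _); last by rewrite cabsM cabs_nat ler_wpM2l.
by rewrite -realCM cabs_real normrM.
Qed.

Lemma restE_bound (x y w : R) : exists B : R, forall z, 1 / 2 <= complex.Im z ->
  cabs (restE x y w z) <= B.
Proof.
pose p : R := expR (- (pi / 2)).
have p1 : p < 1 by rewrite expR_lt1 oppr_lt0 divr_gt0 ?pi_gt0.
pose b : R := 2 * p / (1 - p) / (1 - p).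
exists (`|x| * `|ln 2| + 2 * b + `|x| * b + `|y| * b + `|w| * b) => z z1.
have e1p : cabs (e1 z) <= p.
  by rewrite cabs_e1 ler_expR lerN2; have := pi_gt0 R; nra.
have e2p : cabs (e2 z) <= p.
  by rewrite cabs_e2 ler_expR lerN2; have := pi_gt0 R; nra.
have h1 : cabs (Lam 1 (e2 z)) <= b by apply: cabs_Lam1 => //; rewrite cabs1.
have h2 : cabs (Lam (-1) (e2 z)) <= b by apply: cabs_Lam1 => //; rewrite cabsN cabs1.
have h3 : cabs (Mser (e1 z)) <= b by exact: cabs_Mser.
have h4 : cabs (Mser (- e1 z)) <= b by apply: cabs_Mser => //; rewrite cabsN.
exact: (restE_aux x y w (ln 2) h1 h2 h3 h4).
Qed.

Lemma E4_bound (x y w : R) : exists2 K : R, 0 < K & forall z, 1 / 2 <= complex.Im z ->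
  cabs (E4 x%:C y%:C w%:C z) <= K * expR (- (pi * ordE x y w * complex.Im z)) /\
  expR (- (pi * ordE x y w * complex.Im z)) <= K * cabs (E4 x%:C y%:C w%:C z).
Proof.
have [B HB] := restE_bound x y w; exists (expR B); first exact: expR_gt0.
move=> z z1; have z0 : upper z by rewrite /upper; lra.
have hB := le_trans (cabs_Re _) (HB _ z1); move: hB; rewrite ler_norml => /andP[b1 b2].
rewrite /E4 z0 cabs_cexp logE_rest cReD.
have -> : complex.Re ('i * pi%:C * ((ordE x y w)%:C * z)) = - (pi * ordE x y w * complex.Im z).
  have -> : 'i * pi%:C * ((ordE x y w)%:C * z) = (pi * ordE x y w)%:C * ('i * z).
    by rewrite realCM; ring.
  by rewrite cReZ cReM cRei cImi; ring.
rewrite -!expRD !ler_expR; split; lra.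
Qed.

End BasicForms.

Section Zeta.
Variable R : realType.
Local Notation C := R[i].
Variable N : nat.
Hypothesis hN : (2 < N)%N.
Implicit Types (z w k : C) (g h : M2Z) (f : C -> C).
Local Notation zeta := (zeta R N).

Let N0 : N%:R != 0 :> R. Proof. by rewrite pnatr_eq0; lia. Qed.
Let N0C : N%:R != 0 :> C. Proof. by rewrite pnatr_eq0; lia. Qed.

Lemma zetaE : zeta = e2 (1 / N%:R).
Proof.
have -> : 1 / N%:R = (1 / N%:R : R)%:C :> C by rewrite realCM realCV realCn rmorph1.
rewrite e2E cReR cImR mulr0 oppr0 expR0 !mul1r /Defs.zeta.
by congr Complex; congr (_ _); ring.
Qed.

Lemma zetaX n : zeta ^+ n = e2 (n%:R / N%:R).
Proof. by rewrite zetaE -e2_natM mulrA mulr1. Qed.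

Lemma zeta_eq1 n : (zeta ^+ n == 1) = (N %| n)%N.
Proof.
rewrite zetaX; apply/eqP/dvdnP => [/e2_eq1[k kE]|[k ->]]; last first.
  by rewrite natrM mulfK // -[k%:R]mulr1 e2_natM e2_1 expr1n.
have E : (n%:Z = k * N%:Z)%R.
  apply: (@intr_inj C); rewrite rmorphM /= -kE -!pmulrn divfK //.
by exists (absz k); rewrite -[n]/(absz n%:Z) E abszM.
Qed.

Lemma zeta_prim : N.-primitive_root zeta.
Proof.
apply/andP; split; first lia.
apply/forallP => i; rewrite unity_rootE zeta_eq1; apply/eqP; apply/idP/eqP.
  by move=> h; apply/eqP; rewrite eqn_leq (ltn_ord i) dvdn_leq.
by move=> ->.
Qed.

Lemma zeta_neq0 : zeta != 0.
Proof. by rewrite zetaE e2_neq0. Qed.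

Lemma zetaN : zeta ^+ N = 1.
Proof. by apply/eqP; rewrite zeta_eq1. Qed.

Lemma zeta_conj n : (zeta ^+ n)^* = (zeta ^+ n)^-1.
Proof.
have x0 : zeta ^+ n != 0 by rewrite expf_neq0 // zeta_neq0.
apply: (mulIf x0); rewrite mulVf // conjM_cabs cabsX zetaE cabs_e2.
have -> : 1 / N%:R = (1 / N%:R : R)%:C :> C by rewrite realCM realCV realCn rmorph1.
by rewrite cImR mulr0 oppr0 expR0 !expr1n.
Qed.

Definition zchi (r s : nat) (p : 'Z_N * 'Z_N) : C := zeta ^+ (r * p.1 + s * p.2).

Let NE : (Zp_trunc N).+2 = N. Proof. by rewrite Zp_cast //; lia. Qed.

Lemma zchiD r s p q : zchi r s (p + q) = zchi r s p * zchi r s q.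
Proof.
have e (x y : 'Z_N) : nat_of_ord (x + y)%R = ((nat_of_ord x + nat_of_ord y) %% N)%N.
  by transitivity ((nat_of_ord x + nat_of_ord y) %% (Zp_trunc N).+2)%N; [|congr (_ %% _)%N].
rewrite /zchi -exprD; apply/eqP; rewrite (eq_prim_root_expr zeta_prim) [(p + q).1]/= [(p + q).2]/= !e.
rewrite -modnDm modnMmr [(s * _ %% N)%N]modnMmr modnDm; apply/eqP; congr (_ %% _)%N; ring.
Qed.

Lemma zchi0 r s : zchi r s 0 = 1.
Proof. by rewrite /zchi /= !muln0 addn0 expr0. Qed.

Lemma zchi_neq0 r s p : zchi r s p != 0.
Proof. by rewrite expf_neq0 // zeta_neq0. Qed.

Lemma zchiN r s p : zchi r s (- p) = (zchi r s p)^-1.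
Proof. by apply: (mulIf (zchi_neq0 r s p)); rewrite -zchiD addNr zchi0 mulVf ?zchi_neq0. Qed.

Lemma zchi10 r s : zchi r s (1, 0) = zeta ^+ r.
Proof.
rewrite /zchi /= muln0 addn0; by rewrite modn_small // muln1.
Qed.

Lemma zchi01 r s : zchi r s (0, 1) = zeta ^+ s.
Proof.
rewrite /zchi /= muln0 add0n; by rewrite modn_small // muln1.
Qed.

Lemma slash_exists_exp f (r s : nat) : zoff f ->
  slash matA f = cscale (zeta ^+ r) f -> slash matB f = cscale (zeta ^+ s) f ->
  forall g, Gamma2 g -> exists n, slash g f = cscale (zeta ^+ n) f.
Proof.
move=> f0 fA fB.
have inv m : zeta ^+ (m * (N - 1)) = (zeta ^+ m)^-1.
  have x0 : zeta ^+ m != 0 by rewrite expf_neq0 // zeta_neq0.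
  apply: (mulIf x0); rewrite mulVf // -exprD.
  have -> : (m * (N - 1) + m = N * m)%N by nia.
  by rewrite exprM zetaN expr1n.
have zn m : zeta ^+ m != 0 by rewrite expf_neq0 // zeta_neq0.
apply: Gamma2_ind.
- by exists 0%N; rewrite expr0 cscale1 slash_N1.
- by exists r.
- by exists (r * (N - 1))%N; rewrite inv; apply: slashV_scale => //; exact: SL2Z_A.
- by exists s.
- by exists (s * (N - 1))%N; rewrite inv; apply: slashV_scale => //; exact: SL2Z_B.
move=> g h gG hG [n En] [m Em]; exists (n + m)%N.
rewrite slashM; [|exact: Gamma2SL gG|exact: Gamma2SL hG|by []].
by rewrite En slash_scale Em cscaleA exprD.
Qed.

Definition frac (n : nat) : R := 4 * n%:R / N%:R.

Lemma e2_frac n : e2 ((frac n)%:C / 4) = zeta ^+ n.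
Proof.
rewrite zetaX; congr e2; rewrite /frac !(realCM, realCV, realCn).
by field.
Qed.

Lemma cscale_inj a b c k l : cscale k (@E4 R a b c) = cscale l (E4 a b c) -> k = l.
Proof.
move=> E; have i0 : upper ('i : C) by rewrite /upper /= ltr01.
by have := congr1 (fun F : C -> C => F 'i) E; rewrite /cscale; apply: mulIf; exact: E4_neq0.
Qed.

Lemma ex_expAB : exists phi, is_expAB (N := N) phi.
Proof.
pose E1 := @E4 R (frac 1)%:C 0 (4 - (frac 1)%:C).
pose E2 := @E4 R 0 (frac 1)%:C (4 - (frac 1)%:C).
have s1 : (frac 1)%:C + 0 + (4 - (frac 1)%:C) = 4 by ring.
have s2 : 0 + (frac 1)%:C + (4 - (frac 1)%:C) = 4 by ring.
have A1 : slash matA E1 = cscale (zeta ^+ 1) E1 by rewrite E4_A // e2_frac.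
have B1 : slash matB E1 = cscale (zeta ^+ 0) E1 by rewrite E4_B // mul0r e2_0 expr0.
have A2 : slash matA E2 = cscale (zeta ^+ 0) E2 by rewrite E4_A // mul0r e2_0 expr0.
have B2 : slash matB E2 = cscale (zeta ^+ 1) E2 by rewrite E4_B // e2_frac.
have z1 : zoff E1 by exact: E4_zoff.
have z2 : zoff E2 by exact: E4_zoff.
pose n1 g := xget 0%N [set n | slash g E1 = cscale (zeta ^+ n) E1].
pose n2 g := xget 0%N [set n | slash g E2 = cscale (zeta ^+ n) E2].
have H1 g : Gamma2 g -> slash g E1 = cscale (zeta ^+ n1 g) E1.
  move=> /(slash_exists_exp z1 A1 B1)[n En].
  by apply: (@xgetPex _ 0%N [set n | slash g E1 = cscale (zeta ^+ n) E1]); exists n.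
have H2 g : Gamma2 g -> slash g E2 = cscale (zeta ^+ n2 g) E2.
  move=> /(slash_exists_exp z2 A2 B2)[n En].
  by apply: (@xgetPex _ 0%N [set n | slash g E2 = cscale (zeta ^+ n) E2]); exists n.
have cong n m : zeta ^+ n = zeta ^+ m -> n%:R = m%:R :> 'Z_N.
  move=> /eqP; rewrite (eq_prim_root_expr zeta_prim) => /eqP E.
  by apply: val_inj; rewrite /= !val_Zp_nat ?NE // ; lia.
have U1 g m : Gamma2 g -> slash g E1 = cscale (zeta ^+ m) E1 -> (n1 g)%:R = m%:R :> 'Z_N.
  by move=> gG; rewrite H1 // => /cscale_inj/cong.
have U2 g m : Gamma2 g -> slash g E2 = cscale (zeta ^+ m) E2 -> (n2 g)%:R = m%:R :> 'Z_N.
  by move=> gG; rewrite H2 // => /cscale_inj/cong.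
exists (fun g => ((n1 g)%:R, (n2 g)%:R)); split.
- move=> g h gG hG; have ghG := Gamma2M gG hG.
  have gS := Gamma2SL gG; have hS := Gamma2SL hG.
  rewrite (U1 _ (n1 g + n1 h)%N) //; last first.
    by rewrite slashM // H1 // slash_scale H1 // cscaleA exprD.
  rewrite (U2 _ (n2 g + n2 h)%N) ?natrD //.
  by rewrite slashM // H2 // slash_scale H2 // cscaleA exprD.
- by rewrite (U1 _ 0%N) ?(U2 _ 0%N) ?expr0 ?cscale1 ?slash_N1 //; exact: Gamma2_N1.
- by rewrite (U1 _ 1%N) ?(U2 _ 0%N) //; exact: Gamma2_A.
- by rewrite (U1 _ 0%N) ?(U2 _ 1%N) //; exact: Gamma2_B.
Qed.

Lemma expABP : is_expAB (expAB N).
Proof. exact: xgetPex ex_expAB. Qed.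

Lemma expABM g h : Gamma2 g -> Gamma2 h -> expAB N (g * h) = expAB N g + expAB N h.
Proof. by case: expABP => h1 _ _ _; exact: h1. Qed.

Lemma expAB1 : expAB N 1 = 0.
Proof.
have := expABM Gamma2_1 Gamma2_1; rewrite mulr1 => /eqP.
by rewrite -subr_eq0 opprD addNKr oppr_eq0 => /eqP.
Qed.

Lemma expABV g : Gamma2 g -> expAB N g^-1 = - expAB N g.
Proof.
move=> gG; apply/eqP; rewrite -addr_eq0 -expABM ?mulVSL ?expAB1 //; last exact: Gamma2V.
exact: Gamma2SL gG.
Qed.

Lemma expABX g n : Gamma2 g -> expAB N (g ^+ n) = expAB N g *+ n.
Proof.
move=> gG; elim: n => [|n IH]; first by rewrite expr0 expAB1.
by rewrite exprS expABM ?IH ?mulrS //; exact: Gamma2X.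
Qed.

Lemma Phi_Gamma2 g : Phi N g -> Gamma2 g. Proof. by case. Qed.

Lemma Phi1 : Phi N 1. Proof. by split; [exact: Gamma2_1|exact: expAB1]. Qed.

Lemma PhiM g h : Phi N g -> Phi N h -> Phi N (g * h).
Proof. by move=> [g1 g2] [h1 h2]; split; [exact: Gamma2M|rewrite expABM // g2 h2 addr0]. Qed.

Lemma PhiV g : Phi N g -> Phi N g^-1.
Proof. by move=> [g1 g2]; split; [exact: Gamma2V|rewrite expABV // g2 oppr0]. Qed.

Lemma slash_char f (r s : nat) : zoff f ->
  slash matA f = cscale (zeta ^+ r) f -> slash matB f = cscale (zeta ^+ s) f ->
  forall g, Gamma2 g -> slash g f = cscale (zchi r s (expAB N g)) f.
Proof.
move=> f0 fA fB; have [_ eN eA eB] := expABP.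
have zn m : zeta ^+ m != 0 by rewrite expf_neq0 // zeta_neq0.
apply: Gamma2_ind.
- by rewrite eN zchi0 cscale1 slash_N1.
- by rewrite eA zchi10.
- by rewrite expABV ?eA ?zchiN ?zchi10; [apply: slashV_scale => //; exact: SL2Z_A|exact: Gamma2_A].
- by rewrite eB zchi01.
- by rewrite expABV ?eB ?zchiN ?zchi01; [apply: slashV_scale => //; exact: SL2Z_B|exact: Gamma2_B].
move=> g h gG hG Eg Eh; rewrite slashM; [|exact: Gamma2SL gG|exact: Gamma2SL hG|by []].
by rewrite Eg slash_scale Eh cscaleA expABM // zchiD.
Qed.

Definition e3 (m1 m2 m3 : nat) : C -> C := E4 (frac m1)%:C (frac m2)%:C (frac m3)%:C.

Lemma e3_zoff m1 m2 m3 : zoff (e3 m1 m2 m3).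
Proof. exact: E4_zoff. Qed.

Lemma frac_sum m1 m2 m3 : (m1 + m2 + m3 = N)%N ->
  (frac m1)%:C + (frac m2)%:C + (frac m3)%:C = 4 :> C.
Proof.
move=> h; rewrite -!realCD /frac -!mulrDl -!mulrDr -!natrD h mulfK //.
by rewrite realCn.
Qed.

Lemma e3_A m1 m2 m3 : (m1 + m2 + m3 = N)%N ->
  slash matA (e3 m1 m2 m3) = cscale (zeta ^+ m1) (e3 m1 m2 m3).
Proof. by move=> h; rewrite E4_A ?e2_frac //; exact: frac_sum. Qed.

Lemma e3_B m1 m2 m3 : (m1 + m2 + m3 = N)%N ->
  slash matB (e3 m1 m2 m3) = cscale (zeta ^+ m2) (e3 m1 m2 m3).
Proof. by move=> h; rewrite E4_B ?e2_frac //; exact: frac_sum. Qed.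

Lemma e3_S m1 m2 m3 : slash matS (e3 m1 m2 m3) = cscale (-1) (e3 m2 m1 m3).
Proof. exact: E4_S. Qed.

Lemma e3_T m1 m2 m3 : (m1 + m2 + m3 = N)%N ->
  slash matT (e3 m1 m2 m3) = cscale (cexp ('i * pi%:C * ((frac m1)%:C / 4))) (e3 m1 m3 m2).
Proof. by move=> h; rewrite E4_T //; exact: frac_sum. Qed.

Lemma e3_Gamma2 m1 m2 m3 g : (m1 + m2 + m3 = N)%N -> Gamma2 g ->
  slash g (e3 m1 m2 m3) = cscale (zchi m1 m2 (expAB N g)) (e3 m1 m2 m3).
Proof.
by move=> h; apply: slash_char; [exact: e3_zoff|exact: e3_A|exact: e3_B].
Qed.

Lemma e3_slash g : SL2Z g -> forall m1 m2 m3, (m1 + m2 + m3 = N)%N ->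
  exists k m1' m2' m3', [/\ k != 0, perm_eq [:: m1'; m2'; m3'] [:: m1; m2; m3] &
    slash g (e3 m1 m2 m3) = cscale k (e3 m1' m2' m3')].
Proof.
move: g; apply: SL2Z_ind => [m1 m2 m3 h|m1 m2 m3 h|m1 m2 m3 h|m1 m2 m3 h|].
- by exists 1, m1, m2, m3; rewrite oner_eq0 slash1 cscale1.
- exists (-1), m2, m1, m3; rewrite oppr_eq0 oner_eq0 e3_S; split => //.
  by apply/seq.permP => p /=; lia.
- exists (cexp ('i * pi%:C * ((frac m1)%:C / 4))), m1, m3, m2; rewrite cexp_neq0 e3_T //; split => //.
  by apply/seq.permP => p /=; lia.
- pose x := cexp ('i * pi%:C * ((frac m1)%:C / 4)); exists x^-1, m1, m3, m2.
  have x0 : x != 0 by exact: cexp_neq0.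
  split; [by rewrite invr_eq0|by apply/seq.permP => p /=; lia|].
  have h' : (m1 + m3 + m2 = N)%N by lia.
  rewrite -[e3 m1 m2 m3]cscale1 -(mulVf x0) -cscaleA -e3_T // slash_scale.
  by rewrite slashVK //; [exact: SL2Z_T|exact: e3_zoff].
move=> g h gS hS Pg Ph m1 m2 m3 e.
have [k [m1' [m2' [m3' [k0 p E]]]]] := Pg _ _ _ e.
have e' : (m1' + m2' + m3' = N)%N.
  by have := perm_sumn p; rewrite /= !addn0 !addnA e.
have [l [n1 [n2 [n3 [l0 q E']]]]] := Ph _ _ _ e'.
exists (k * l), n1, n2, n3; rewrite mulf_neq0 //; split => //; first exact: perm_trans q p.
by rewrite slashM //; [rewrite E slash_scale E' cscaleA|exact: e3_zoff].
Qed.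

Lemma zeta_ord_eq0 (x : 'Z_N) : zeta ^+ x = 1 -> x = 0.
Proof.
move=> /eqP; rewrite zeta_eq1 => h; apply: val_inj => /=.
have : (x < N)%N by have := ltn_ord x; rewrite {2}NE.
by move: h; case: (nat_of_ord x) => // n /dvdn_leq; lia.
Qed.

Lemma PhiJ g h : SL2Z g -> Phi N h -> Phi N (g * h * g^-1).
Proof.
move=> gS [hG h0]; have gJ := Gamma2J gS hG; split => //.
have hS := Gamma2SL hG; have gV := SL2ZV gS.
have triv m1 m2 m3 : (m1 + m2 + m3 = N)%N ->
    slash (g * h * g^-1) (e3 m1 m2 m3) = e3 m1 m2 m3.
  move=> e; have [k [m1' [m2' [m3' [k0 p E]]]]] := e3_slash gS e.
  have e' : (m1' + m2' + m3' = N)%N by have := perm_sumn p; rewrite /= !addn0 !addnA e.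
  rewrite slashM //; [|exact: SL2ZM|exact: e3_zoff].
  rewrite slashM //; last exact: e3_zoff.
  rewrite E slash_scale e3_Gamma2 // h0 zchi0 cscale1 -E slashVK //.
  exact: e3_zoff.
have z m1 m2 m3 : (m1 + m2 + m3 = N)%N -> zchi m1 m2 (expAB N (g * h * g^-1)) = 1.
  by move=> e; have := triv _ _ _ e; rewrite e3_Gamma2 // -[RHS]cscale1 => /cscale_inj.
have z1 : zchi 1 0 (expAB N (g * h * g^-1)) = 1 by apply: (z _ _ (N - 1)%N); lia.
have z2 : zchi 0 1 (expAB N (g * h * g^-1)) = 1 by apply: (z _ _ (N - 1)%N); lia.
move: z1 z2; rewrite /zchi !mul0n !mul1n addn0 add0n; case: (expAB _ _) => x y /= z1 z2.
by rewrite (zeta_ord_eq0 z1) (zeta_ord_eq0 z2).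
Qed.

End Zeta.

(** * Cusp forms of level Phi(N) *)

Section VanishFamily.
Variable R : realType.
Local Notation C := R[i].
Implicit Types (z w : C).

Lemma exprn_large (x B : R) : 1 < x -> exists n, B < x ^+ n.
Proof.
move=> x1; pose d := x - 1; have d0 : 0 < d by rewrite subr_gt0.
have bern n : 1 + n%:R * d <= x ^+ n.
  elim: n => [|n IH]; first by rewrite mul0r addr0 expr0.
  have x0 : 0 <= x by lra.
  rewrite exprS -natr1; have := ler_wpM2l x0 IH; apply: le_trans.
  have -> : x = 1 + d by rewrite /d; ring.
  have : 0 <= n%:R * (d * d) by rewrite !mulr_ge0 // ltW.
  by lra.
exists (Num.bound (`|B| / d)); apply: lt_le_trans (bern _).
have := archi_boundP (divr_ge0 (normr_ge0 B) (ltW d0)).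
by rewrite ltr_pdivrMr // => h; have := ler_norm B; lra.
Qed.

Variables (I : finType) (P : I -> C -> C).
Hypothesis PS : forall i, exists j, forall z, upper z -> cabs (P i (Sinv z)) = cabs (P j z).
Hypothesis PT : forall i, exists j, forall z, upper z -> cabs (P i (z + 1)) = cabs (P j z).
Hypothesis PT' : forall i, exists j, forall z, upper z -> cabs (P i (z - 1)) = cabs (P j z).
Hypothesis PD : forall i z, upper z -> cdiff (P i) z.
Hypothesis P0 : forall i e, 0 < e -> exists Y, forall z, Y < complex.Im z -> cabs (P i z) <= e.

Let equiv z z' := forall i, exists j, cabs (P i z) = cabs (P j z').

Let equiv_trans z1 z2 z3 : equiv z1 z2 -> equiv z2 z3 -> equiv z1 z3.
Proof. by move=> h1 h2 i; have [j ->] := h1 i; exact: h2. Qed.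

Let equiv_shift z (n : int) : upper z -> equiv (z + n%:~R) z.
Proof.
move=> z0; have up m : upper (z + m%:R%:C) by rewrite upper_addr.
have up' m : upper (z - m%:R%:C) by rewrite -realCN upper_addr.
case: n => n.
  elim: n => [|n IH]; first by rewrite addr0 => i; exists i.
  move=> i; have [j Ej] := PT i; have [k Ek] := IH j; exists k; rewrite -Ek -Ej.
    by rewrite -addrA; congr (cabs (P _ (_ + _))); rewrite -!pmulrn -natr1.
  by rewrite -pmulrn -realCn; exact: up.
rewrite NegzE rmorphN /= -pmulrn; elim: {n}n.+1 => [|n IH]; first by rewrite subr0 => i; exists i.
move=> i; have [j Ej] := PT' i; have [k Ek] := IH j; exists k; rewrite -Ek -Ej.
  by rewrite -addrA -opprD natr1.
by rewrite -realCn; exact: up'.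
Qed.

Let reduction n z : upper z -> 1 / 2 <= 2 ^+ n * complex.Im z ->
  exists z', [/\ -(1/2) <= complex.Re z' <= 1/2, 1/2 <= complex.Im z' & equiv z z'].
Proof.
elim: n z => [|n IH] z z0 zn.
all: pose m := Num.floor (complex.Re z + 1 / 2).
all: pose z1 := z + (- m)%:~R.
all: have I1 : complex.Im z1 = complex.Im z by rewrite cImD cIm_intr addr0.
all: have up1 : upper z1 by rewrite /upper I1.
all: have e1 : equiv z z1 by have := @equiv_shift z1 m up1; rewrite /z1 rmorphN subrK.
all: have R1 : -(1/2) <= complex.Re z1 <= 1/2 by (rewrite cReD cRe_intr rmorphN /=;
  have := floor_le (complex.Re z + 1 / 2); have := floorD1_gt (complex.Re z + 1/2);
  rewrite -/m intrD; lra).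
  exists z1; split; [exact: R1| |exact: e1].
  by move: zn; rewrite I1 expr0; lra.
have [z1l|z1l] := leP (1/2) (complex.Im z1); first by exists z1.
have [] := IH (Sinv z1).
- by rewrite upper_Sinvb.
- rewrite Im_Sinv; have n0 : 0 < cabs z1 ^+ 2 by rewrite exprn_gt0 // cabs_gt0 upper_neq0.
  rewrite mulrA ler_pdivlMr //; move: zn; rewrite -I1 exprS.
  have : cabs z1 ^+ 2 <= 1/2.
    rewrite cabs_sqr; move: R1 z1l up1 => /andP[]; rewrite /upper; nra.
  lra.
move=> z' [h1 h2 h3]; exists z'; split => //.
apply: equiv_trans e1 _; apply: equiv_trans h3 => i.
have [j Ej] := PS i; exists j; rewrite -Ej ?upper_Sinvb //.
by rewrite SinvK.
Qed.

Let reduce z : upper z ->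
  exists z', [/\ -(1/2) <= complex.Re z' <= 1/2, 1/2 <= complex.Im z' & equiv z z'].
Proof.
move=> z0; have [n nE] := @exprn_large 2 (1 / 2 / complex.Im z) ltac:(lra).
apply: (reduction (n := n)) => //.
by move: nE; rewrite ltr_pdivrMr // => /ltW.
Qed.

(* Maximum principle: modulo [PS] and [PT] every point may be moved to the region
   |Re z| <= 1/2, Im z >= 1/2, where by [P0] the largest value would be attained. *)
Lemma vanish_family i z : upper z -> P i z = 0.
Proof.
move=> z0; apply/eqP; rewrite -cabs_eq0; apply/eqP/le_anti; rewrite cabs_ge0 andbT.
rewrite leNgt; apply/negP; set M1 := cabs _ => M10.
have M2 : 0 < M1 / 2 by rewrite divr_gt0.
have [Yf HYf] : exists Yf : I -> R, forall j w, Yf j < complex.Im w -> cabs (P j w) <= M1 / 2.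
  exists (fun j => xget 0 [set Y | forall w, Y < complex.Im w -> cabs (P j w) <= M1 / 2]).
  move=> j; have [Y HY] := P0 j M2.
  by apply: (@xgetPex _ 0 [set Y | forall w, Y < complex.Im w -> cabs (P j w) <= M1 / 2]); exists Y.
pose Y := 1 + \sum_j `|Yf j|.
have YfY j : Yf j <= Y.
  apply: le_trans (ler_norm _) _; rewrite /Y (bigD1 j) //=.
  have : 0 <= \sum_(i0 | i0 != j) `|Yf i0| by apply: sumr_ge0.
  lra.
have Y1 : 1 <= Y by rewrite lerDl sumr_ge0.
have high j w : Y < complex.Im w -> cabs (P j w) <= M1 / 2.
  by move=> h; apply: HYf; exact: le_lt_trans h.
have hY : 1 / 2 <= Y by lra.
have hx : -(1/2) <= 1/2 :> R by lra.
pose F j w := P j (clampy (1/2) Y w).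
have cF j : gcont (F j).
  move=> w; apply: (@ccont_comp _ (clampy (1/2) Y) (P j)); first exact: ccont_clampy.
  by apply: cdiff_cont; apply: PD; rewrite /upper; have := clampy_Im w hY; lra.
have HF j : exists p : R * R, [/\ -(1/2) <= p.1 <= 1/2, 1/2 <= p.2 <= Y &
    forall w, -(1/2) <= complex.Re w <= 1/2 -> 1/2 <= complex.Im w <= Y ->
    cabs (P j w) <= cabs (P j (p.1 +i* p.2))].
  have [x0 [y0 [h1 h2 h3]]] := gcont_max (cF j) hx hY; exists (x0, y0); split=> // w w1 w2.
  have := h3 _ _ w1 w2; rewrite /F !clampy_id //=; by case: w {w1 w2}.
pose p j : R * R := xget (0, 0) [set p : R * R | [/\ -(1/2) <= p.1 <= 1/2, 1/2 <= p.2 <= Y &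
    forall w, -(1/2) <= complex.Re w <= 1/2 -> 1/2 <= complex.Im w <= Y ->
    cabs (P j w) <= cabs (P j (p.1 +i* p.2))]].
have Hp j : [/\ -(1/2) <= (p j).1 <= 1/2, 1/2 <= (p j).2 <= Y &
    forall w, -(1/2) <= complex.Re w <= 1/2 -> 1/2 <= complex.Im w <= Y ->
    cabs (P j w) <= cabs (P j ((p j).1 +i* (p j).2))].
  exact: (@xgetPex _ (0, 0) [set p : R * R | [/\ -(1/2) <= p.1 <= 1/2, 1/2 <= p.2 <= Y &
    forall w, -(1/2) <= complex.Re w <= 1/2 -> 1/2 <= complex.Im w <= Y ->
    cabs (P j w) <= cabs (P j (p.1 +i* p.2))]] (HF j)).
pose q j : C := (p j).1 +i* (p j).2.
pose i0 := [arg max_(j > i) cabs (P j (q j))]%O.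
have Hi0 j : cabs (P j (q j)) <= cabs (P i0 (q i0)).
  by rewrite /i0; case: arg_maxP => // k _ h; exact: h.
set M := cabs (P i0 (q i0)) in Hi0.
have low j w : -(1/2) <= complex.Re w <= 1/2 -> 1/2 <= complex.Im w <= Y -> cabs (P j w) <= M.
  by move=> h1 h2; have [_ _ h] := Hp j; exact: le_trans (h _ h1 h2) (Hi0 j).
have M1M : M1 <= M.
  have [z' [h1 h2 h3]] := reduce z0; have [j Ej] := h3 i; rewrite /M1 Ej.
  apply: low => //; rewrite h2 leNgt; apply/negP => /(high j); rewrite -Ej -/M1; lra.
have bnd j w : upper w -> cabs (P j w) <= M.
  move=> w0; have [z' [h1 h2 h3]] := reduce w0; have [k Ek] := h3 j; rewrite Ek.
  have [h|h] := leP (complex.Im z') Y; first by apply: low => //; rewrite h2.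
  by apply: le_trans (high k _ h) _; lra.
have climb n : exists w, complex.Im w = (p i0).2 * (3 / 2) ^+ n /\ cabs (P i0 w) = M.
  have [_ /andP[p2 _] _] := Hp i0.
  elim: n => [|n [w [wI wM]]]; first by exists (q i0); rewrite expr0 mulr1.
  have w0 : 0 < complex.Im w by rewrite wI mulr_gt0 ?exprn_gt0; lra.
  have near v : cabs (v - w) < complex.Im w -> upper v.
    move=> vw; have := le_lt_trans (cabs_Im (v - w)) vw; rewrite cImD cImN ltr_norml /upper => /andP[]; lra.
  exists (w + (complex.Im w / 2)%:C * 'i); split.
    by rewrite cImD cImZ cImi wI exprS; field.
  apply: (max_modulus (r' := complex.Im w) _ _ wM) => [v /near vu|v /near vu|].
  - exact: PD.
  - exact: bnd.
  by rewrite addrC addKr cabsM cabs_i mulr1 cabs_real gtr0_norm; lra.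
have [n nE] := @exprn_large (3/2) (2 * Y) ltac:(lra).
have [w [wI wM]] := climb n; have [_ /andP[p2 _] _] := Hp i0.
have : Y < complex.Im w by rewrite wI; nra.
by move=> /(high i0); rewrite wM; lra.
Qed.

End VanishFamily.

Section CuspForms.
Variable R : realType.
Local Notation C := R[i].
Variable N : nat.
Hypothesis hN : (2 < N)%N.
Implicit Types (z w k : C) (g h : M2Z) (f : C -> C).
Local Notation zeta := (zeta R N).
Local Notation S2 := (@S2 R N).
Local Notation e3 := (@e3 R N).

Lemma vanishP f : vanish_at_ioo f <-> forall e : R, 0 < e -> exists B : R,
  forall z, B < complex.Im z -> cabs (f z) < e.
Proof.
by split=> h e /h[B HB]; exists B => z /HB; rewrite normC_cabs ltcR.
Qed.

Lemma S2_zoff f : S2 f -> zoff f. Proof. by case. Qed.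

Lemma S2_cdiff f z : S2 f -> upper z -> cdiff f z.
Proof. by case=> _ h _ _ /h/derivable_cdiff. Qed.

Lemma S2_intro f : zoff f -> (forall z, upper z -> cdiff f z) ->
  (forall g, Phi N g -> slash g f = f) ->
  (forall g, SL2Z g -> forall e : R, 0 < e -> exists B : R,
     forall z, B < complex.Im z -> cabs (slash g f z) < e) -> S2 f.
Proof.
move=> h1 h2 h3 h4; split=> // [z /h2/derivable_cdiff//|g /h4 h].
exact/vanishP.
Qed.

Lemma cdiff_slash g f z : SL2Z g -> (forall w, upper w -> cdiff f w) -> upper z ->
  cdiff (slash g f) z.
Proof.
move=> gS df z0; have d0 := den_upper_neq0 gS z0.
have dl (a b : C) : cdiff (fun w => a * w + b) z.
  by apply: cdiffD; [apply: cdiffZ; exact: cdiff_id|exact: cdiff_cst].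
apply: (@cdiffM _ (fun w => f (mob g w)) (fun w => (den g w ^+ 2)^-1)).
  apply: (@cdiff_comp _ (mob g) f); last by apply: df; exact: upper_mob.
  by apply: cdiffM; [exact: dl|apply: cdiffV; [|exact: dl]].
apply: cdiffV; first by rewrite expf_neq0.
by apply: (@cdiff_comp _ (den g) (fun w => w ^+ 2)); [exact: dl|exact: cdiffX].
Qed.

Lemma S2_Phi f g : S2 f -> Phi N g -> slash g f = f.
Proof. by case=> _ _ h _; exact: h. Qed.

Lemma S2_vanish f g : S2 f -> SL2Z g -> forall e : R, 0 < e -> exists B : R,
  forall z, B < complex.Im z -> cabs (slash g f z) < e.
Proof. by case=> _ _ _ h gS; exact: (vanishP _).1 (h _ gS). Qed.

Lemma S2_slash g f : SL2Z g -> S2 f -> S2 (slash g f).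
Proof.
move=> gS fS; have f0 := S2_zoff fS; apply: S2_intro.
- exact: slash_zoff.
- by move=> z; apply: cdiff_slash => // w; exact: S2_cdiff.
- move=> h hP; have hS := Gamma2SL (Phi_Gamma2 hP).
  have jP := PhiJ R hN gS hP; have jS := Gamma2SL (Phi_Gamma2 jP).
  rewrite -slashM //; have -> : g * h = g * h * g^-1 * g by rewrite -mulrA mulVSL ?mulr1.
  by rewrite slashM // (S2_Phi fS jP).
move=> h hS e e0; have [B HB] := S2_vanish fS (SL2ZM gS hS) e0.
by exists B => z /HB; rewrite slashM.
Qed.

Lemma S2_add f1 f2 : S2 f1 -> S2 f2 -> S2 (fun z => f1 z + f2 z).
Proof.
move=> h1 h2; have sl g : slash g (fun z => f1 z + f2 z) = fun z => slash g f1 z + slash g f2 z.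
  by apply/funext => z; rewrite !slashE mulrDl.
apply: S2_intro => [z z0|z z0|g gP|g gS e e0].
- by rewrite (S2_zoff h1 z0) (S2_zoff h2 z0) addr0.
- by apply: cdiffD; exact: S2_cdiff.
- by rewrite sl (S2_Phi h1 gP) (S2_Phi h2 gP).
have e2 : 0 < e / 2 by rewrite divr_gt0.
have [B1 H1] := S2_vanish h1 gS e2; have [B2 H2] := S2_vanish h2 gS e2.
exists (Num.max B1 B2) => z; rewrite gt_max => /andP[/H1 k1 /H2 k2].
by rewrite sl; have := cabsD (slash g f1 z) (slash g f2 z); lra.
Qed.

Lemma S2_scale k f : S2 f -> S2 (cscale k f).
Proof.
move=> h; apply: S2_intro => [z z0|z z0|g gP|g gS e e0].
- by rewrite /cscale (S2_zoff h z0) mulr0.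
- by apply: cdiffZ; exact: S2_cdiff.
- by rewrite slash_scale (S2_Phi h gP).
have K0 : 0 < cabs k + 1 by rewrite ltr_wpDl ?cabs_ge0.
have e1 : 0 < e / (cabs k + 1) by rewrite divr_gt0.
have [B H] := S2_vanish h gS e1; exists B => z /H.
rewrite slash_scale /cscale cabsM ltr_pdivlMr // => k1.
by apply: le_lt_trans k1; rewrite mulrC ler_wpM2l ?cabs_ge0 // lerDl.
Qed.

Lemma S2_zero : S2 (fun=> 0).
Proof.
apply: S2_intro => [//|z _|g _|g _ e e0]; first exact: cdiff_cst.
  by apply/funext => z; rewrite slashE mul0r.
by exists 0 => z _; rewrite slashE mul0r cabs0.
Qed.

Lemma S2_sum (I : finType) (P : pred I) (F : I -> C -> C) :
  (forall i, P i -> S2 (F i)) -> S2 (fun z => \sum_(i | P i) F i z).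
Proof.
move=> h; suff : forall s : seq I, S2 (fun z => \sum_(i <- s | P i) F i z) by apply.
elim=> [|i s IH].
  by rewrite (_ : (fun z => _) = fun=> 0); [exact: S2_zero|apply/funext => z; rewrite big_nil].
have [Pi|Pi] := boolP (P i); last first.
  by rewrite (_ : (fun z => _) = fun z => \sum_(i <- s | P i) F i z) //; apply/funext => z;
    rewrite big_cons (negPf Pi).
rewrite (_ : (fun z => _) = fun z => F i z + \sum_(i <- s | P i) F i z); last first.
  by apply/funext => z; rewrite big_cons Pi.
by apply: S2_add => //; exact: h.
Qed.

Lemma ordE_frac (r s t k : nat) : (r + s + t = k * N)%N ->
  ordE (frac R N r) (frac R N s) (frac R N t) = r%:R / N%:R + (1 - k%:R) / 3.
Proof.
move=> h; have N0 : N%:R != 0 :> R by rewrite pnatr_eq0; lia.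
have hR : t%:R = k%:R * N%:R - r%:R - s%:R :> R by rewrite -natrM -h !natrD; ring.
by rewrite /ordE /frac hR; field.
Qed.

Lemma expR_small (x e : R) : 0 < x -> 0 < e -> exists Y, forall y, Y < y -> expR (- (x * y)) < e.
Proof.
move=> x0 e0; exists (- ln e / x) => y; rewrite ltr_pdivrMr // => h.
by rewrite -[e in X in _ < X](lnK e0) ltr_expR; lra.
Qed.

Lemma e3_S2 m1 m2 m3 : (0 < m1)%N -> (0 < m2)%N -> (0 < m3)%N -> (m1 + m2 + m3 = N)%N ->
  S2 (e3 m1 m2 m3).
Proof.
move=> p1 p2 p3 e; apply: S2_intro.
- exact: e3_zoff.
- by move=> z; exact: cdiff_E4.
- by move=> g [gG g0]; rewrite e3_Gamma2 // g0 zchi0 cscale1.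
move=> g gS d d0; have [k [n1 [n2 [n3 [k0 p ->]]]]] := e3_slash R hN gS e.
have e' : (n1 + n2 + n3 = N)%N by have := perm_sumn p; rewrite /= !addn0 !addnA e.
have q1 : (0 < n1)%N.
  have : n1 \in [:: m1; m2; m3] by rewrite -(perm_mem p) inE eqxx.
  by rewrite !inE => /or3P[]/eqP ->.
have [K K0 HK] := E4_bound (frac R N n1) (frac R N n2) (frac R N n3).
have x0 : 0 < pi * ordE (frac R N n1) (frac R N n2) (frac R N n3).
  rewrite (ordE_frac (k := 1)) ?mul1n // subrr mul0r addr0.
  by rewrite mulr_gt0 ?pi_gt0 // divr_gt0 ?ltr0n //; lia.
have kK : 0 < cabs k * K by rewrite mulr_gt0 // cabs_gt0.
have [Y HY] := expR_small x0 (divr_gt0 d0 kK).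
exists (Num.max Y 1) => z; rewrite gt_max => /andP[/HY]; rewrite ltr_pdivlMr // => y1 y2.
rewrite /cscale cabsM; apply: le_lt_trans y1.
rewrite [leRHS]mulrCA ler_wpM2l ?cabs_ge0 // mulrC.
by apply: (HK z _).1; lra.
Qed.

(* Order at least [x] at infinity, measured in powers of e2 (tau / 2). *)
Definition ord_ge f (x : R) := exists K : R, 0 <= K /\ forall z, 1 / 2 <= complex.Im z ->
  cabs (f z) <= K * expR (- (pi * x * complex.Im z)).

Lemma slash_A_per f (r : nat) z : slash matA f = cscale (zeta ^+ r) f ->
  f (z + 2) = zeta ^+ r * f z.
Proof. by move=> h; rewrite -slash_A h. Qed.

Lemma cabs_zeta n : cabs (zeta ^+ n) = 1.
Proof.
rewrite cabsX zetaE // cabs_e2.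
have -> : 1 / N%:R = (1 / N%:R : R)%:C :> C by rewrite realCM realCV realCn rmorph1.
by rewrite cImR mulr0 oppr0 expR0 expr1n.
Qed.


Lemma decay f (r : nat) : S2 f -> slash matA f = cscale (zeta ^+ r) f ->
  (0 < r <= N)%N -> exists c : C,
  ord_ge (fun z => f z - c * e2 ((r%:R / N%:R / 2)%:C * z)) (r%:R / N%:R + 1) /\
  ord_ge f (r%:R / N%:R).
Proof.
move=> fS fA /andP[r0 rN]; pose x : R := r%:R / N%:R.
have N0R : 0 < N%:R :> R by rewrite ltr0n; lia.
have x0 : 0 < x by rewrite divr_gt0 // ltr0n.
have x1 : x <= 1 by rewrite ler_pdivrMr // mul1r ler_nat.
pose g w := f (2 * w) * e2 (- (x%:C * w)).
have up2 w : upper (2 * w) = upper w.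
  by rewrite /upper -(realCn R 2) cImZ pmulr_rgt0.
have dg w : 0 < complex.Im w -> cdiff g w.
  move=> w0; apply: cdiffM.
    apply: (@cdiff_comp _ (fun w => 2 * w) f); first by apply: cdiffZ; exact: cdiff_id.
    by apply: S2_cdiff; rewrite ?up2.
  apply: (@cdiff_comp _ (fun w => - (x%:C * w)) (@e2 R)); last exact: cdiff_e2.
  by apply: cdiffN; apply: cdiffZ; exact: cdiff_id.
have per w : g (w + 1) = g w.
  rewrite /g mulrDr mulr1 (slash_A_per _ fA) zetaX //.
  have -> : - (x%:C * (w + 1)) = - (x%:C * w) + - (r%:R / N%:R).
    by rewrite /x realCM realCV !realCn; ring.
  have aux (X F E : C) : X != 0 -> X * F * (E / X) = F * E by move=> X0; field.
  by rewrite e2D (e2N (r%:R / N%:R)); exact: (aux _ _ _ (e2_neq0 _)).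
have abs_e w : cabs (e2 (- (x%:C * w))) = expR (2 * pi * x * complex.Im w).
  by rewrite cabs_e2 cImN cImZ; congr expR; ring.
have growth e : 0 < e -> exists Y, forall w, Y < complex.Im w ->
    cabs (g w) <= e * expR (2 * pi * complex.Im w).
  move=> e0; have [B HB] := S2_vanish fS SL2Z1 e0.
  exists (Num.max B 0) => w; rewrite gt_max => /andP[wB w0].
  rewrite cabsM abs_e; apply: ler_pM; rewrite ?cabs_ge0 ?expR_ge0 //.
    have := HB (2 * w); rewrite slash1 -(realCn R 2) cImZ => h; apply/ltW/h; lra.
  rewrite ler_expR -mulrA ler_wpM2l ?mulr_ge0 ?pi_ge0 //.
  by rewrite ler_piMl // ltW.
have [c [_ Hc]] := strip dg (fun w _ => per w) growth.
have rc : rcont (fun t => g (t +i* (1/8))).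
  have cl : rcont (fun t : R => t +i* (1/8 : R)) by exact: rcont_hline.
  by apply: (rcont_ccont cl) => t; apply: cdiff_cont; apply: dg => /=; lra.
have [M M0 HM] : exists2 M : R, 0 <= M & forall t, cabs (g (t +i* (1/8))) <= M.
  apply: rcont_bounded rc _ => t; rewrite -(per (t +i* (1/8))).
  by congr g; apply: complex_eq => /=; rewrite ?addr0.
pose b : R := expR (- (pi / 4)).
have b1 : b < 1 by rewrite expR_lt1 oppr_lt0 divr_gt0 ?pi_gt0.
pose K : R := M * expR (pi / 4) / (1 - b).
have K0 : 0 <= K by rewrite divr_ge0 ?mulr_ge0 ?expR_ge0 // subr_ge0 ltW.
have main z : 1 / 2 <= complex.Im z -> cabs (g (z / 2) - c) <= K * expR (- (pi * complex.Im z)).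
  move=> z1; have h2 : complex.Im (z / 2) = complex.Im z / 2.
    have -> : z / 2 = (1 / 2 : R)%:C * z by rewrite realCM realCV realCn rmorph1; ring.
    by rewrite cImZ; ring.
  have := Hc (1/8) M (z / 2) ltac:(lra) HM; rewrite h2 => /(_ ltac:(lra)).
  set rho := expR _ => h; apply: le_trans h _.
  have rE : rho = expR (pi / 4) * expR (- (pi * complex.Im z)).
    by rewrite -expRD /rho; congr expR; field.
  have rb : rho <= b by rewrite ler_expR; have := pi_gt0 R; nra.
  have -> : K * expR (- (pi * complex.Im z)) = M * (rho / (1 - b)) by rewrite rE /K; ring.
  rewrite ler_wpM2l // ler_wpM2l ?expR_ge0 // lef_pV2 ?posrE ?subr_gt0 //; lra.
have fg z : f z = g (z / 2) * e2 ((x / 2)%:C * z).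
  rewrite /g mulrCA divff ?mulr1 ?pnatr_eq0 // -mulrA -e2D.
  have -> : - (x%:C * (z / 2)) + (x / 2)%:C * z = 0 by rewrite realCM realCV realCn; ring.
  by rewrite e2_0 mulr1.
have ae z : cabs (e2 ((x / 2)%:C * z)) = expR (- (pi * x * complex.Im z)).
  by rewrite cabs_e2 cImZ; congr expR; field.
exists c; split.
  exists K; split=> // z z1; rewrite (fg z) -mulrBl cabsM ae.
  have -> : - (pi * (x + 1) * complex.Im z) = - (pi * complex.Im z) + - (pi * x * complex.Im z) by ring.
  by rewrite expRD mulrA ler_wpM2r ?expR_ge0 // main.
exists (K + cabs c); split; first by rewrite addr_ge0 ?cabs_ge0.
move=> z z1; rewrite (fg z) cabsM ae ler_wpM2r ?expR_ge0 //.
have -> : g (z / 2) = (g (z / 2) - c) + c by rewrite subrK.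
apply: le_trans (cabsD _ _) _; rewrite lerD2r; apply: le_trans (main _ z1) _.
rewrite ler_piMr // expR_le1 oppr_le0 mulr_ge0 ?pi_ge0 //; lra.
Qed.

End CuspForms.

Section Quotients.
Variable R : realType.
Local Notation C := R[i].
Variable N : nat.
Hypothesis hN : (2 < N)%N.
Implicit Types (z w k : C) (g h : M2Z) (f : C -> C).
Local Notation zeta := (zeta R N).
Local Notation S2 := (@S2 R N).
Local Notation e3 := (@e3 R N).

Lemma matSA : matS * matA = matB * matS.
Proof. by rewrite -matSAS mulrVK //; exact: SL2Z_unit SL2Z_S. Qed.

Lemma matTB : matT * matB = - (matB^-1 * matA^-1) * matT.
Proof. by rewrite -matTBT mulrVK //; exact: SL2Z_unit SL2Z_T. Qed.

Lemma matTST : matT * matS * matT = - (matS * matT^-1 * matS).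
Proof. by have [_ -> _ _ _] := matV; rewrite !mulmx22 oppmx22; congr mx22. Qed.

Let SS := SL2Z_S.
Let ST := SL2Z_T.
Let SA := SL2Z_A.
Let SB := SL2Z_B.

Lemma char_S_A f s : zoff f -> slash matB f = cscale s f ->
  slash matA (slash matS f) = cscale s (slash matS f).
Proof. by move=> f0 fB; rewrite -slashM // matSA slashM // fB slash_scale. Qed.

Lemma char_T_B f r s : zoff f -> r != 0 -> s != 0 -> slash matA f = cscale r f ->
  slash matB f = cscale s f -> slash matB (slash matT f) = cscale (r * s)^-1 (slash matT f).
Proof.
move=> f0 r0 s0 fA fB; have SA' := SL2ZV SA; have SB' := SL2ZV SB.
rewrite -slashM // matTB slashM //; last by apply: SL2ZN; exact: SL2ZM.
rewrite slash_opp slashM // (slashV_scale SB f0 s0 fB) slash_scale.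
by rewrite (slashV_scale SA f0 r0 fA) cscaleA slash_scale invfM mulrC.
Qed.

Lemma char_TST f s : zoff f -> s != 0 -> slash matB f = cscale s f ->
  slash matS (slash matT (slash matS f)) = cscale s (slash matT (slash matS (slash matT f))).
Proof.
move=> f0 s0 fB; have fS := char_S_A f0 fB; have z1 := slash_zoff SS f0.
have e : slash matT (slash matS (slash matT f)) = slash matS (slash matT^-1 (slash matS f)).
  have ST' := SL2ZV ST.
  rewrite -!slashM //; try exact: SL2ZM; try exact: slash_zoff.
  by rewrite !mulrA matTST slash_opp.
have e' : slash matT^-1 (slash matS f) = cscale s^-1 (slash matT (slash matS f)).
  have h : matT^-1 = matA^-1 * matT.
    by have [_ -> -> _ _] := matV; rewrite mulmx22; congr mx22.
  by rewrite h slashM //; [rewrite (slashV_scale SA z1 s0 fS) slash_scale|exact: SL2ZV].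
by rewrite e e' slash_scale cscaleA divff // cscale1.
Qed.

Definition PP f (x y w : nat) z : C :=
  f z / E4 (frac R N x)%:C (frac R N y)%:C (frac R N w)%:C z.

Lemma PP_S f (x y w : nat) z : upper z ->
  cabs (PP f x y w (Sinv z)) = cabs (PP (slash matS f) y x w z).
Proof.
move=> z0; have zn := upper_neq0 z0.
have e : E4 (frac R N x)%:C (frac R N y)%:C (frac R N w)%:C (Sinv z) =
    - z ^+ 2 * E4 (frac R N y)%:C (frac R N x)%:C (frac R N w)%:C z.
  have := congr1 (fun F : C -> C => F z) (E4_S (frac R N x)%:C (frac R N y)%:C (frac R N w)%:C).
  rewrite slash_S /cscale => h; apply: (mulIf (invr_neq0 (expf_neq0 2 zn))); rewrite h.
  have aux (X E : C) : X != 0 -> -1 * E = - X * E / X by move=> X0; field.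
  exact: aux (expf_neq0 2 zn).
rewrite /PP e slash_S -cabsN; congr cabs.
have e0 : E4 (frac R N y)%:C (frac R N x)%:C (frac R N w)%:C z != 0 by exact: E4_neq0.
by field; rewrite zn e0.
Qed.

Let logE_T_aux (p a b c l w2 w3 w4 : C) :
  2 * (l + p / 6) + (a * (w2 + p / 6) + b * (w3 - p / 12) + c * (w4 - p / 12)) =
  p * (1 / 3 + a / 6 - b / 12 - c / 12) + (2 * l + (a * w2 + c * w4 + b * w3)).
Proof. by field. Qed.

Lemma PP_T f (x y w : nat) z : upper z ->
  cabs (PP f x y w (z + 1)) = cabs (PP (slash matT f) x w y z).
Proof.
move=> z0; rewrite /PP slash_T !cabsM !cabsV; congr (_ / _).
rewrite /E4 (upper_addr 1) z0 /logE l0_T W2_T W4_T W3_T logE_T_aux -ordEC cexpD cabsM.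
have -> : 'i * pi%:C * (ordE (frac R N x) (frac R N y) (frac R N w))%:C =
    (pi * ordE (frac R N x) (frac R N y) (frac R N w))%:C * 'i by rewrite realCM; ring.
by rewrite cabs_cexp cReZ cRei mulr0 expR0 mul1r.
Qed.

Lemma PP_scale f (x y w : nat) z k : cabs k = 1 -> cabs (PP (cscale k f) x y w z) = cabs (PP f x y w z).
Proof. by move=> k1; rewrite /PP /cscale -mulrA cabsM k1 mul1r. Qed.

Lemma PP_cdiff f (x y w : nat) z : S2 f -> upper z -> cdiff (PP f x y w) z.
Proof.
move=> fS z0; apply: cdiffM; first exact: (S2_cdiff fS z0).
by apply: cdiffV; [exact: E4_neq0|exact: cdiff_E4].
Qed.

Lemma PP_decay f (x y w k : nat) : (x + y + w = k * N)%N -> (1 < k)%N ->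
  ord_ge f (x%:R / N%:R) -> forall e : R, 0 < e -> exists Y : R, forall z,
  Y < complex.Im z -> cabs (PP f x y w z) <= e.
Proof.
move=> h k1 [K [K0 HK]] e e0.
have [B B0 HB] := E4_bound (frac R N x) (frac R N y) (frac R N w).
rewrite (ordE_frac R hN h) in HB.
have d0 : 0 < pi * ((k%:R - 1) / 3) :> R.
  have : 1 < k%:R :> R by rewrite ltr1n.
  by have := pi_gt0 R; nra.
have KB : 0 < (K + 1) * B by rewrite mulr_gt0 // ltr_wpDl.
have [Y HY] := expR_small d0 (divr_gt0 e0 KB); exists (Num.max Y 1) => z.
rewrite gt_max => /andP[zY z1]; have z2 : 1 / 2 <= complex.Im z by lra.
have u : upper z by rewrite /upper; lra.
rewrite /PP cabsM cabsV ler_pdivrMr ?cabs_gt0 ?E4_neq0 //.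
apply: le_trans (HK _ z2) _; have [_ b2] := HB _ z2.
have := HY _ zY; rewrite ltr_pdivlMr // => y1.
set E := cabs (E4 _ _ _ _) in b2 *; have E0 : 0 <= E by exact: cabs_ge0.
set a := expR (- (pi * (x%:R / N%:R) * _)).
set b := expR (- (pi * (x%:R / N%:R + _) * _)) in b2.
set c := expR (- (pi * ((k%:R - 1) / 3) * _)) in y1.
have ab : a = b * c.
  have aux (p u' v y' : R) : - (p * u' * y') = - (p * (u' + (1 - v) / 3) * y') + - (p * ((v - 1) / 3) * y').
    by field.
  by rewrite /a /b /c -expRD; congr expR; exact: aux.
rewrite ab; have c0 : 0 <= c by exact: expR_ge0.
apply: (@le_trans _ _ (K * (B * E * c))); first by rewrite ler_wpM2l // ler_wpM2r.
have -> : K * (B * E * c) = E * (c * (K * B)) by ring.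
rewrite [leRHS]mulrC ler_wpM2l //.
apply: le_trans (ltW y1); rewrite ler_wpM2l // ler_wpM2r ?lerDl // ltW //.
Qed.

Lemma ord_ge_T f x : ord_ge f x -> ord_ge (slash matT f) x.
Proof.
move=> [K [K0 HK]]; exists K; split => // z z1; rewrite slash_T.
by have := HK (z + 1); rewrite cImD addr0; apply.
Qed.

Lemma vanish_seq (L : seq (C -> C)) : let P m := nth (fun=> 0) L m in
  (forall m, (m < size L)%N -> exists2 m', (m' < size L)%N &
     forall z, upper z -> cabs (P m (Sinv z)) = cabs (P m' z)) ->
  (forall m, (m < size L)%N -> exists2 m', (m' < size L)%N &
     (forall z, upper z -> cabs (P m (z + 1)) = cabs (P m' z)) /\
     (forall z, upper z -> cabs (P m' (z + 1)) = cabs (P m z))) ->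
  (forall m z, (m < size L)%N -> upper z -> cdiff (P m) z) ->
  (forall m (e : R), (m < size L)%N -> 0 < e -> exists Y : R, forall z, Y < complex.Im z ->
     cabs (P m z) <= e) ->
  forall m z, (m < size L)%N -> upper z -> P m z = 0.
Proof.
move=> P hS hT hd h0 m z mL z0; apply: (@vanish_family _ 'I_(size L) P _ _ _ _ _ (Ordinal mL)) => //.
- by move=> i; have [m' l h] := hS i (ltn_ord i); exists (Ordinal l).
- by move=> i; have [m' l [h _]] := hT i (ltn_ord i); exists (Ordinal l).
- move=> i; have [m' l [_ h]] := hT i (ltn_ord i); exists (Ordinal l) => w w0.
  by rewrite /= -h ?subrK // -[w - 1]/(w + - 1%:C) -realCN upper_addr.
- by move=> i w; exact: hd.
- by move=> i e; exact: h0.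
Qed.

Lemma forms_vanish f (r s t k : nat) : S2 f ->
  slash matA f = cscale (zeta ^+ r) f -> slash matB f = cscale (zeta ^+ s) f ->
  (r + s + t = k * N)%N -> (1 < k)%N ->
  ord_ge f (r%:R / N%:R) -> ord_ge (slash matS f) (s%:R / N%:R) ->
  ord_ge (slash matS (slash matT f)) (t%:R / N%:R) -> f = fun=> 0.
Proof.
move=> fS fA fB e k1 o1 o2 o3; have f0 := S2_zoff fS.
have zn m : zeta ^+ m != 0 by rewrite expf_neq0 // zeta_neq0.
have cz m : cabs (zeta ^+ m) = 1 by exact: cabs_zeta.
have sS (h : C -> C) : S2 h -> S2 (slash matS h) by exact: S2_slash.
have sT (h : C -> C) : S2 h -> S2 (slash matT h) by exact: S2_slash.
pose fs := slash matS f; pose ft := slash matT f; pose fts := slash matS ft.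
pose fst := slash matT fs; pose ftst := slash matT fts.
have [S1 S3] : S2 fs /\ S2 ft by split; [exact: sS|exact: sT].
have [S4 S5] : S2 fst /\ S2 fts by split; [exact: sT|exact: sS].
have S6 : S2 ftst by exact: sT.
have SSK (h : C -> C) : S2 h -> slash matS (slash matS h) = h.
  by move=> /S2_zoff h0; rewrite -slashM // matSS slash_N1.
have TTA (h : C -> C) : S2 h -> slash matT (slash matT h) = slash matA h.
  by move=> /S2_zoff h0; rewrite -slashM // matTT.
have a2 : slash matA fs = cscale (zeta ^+ s) fs by exact: char_S_A.
have bT : slash matB ft = cscale (zeta ^+ r * zeta ^+ s)^-1 ft by exact: char_T_B.
have a4 : slash matA fts = cscale (zeta ^+ r * zeta ^+ s)^-1 fts.
  by apply: char_S_A => //; exact: (S2_zoff S3).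
have rs1 : cabs (zeta ^+ r * zeta ^+ s)^-1 = 1 by rewrite cabsV cabsM !cz mulr1 invr1.
have st : slash matS fst = cscale (zeta ^+ s) ftst by exact: char_TST.
have ts : slash matS ftst = cscale (zeta ^+ s)^-1 fst.
  by rewrite -[fst]SSK // st slash_scale cscaleA mulVf ?cscale1.
pose L := [:: PP f r s t; PP ft r t s; PP fs s r t; PP fst s t r; PP fts t r s; PP ftst t s r].
have [e1 [e2 [e3' [e4 [e5 e6]]]]] : (r + t + s = k * N /\ s + r + t = k * N /\ s + t + r = k * N /\
  t + r + s = k * N /\ t + s + r = k * N /\ true)%N by rewrite -e; do !split; lia.
have := @vanish_seq L; rewrite /= => V.
have {}V : forall z, upper z -> PP f r s t z = 0.
  move=> z z0; apply: (V _ _ _ _ 0%N z) => //.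
  - case=> [|[|[|[|[|[|//]]]]]] _ /=.
    + by exists 2%N => // w w0; exact: PP_S.
    + by exists 4%N => // w w0; exact: PP_S.
    + by exists 0%N => // w w0; rewrite /= PP_S // SSK.
    + by exists 5%N => // w w0; rewrite /= PP_S // st PP_scale.
    + by exists 1%N => // w w0; rewrite /= PP_S // SSK.
    + by exists 3%N => // w w0; rewrite /= PP_S // ts PP_scale // cabsV cz invr1.
  - have t01 w : upper w -> cabs (PP f r s t (w + 1)) = cabs (PP ft r t s w) by exact: PP_T.
    have t10 w : upper w -> cabs (PP ft r t s (w + 1)) = cabs (PP f r s t w).
      by move=> w0; rewrite PP_T // TTA // fA PP_scale.
    have t23 w : upper w -> cabs (PP fs s r t (w + 1)) = cabs (PP fst s t r w) by exact: PP_T.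
    have t32 w : upper w -> cabs (PP fst s t r (w + 1)) = cabs (PP fs s r t w).
      by move=> w0; rewrite PP_T // TTA // a2 PP_scale.
    have t45 w : upper w -> cabs (PP fts t r s (w + 1)) = cabs (PP ftst t s r w) by exact: PP_T.
    have t54 w : upper w -> cabs (PP ftst t s r (w + 1)) = cabs (PP fts t r s w).
      by move=> w0; rewrite PP_T // TTA // a4 PP_scale.
    by case=> [|[|[|[|[|[|//]]]]]] _ /=; [exists 1%N|exists 0%N|exists 3%N|exists 2%N|exists 5%N|exists 4%N].
  - by case=> [|[|[|[|[|[|//]]]]]] w _ w0; exact: PP_cdiff.
  - case=> [|[|[|[|[|[|//]]]]]] d _; [
      exact: (PP_decay e)|exact: (PP_decay e1 k1 (ord_ge_T o1))|exact: (PP_decay e2)|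
      exact: (PP_decay e3' k1 (ord_ge_T o2))|exact: (PP_decay e4)|
      exact: (PP_decay e5 k1 (ord_ge_T o3))].
apply/funext => z; have [z0|z0] := boolP (upper z); last exact: f0.
have := V z z0; rewrite /PP => /eqP; rewrite mulf_eq0 invr_eq0 (negPf (E4_neq0 _ _ _ z0)) orbF.
by move=> /eqP.
Qed.

Lemma ord_ge_scale f x k : ord_ge f x -> ord_ge (cscale k f) x.
Proof.
move=> [K [K0 HK]]; exists (cabs k * K); rewrite mulr_ge0 ?cabs_ge0 //; split=> // z z1.
by rewrite /cscale cabsM -mulrA ler_wpM2l ?cabs_ge0 // HK.
Qed.

Lemma ord_ge_add f1 f2 x : ord_ge f1 x -> ord_ge f2 x -> ord_ge (fun z => f1 z + f2 z) x.
Proof.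
move=> [K1 [K10 H1]] [K2 [K20 H2]]; exists (K1 + K2); rewrite addr_ge0 //; split=> // z z1.
by apply: le_trans (cabsD _ _) _; rewrite mulrDl lerD ?H1 ?H2.
Qed.

Lemma cexpansion f (g : C -> C) (c d x : C) (y : R) : d != 0 ->
  ord_ge (fun z => f z - c * e2 (x * z)) y -> ord_ge (fun z => g z - d * e2 (x * z)) y ->
  ord_ge (fun z => f z + (- (c / d)) * g z) y.
Proof.
move=> d0 h1 h2; have := ord_ge_add h1 (ord_ge_scale (- (c / d)) h2).
move=> [K [K0 HK]]; exists K; split=> // z /HK; apply: le_trans.
rewrite le_eqVlt; apply/orP; left; apply/eqP; congr cabs.
by rewrite /cscale; field.
Qed.

Lemma e3_lead_neq0 (m1 m2 m3 : nat) (c : C) : (m1 + m2 + m3 = N)%N ->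
  ord_ge (fun z => e3 m1 m2 m3 z - c * e2 ((m1%:R / N%:R / 2)%:C * z)) (m1%:R / N%:R + 1) ->
  c != 0.
Proof.
move=> e [K [K0 HK]]; apply/eqP => c0.
have [B B0 HB] := E4_bound (frac R N m1) (frac R N m2) (frac R N m3).
have e' : (m1 + m2 + m3 = 1 * N)%N by rewrite mul1n.
rewrite (ordE_frac R hN e') in HB.
have p0 := pi_gt0 R; have KB : 0 < (K + 1) * B by rewrite mulr_gt0 // ltr_wpDl.
have [Y HY] := expR_small p0 (divr_gt0 ltr01 KB).
pose y := Num.max Y 1 + 1; pose z : C := 'i * y%:C.
have Ym : Y <= Num.max Y 1 by rewrite le_max lexx.
have m1' : 1 <= Num.max Y 1 by rewrite le_max lexx orbT.
have yY : Y < y by rewrite /y; lra.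
have y1 : 1 < y by rewrite /y; lra.
have zI : complex.Im z = y by rewrite /z mulrC cImZ cImi mulr1.
have z2 : 1 / 2 <= complex.Im z by rewrite zI; lra.
have := HK z z2; rewrite c0 mul0r subr0 zI => h1.
have [_ h2] := HB z z2; rewrite zI in h2.
have := HY y yY; rewrite ltr_pdivlMr // => h3.
set a := expR (- (pi * (m1%:R / N%:R + 1) * y)) in h1.
set b := expR (- (pi * (m1%:R / N%:R + (1 - 1) / 3) * y)) in h2.
set d := expR (- (pi * y)) in h3.
have ab : a = b * d.
  have aux (p u v : R) : - (p * (u + 1) * v) = - (p * (u + (1 - 1) / 3) * v) + - (p * v) by field.
  by rewrite /a /b /d -expRD; congr expR; exact: aux.
have b0 : 0 < b by exact: expR_gt0.
have d0 : 0 < d by exact: expR_gt0.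
have h4 : b <= B * (K * (b * d)).
  by apply: le_trans h2 _; rewrite ler_pM2l // -ab.
have : b * (1 - B * K * d) <= 0 by lra.
rewrite pmulr_rle0 // => h5; have : 0 < d * B by rewrite mulr_gt0.
nra.
Qed.

Lemma S2_eigen f (r s : nat) : S2 f -> (r < N)%N -> (s < N)%N ->
  slash matA f = cscale (zeta ^+ r) f -> slash matB f = cscale (zeta ^+ s) f ->
  exists c, f = if (0 < r)%N && (0 < s)%N && (r + s < N)%N
                then cscale c (e3 r s (N - r - s)) else fun=> 0.
Proof.
move=> fS rN sN fA fB.
have zn m : zeta ^+ m != 0 by rewrite expf_neq0 // zeta_neq0.
pose r' := if r == 0%N then N else r; pose s' := if s == 0%N then N else s.
have zr : zeta ^+ r = zeta ^+ r'.
  by rewrite /r'; case: eqP => // ->; rewrite expr0 zetaN.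
have zs : zeta ^+ s = zeta ^+ s'.
  by rewrite /s'; case: eqP => // ->; rewrite expr0 zetaN.
have r'N : (0 < r' <= N)%N by rewrite /r'; case: eqP; lia.
have s'N : (0 < s' <= N)%N by rewrite /s'; case: eqP; lia.
have key (t k : nat) (h : C -> C) : S2 h -> (r' + s' + t = k * N)%N -> (0 < t <= N)%N ->
    slash matA h = cscale (zeta ^+ r) h -> slash matB h = cscale (zeta ^+ s) h ->
    ord_ge (slash matS h) (s'%:R / N%:R) /\ ord_ge (slash matS (slash matT h)) (t%:R / N%:R).
  move=> hS e tN hA hB; have h0 := S2_zoff hS.
  have S1 : S2 (slash matS h) by exact: S2_slash.
  have S3 : S2 (slash matT h) by exact: S2_slash.
  have S5 : S2 (slash matS (slash matT h)) by exact: S2_slash.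
  have a2 : slash matA (slash matS h) = cscale (zeta ^+ s') (slash matS h).
    by apply: char_S_A => //; rewrite hB zs.
  have bT := char_T_B h0 (zn r) (zn s) hA hB.
  have a4 := char_S_A (S2_zoff S3) bT.
  have rst : (zeta ^+ r * zeta ^+ s)^-1 = zeta ^+ t.
    apply: (mulIf (mulf_neq0 (zn r) (zn s))); rewrite mulVf ?mulf_neq0 //.
    by rewrite zr zs -!exprD addnC e mulnC exprM zetaN // expr1n.
  rewrite rst in a4.
  have [c1 [_ h1]] := decay hN S1 a2 s'N.
  by have [c2 [_ h2]] := decay hN S5 a4 tN.
have [c1 [hoc of1]] := decay hN fS (etrans fA (congr1 (fun k => cscale k f) zr)) r'N.
have [/andP[/andP[r0 s0] rs]|rs] := boolP ((0 < r)%N && (0 < s)%N && (r + s < N)%N).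
- have rr : r' = r by rewrite /r' gtn_eqF.
  have ss : s' = s by rewrite /s' gtn_eqF.
  pose t := (N - r - s)%N; have e : (r + s + t = N)%N by rewrite /t; lia.
  have t0 : (0 < t <= N)%N by rewrite /t; lia.
  have eS : S2 (e3 r s t) by apply: e3_S2 => //; case/andP: t0.
  have eA := e3_A R hN e; have eB := e3_B R hN e.
  have [c2 [oc2 _]] := decay hN eS (etrans eA (congr1 (fun k => cscale k _) zr)) r'N.
  have c20 : c2 != 0 by apply: (@e3_lead_neq0 r s t) => //; rewrite rr in oc2.
  pose k := - (c1 / c2); pose f' z := f z + k * e3 r s t z.
  have f'S : S2 f' by apply: S2_add => //; exact: S2_scale.
  have lin g : slash g f' = fun z => slash g f z + k * slash g (e3 r s t) z.
    by apply/funext => z; rewrite !slashE mulrDl mulrA.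
  have f'A : slash matA f' = cscale (zeta ^+ r) f'.
    by rewrite lin fA eA; apply/funext => z; rewrite /cscale /f'; ring.
  have f'B : slash matB f' = cscale (zeta ^+ s) f'.
    by rewrite lin fB eB; apply/funext => z; rewrite /cscale /f'; ring.
  have e' : (r' + s' + t = 1 * N)%N by rewrite rr ss mul1n.
  have [ho2 ho3] := key _ _ _ f'S e' t0 f'A f'B.
  have o1 : ord_ge f' (r%:R / N%:R + 1).
    by rewrite rr in hoc oc2; exact: (cexpansion c20 hoc oc2).
  have rN1 : r%:R / N%:R + 1 = (r + N)%:R / N%:R :> R.
    by rewrite natrD mulrDl divff // pnatr_eq0; lia.
  have f'0 : f' = fun=> 0.
    apply: (@forms_vanish f' (r + N)%N s t 2); rewrite -?rN1 //.
    + by rewrite exprD zetaN // mulr1.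
    + by lia.
    + by rewrite -ss.
  exists (- k); apply/funext => z; have := congr1 (fun F : C -> C => F z) f'0.
  by move=> h; apply/eqP; rewrite -subr_eq0 /cscale mulNr opprK -/t; apply/eqP.
- exists 0.
  have [t [k [e tN k1]]] : exists t k : nat, [/\ (r' + s' + t = k * N)%N, (0 < t <= N)%N & (1 < k)%N].
    have rs' : (N <= r' + s' <= 2 * N)%N by move: rs; rewrite /r' /s'; case: eqP; case: eqP; lia.
    have [h|h] := ltnP (r' + s')%N (2 * N)%N.
      by exists (2 * N - (r' + s'))%N, 2%N; split; lia.
    by exists N, 3%N; split; lia.
  have [ho2 ho3] := key _ _ _ fS e tN fA fB.
  by apply: (@forms_vanish f r' s' t k) => //; rewrite ?fA ?fB ?zr ?zs.
Qed.

End Quotients.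

Section Basis.
Variable R : realType.
Local Notation C := R[i].
Variable N : nat.
Hypothesis hN : (2 < N)%N.
Implicit Types (z w k : C) (g h X Y : M2Z) (f : C -> C).
Local Notation zeta := (zeta R N).
Local Notation S2 := (@S2 R N).
Local Notation e3 := (@e3 R N).

Let zn m : zeta ^+ m != 0. Proof. by rewrite expf_neq0 // zeta_neq0. Qed.
Let NC0 : N%:R != 0 :> C. Proof. by rewrite pnatr_eq0; lia. Qed.

Lemma zeta_sum (m n : nat) :
  \sum_(i < N) zeta ^+ (m * i) / zeta ^+ (n * i) = if m == n %[mod N] then N%:R else 0.
Proof.
pose x := zeta ^+ m / zeta ^+ n.
have xi (i : nat) : zeta ^+ (m * i) / zeta ^+ (n * i) = x ^+ i.
  by rewrite /x expr_div_n !exprM.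
rewrite (eq_bigr (fun i : 'I_N => x ^+ i)) //.
have x1 : (x == 1) = (m == n %[mod N]).
  rewrite -(eq_prim_root_expr (zeta_prim R hN)) -(inj_eq (mulIf (zn n))) mul1r.
  by rewrite /x divfK.
rewrite -x1; case: eqP => [->|/eqP xn1].
  by rewrite (eq_bigr (fun=> 1)) ?sumr_const ?card_ord // => i _; rewrite expr1n.
have := subrX1 x N; rewrite -xi mulnC exprM (mulnC n) exprM !zetaN // !expr1n divr1 subrr.
by move=> /esym/eqP; rewrite mulf_eq0 subr_eq0 (negPf xn1) => /eqP.
Qed.

Lemma Zp_mulrN (x : 'Z_N * 'Z_N) : x *+ N = 0.
Proof.
have h (y : 'Z_N) : y *+ N = 0.
  have -> : y *+ N = y *+ (Zp_trunc N).+2 by congr (_ *+ _); rewrite Zp_cast //; lia.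
  by rewrite Zp_mulrn; apply: val_inj; rewrite /= modnMl.
have e n : x *+ n = (x.1 *+ n, x.2 *+ n).
  by elim: n => [|n IH]; rewrite ?mulr0n // !mulrS IH.
by rewrite e !h.
Qed.

Lemma S2_congr g h f : S2 f -> Gamma2 g -> Gamma2 h -> expAB N g = expAB N h ->
  slash g f = slash h f.
Proof.
move=> fS gG hG e; have hS := Gamma2SL hG; have f0 := S2_zoff fS.
have p : Phi N (g * h^-1).
  split; first by apply: Gamma2M => //; exact: Gamma2V.
  by rewrite (expABM R hN) ?(expABV R hN) ?e ?subrr //; exact: Gamma2V.
rewrite -[g]mulr1 -(mulVSL hS) mulrA slashM //; last exact: Gamma2SL (Phi_Gamma2 p).
by rewrite (S2_Phi fS p).
Qed.

Definition proj X (r : nat) f z : C :=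
  N%:R^-1 * \sum_(i < N) (zeta ^+ (r * i))^-1 * slash (X ^+ i) f z.

Section Proj.
Variable X : M2Z.
Hypothesis XG : Gamma2 X.
Let XS := Gamma2SL XG.

Lemma slash_XN f : S2 f -> slash (X ^+ N) f = f.
Proof.
move=> fS; apply: (S2_Phi fS); split; first exact: Gamma2X.
by rewrite (expABX R hN) // Zp_mulrN.
Qed.

Lemma proj_S2 r f : S2 f -> S2 (proj X r f).
Proof.
move=> fS; apply: S2_scale; apply: S2_sum => i _; apply: S2_scale.
by apply: S2_slash => //; exact: SL2ZX.
Qed.

Lemma slash_proj g r f z : slash g (proj X r f) z =
  N%:R^-1 * \sum_(i < N) (zeta ^+ (r * i))^-1 * slash g (slash (X ^+ i) f) z.
Proof.
rewrite slashE /proj -mulrA mulr_suml; congr (_ * _); apply: eq_bigr => i _.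
by rewrite -mulrA.
Qed.

Lemma proj_char r f : S2 f -> slash X (proj X r f) = cscale (zeta ^+ r) (proj X r f).
Proof.
move=> fS; have f0 := S2_zoff fS; apply/funext => z; rewrite slash_proj /cscale /proj mulrCA.
congr (_ * _); pose a (i : nat) := (zeta ^+ (r * i))^-1 * slash (X ^+ i) f z.
rewrite (eq_bigr (fun i : 'I_N => zeta ^+ r * a i.+1)); last first.
  move=> i _; rewrite -slashM //; last exact: SL2ZX.
  by rewrite -exprSr /a mulnS exprD invfM !mulrA divff // mul1r.
rewrite -mulr_sumr; congr (_ * _).
have aN : a N = a 0%N.
  by rewrite /a muln0 mulnC exprM zetaN // expr1n slash_XN // expr0 expr0 slash1.
have := big_ord_recl N (fun i => a (nat_of_ord i)) => /= E1.
have := big_ord_recr N (fun i => a (nat_of_ord i)) => /= E2.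
have := @big_ord_recl _ 0 +%R N (fun i => a (nat_of_ord i)).
rewrite (@big_ord_recr _ 0 +%R N (fun i => a (nat_of_ord i))) /= aN addrC => /addrI ->.
by apply: eq_bigr => i _.
Qed.

Lemma proj_sum f z : S2 f -> f z = \sum_(r < N) proj X r f z.
Proof.
move=> fS; rewrite /proj -mulr_sumr exchange_big /=.
rewrite (eq_bigr (fun i : 'I_N => (if i == 0 :> nat then N%:R else 0) * slash (X ^+ i) f z)).
  have N0 : (0 < N)%N by lia.
  rewrite (bigD1 (Ordinal N0)) //= expr0 slash1 big1 ?addr0 ?mulKf //.
  by move=> i; rewrite -val_eqE /= => /negPf ->; rewrite mul0r.
move=> i _; rewrite -mulr_suml; congr (_ * _).
rewrite -(_ : 0 == i %[mod N] = (i == 0 :> nat)) ?(modn_small (ltn_ord i)) ?mod0n; last by rewrite eq_sym.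
have := zeta_sum 0 i; rewrite mod0n (modn_small (ltn_ord i)) eq_sym => <-.
by apply: eq_bigr => r _; rewrite mul0n expr0 mul1r mulnC.
Qed.

Lemma proj_comm Y k r f : Gamma2 Y -> S2 f -> slash Y f = cscale k f ->
  slash Y (proj X r f) = cscale k (proj X r f).
Proof.
move=> YG fS fY; have f0 := S2_zoff fS; have YS := Gamma2SL YG.
apply/funext => z; rewrite slash_proj /cscale /proj mulrCA; congr (_ * _).
rewrite mulr_sumr; apply: eq_bigr => i _.
have Xi : Gamma2 (X ^+ i) by exact: Gamma2X.
have XiS := Gamma2SL Xi.
have -> : slash Y (slash (X ^+ i) f) = cscale k (slash (X ^+ i) f).
  rewrite -slashM // (@S2_congr (X ^+ i * Y) (Y * X ^+ i) f fS) ?slashM ?fY ?slash_scale //.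
  - exact: Gamma2M.
  - exact: Gamma2M.
  - by rewrite !(expABM R hN) // addrC.
by rewrite /cscale mulrCA.
Qed.

End Proj.

Definition idx : pred ('I_N * 'I_N) :=
  [pred p : 'I_N * 'I_N | [&& (0 < p.1)%N, (0 < p.2)%N & (p.1 + p.2 < N)%N]].
Definition vec (p : 'I_N * 'I_N) : C -> C := e3 p.1 p.2 (N - p.1 - p.2).
Definition bas (i : 'I_#|idx|) : C -> C := vec (enum_val i).

Lemma idxP (i : 'I_#|idx|) : idx (enum_val i).
Proof. exact: enum_valP i. Qed.

Lemma idx_sum p : idx p -> (p.1 + p.2 + (N - p.1 - p.2) = N)%N.
Proof. by rewrite /idx /=; lia. Qed.

Lemma vec_S2 p : idx p -> S2 (vec p).
Proof.
move=> pI; have e := idx_sum pI; move: pI => /and3P[h1 h2 h3].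
by apply: e3_S2 => //; lia.
Qed.

Lemma vec_AB p (a b : nat) : idx p ->
  slash (matA ^+ a * matB ^+ b) (vec p) = cscale (zeta ^+ (p.1 * a) * zeta ^+ (p.2 * b)) (vec p).
Proof.
move=> pI; have e := idx_sum pI; have z0 := e3_zoff (R := R) N p.1 p.2 (N - p.1 - p.2).
have pow g k (n : nat) : SL2Z g -> slash g (vec p) = cscale k (vec p) ->
    slash (g ^+ n) (vec p) = cscale (k ^+ n) (vec p).
  move=> gS h; elim: n => [|n IH]; first by rewrite expr0 slash1 expr0 cscale1.
  rewrite exprS slashM //; last exact: SL2ZX.
  by rewrite h slash_scale IH cscaleA -exprS.
rewrite slashM //; try (apply: SL2ZX; [exact: SL2Z_A || exact: SL2Z_B]).
rewrite (pow _ (zeta ^+ p.1)) ?slash_scale; [|exact: SL2Z_A|exact: e3_A].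
rewrite (pow _ (zeta ^+ p.2)) ?cscaleA; [|exact: SL2Z_B|exact: e3_B].
by rewrite -!exprM.
Qed.

Lemma span_idx f : S2 f -> exists c : 'I_N * 'I_N -> C,
  forall z, f z = \sum_(p | idx p) c p * vec p z.
Proof.
move=> fS; have GA := Gamma2_A; have GB := Gamma2_B.
pose F (p : 'I_N * 'I_N) := proj matB p.2 (proj matA p.1 f).
have FS p : S2 (F p) by apply: proj_S2 => //; exact: proj_S2.
have E p : exists c, F p = if idx p then cscale c (vec p) else fun=> 0.
  have [c ->] : exists c, F p = if (0 < p.1)%N && (0 < p.2)%N && (p.1 + p.2 < N)%N
      then cscale c (e3 p.1 p.2 (N - p.1 - p.2)) else fun=> 0.
    apply: S2_eigen; rewrite ?ltn_ord //.
      by apply: proj_comm => //; [exact: proj_S2|exact: proj_char].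
    by apply: proj_char => //; exact: proj_S2.
  by exists c; rewrite /idx /= andbA.
pose c p := xget 0 [set c | F p = if idx p then cscale c (vec p) else fun=> 0].
have cP p : F p = if idx p then cscale (c p) (vec p) else fun=> 0.
  have [x Ex] := E p.
  by apply: (@xgetPex _ 0 [set c | F p = if idx p then cscale c (vec p) else fun=> 0]); exists x.
exists c => z; rewrite (proj_sum matA z fS).
rewrite (eq_bigr (fun r : 'I_N => \sum_(s < N) F (r, s) z)); last first.
  by move=> r _; rewrite (proj_sum matB z (proj_S2 GA r fS)).
rewrite pair_big /= [RHS]big_mkcond /=; apply: eq_bigr => -[r s] _ /=; rewrite cP.
by case: ifP.
Qed.

Lemma lincomb_coef (c : 'I_#|idx| -> C) f (i : 'I_#|idx|) z : f = lincomb bas c ->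
  N%:R ^+ 2 * (c i * bas i z) = \sum_(a < N) \sum_(b < N)
    (zeta ^+ ((enum_val i).1 * a) * zeta ^+ ((enum_val i).2 * b))^-1 *
      slash (matA ^+ a * matB ^+ b) f z.
Proof.
move=> ->; pose q := enum_val i.
rewrite (eq_bigr (fun a : 'I_N => \sum_(b < N) \sum_j c j * bas j z *
   ((zeta ^+ ((enum_val j).1 * a) / zeta ^+ (q.1 * a)) *
    (zeta ^+ ((enum_val j).2 * b) / zeta ^+ (q.2 * b))))); last first.
  move=> a _; apply: eq_bigr => b _; rewrite slash_lincomb /lincomb mulr_sumr.
  apply: eq_bigr => j _; rewrite /bas vec_AB ?idxP // /cscale -/q.
  by field; rewrite !zn.
have -> : \sum_(a < N) \sum_(b < N) \sum_j c j * bas j z *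
   ((zeta ^+ ((enum_val j).1 * a) / zeta ^+ (q.1 * a)) *
    (zeta ^+ ((enum_val j).2 * b) / zeta ^+ (q.2 * b))) =
  \sum_j c j * bas j z *
   ((\sum_(a < N) zeta ^+ ((enum_val j).1 * a) / zeta ^+ (q.1 * a)) *
    (\sum_(b < N) zeta ^+ ((enum_val j).2 * b) / zeta ^+ (q.2 * b))).
  rewrite (eq_bigr (fun a : 'I_N => \sum_j \sum_(b < N) c j * bas j z *
     ((zeta ^+ ((enum_val j).1 * a) / zeta ^+ (q.1 * a)) *
      (zeta ^+ ((enum_val j).2 * b) / zeta ^+ (q.2 * b))))).
    rewrite exchange_big /=; apply: eq_bigr => j _.
    rewrite big_distrlr /= mulr_sumr; apply: eq_bigr => a _.
    by rewrite mulr_sumr.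
  by move=> a _; rewrite exchange_big.
rewrite (bigD1 i) //= -/q !zeta_sum !eqxx big1 ?addr0; first by ring.
move=> j ji; rewrite !zeta_sum !(modn_small (ltn_ord _)).
have : enum_val j != q by rewrite (inj_eq enum_val_inj).
rewrite -pair_eqE /= negb_and -!val_eqE => /orP[] /negPf /= ->; first by rewrite mul0r mulr0.
by rewrite !mulr0.
Qed.

Lemma lincomb_inj (c c' : 'I_#|idx| -> C) : lincomb bas c = lincomb bas c' -> c =1 c'.
Proof.
move=> E i; have i0 : upper ('i : C) by rewrite /upper /= ltr01.
have h := lincomb_coef i 'i (erefl (lincomb bas c)).
have h' := lincomb_coef i 'i E; rewrite -h' in h.
have n2 : N%:R ^+ 2 != 0 :> C by rewrite expf_neq0.
have b0 : bas i 'i != 0 by exact: E4_neq0.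
by apply: (mulIf b0); apply: (mulfI n2).
Qed.

Lemma S2_basis : is_basis S2 bas.
Proof.
split=> [i|f fS]; first exact: vec_S2 (idxP i).
have [c cE] := span_idx fS.
have fE : f = lincomb bas [ffun i => c (enum_val i)].
  apply/funext => z; rewrite cE /lincomb big_enum_val /=.
  by apply: eq_bigr => i _; rewrite ffunE.
exists [ffun i => c (enum_val i)]; split => // c' c'E.
by apply/ffunP; apply: lincomb_inj; rewrite -fE -c'E.
Qed.

End Basis.

(** * The canonical character *)

Section Traces.
Variable R : realType.
Local Notation C := R[i].
Implicit Types (V : set (C -> C)) (T : (C -> C) -> (C -> C)).

Lemma basis_inj V n (e : 'I_n -> C -> C) (c c' : 'I_n -> C) : is_basis V e ->
  V (lincomb e c) -> lincomb e c = lincomb e c' -> c =1 c'.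
Proof.
move=> [_ h] Vc E i; have [d [_ dU]] := h _ Vc.
have ff (b : 'I_n -> C) : lincomb e b = lincomb e [ffun i => b i].
  by apply/funext => z; apply: eq_bigr => j _; rewrite ffunE.
have h1 := dU _ (ff c); have h2 := dU _ (etrans E (ff c')).
by have := congr1 (fun b : {ffun 'I_n -> C} => b i) (etrans (esym h1) h2); rewrite !ffunE.
Qed.

Lemma lincomb_mul n m (e : 'I_n -> C -> C) (P : 'M[C]_(m, n)) (c : 'I_m -> C) :
  lincomb (fun i => lincomb e (P i)) c = lincomb e (fun k => \sum_i c i * P i k).
Proof.
apply/funext => z; rewrite /lincomb.
rewrite (eq_bigr (fun i => \sum_k c i * P i k * e k z)); last first.
  by move=> i _; rewrite mulr_sumr; apply: eq_bigr => k _; rewrite mulrA.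
by rewrite exchange_big; apply: eq_bigr => k _; rewrite mulr_suml.
Qed.

Lemma basis_mx V n m (e : 'I_n -> C -> C) (f : 'I_m -> C -> C) : is_basis V e ->
  (forall i, V (f i)) -> exists P : 'M[C]_(m, n), forall i, f i = lincomb e (P i).
Proof.
move=> [_ h] fV.
have c i : {c : {ffun 'I_n -> C} | f i = lincomb e c}.
  by apply: cid; have [c [cE _]] := h _ (fV i); exists c.
exists (\matrix_(i, j) sval (c i) j) => i; rewrite {1}(svalP (c i)).
by apply/funext => z; apply: eq_bigr => j _; rewrite mxE.
Qed.

Lemma trace_uniq V T n m (e : 'I_n -> C -> C) (e' : 'I_m -> C -> C) (M : 'M[C]_n) (M' : 'M[C]_m) :
  (forall k (b : 'I_k -> C -> C) c, T (lincomb b c) = lincomb (fun i => T (b i)) c) ->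
  (forall f, V f -> V (T f)) ->
  is_basis V e -> is_basis V e' ->
  (forall i, T (e i) = lincomb e (M i)) -> (forall i, T (e' i) = lincomb e' (M' i)) ->
  \tr M = \tr M'.
Proof.
move=> Tlin TV be be' eM eM'.
have [P eP] := basis_mx be be'.1; have [Q eQ] := basis_mx be' be.1.
have lin k l (b : 'I_k -> C -> C) (f : 'I_l -> C -> C) (A : 'M[C]_(l, k)) c :
    (forall i, f i = lincomb b (A i)) -> lincomb f c = lincomb b (fun j => \sum_i c i * A i j).
  by move=> h; rewrite -lincomb_mul; congr lincomb; apply/funext => i; exact: h.
have QP : Q *m P = 1%:M.
  apply/matrixP => i j; rewrite mxE.
  have E : lincomb e (fun k => \sum_j Q i j * P j k) = lincomb e ((1%:M : 'M[C]_n) i).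
    rewrite -(lin _ _ _ _ _ _ eP) -eQ; apply/funext => z; rewrite /lincomb (bigD1 i) //=.
    rewrite mxE eqxx mul1r big1 ?addr0 // => k ki.
    by rewrite mxE eq_sym (negPf ki) mul0r.
  apply: (basis_inj be _ E); rewrite -(lin _ _ _ _ _ _ eP) -eQ; exact: be.1.
have PM : P *m M = M' *m P.
  apply/matrixP => i j; rewrite !mxE.
  have E1 : T (e' i) = lincomb e (fun k => \sum_j P i j * M j k).
    by rewrite eP Tlin (lin _ _ _ _ _ _ eM).
  have E2 : T (e' i) = lincomb e (fun k => \sum_j M' i j * P j k).
    by rewrite eM' (lin _ _ _ _ _ _ eP).
  apply: (basis_inj be _ (etrans (esym E1) E2)); rewrite -E1; apply: TV; exact: be'.1.
have PQ : P *m Q = 1%:M.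
  apply/matrixP => i j; rewrite mxE.
  have E : lincomb e' (fun k => \sum_j P i j * Q j k) = lincomb e' ((1%:M : 'M[C]_m) i).
    rewrite -(lin _ _ _ _ _ _ eQ) -eP; apply/funext => z; rewrite /lincomb (bigD1 i) //=.
    rewrite mxE eqxx mul1r big1 ?addr0 // => k ki.
    by rewrite mxE eq_sym (negPf ki) mul0r.
  apply: (basis_inj be' _ E); rewrite -(lin _ _ _ _ _ _ eQ) -eP; exact: be'.1.
by rewrite -[M']mulmx1 -PQ mulmxA -PM mxtrace_mulC mulmxA QP mul1mx.
Qed.

End Traces.

Section Canonical.
Variable R : realType.
Local Notation C := R[i].
Variable N : nat.
Hypothesis hN : (2 < N)%N.
Implicit Types (z w k : C) (g h x : M2Z) (F G : M2Z -> C).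
Local Notation zeta := (zeta R N).
Local Notation bas := (@bas R N).
Local Notation dim := #|@idx N|.
Local Notation canon := (canonical_char R N).


Let cconjM z w : (z * w)^*%R = z^* * w^*. Proof. exact: rmorphM. Qed.
Let cconjV z : (z^-1)^*%R = (z^*%R)^-1. Proof. exact: fmorphV. Qed.
Let cconj_zeta n : (zeta ^+ n)^*%R = (zeta ^+ n)^-1. Proof. exact: zeta_conj. Qed.

Definition Mx g : 'M[C]_(dim) := xget 0 [set M : 'M[C]_(dim) | forall i, slash g (bas i) = lincomb bas (M i)].

Lemma MxP g : SL2Z g -> forall i, slash g (bas i) = lincomb bas (Mx g i).
Proof.
move=> gS; have [h _] := S2_basis R hN.
have [M hM] := basis_mx (S2_basis R hN) (fun i => S2_slash hN gS (h i)).
by apply: (@xgetPex _ 0 [set M : 'M[C]_(dim) | forall i, slash g (bas i) = lincomb bas (M i)]); exists M.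
Qed.

Lemma Mx_eq g (M : 'M[C]_(dim)) : SL2Z g -> (forall i, slash g (bas i) = lincomb bas (M i)) -> Mx g = M.
Proof.
move=> gS h; apply/matrixP => i j.
by apply: (lincomb_inj hN (c := Mx g i) (c' := M i)); rewrite -MxP.
Qed.

Lemma bas_zoff i : zoff (bas i).
Proof. exact: e3_zoff. Qed.

Lemma MxM g h : SL2Z g -> SL2Z h -> Mx (g * h) = Mx g *m Mx h.
Proof.
move=> gS hS; apply: Mx_eq; first exact: SL2ZM.
move=> i; rewrite slashM //; last exact: bas_zoff.
rewrite MxP // slash_lincomb.
have -> : (fun i => slash h (bas i)) = fun i => lincomb bas (Mx h i).
  by apply/funext => j; exact: MxP.
by rewrite lincomb_mul; congr lincomb; apply/funext => k; rewrite mxE.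
Qed.

Lemma Mx_scalar g (c : 'I_dim -> C) : SL2Z g -> (forall i, slash g (bas i) = cscale (c i) (bas i)) ->
  Mx g = diag_mx (\row_i c i).
Proof.
move=> gS h; apply: Mx_eq => // i; rewrite h; apply/funext => z; rewrite /lincomb (bigD1 i) //=.
rewrite !mxE eqxx mulr1n big1 ?addr0 // => k ki.
by rewrite !mxE eq_sym (negPf ki) mulr0n mul0r.
Qed.

Lemma Mx_Phi g : Phi N g -> Mx g = 1%:M.
Proof.
move=> gP; rewrite (@Mx_scalar g (fun=> 1)).
- by apply/matrixP => i j; rewrite !mxE.
- exact: Gamma2SL (Phi_Gamma2 gP).
by move=> i; rewrite cscale1 (S2_Phi _ gP) //; exact: (S2_basis R hN).1.
Qed.

Lemma canonE g : SL2Z g -> canon g = \tr (Mx g).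
Proof.
move=> gS; have tr : is_trace (@S2 R N) (slash g) (\tr (Mx g)).
  by exists dim, bas, (Mx g); split; [exact: S2_basis|exact: MxP|].
rewrite /canonical_char /trace_on.
have [n [e [M [be eM ->]]]] := xgetPex 0 (ex_intro (is_trace (@S2 R N) (slash g)) _ tr).
apply: (trace_uniq (T := slash g)) be (S2_basis R hN) eM (MxP gS).
- by move=> k b c; exact: slash_lincomb.
- by move=> f; exact: S2_slash.
Qed.

Lemma canon_Phi g h : SL2Z g -> Phi N h -> canon (g * h) = canon g.
Proof.
move=> gS hP; have hS := Gamma2SL (Phi_Gamma2 hP).
by rewrite (canonE (SL2ZM gS hS)) (canonE gS) (MxM gS hS) (Mx_Phi hP) mulmx1.
Qed.

Lemma canonJ x g : SL2Z x -> SL2Z g -> canon (x^-1 * g * x) = canon g.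
Proof.
move=> xS gS; have xV := SL2ZV xS; have xg := SL2ZM xV gS.
rewrite (canonE (SL2ZM xg xS)) (canonE gS) (MxM xg xS) (MxM xV gS).
by rewrite mxtrace_mulC mulmxA -(MxM xS xV) (mulSLV xS) (Mx_Phi (Phi1 R hN)) mul1mx.
Qed.

Definition mAB (a b : nat) : M2Z := matA ^+ a * matB ^+ b.

Lemma mAB_Gamma2 a b : Gamma2 (mAB a b).
Proof. by apply: Gamma2M; apply: Gamma2X; [exact: Gamma2_A|exact: Gamma2_B]. Qed.

Lemma canon_wAB x (a b : nat) : SL2Z x -> canon (x * mAB a b) = \sum_(i < dim)
  Mx x i i * (zeta ^+ ((enum_val i).1 * a) * zeta ^+ ((enum_val i).2 * b)).
Proof.
move=> xS; have mS := Gamma2SL (mAB_Gamma2 a b).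
rewrite (canonE (SL2ZM xS mS)) (MxM xS mS).
rewrite (@Mx_scalar (mAB a b)
  (fun i => zeta ^+ ((enum_val i).1 * a) * zeta ^+ ((enum_val i).2 * b))) //; last first.
  by move=> i; apply: vec_AB => //; exact: idxP.
by rewrite /mxtrace; apply: eq_bigr => i _; rewrite mul_mx_diag !mxE.
Qed.

Definition Isix := ('I_(size six) * ('I_N * 'I_N))%type.
Definition rep (i : Isix) : M2Z := nth 1 six i.1 * mAB i.2.1 i.2.2.

Let six_nth (i : 'I_(size six)) : nth 1 six i \in six.
Proof. by rewrite mem_nth. Qed.

Lemma rep_SL i : SL2Z (rep i).
Proof. by apply: SL2ZM; [exact: six_SL (six_nth _)|exact: Gamma2SL (mAB_Gamma2 _ _)]. Qed.

Let NE : (Zp_trunc N).+2 = N. Proof. by rewrite Zp_cast //; lia. Qed.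

Lemma expAB_mAB a b : expAB N (mAB a b) = (a%:R, b%:R).
Proof.
have [_ _ eA eB] := expABP R hN.
have GA := Gamma2_A; have GB := Gamma2_B.
rewrite (expABM R hN) ?(expABX R hN) //; try exact: Gamma2X.
have e (p : 'Z_N * 'Z_N) n : p *+ n = (p.1 *+ n, p.2 *+ n).
  by elim: n => [|n IH]; rewrite ?mulr0n // !mulrS IH.
have ad (p q p' q' : 'Z_N) : (p, q) + (p', q') = (p + p', q + q') by [].
by rewrite eA eB !e ad /= !mul0rn addr0 add0r.
Qed.

Lemma rep_surj g : SL2Z g -> exists i, Phi N ((rep i)^-1 * g).
Proof.
move=> gS; have [x x6 xG] := six_cover gS; have xS := six_SL x6.
have xi : (index x six < size six)%N by rewrite index_mem.
pose e := expAB N (x^-1 * g).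
have l1 : (e.1 < N)%N by rewrite -[X in (_ < X)%N]NE.
have l2 : (e.2 < N)%N by rewrite -[X in (_ < X)%N]NE.
exists (Ordinal xi, (Ordinal l1, Ordinal l2)); rewrite /rep /= nth_index //.
set m := mAB _ _; have mG : Gamma2 m by exact: mAB_Gamma2.
have mS := Gamma2SL mG.
have -> : (x * m)^-1 * g = m^-1 * (x^-1 * g).
  by rewrite invrM ?mulrA //; exact: SL2Z_unit.
have mV := Gamma2V mG.
split; first exact: Gamma2M.
rewrite (expABM R hN) // (expABV R hN) // -/e expAB_mAB /= !natr_Zp.
by case: (e) => ? ?; exact: addNr.
Qed.

Lemma rep_inj i j : Phi N ((rep i)^-1 * rep j) -> i = j.
Proof.
case: i => i [a b]; case: j => j [a' b'] hP; rewrite /rep /= in hP.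
have iS := six_SL (six_nth i); have jS := six_SL (six_nth j).
set m := mAB a b in hP; set m' := mAB a' b' in hP.
have mG : Gamma2 m by exact: mAB_Gamma2.
have m'G : Gamma2 m' by exact: mAB_Gamma2.
have E : (nth 1 six i * m)^-1 * (nth 1 six j * m') = m^-1 * ((nth 1 six i)^-1 * nth 1 six j) * m'.
  by rewrite invrM ?mulrA //; apply: SL2Z_unit => //; exact: Gamma2SL.
rewrite E in hP.
have G : Gamma2 ((nth 1 six i)^-1 * nth 1 six j).
  have -> : (nth 1 six i)^-1 * nth 1 six j =
      m * (m^-1 * ((nth 1 six i)^-1 * nth 1 six j) * m') * m'^-1.
    rewrite -(mulrA m^-1 _ m') mulVKr; last by apply: SL2Z_unit; exact: Gamma2SL mG.
    by rewrite mulrK //; apply: SL2Z_unit; exact: Gamma2SL m'G.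
  apply: Gamma2M; last exact: Gamma2V.
  exact: Gamma2M mG (Phi_Gamma2 hP).
have ij := six_inj (six_nth i) (six_nth j) G.
have eij : i = j by apply/val_inj/eqP; rewrite -(nth_uniq 1 _ _ six_uniq) ?ltn_ord // ij.
congr pair => //; move: hP; rewrite ij mulVSL // mulr1 => -[_].
rewrite (expABM R hN) ?(expABV R hN) //; last exact: Gamma2V.
rewrite !expAB_mAB => /eqP; rewrite addrC subr_eq0 => /eqP[].
move=> /(congr1 (@nat_of_ord _)) + /(congr1 (@nat_of_ord _)); rewrite /= !val_Zp_nat ?NE //; try lia.
rewrite !modn_small ?ltn_ord // => h1 h2.
by congr pair; apply: val_inj.
Qed.

Definition Phi_inv (K : set M2Z) F := forall g h, K g -> Phi N h -> F (g * h) = F g.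

Definition cosets_of (W : seq M2Z) (K : set M2Z) :=
  {subset W <= six} /\ forall g, K g <-> SL2Z g /\ exists2 x, x \in W & Gamma2 (x^-1 * g).

Definition repsum (W : seq M2Z) F : C :=
  \sum_(x <- six | x \in W) \sum_(a < N) \sum_(b < N) F (x * mAB a b).

Lemma repsumE W F : repsum W F = \sum_(i : Isix | nth 1 six i.1 \in W) F (rep i).
Proof.
rewrite /repsum (big_nth 1) big_mkord.
rewrite (eq_bigr (fun i : 'I_(size six) => \sum_(p : 'I_N * 'I_N) F (rep (i, p)))); last first.
  by move=> i _; rewrite pair_big.
rewrite pair_big_dep /=; apply: eq_big => [[i p]|[i p] _] //=.
by rewrite andbT.
Qed.

Lemma cosets_rep W K i : cosets_of W K -> K (rep i) <-> nth 1 six i.1 \in W.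
Proof.
move=> [W6 KW]; have iS := six_SL (six_nth i.1).
have e : (nth 1 six i.1)^-1 * rep i = mAB i.2.1 i.2.2.
  by rewrite /rep mulrA mulVSL // mul1r.
split=> [/KW[_ [x xW G]]|iW]; last first.
  by apply/KW; split; [exact: rep_SL|exists (nth 1 six i.1); rewrite // e; exact: mAB_Gamma2].
have xS := six_SL (W6 _ xW).
suff -> : nth 1 six i.1 = x by [].
apply/esym; apply: (six_inj (W6 _ xW) (six_nth _)).
have -> : x^-1 * nth 1 six i.1 = x^-1 * rep i * (mAB i.2.1 i.2.2)^-1.
  by rewrite /rep (mulrA x^-1) mulrK //; exact: SL2Z_unit (Gamma2SL (mAB_Gamma2 _ _)).
by apply: Gamma2M => //; apply: Gamma2V; exact: mAB_Gamma2.
Qed.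

Lemma PhiVM g h : SL2Z g -> SL2Z h -> Phi N (g^-1 * h) -> Phi N (h^-1 * g).
Proof.
move=> gS hS; have uV := SL2Z_unit (SL2ZV gS); have uh := SL2Z_unit hS.
by move=> /(PhiV R hN); rewrite invrM // invrK.
Qed.

Lemma qsumE W K F : cosets_of W K -> Phi_inv K F -> qsum N K F = repsum W F.
Proof.
move=> KW Finv; rewrite repsumE /qsum.
pose cs (i : Isix) : set M2Z := [set rep i * h | h in Phi N].
have csP i g : cs i g <-> Phi N ((rep i)^-1 * g).
  split=> [[h hP <-]|hP]; first by rewrite mulrA mulVSL ?mul1r //; exact: rep_SL.
  by exists ((rep i)^-1 * g) => //; rewrite mulrA mulSLV ?mul1r //; exact: rep_SL.
have P1 := Phi1 R hN.
have bij : set_bij [set i : Isix | nth 1 six i.1 \in W] (quot N K) cs.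
  split.
  - move=> i /= iW; exists (rep i) => //; exact/(cosets_rep i KW).
  - move=> i j _ _ E; apply: rep_inj; apply/csP; rewrite E; apply/csP.
    by rewrite mulVSL //; exact: rep_SL.
  - move=> X [g gK <-]; have gS : SL2Z g by case/KW.2: gK.
    have [i iP] := rep_surj gS; exists i.
      rewrite /=; apply/(cosets_rep i KW)/KW.2; split; first exact: rep_SL.
      have [_ [x xW xG]] := (KW.2 g).1 gK; exists x => //.
      have -> : x^-1 * rep i = x^-1 * g * (g^-1 * rep i).
        by rewrite -!mulrA (mulrA g) mulSLV // mul1r.
      by apply: Gamma2M => //; apply: Phi_Gamma2; apply: PhiVM => //; exact: rep_SL.
    apply/seteqP; split=> h.
      move=> /csP hP; exists (g^-1 * h); last by rewrite mulrA mulSLV ?mul1r.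
      have -> : g^-1 * h = (g^-1 * rep i) * ((rep i)^-1 * h).
        by rewrite -(mulrA g^-1) mulVKr //; exact: SL2Z_unit (rep_SL i).
      by apply: (PhiM R hN) => //; apply: PhiVM => //; exact: rep_SL.
    move=> [k kP <-]; apply/csP; rewrite mulrA; exact: (PhiM R hN).
rewrite (reindex_fsbig cs [set i : Isix | nth 1 six i.1 \in W] (quot N K) _ bij).
have Fcs (i : Isix) : nth 1 six i.1 \in W -> F (xget 1 (cs i)) = F (rep i).
  move=> iW; have : cs i (xget 1 (cs i)).
    apply: (@xgetPex _ 1 (cs i)); exists (rep i); apply/csP.
    by rewrite mulVSL //; exact: rep_SL.
  case=> h hP <-; apply: Finv => //; exact/(cosets_rep i KW).
rewrite -(eq_bigr _ Fcs).
rewrite (bigfs _ (index_enum_uniq _)) //.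
by move=> i _; rewrite mem_index_enum.
Qed.

Lemma cosets_SL : cosets_of six (@SL2Z).
Proof.
split=> // g; split=> [gS|[]//]; split=> //.
by have [x x6 xG] := six_cover gS; exists x.
Qed.

Lemma cosets_Gamma2 : cosets_of [:: 1] Gamma2.
Proof.
split=> [x|g]; first by rewrite inE => /eqP ->; rewrite inE eqxx.
split=> [gG|[_ [x]]]; last by rewrite inE => /eqP ->; rewrite invr1 mul1r.
by split; [exact: Gamma2SL|exists 1; rewrite ?inE ?invr1 ?mul1r].
Qed.

Lemma cosets_Gamma2S : cosets_of [:: 1; matS] Gamma2S.
Proof.
split=> [x|g]; first by rewrite !inE => /orP[] /eqP ->; rewrite !eqxx ?orbT.
have SS := SL2Z_S.
split=> [[gG|[h hG <-]]|[gS [x]]].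
- by split; [exact: Gamma2SL|exists 1; [rewrite !inE eqxx|rewrite invr1 mul1r]].
- split; first by apply: SL2ZM => //; exact: Gamma2SL.
  exists matS; first by rewrite !inE eqxx orbT.
  have -> : matS^-1 * (h * matS) = matS^-1 * h * (matS^-1)^-1 by rewrite invrK mulrA.
  by apply: Gamma2J => //; exact: SL2ZV.
rewrite !inE => /orP[] /eqP -> G; first by left; rewrite -[g]mul1r -invr1.
right; exists (g * matS^-1); last by rewrite -mulrA mulVSL ?mulr1.
have -> : g * matS^-1 = matS * (matS^-1 * g) * matS^-1.
  by rewrite (mulrA matS) mulSLV ?mul1r.
exact: Gamma2J.
Qed.

Lemma qcardE W K : cosets_of W K -> uniq W -> qcard R N K = (size W)%:R * N%:R ^+ 2.
Proof.
move=> KW uW; rewrite /qcard (qsumE KW) // /repsum.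
rewrite (eq_bigr (fun=> N%:R ^+ 2)); last first.
  by move=> x _; rewrite (eq_bigr (fun=> N%:R)) => [|a _]; rewrite sumr_const card_ord // expr2 mulr_natr.
suff cnt : count (fun x => x \in W) six = size W by rewrite big_const_seq iter_addr addr0 cnt mulr_natl.
rewrite -size_filter; apply/eqP; rewrite eqn_leq; apply/andP; split.
  by apply: uniq_leq_size; [apply: filter_uniq; exact: six_uniq|move=> x; rewrite mem_filter => /andP[]].
by apply: uniq_leq_size => // x xW; rewrite mem_filter xW (KW.1 _ xW).
Qed.

Let conj_aux x g h (k : M2Z) : x \is a GRing.unit -> g \is a GRing.unit -> h \is a GRing.unit ->
  x * ((x^-1 * g * x)^-1 * h * (h^-1 * (x^-1 * k * x))) * x^-1 = g^-1 * k.
Proof.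
move=> ux ug uh; have uxV : x^-1 \is a GRing.unit by rewrite unitrV.
have uxg : x^-1 * g \is a GRing.unit by rewrite unitrMl.
rewrite -(mulrA _ h) mulVKr // (invrM uxg ux) (invrM uxV ug) invrK.
rewrite -!(mulrA x^-1) (mulrA x x^-1) mulrV // mul1r -!mulrA (mulrA x x^-1) mulrV // mul1r.
by rewrite mulr1.
Qed.

Lemma qsum_conj F x : SL2Z x -> Phi_inv (@SL2Z) F ->
  qsum N (@SL2Z) (fun g => F (x^-1 * g * x)) = qsum N (@SL2Z) F.
Proof.
move=> xS Finv; have xV := SL2ZV xS.
have inv' : Phi_inv (@SL2Z) (fun g => F (x^-1 * g * x)).
  move=> g h gS hP; have -> : x^-1 * (g * h) * x = (x^-1 * g * x) * (x^-1 * h * (x^-1)^-1).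
    by rewrite invrK -!mulrA (mulrA x) mulSLV // mul1r.
  by apply: Finv; [exact: SL2ZM (SL2ZM xV gS) xS|exact: (PhiJ R hN xV hP)].
rewrite (qsumE cosets_SL inv') (qsumE cosets_SL Finv) !repsumE.
have alls (i : Isix) : nth 1 six i.1 \in six by exact: six_nth.
rewrite [LHS](eq_bigl predT) // [RHS](eq_bigl predT) //.
have cJ i : SL2Z (x^-1 * rep i * x) by exact: SL2ZM (SL2ZM xV (rep_SL i)) xS.
pose s i := xget i [set j | Phi N ((rep j)^-1 * (x^-1 * rep i * x))].
have sP i : Phi N ((rep (s i))^-1 * (x^-1 * rep i * x)).
  have [j jP] := rep_surj (cJ i).
  by apply: (@xgetPex _ i [set j | Phi N ((rep j)^-1 * (x^-1 * rep i * x))]); exists j.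
have sinj : injective s.
  move=> i j E; apply: rep_inj.
  have h1 := PhiVM (rep_SL _) (cJ i) (sP i); have h2 := sP j; rewrite -E in h2.
  have h3 := PhiM R hN h1 h2; have := PhiJ R hN xS h3.
  suff -> : x * ((x^-1 * rep i * x)^-1 * rep (s i) * ((rep (s i))^-1 * (x^-1 * rep j * x))) * x^-1 =
     (rep i)^-1 * rep j by [].
  exact: conj_aux (SL2Z_unit xS) (SL2Z_unit (rep_SL i)) (SL2Z_unit (rep_SL _)).
rewrite [RHS](reindex_inj sinj) /=; apply: eq_bigr => i _.
have := Finv (rep (s i)) _ (rep_SL _) (sP i).
by rewrite (mulVKr (SL2Z_unit (rep_SL _))) => ->.
Qed.

Lemma qsumZ W K F (c : C) : cosets_of W K -> Phi_inv K F ->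
  qsum N K (fun g => c * F g) = c * qsum N K F.
Proof.
move=> KW Finv; rewrite (qsumE KW) => [|g h gK hP]; last by rewrite Finv.
rewrite (qsumE KW) // !repsumE mulr_sumr; exact: eq_bigr.
Qed.

Lemma eq_qsum W K F G : cosets_of W K -> Phi_inv K F -> Phi_inv K G ->
  (forall g, K g -> F g = G g) -> qsum N K F = qsum N K G.
Proof.
move=> KW Finv Ginv h; rewrite !(qsumE KW) // !repsumE; apply: eq_bigr => i iW.
by apply: h; apply/(cosets_rep i KW).
Qed.

Lemma qsum_restrict W K F : cosets_of W K -> Phi_inv K F ->
  qsum N (@SL2Z) (fun g => if g \in K then F g else 0) = qsum N K F.
Proof.
move=> KW Finv.
have KM g h : SL2Z g -> Phi N h -> (g * h \in K) = (g \in K).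
  move=> gS hP; have hG := Phi_Gamma2 hP; have hS := Gamma2SL hG.
  apply/idP/idP; rewrite !inE => /KW.2[_ [x xW xG]]; apply/KW.2; split; rewrite ?inE //.
  - exists x => //; have -> : x^-1 * g = x^-1 * (g * h) * h^-1.
      by rewrite mulrA mulrK //; exact: SL2Z_unit.
    by apply: Gamma2M => //; exact: Gamma2V.
  - exact: SL2ZM.
  - by exists x => //; rewrite mulrA; exact: Gamma2M.
rewrite (qsumE cosets_SL); last first.
  move=> g h gS hP; rewrite KM //; case: ifP => // gK; apply: Finv => //.
  by move: gK; rewrite inE.
rewrite (qsumE KW) // !repsumE [LHS](eq_bigl predT) => [|i]; last by rewrite six_nth.
rewrite [RHS]big_mkcond; apply: eq_bigr => i _.
have -> : (rep i \in K) = (nth 1 six i.1 \in W).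
  by apply/idP/idP; rewrite inE => /(cosets_rep i KW).
by [].
Qed.

Let conj2_aux x g h : x \is a GRing.unit -> g \is a GRing.unit -> h \is a GRing.unit ->
  (x * h)^-1 * g * (x * h) =
  (x^-1 * g * x) * ((x^-1 * g * x)^-1 * h^-1 * ((x^-1 * g * x)^-1)^-1 * h).
Proof.
move=> ux ug uh; have uy : x^-1 * g * x \is a GRing.unit by rewrite unitrMl // unitrMl // unitrV.
rewrite (invrK (x^-1 * g * x)) -(mulrA _ (x^-1 * g * x)) -(mulrA _ h^-1) mulVKr //.
by rewrite invrM // !mulrA.
Qed.

Lemma frobenius W K (l : M2Z -> C) : cosets_of W K -> uniq W -> (0 < size W)%N ->
  Phi_inv K l ->
  cdot N canon (ind N K l) = (qcard R N K)^-1 * qsum N K (fun g => canon g * (l g)^*).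
Proof.
move=> KW uW W0 linv; have KS := cosets_SL.
have cinv : Phi_inv (@SL2Z) canon by move=> g h; exact: canon_Phi.
have KSL g : K g -> SL2Z g by case/KW.2.
pose H y : C := if y \in K then l y else 0.
have Hinv : Phi_inv (@SL2Z) H.
  move=> g h gS hP; rewrite /H; have hG := Phi_Gamma2 hP; have hS := Gamma2SL hG.
  have -> : (g * h \in K) = (g \in K).
    apply/idP/idP; rewrite !inE => /KW.2[_ [x xW xG]]; apply/KW.2; split; rewrite ?inE //.
    - exists x => //; have -> : x^-1 * g = x^-1 * (g * h) * h^-1.
        by rewrite mulrA mulrK //; exact: SL2Z_unit.
      by apply: Gamma2M => //; exact: Gamma2V.
    - exact: SL2ZM.
    - by exists x => //; rewrite mulrA; exact: Gamma2M.
  by case: ifP => // gK; apply: linv => //; move: gK; rewrite inE.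
pose Q := qsum N K (fun g => canon g * (l g)^*).
have GKinv : Phi_inv K (fun g => canon g * (l g)^*).
  by move=> g h gK hP; rewrite linv // cinv //; exact: KSL.
have QE : qsum N (@SL2Z) (fun g => canon g * (H g)^*) = Q.
  rewrite /Q -(qsum_restrict KW GKinv).
  congr qsum; apply/funext => g; rewrite /H; case: ifP => // _.
  by rewrite rmorph0 mulr0.
have GSinv : Phi_inv (@SL2Z) (fun g => canon g * (H g)^*).
  by move=> g h gS hP; rewrite Hinv // cinv.
have xJ x g : SL2Z x -> SL2Z g -> SL2Z (x^-1 * g * x).
  by move=> xS gS; apply: SL2ZM => //; apply: SL2ZM => //; exact: SL2ZV.
have JR x g h : SL2Z x -> SL2Z g -> Phi N h -> H (x^-1 * (g * h) * x) = H (x^-1 * g * x).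
  move=> xS gS hP; have -> : x^-1 * (g * h) * x = (x^-1 * g * x) * (x^-1 * h * (x^-1)^-1).
    rewrite invrK -!mulrA; congr (_ * (_ * _)).
    by rewrite mulVKr //; exact: SL2Z_unit.
  by apply: Hinv; [exact: xJ|exact: (PhiJ R hN (SL2ZV xS) hP)].
have JL x g h : SL2Z x -> SL2Z g -> Phi N h -> H ((x * h)^-1 * g * (x * h)) = H (x^-1 * g * x).
  move=> xS gS hP; have hS := Gamma2SL (Phi_Gamma2 hP).
  pose y := x^-1 * g * x; have yS : SL2Z y by exact: xJ.
  have -> : (x * h)^-1 * g * (x * h) = y * (y^-1 * h^-1 * (y^-1)^-1 * h).
    by apply: conj2_aux; exact: SL2Z_unit.
  apply: Hinv => //; apply: (PhiM R hN) => //.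
  by apply: (PhiJ R hN); [exact: SL2ZV|exact: (PhiV R hN)].
have conjE : qsum N (@SL2Z) (fun x => Q) = qcard R N (@SL2Z) * Q.
  rewrite /qcard mulrC -(qsumZ Q KS) //; congr qsum; apply/funext => g.
  by rewrite mulr1.
have c0 : qcard R N (@SL2Z) != 0.
  by rewrite (qcardE KS six_uniq) mulf_neq0 ?expf_neq0 ?pnatr_eq0 //; lia.
rewrite /cdot.
pose F2 g x := canon g * (H (x^-1 * g * x))^*.
have F2r g x h : SL2Z g -> SL2Z x -> Phi N h -> F2 g (x * h) = F2 g x.
  by move=> gS xS hP; rewrite /F2 JL.
have F2l g x h : SL2Z x -> SL2Z g -> Phi N h -> F2 (g * h) x = F2 g x.
  by move=> xS gS hP; rewrite /F2 JR // cinv.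
have -> : qsum N (@SL2Z) (fun g => canon g * (ind N K l g)^*) =
    (qcard R N K)^-1 * qsum N (@SL2Z) (fun x => Q).
  have cK : (qcard R N K)^*%R = qcard R N K.
    by rewrite (qcardE KW uW) rmorphM rmorphXn !rmorph_nat.
  have E1 g : SL2Z g -> canon g * (ind N K l g)^* = (qcard R N K)^-1 * repsum six (F2 g).
    move=> gS; rewrite /ind cconjM cconjV cK mulrCA; congr (_ * _).
    rewrite (qsumE KS); last by move=> x h xS hP; exact: JL.
    by rewrite !repsumE rmorph_sum mulr_sumr.
  have inv1 : Phi_inv (@SL2Z) (fun g => (qcard R N K)^-1 * repsum six (F2 g)).
    move=> g h gS hP; congr (_ * _); rewrite !repsumE; apply: eq_bigr => i _.
    by apply: F2l => //; exact: rep_SL.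
  rewrite (eq_qsum KS _ inv1 E1); last first.
    by move=> g h gS hP; rewrite (E1 _ (SL2ZM gS (Gamma2SL (Phi_Gamma2 hP)))) (E1 _ gS) (inv1 _ _ gS hP).
  rewrite (qsumZ _ KS); last first.
    by move=> g h gS hP; rewrite !repsumE; apply: eq_bigr => i _; apply: F2l => //; exact: rep_SL.
  congr (_ * _); rewrite (qsumE KS); last first.
    by move=> g h gS hP; rewrite !repsumE; apply: eq_bigr => i _; apply: F2l => //; exact: rep_SL.
  rewrite (qsumE KS) // !repsumE.
  rewrite (eq_bigr _ (fun i _ => repsumE _ _)) exchange_big /=; apply: eq_bigr => i _.
  have iS := rep_SL i; transitivity (repsum six (F2^~ (rep i))); first by rewrite repsumE.
  rewrite -(qsumE KS); last by move=> g h gS hP; exact: F2l.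
  rewrite -QE -(qsum_conj iS GSinv); apply: (eq_qsum KS).
  - by move=> g h gS hP; exact: F2l.
  - move=> g h gS hP /=; have ghS := SL2ZM gS (Gamma2SL (Phi_Gamma2 hP)).
    by rewrite (JR _ _ _ iS gS hP) (canonJ iS ghS) (canonJ iS gS) cinv.
  - by move=> g gS; rewrite /F2 (canonJ iS).
by rewrite conjE mulrCA mulKf.
Qed.

(* Orthogonality of the characters of (Z/N)^2 leaves only the basis form with
   the same eigenvalues as [l]. *)
Lemma qsum_canon W K (l : M2Z -> C) (m n : nat) : cosets_of W K -> Phi_inv K l ->
  (m < N)%N -> (n < N)%N ->
  (forall x (a b : nat), x \in W -> l (x * mAB a b) = l x * (zeta ^+ (m * a) * zeta ^+ (n * b))) ->
  qsum N K (fun g => canon g * (l g)^*) =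
  N%:R ^+ 2 * \sum_(x <- six | x \in W) (l x)^* *
    \sum_(i < dim | ((enum_val i).1 == m :> nat) && ((enum_val i).2 == n :> nat)) Mx x i i.
Proof.
move=> KW linv mN nN lE.
have KSL g : K g -> SL2Z g by case/KW.2.
rewrite (qsumE KW); last by move=> g h gK hP; rewrite linv // canon_Phi //; exact: KSL.
rewrite /repsum mulr_sumr; apply: eq_bigr => x xW; have xS := six_SL (KW.1 _ xW).
rewrite (eq_bigr (fun a : 'I_N => \sum_(b < N) \sum_(i < dim) (l x)^* * (Mx x i i *
  ((zeta ^+ ((enum_val i).1 * a) / zeta ^+ (m * a)) *
   (zeta ^+ ((enum_val i).2 * b) / zeta ^+ (n * b)))))); last first.
  move=> a _; apply: eq_bigr => b _; rewrite canon_wAB // lE // !cconjM !cconj_zeta.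
  rewrite mulr_suml; apply: eq_bigr => i _; rewrite /=.
  by ring.
rewrite (eq_bigr (fun a : 'I_N => \sum_(i < dim) \sum_(b < N) (l x)^* * (Mx x i i *
  ((zeta ^+ ((enum_val i).1 * a) / zeta ^+ (m * a)) *
   (zeta ^+ ((enum_val i).2 * b) / zeta ^+ (n * b)))))); last first.
  by move=> a _; rewrite exchange_big.
rewrite exchange_big /= [in RHS]big_mkcond /= !mulr_sumr; apply: eq_bigr => i _.
rewrite (eq_bigr (fun a : 'I_N => (l x)^* * (Mx x i i *
  ((zeta ^+ ((enum_val i).1 * a) / zeta ^+ (m * a)) *
   \sum_(b < N) (zeta ^+ ((enum_val i).2 * b) / zeta ^+ (n * b)))))); last first.
  by move=> a _; rewrite !mulr_sumr.
rewrite -mulr_sumr -mulr_sumr -mulr_suml !(zeta_sum _ hN) !(modn_small (ltn_ord _)) !modn_small //.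
case: eqP => _; case: eqP => _ /=; ring.
Qed.

End Canonical.

(** * The quotient S_3 and the multiplicities *)

Section SymmetricGroup.
Implicit Types (g h x : M2Z).

Definition parity (a : int) : bool := odd (absz a).

Lemma parityD a b : parity (a + b) = parity a (+) parity b.
Proof. by rewrite /parity; lia. Qed.

Lemma parityM a b : parity (a * b) = parity a && parity b.
Proof. by rewrite /parity abszM oddM. Qed.

(* Nonzero row vectors over the field with two elements, and their images
   under a matrix with entries of parities [a], [b], [c], [d]. *)
Definition vec2 (i : 'I_3) : bool * bool :=
  match nat_of_ord i with 0 => (true, false) | 1 => (false, true) | _ => (true, true) end.
Definition vec2_inv (v : bool * bool) : 'I_3 :=
  match v with (true, false) => 0 | (false, true) => 1 | _ => 2%:R end.
Definition act2 (a b c d : bool) (i : 'I_3) : 'I_3 :=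
  let v := vec2 i in vec2_inv ((v.1 && a) (+) (v.2 && c), (v.1 && b) (+) (v.2 && d)).

Lemma ord3P (i : 'I_3) : [\/ i = 0, i = 1 | i = 2%:R].
Proof.
by case: i => [[|[|[|//]]]] h; [constructor 1|constructor 2|constructor 3]; apply: val_inj.
Qed.

Lemma act2_inj a b c d : (a && d) (+) (b && c) -> injective (act2 a b c d).
Proof.
case: a; case: b; case: c; case: d => //= _ i j;
  by case: (ord3P i) => ->; case: (ord3P j) => ->; move=> /(congr1 val).
Qed.

Lemma act2_mul a b c d a' b' c' d' i : (a && d) (+) (b && c) -> (a' && d') (+) (b' && c') ->
  act2 ((a && a') (+) (b && c')) ((a && b') (+) (b && d'))
       ((c && a') (+) (d && c')) ((c && b') (+) (d && d')) i =
  act2 a' b' c' d' (act2 a b c d i).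
Proof.
by case: (ord3P i) => ->; case: a; case: b; case: c; case: d => //= _;
  case: a'; case: b'; case: c'; case: d' => //= _; apply: val_inj.
Qed.

Lemma act2_id a b c d : (a && d) (+) (b && c) -> act2 a b c d =1 id <-> [/\ a, ~~ b, ~~ c & d].
Proof.
move=> h; split=> [H|]; last first.
  move=> [ha /negPf hb /negPf hc hd] i; rewrite ha hb hc hd.
  by case: (ord3P i) => ->; apply: val_inj.
have := congr1 val (H 0); have := congr1 val (H 1).
by case: a h {H} => //; case: b => //; case: c => //; case: d.
Qed.

Definition actZ g := act2 (parity (g 0 0)) (parity (g 0 1)) (parity (g 1 0)) (parity (g 1 1)).
Definition perm2 g : 'S_3 := xget 1%g [set s : 'S_3 | s =1 actZ g].

Lemma parity_det g : SL2Z g ->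
  (parity (g 0 0) && parity (g 1 1)) (+) (parity (g 0 1) && parity (g 1 0)).
Proof.
case/SL2Z_mx22P => a [b [c [d [-> e]]]]; rewrite !mxE /= -!parityM.
have : parity (a * d - b * c) by rewrite e.
by rewrite parityD /parity abszN.
Qed.

Lemma perm2E g : SL2Z g -> perm2 g =1 actZ g.
Proof.
move=> gS; apply: (@xgetPex _ 1%g [set s : 'S_3 | s =1 actZ g]).
by exists (perm (act2_inj (parity_det gS))) => i; rewrite permE.
Qed.

Lemma Gamma2_parity g : SL2Z g -> Gamma2 g <->
  [/\ parity (g 0 0), ~~ parity (g 0 1), ~~ parity (g 1 0) & parity (g 1 1)].
Proof.
case/SL2Z_mx22P => a [b [c [d [-> e]]]]; rewrite !mxE /= /parity; split.
  by case/Gamma2P => _ h1 h2 h3 h4; split; lia.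
by move=> [h1 h2 h3 h4]; apply/Gamma2P; split => //; lia.
Qed.

Let perm2M g h : SL2Z g -> SL2Z h -> perm2 (g * h) = (perm2 g * perm2 h)%g.
Proof.
move=> gS hS; apply/permP => i; rewrite permM !perm2E //; last exact: SL2ZM.
have := parity_det gS; have := parity_det hS; rewrite /actZ.
case/SL2Z_mx22P: gS => a [b [c [d [-> _]]]]; case/SL2Z_mx22P: hS => a' [b' [c' [d' [-> _]]]].
rewrite mulmx22 !mxE /= !parityD !parityM => h1 h2.
exact: act2_mul.
Qed.

Let perm2_ker g : SL2Z g -> (perm2 g = 1%g <-> Gamma2 g).
Proof.
move=> gS; rewrite Gamma2_parity // -(act2_id (parity_det gS)) -/(actZ g); split.
  by move=> e i; rewrite -perm2E // e perm1.
by move=> e; apply/permP => i; rewrite perm2E // e perm1.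
Qed.

Lemma six_perm (p : M2Z -> 'S_3) :
  (forall g h, SL2Z g -> SL2Z h -> p (g * h) = (p g * p h)%g) ->
  (forall g, SL2Z g -> (p g = 1%g <-> Gamma2 g)) ->
  perm_eq [seq p x | x <- six] (enum 'S_3).
Proof.
move=> pM pK.
have pinj : {in six &, injective p}.
  move=> x y x6 y6 e; have xS := six_SL x6; have yS := six_SL y6.
  apply: six_inj => //; have xV := SL2ZV xS; apply/pK; first exact: SL2ZM.
  by rewrite pM // -e -pM // mulVSL //; apply/pK; [exact: SL2Z1|exact: Gamma2_1].
have u : uniq [seq p x | x <- six] by rewrite map_inj_in_uniq // six_uniq.
have sub : {subset [seq p x | x <- six] <= enum 'S_3} by move=> s _; rewrite mem_enum.
have sz : (size (enum 'S_3) <= size [seq p x | x <- six])%N.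
  by rewrite -cardE card_Sn size_map.
have [_ E] := uniq_min_size u sub sz.
by apply: uniq_perm => //; exact: enum_uniq.
Qed.

Lemma toS3P : is_toS3 toS3.
Proof.
apply: xgetPex; exists perm2; split=> // s.
have : s \in [seq perm2 x | x <- six] by rewrite (perm_mem (six_perm perm2M perm2_ker)) mem_enum.
by case/mapP => x x6 ->; exists x => //; exact: six_SL.
Qed.

Lemma toS3M g h : SL2Z g -> SL2Z h -> toS3 (g * h) = (toS3 g * toS3 h)%g.
Proof. by case: toS3P => h1 _ _; exact: h1. Qed.

Lemma toS3_Gamma2 g : Gamma2 g -> toS3 g = 1%g.
Proof. by move=> gG; have [_ h _] := toS3P; apply/(h g (Gamma2SL gG)). Qed.

Lemma sum_six (V : nmodType) (G : 'S_3 -> V) : \sum_(x <- six) G (toS3 x) = \sum_(s : 'S_3) G s.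
Proof.
have [h1 h2 _] := toS3P.
by rewrite -(big_map toS3 xpredT G) (perm_big _ (six_perm h1 h2)) big_enum.
Qed.

Lemma matU3 : Gamma2 (matU ^+ 3).
Proof. by rewrite !exprS expr0 mulr1 !mulmx22; apply/Gamma2P; split. Qed.

Lemma odd_toS3U : odd_perm (toS3 matU) = false.
Proof.
have US := SL2Z_U.
have e : toS3 (matU ^+ 3) = (toS3 matU * (toS3 matU * toS3 matU))%g.
  by rewrite !exprS expr0 mulr1 !toS3M //; exact: SL2ZM.
have := congr1 (@odd_perm _) (toS3_Gamma2 matU3); rewrite e !odd_permM odd_perm1.
by case: (odd_perm _).
Qed.

Lemma odd_toS3S : odd_perm (toS3 matS) = true.
Proof.
have US := SL2Z_U; have SS := SL2Z_S; have U2 := SL2ZX 2 US.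
case E : (odd_perm (toS3 matS)) => //.
have o1 : odd_perm (toS3 1) = false by rewrite (toS3_Gamma2 Gamma2_1) odd_perm1.
have o2 : odd_perm (toS3 (matU ^+ 2)) = false by rewrite expr2 toS3M // odd_permM odd_toS3U.
have all0 : forall x, x \in six -> odd_perm (toS3 x) = false.
  move=> x; rewrite !inE => /or4P[|||/or3P[]] /eqP -> //; first exact: odd_toS3U.
  - by rewrite toS3M // odd_permM E odd_toS3U.
  - by rewrite toS3M // odd_permM E o2.
have [h1 h2 _] := toS3P.
have : tperm (0 : 'I_3) 1 \in [seq toS3 x | x <- six].
  by rewrite (perm_mem (six_perm h1 h2)) mem_enum.
case/mapP => x x6 /(congr1 (@odd_perm _)).
by rewrite (all0 _ x6) odd_tperm.
Qed.

Lemma sign_sum0 (K : numDomainType) (t : 'S_3) (G : 'S_3 -> K) : odd_perm t ->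
  (forall s, G (t * s)%g = G s) -> \sum_(s : 'S_3) G s * (-1) ^+ odd_perm s = 0.
Proof.
move=> ot Gt; set X := \sum_s _; apply/eqP; have : X *+ 2 == 0; last by rewrite mulrn_eq0.
rewrite mulr2n /X.
rewrite {2}(reindex_inj (mulgI t)) /= -big_split big1 // => s _.
by rewrite /= Gt odd_permM ot /= signrN mulrN subrr.
Qed.

Lemma perm_trace_sign (R : realType) :
  \sum_(s : 'S_3) (\tr (perm_mx s : 'M[R[i]]_3) - 1) * (-1) ^+ odd_perm s = 0.
Proof.
rewrite (eq_bigr (fun s : 'S_3 => \sum_i ((s i == i)%:R * (-1) ^+ odd_perm s) - 1 * (-1) ^+ odd_perm s)).
  rewrite sumrB exchange_big /= (sign_sum0 (t := tperm 0 1) (G := fun=> 1)) ?odd_tperm // subr0.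
  apply: big1 => i _.
  have [t ot ti] : exists2 t : 'S_3, odd_perm t & t i = i.
    case: (ord3P i) => ->; [exists (tperm 1 2%:R)|exists (tperm 0 2%:R)|exists (tperm 0 1)];
      by rewrite ?odd_tperm // tpermD.
  by apply: (sign_sum0 (t := t)) => // s; rewrite permM ti.
move=> s _; rewrite mulrBl; congr (_ - _); rewrite /mxtrace mulr_suml.
by apply: eq_bigr => i _; rewrite !mxE.
Qed.

End SymmetricGroup.

Section LinearCharacters.
Variable R : realType.
Local Notation C := R[i].
Variable N : nat.
Hypothesis hN : (2 < N)%N.
Implicit Types (g h x : M2Z) (l F : M2Z -> C).
Local Notation zeta := (zeta R N).
Local Notation gchi r s g := (zchi R r s (expAB N g)).
Local Notation dim := #|@idx N|.

Definition is_lin (K : set M2Z) (P : (M2Z -> C) -> Prop) l :=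
  [/\ mult_on K l, forall g, Phi N g -> l g = 1 & P l].

Lemma the_lin_charP K P l : is_lin K P l -> is_lin K P (the_lin_char N K P).
Proof. by move=> h; apply: (@xgetPex _ (fun=> 0) [set l | is_lin K P l]); exists l. Qed.

Lemma mult_Phi_inv K l : Gamma2 `<=` K -> mult_on K l -> (forall g, Phi N g -> l g = 1) ->
  Phi_inv N K l.
Proof.
move=> GK lM lP g h gK hP.
by rewrite (lM _ _ gK (GK _ (Phi_Gamma2 hP))) (lP _ hP) mulr1.
Qed.

Lemma mult_mAB K l (r s : nat) : Gamma2 `<=` K -> mult_on K l -> l 1 = 1 ->
  l matA = zeta ^+ r -> l matB = zeta ^+ s ->
  forall x (a b : nat), K x -> l (x * mAB a b) = l x * (zeta ^+ (r * a) * zeta ^+ (s * b)).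
Proof.
move=> GK lM l1 lA lB x a b xK.
have pow g k (n : nat) : Gamma2 g -> l g = k -> l (g ^+ n) = k ^+ n.
  move=> gG h; elim: n => [|n IH]; first by rewrite !expr0.
  by rewrite !exprS lM ?IH ?h //; apply: GK => //; exact: Gamma2X.
have GA := Gamma2_A; have GB := Gamma2_B.
rewrite lM //; last by apply: GK; exact: mAB_Gamma2.
rewrite /mAB lM; try by apply: GK; exact: Gamma2X.
by rewrite (pow _ _ _ GA lA) (pow _ _ _ GB lB) -!exprM.
Qed.

Lemma zchiM r s g h : Gamma2 g -> Gamma2 h -> gchi r s (g * h) = gchi r s g * gchi r s h.
Proof. by move=> gG hG; rewrite (expABM R hN) // zchiD. Qed.

Lemma chi_lin a b : is_lin Gamma2 (fun l => l matA = zeta ^+ a /\ l matB = zeta ^+ b) (chi R N a b).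
Proof.
apply: (the_lin_charP (l := fun g => gchi a b g)); split.
- by move=> g h; exact: zchiM.
- by move=> g [gG ->]; rewrite zchi0.
- by have [_ _ -> ->] := expABP R hN; rewrite zchi10 // zchi01.
Qed.

Lemma chiE a b g : Gamma2 g -> chi R N a b g = gchi a b g.
Proof.
have [lM lP [lA lB]] := chi_lin a b; have P1 := Phi1 R hN.
have GA := Gamma2_A; have GB := Gamma2_B; have G1 := Gamma2_1.
have inv x : Gamma2 x -> chi R N a b x = gchi a b x -> chi R N a b x^-1 = gchi a b x^-1.
  move=> xG e; have xV := Gamma2V xG; apply: (mulIf (zchi_neq0 R a b (expAB N x))).
  rewrite -{1}e -lM // -zchiM // mulVSL; last exact: Gamma2SL.
  by rewrite lP // (expAB1 R hN) zchi0.
have zA : gchi a b matA = zeta ^+ a by have [_ _ -> _] := expABP R hN; rewrite zchi10.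
have zB : gchi a b matB = zeta ^+ b by have [_ _ _ ->] := expABP R hN; rewrite zchi01.
move: g; apply: Gamma2_ind; rewrite ?lA ?lB ?zA ?zB //.
- have h : Phi N (-1) by split; [exact: Gamma2_N1|have [_ -> _ _] := expABP R hN].
  by rewrite lP // h.2 zchi0.
- by apply: inv => //; rewrite lA zA.
- by apply: inv => //; rewrite lB zB.
by move=> g h gG hG eg eh; rewrite lM // eg eh zchiM.
Qed.

(* [S] multiplies this form by a constant, so the character by which Gamma(2)
   acts on it is invariant under conjugation by [S]. *)
Definition symE (a : nat) : C -> C :=
  E4 (frac R N a)%:C (frac R N a)%:C (4 - 2 * (frac R N a)%:C).

Lemma zchi_conj_S a g : Gamma2 g -> gchi a a (matS * g * matS^-1) = gchi a a g.
Proof.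
move=> gG; have SS := SL2Z_S; have gS := Gamma2SL gG; have JG := Gamma2J SS gG.
have f0 : zoff (symE a) by exact: E4_zoff.
have sum4 : (frac R N a)%:C + (frac R N a)%:C + (4 - 2 * (frac R N a)%:C) = 4 by ring.
have fA : slash matA (symE a) = cscale (zeta ^+ a) (symE a) by rewrite E4_A // e2_frac.
have fB : slash matB (symE a) = cscale (zeta ^+ a) (symE a) by rewrite E4_B // e2_frac.
have key := slash_char hN f0 fA fB.
have fS : slash matS (symE a) = cscale (-1) (symE a) by exact: E4_S.
have := key _ JG; rewrite slashM //; [|exact: SL2ZM|exact: SL2ZV].
rewrite slashM // fS !slash_scale key // !slash_scale.
have [-> _ _ _ _] := matV; rewrite slash_opp fS !cscaleA => /cscale_inj <-; ring.
Qed.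

Lemma Gamma2S_sub : Gamma2 `<=` Gamma2S. Proof. by move=> g gG; left. Qed.

Lemma S_notin_Gamma2 g : Gamma2 g -> ~ Gamma2 (g * matS).
Proof.
move=> gG h; have : Gamma2 (g^-1 * (g * matS)) by apply: Gamma2M => //; exact: Gamma2V.
by rewrite mulKr; [case/Gamma2P|exact: SL2Z_unit (Gamma2SL gG)].
Qed.

Lemma rho_sgn_lin (eps : C) a : eps * eps = 1 ->
  exists l, is_lin Gamma2S (fun l => (forall g, Gamma2 g -> l g = chi R N a a g) /\ l matS = eps) l.
Proof.
move=> ee; have SS := SL2Z_S; have uS := SL2Z_unit SS.
pose l g : C := if g \in Gamma2 then gchi a a g else eps * gchi a a (g * matS^-1).
have lG g : Gamma2 g -> l g = gchi a a g by move=> gG; rewrite /l mem_set.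
have lGS g : Gamma2 g -> l (g * matS) = eps * gchi a a g.
  by move=> gG; rewrite /l memNset ?mulrK //; exact: S_notin_Gamma2.
have JG g : Gamma2 g -> Gamma2 (matS * g * matS^-1) by exact: Gamma2J.
exists l; split; last split.
- move=> g h [gG|[g' gG <-]] [hG|[h' hG <-]].
  + by rewrite !lG ?zchiM //; exact: Gamma2M.
  + by rewrite mulrA !lGS ?lG ?zchiM //; [ring|exact: Gamma2M].
  + have -> : g' * matS * h = g' * (matS * h * matS^-1) * matS by rewrite !mulrA mulrVK.
    have hJ := JG _ hG.
    rewrite lGS; last exact: Gamma2M.
    by rewrite lGS // (lG h) // zchiM // zchi_conj_S //; ring.
  + have -> : g' * matS * (h' * matS) = - (g' * (matS * h' * matS^-1)).
      by rewrite -mulrN1 -matSS !mulrA mulrVK.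
    have hJ := JG _ hG; have pG := Gamma2M gG hJ.
    rewrite -mulrN1 !lGS // lG; last by apply: Gamma2M => //; exact: Gamma2_N1.
    rewrite (zchiM _ _ pG Gamma2_N1) (zchiM _ _ gG hJ) (zchi_conj_S _ hG).
    by have [_ -> _ _] := expABP R hN; rewrite zchi0 mulr1 mulrACA ee mul1r.
- by move=> g [gG g0]; rewrite lG // g0 zchi0.
- by move=> g gG; rewrite lG // chiE.
- by rewrite -[matS]mul1r lGS ?(expAB1 R hN) ?zchi0 ?mulr1 //; exact: Gamma2_1.
Qed.

Definition diag_coef x (m n : nat) : C :=
  \sum_(i < dim | ((enum_val i).1 == m :> nat) && ((enum_val i).2 == n :> nat)) @Mx R N x i i.

Lemma diag_coef0 x m n : ~~ [&& (0 < m)%N, (0 < n)%N & (m + n < N)%N] -> diag_coef x m n = 0.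
Proof.
move=> h; apply: big1 => i /andP[/eqP e1' /eqP e2']; exfalso.
by move: h; rewrite -e1' -e2'; have := idxP i; rewrite /idx /= => ->.
Qed.

Lemma diag_coef1 x m n c : SL2Z x -> (0 < m)%N -> (0 < n)%N -> (m + n < N)%N ->
  slash x (e3 N m n (N - m - n)) = cscale c (e3 N m n (N - m - n)) -> diag_coef x m n = c.
Proof.
move=> xS m0 n0 mn E.
have mN : (m < N)%N by lia.
have nN : (n < N)%N by lia.
pose p := (Ordinal mN, Ordinal nN); have pI : p \in @idx N by rewrite inE /= m0 n0.
pose i0 := enum_rank_in pI p; have i0E : enum_val i0 = p by rewrite enum_rankK_in.
rewrite /diag_coef (bigD1 i0) /=; last by rewrite i0E /= !eqxx.
rewrite big1 ?addr0; last first.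
  move=> j /andP[/andP[/eqP h1 /eqP h2]] /eqP []; apply: enum_val_inj; rewrite i0E.
  by case: (enum_val j) h1 h2 => a b /= h1 h2; congr pair; apply: val_inj.
have bE : slash x (bas i0) = cscale c (bas i0) by rewrite /bas i0E.
have cE : cscale c (bas i0) = lincomb (@bas R N) (fun j => if j == i0 then c else 0).
  apply/funext => z; rewrite /lincomb (bigD1 i0) //= eqxx big1 ?addr0 // => j ji.
  by rewrite (negPf ji) mul0r.
have := lincomb_inj hN (etrans (esym (MxP R hN xS i0)) (etrans bE cE)) i0.
by rewrite eqxx.
Qed.

Lemma diag_coef_1 m n : diag_coef 1 m n = if [&& (0 < m)%N, (0 < n)%N & (m + n < N)%N] then 1 else 0.
Proof.
case: ifP => [/and3P[h1 h2 h3]|/negbT]; last exact: diag_coef0.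
by apply: diag_coef1 => //; [exact: SL2Z1|rewrite slash1 cscale1].
Qed.

Lemma diag_coef_S m : diag_coef matS m m = if [&& (0 < m)%N, (0 < m)%N & (m + m < N)%N] then -1 else 0.
Proof.
case: ifP => [/and3P[h1 h2 h3]|/negbT]; last exact: diag_coef0.
by apply: diag_coef1 => //; [exact: SL2Z_S|exact: e3_S].
Qed.

Let NC0 : N%:R != 0 :> C. Proof. by rewrite pnatr_eq0; lia. Qed.

Let cancel_square (s X : C) : (s * N%:R ^+ 2)^-1 * (N%:R ^+ 2 * X) = s^-1 * X.
Proof. by rewrite invfM -mulrA mulKf ?expf_neq0. Qed.

Lemma multiplicity_lin F m n : Phi_inv N (@SL2Z) F -> (m < N)%N -> (n < N)%N ->
  (forall x (a b : nat), x \in six ->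
     F (x * mAB a b) = F x * (zeta ^+ (m * a) * zeta ^+ (n * b))) ->
  multiplicity N F = 6%:R^-1 * \sum_(x <- six) (F x)^* * diag_coef x m n.
Proof.
move=> Finv mN nN FE; rewrite /multiplicity /cdot.
rewrite (qsum_canon hN cosets_SL Finv mN nN FE) (qcardE R hN cosets_SL six_uniq).
rewrite -big_filter (_ : [seq x <- six | x \in six] = six); last first.
  by apply/all_filterP/allP.
exact: cancel_square.
Qed.

Lemma multiplicity_ind W K l m n : cosets_of W K -> uniq W -> (0 < size W)%N ->
  Phi_inv N K l -> (m < N)%N -> (n < N)%N ->
  (forall x (a b : nat), x \in W ->
     l (x * mAB a b) = l x * (zeta ^+ (m * a) * zeta ^+ (n * b))) ->
  multiplicity N (ind N K l) =
  (size W)%:R^-1 * \sum_(x <- W) (l x)^* * diag_coef x m n.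
Proof.
move=> KW uW W0 linv mN nN lE; rewrite /multiplicity (frobenius hN KW uW W0 linv).
rewrite (qsum_canon hN KW linv mN nN lE) (qcardE R hN KW uW).
rewrite -big_filter (perm_big W); last first.
  apply: uniq_perm => //; first by apply: filter_uniq; exact: six_uniq.
  by move=> x; rewrite mem_filter; case xW: (x \in W) => //=; exact: KW.1.
exact: cancel_square.
Qed.

Lemma multiplicity_rho6 a b : (0 < a < N)%N -> (0 < b < N)%N ->
  multiplicity N (rho6 R N a b) = if (a + b < N)%N then 1 else 0.
Proof.
move=> /andP[a0 aN] /andP[b0 bN]; have [lM lP [lA lB]] := chi_lin a b.
have P1 := Phi1 R hN; have l1 := lP _ P1.
rewrite /rho6 (multiplicity_ind (W := [:: 1]) (m := a) (n := b) cosets_Gamma2) //.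
- by rewrite big_seq1 l1 invr1 mul1r rmorph1 mul1r diag_coef_1 a0 b0.
- by apply: mult_Phi_inv.
- move=> x i j; rewrite inE => /eqP ->; apply: (mult_mAB (K := Gamma2)) => //; exact: Gamma2_1.
Qed.

Lemma multiplicity_rho_sgn (eps : C) a : eps * eps = 1 -> (0 < a < N)%N ->
  multiplicity N (rho_sgn N eps a) = if (a + a < N)%N then (1 - eps^*) / 2 else 0.
Proof.
move=> ee /andP[a0 aN]; have [l lin] := rho_sgn_lin a ee.
have [lM lP [lG lS]] := the_lin_charP lin; rewrite /rho_sgn; move: (the_lin_char _ _ _) lM lP lG lS.
move=> {lin} {}l lM lP lG lS.
have P1 := Phi1 R hN; have l1 := lP _ P1.
have [cM cP [cA cB]] := chi_lin a a.
have S1 : matS != 1.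
  by apply/eqP => E; have := congr1 (fun M : M2Z => M 0 0) E; rewrite onemx22 !mxE.
rewrite (multiplicity_ind (W := [:: 1; matS]) (m := a) (n := a) cosets_Gamma2S) //.
- rewrite big_cons big_seq1 l1 lS diag_coef_1 diag_coef_S a0 /= rmorph1 mul1r.
  by case: ifP => _; [rewrite mulrN1 mulrC|rewrite mulr0 addr0 mulr0].
- by rewrite /= inE eq_sym S1.
- by apply: mult_Phi_inv => //; exact: Gamma2S_sub.
- have key := mult_mAB Gamma2S_sub lM l1 (etrans (lG _ Gamma2_A) cA) (etrans (lG _ Gamma2_B) cB).
  move=> x i j; rewrite !inE => /orP[] /eqP ->; apply: key.
    by left; exact: Gamma2_1.
  by right; exists 1; [exact: Gamma2_1|rewrite mul1r].
Qed.

Lemma rho2M x g : SL2Z x -> Gamma2 g -> rho2 R (x * g) = rho2 R x.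
Proof. by move=> xS gG; rewrite /rho2 (toS3M xS (Gamma2SL gG)) (toS3_Gamma2 gG) mulg1. Qed.

Lemma rho3M x g : SL2Z x -> Gamma2 g -> rho3 R (x * g) = rho3 R x.
Proof. by move=> xS gG; rewrite /rho3 (toS3M xS (Gamma2SL gG)) (toS3_Gamma2 gG) mulg1. Qed.

Lemma multiplicity_S3 F : (forall x g, SL2Z x -> Gamma2 g -> F (x * g) = F x) ->
  multiplicity N F = 0.
Proof.
move=> FG; rewrite (multiplicity_lin (m := 0) (n := 0)); try lia.
- by rewrite big1 ?mulr0 // => x _; rewrite diag_coef0 ?mulr0.
- by move=> g h gS hP; exact: (FG _ _ gS (Phi_Gamma2 hP)).
move=> x a b x6; rewrite FG ?mul0n ?expr0 ?mulr1 //; first exact: six_SL.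
exact: mAB_Gamma2.
Qed.

Section Third.
Variable n : nat.
Hypothesis n3 : (n + n + n = N)%N.
Let vn := e3 (R := R) N n n n.

Let vn0 : zoff vn. Proof. exact: e3_zoff. Qed.

Lemma slash_vn g : SL2Z g -> exists2 k : C, k != 0 & slash g vn = cscale k vn.
Proof.
move=> gS; have [k [m1 [m2 [m3 [k0 p E]]]]] := e3_slash R hN gS n3.
have q m : m \in [:: m1; m2; m3] -> m = n by rewrite (perm_mem p) !inE orbb orbb => /eqP.
have e1 : m1 = n by apply: q; rewrite !inE eqxx.
have e2 : m2 = n by apply: q; rewrite !inE eqxx orbT.
have e3 : m3 = n by apply: q; rewrite !inE eqxx !orbT.
by exists k => //; move: E; rewrite e1 e2 e3.
Qed.

(* For 3 | N the form [vn] = (theta_2 theta_3 theta_4)^(4/3) = (2 eta^3)^(4/3) spans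
   a G-stable line; powers of its multiplier give the extended characters. *)
Definition mult_vn g : C := xget 0 [set k | slash g vn = cscale k vn].

Lemma mult_vnP g : SL2Z g -> slash g vn = cscale (mult_vn g) vn.
Proof.
move=> /slash_vn[k _ E].
by apply: (@xgetPex _ 0 [set k | slash g vn = cscale k vn]); exists k.
Qed.

Lemma mult_vn_eq g k : SL2Z g -> slash g vn = cscale k vn -> mult_vn g = k.
Proof. by move=> gS; rewrite mult_vnP // => /cscale_inj. Qed.

Lemma mult_vnM g h : SL2Z g -> SL2Z h -> mult_vn (g * h) = mult_vn g * mult_vn h.
Proof.
move=> gS hS; apply: mult_vn_eq; first exact: SL2ZM.
by rewrite slashM // mult_vnP // slash_scale mult_vnP // cscaleA.
Qed.

Lemma mult_vn1 : mult_vn 1 = 1.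
Proof. by apply: mult_vn_eq; [exact: SL2Z1|rewrite slash1 cscale1]. Qed.

Lemma mult_vnV g : SL2Z g -> mult_vn g^-1 = (mult_vn g)^-1.
Proof.
move=> gS; have gV := SL2ZV gS; have [k k0 E] := slash_vn gS.
have x0 : mult_vn g != 0 by rewrite (mult_vn_eq gS E).
by apply: (mulIf x0); rewrite -mult_vnM // mulVSL // mult_vn1 mulVf.
Qed.

Lemma mult_vnS : mult_vn matS = -1.
Proof. by apply: mult_vn_eq; [exact: SL2Z_S|exact: e3_S]. Qed.

Lemma mult_vnU : mult_vn matU = 1.
Proof.
have SS := SL2Z_S; have ST := SL2Z_T; have SV := SL2ZV SS; have TV := SL2ZV ST.
have [k k0 E] := slash_vn ST; have t0 : mult_vn matT != 0 by rewrite (mult_vn_eq ST E).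
rewrite matU_ST !mult_vnM //; try exact: SL2ZM; last by apply: SL2ZM => //; exact: SL2ZM.
rewrite !mult_vnV // mult_vnS; move: (mult_vn matT) t0 => t t0.
by rewrite invrN1; field.
Qed.

Lemma mult_vn_Gamma2 g : Gamma2 g -> mult_vn g = gchi n n g.
Proof. by move=> gG; apply: mult_vn_eq; [exact: Gamma2SL|exact: e3_Gamma2]. Qed.

Lemma mult_vn_cube g : Gamma2 g -> mult_vn g ^+ 3 = 1.
Proof.
move=> gG; rewrite mult_vn_Gamma2 // /zchi -exprM; apply/eqP; rewrite zeta_eq1 //.
by apply/dvdnP; exists ((expAB N g).1 + (expAB N g).2)%N; nia.
Qed.

Lemma mult_vn_six x : x \in six -> mult_vn x = rho2 R x.
Proof.
have SS := SL2Z_S; have SU := SL2Z_U; have SU2 := SL2ZX 2 SU.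
have o1 : odd_perm (toS3 1) = false by rewrite (toS3_Gamma2 Gamma2_1) odd_perm1.
have o2 : odd_perm (toS3 (matU ^+ 2)) = false by rewrite expr2 toS3M // odd_permM odd_toS3U.
have u2 : mult_vn (matU ^+ 2) = 1 by rewrite expr2 mult_vnM // mult_vnU mulr1.
rewrite /rho2 !inE => /or4P[|||/or3P[]] /eqP ->.
- by rewrite mult_vn1 o1.
- by rewrite mult_vnU odd_toS3U.
- by rewrite u2 o2.
- by rewrite mult_vnS odd_toS3S.
- by rewrite mult_vnM // toS3M // odd_permM mult_vnS mult_vnU odd_toS3S odd_toS3U mulr1.
- by rewrite mult_vnM // toS3M // odd_permM mult_vnS u2 odd_toS3S o2 mulr1.
Qed.

Lemma chi_ext_lin (e : nat) (j : nat) : (j = e %[mod 3])%N -> ~~ odd j ->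
  is_lin (@SL2Z) (fun l => [/\ forall g, Gamma2 g -> l g = chi R N (e * n) (e * n) g,
                  l matS = 1 & l matU = 1]) (chi_ext R N (e * n)).
Proof.
move=> je j2; apply: (the_lin_charP (l := fun g => mult_vn g ^+ j)); split.
- by move=> g h gS hS; rewrite mult_vnM // exprMn.
- by move=> g [gG g0]; rewrite mult_vn_Gamma2 // g0 zchi0 expr1n.
split=> [g gG||]; last by rewrite mult_vnU expr1n.
- have -> : mult_vn g ^+ j = mult_vn g ^+ e.
    rewrite (divn_eq j 3) (divn_eq e 3) je !exprD !(mulnC _ 3) !exprM.
    by rewrite mult_vn_cube // !expr1n.
  rewrite mult_vn_Gamma2 // chiE // /zchi -exprM; congr (_ ^+ _); ring.
by rewrite mult_vnS -signr_odd (negPf j2).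
Qed.

Lemma chi_ext_six (e j : nat) x : (j = e %[mod 3])%N -> ~~ odd j -> x \in six ->
  chi_ext R N (e * n) x = 1.
Proof.
move=> je j2; have [lM lP [_ lS lU]] := chi_ext_lin je j2.
have SS := SL2Z_S; have SU := SL2Z_U; have SU2 := SL2ZX 2 SU.
have l2 : chi_ext R N (e * n) (matU ^+ 2) = 1 by rewrite expr2 lM // lU mulr1.
have l1 := lP _ (Phi1 R hN).
rewrite !inE => /or4P[|||/or3P[]] /eqP -> //.
- by rewrite lM // lS lU mulr1.
- by rewrite lM // lS l2 mulr1.
Qed.

Lemma multiplicity_ext (e j : nat) F : (j = e %[mod 3])%N -> ~~ odd j -> (e < 3)%N ->
  (forall x g, SL2Z x -> Gamma2 g -> F (x * g) = F x) ->
  multiplicity N (fun g => F g * chi_ext R N (e * n) g) =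
  6%:R^-1 * \sum_(x <- six) (F x)^* * diag_coef x (e * n) (e * n).
Proof.
move=> je j2 e3' FG; have [lM lP [lG _ _]] := chi_ext_lin je j2.
have [cM cP [cA cB]] := chi_lin (e * n) (e * n).
have GK : Gamma2 `<=` (@SL2Z) by move=> g; exact: Gamma2SL.
have l1 := lP _ (Phi1 R hN).
have en : (e * n < N)%N by rewrite -n3; move: e3'; case: (e) => [|[|[|//]]] _; lia.
rewrite (multiplicity_lin (m := e * n) (n := e * n)) //.
- congr (_ * _); apply: eq_big_seq => x x6.
  by rewrite (chi_ext_six je j2 x6) mulr1.
- move=> g h gS hP; by rewrite (FG _ _ gS (Phi_Gamma2 hP)) (mult_Phi_inv GK lM lP gS hP).
move=> x a b x6; have xS := six_SL x6; rewrite FG //; last exact: mAB_Gamma2.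
by rewrite (mult_mAB GK lM l1 (etrans (lG _ Gamma2_A) cA) (etrans (lG _ Gamma2_B) cB)) // mulrA.
Qed.

Lemma multiplicity_ext2 F : (forall x g, SL2Z x -> Gamma2 g -> F (x * g) = F x) ->
  multiplicity N (fun g => F g * chi_ext R N (2 * n) g) = 0.
Proof.
move=> FG; rewrite (multiplicity_ext (j := 2)) // big1 ?mulr0 // => x _.
by rewrite diag_coef0 ?mulr0 //; lia.
Qed.

Lemma multiplicity_ext1 F : (forall x g, SL2Z x -> Gamma2 g -> F (x * g) = F x) ->
  multiplicity N (fun g => F g * chi_ext R N (1 * n) g) =
  6%:R^-1 * \sum_(x <- six) (F x)^* * rho2 R x.
Proof.
move=> FG; rewrite (multiplicity_ext (j := 4)) //; congr (_ * _); apply: eq_big_seq => x x6.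
rewrite -(mult_vn_six x6); congr (_ * _).
have n0 : (0 < n)%N by lia.
have xS := six_SL x6.
apply: diag_coef1 => //; rewrite ?mul1n //; first lia.
have -> : (N - n - n = n)%N by lia.
exact: mult_vnP.
Qed.

End Third.

End LinearCharacters.

Local Open Scope card_scope.

Theorem theorem6p4 (R : realType) (N : nat) (hN : (2 < N)%N) (h3 : (3 %| N)%N) :
  let d : (M2Z -> R[i]) -> R[i] := multiplicity N in
  let N3 := (N %/ 3)%N in
  let N23 := ((2 * N) %/ 3)%N in
  [/\ [/\ d (rho1 R) = 0, d (rho2 R) = 0 & d (rho3 R) = 0],
      (forall a : nat, (1 <= a <= N - 1)%N -> a <> N3 -> a <> N23 ->
         d (rho_plus R N a) = 0),
      (forall a : nat, (1 <= a <= N - 1)%N -> a <> N3 -> a <> N23 ->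
         d (rho_minus R N a) = if (a <= (N - 1) %/ 2)%N then 1 else 0),
      (forall a b : nat, (1 <= a <= N - 1)%N -> (1 <= b <= N - 1)%N ->
         orbit_chi R N a b #= `I_6 ->
         d (rho6 R N a b) = if (a + b < N)%N then 1 else 0) &
      [/\ d (rho1_ R N N3) = 0, d (rho1_ R N N23) = 0, d (rho2_ R N N23) = 0,
          d (rho2_ R N N3) = 1 &
          d (rho3_ R N N3) = 0 /\ d (rho3_ R N N23) = 0]].
Proof.
move=> d N3 N23.
have n3 : (N3 + N3 + N3 = N)%N by rewrite /N3; lia.
have e1 : N3 = (1 * N3)%N by rewrite mul1n.
have e2 : N23 = (2 * N3)%N by rewrite /N23 /N3; lia.
have c1 : (1 : R[i])^*%R = 1 by exact: rmorph1.
have r1 x g : SL2Z x -> Gamma2 g -> rho1 R (x * g) = rho1 R x by [].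
have r2 := @rho2M R; have r3 := @rho3M R.
have sixN0 : 6%:R != 0 :> R[i] by rewrite pnatr_eq0.
split.
- by split; apply: multiplicity_S3.
- move=> a aN _ _; rewrite /d /rho_plus multiplicity_rho_sgn ?mulr1 //; last lia.
  by rewrite c1 subrr mul0r; case: ifP.
- move=> a aN _ _; rewrite /d /rho_minus multiplicity_rho_sgn ?mulrNN ?mulr1 //; last lia.
  have -> : (a + a < N)%N = (a <= (N - 1) %/ 2)%N by lia.
  case: ifP => // _; have -> : (-1 : R[i])^*%R = -1 by rewrite rmorphN /= rmorph1.
  by rewrite opprK; field.
- by move=> a b aN bN _; apply: multiplicity_rho6; lia.
have s2 (x : M2Z) : (rho2 R x)^*%R = rho2 R x.
  by rewrite /rho2; case: (odd_perm _); rewrite ?expr0 ?expr1 ?rmorphN rmorph1.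
have s3 (x : M2Z) : (rho3 R x)^*%R = rho3 R x.
  rewrite /rho3 rmorphB rmorph1; congr (_ - _); rewrite /mxtrace rmorph_sum; apply: eq_bigr => i _.
  by rewrite !mxE rmorph_nat.
have S0 : \sum_(s : 'S_3) (-1) ^+ odd_perm s = 0 :> R[i].
  rewrite -[RHS](sign_sum0 (K := R[i]) (t := tperm 0 1) (G := fun=> 1)) ?odd_tperm //.
  by apply: eq_bigr => s _; rewrite mul1r.
split.
- rewrite /d {1}e1 (multiplicity_ext1 hN n3 r1) /rho1.
  rewrite (eq_bigr (fun x => (-1) ^+ odd_perm (toS3 x))) => [|x _]; last by rewrite rmorph1 mul1r.
  by rewrite (sum_six (fun s => (-1) ^+ odd_perm s)) S0 mulr0.
- by rewrite /d e2; apply: (multiplicity_ext2 hN n3 r1).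
- by rewrite /d e2; apply: (multiplicity_ext2 hN n3 r2).
- rewrite /d {1}e1 (multiplicity_ext1 hN n3 r2).
  rewrite (eq_bigr (fun=> 1)) => [|x _].
    by rewrite !big_cons big_nil; field.
  by rewrite s2 /rho2 -expr2 sqrr_sign.
split; last by rewrite /d e2; apply: (multiplicity_ext2 hN n3 r3).
rewrite /d {1}e1 (multiplicity_ext1 hN n3 r3).
rewrite (eq_bigr (fun x => (\tr (perm_mx (toS3 x) : 'M[R[i]]_3) - 1) * (-1) ^+ odd_perm (toS3 x))).
  by rewrite (sum_six (fun s => (\tr (perm_mx s) - 1) * (-1) ^+ odd_perm s)) perm_trace_sign mulr0.
by move=> x _; rewrite s3.
Qed.
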